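(* Let $V_1\in\mathcal{K}_1$, $V_2\in\mathcal{K}_2$, let $x,y\in\mathbb{R}$ and $t>t_0$. For the potential $V=g(V_1+V_2)$ with coupling constant $g$, let $K=K_g(x,t|y,t_0):=TI_g(0)$ be the Feynman integral (the expectation of the Feynman integrand $I_g$ for the potential $g(V_1+V_2)$), which solves the propagator equation $$i\partial_tK(x,t|y,t_0)=\Big(-\frac12\partial_x^2+V(x)\Big)K(x,t|y,t_0),\qquad t>t_0 .$$ Then $K$ is analytic in the coupling constant $g$.
   Context: Potentials. $\mathcal{K}_1$: functions $V_1(x)=\int_{\mathbb{R}}e^{\alpha x}dm_1(\alpha)$, $m_1$ a complex Borel measure on $\mathbb{R}$ with $\int e^{C|\alpha|}d|m_1|(\alpha)<\infty$ for all $C>0$. $\mathcal{K}_2$: generalized functions $V_2(x)=\int_{\mathbb{R}}\delta(x-y)dm_2(y)$, $m_2$ a finite signed Borel measure on $\mathbb{R}$ of bounded support. Feynman integral. For a potential $V_1+V_2$ with $V_i\in\mathcal{K}_i$ the Feynman integrand $I$ is the generalized white noise functional giving meaning to $I_0\exp(-i\int_{t_0}^t(V_1+V_2)(x(\tau))d\tau)$ (with $I_0$ the free Feynman integrand for paths $x(\tau)=x-\langle\omega,1_{(\tau,t]}\rangle$ from $y$ at time $t_0$ to $x$ at time $t$). Its expectation $TI(0)$ (value of its $T$-transform at $0$) is the convergent series $$TI(0)=\sum_{n=0}^\infty \frac{(-i)^n}{n!}\sum_{k=0}^n\binom nk k!\int_{\Delta_k}d^k\tau \int_{[t_0,t]^{n-k}}d^{n-k}s\int_{\mathbb{R}^k}\int_{\mathbb{R}^{n-k}}F_{n,k}\prod_{l=1}^{n-k}dm_1(\alpha_l)\prod_{j=1}^kdm_2(x_j),$$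 where $\Delta_k=\{t_0<\tau_1<\dots<\tau_k<t\}$ (integrals over $\Delta_k,\mathbb{R}^k$ absent if $k=0$; integrals over $[t_0,t]^{n-k},\mathbb{R}^{n-k}$ absent if $k=n$) and, with $\tau_0:=t_0$, $x_0:=y$, $\tau_{k+1}:=t$, $x_{k+1}:=x$, $\eta:=i\sum_{l=1}^{n-k}\alpha_l1_{(s_l,t]}$, $$F_{n,k}=\exp\Big(x\sum_{l=1}^{n-k}\alpha_l\Big)\exp\Big(-\tfrac i2\int_{\mathbb{R}}\eta(s)^2ds\Big)\prod_{j=1}^{k+1}\frac{1}{\sqrt{2\pi i(\tau_j-\tau_{j-1})}}\exp\Big(\frac{i}{2(\tau_j-\tau_{j-1})}\Big(\int_{\tau_{j-1}}^{\tau_j}\eta(s)ds+x_j-x_{j-1}\Big)^2\Big)$$ (principal branch of the square root). $TI_g(0)$ is this expression with $m_1,m_2$ replaced by $gm_1,gm_2$. The propagator equation is understood in the sense of distributions in $(x,t)$, with $V_1K$ the pointwise product and $\langle V_2K,\varphi\rangle=\int dm_2(x)\int dt\,K(x,t|y,t_0)\varphi(x,t)$. *)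

(* Defs.v *)
(* Complex numbers are R[i]; R[i]^o carries the norm topology. *)
From HB Require Import structures.
From mathcomp Require Import all_boot all_order all_algebra.
From mathcomp Require Import all_classical all_reals all_analysis.
From mathcomp Require Import complex.

Set Implicit Arguments.
Unset Strict Implicit.
Unset Printing Implicit Defensive.

Import Order.TTheory GRing.Theory Num.Theory.
Import numFieldNormedType.Exports.

Local Open Scope classical_set_scope.
Local Open Scope ring_scope.
Local Open Scope complex_scope.

Section Defs.
Variable R : realType.
Local Notation C := R[i].
Local Notation B := (measurableTypeR R).
Local Notation leb := (@lebesgue_measure R).
(* the R-valued projections, not the C-valued ones of numClosedFieldType *)
Local Notation Re := complex.Re.
Local Notation Im := complex.Im.

Definition cexp (z : C) : C :=
  (expR (Re z))%:C * (cos (Im z) +i* sin (Im z)).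

Definition analytic_at (f : C -> C) (g0 : C) : Prop :=
  exists2 r : R, 0 < r & exists c : nat -> C, forall g : C,
    `|g - g0| < r%:C ->
    series (fun n => c n * (g - g0) ^+ n : C^o) @ \oo --> (f g : C^o).

Definition analytic (f : C -> C) : Prop := forall g0, analytic_at f g0.

Definition cintegral d (T : measurableType d)
    (mu : {measure set T -> \bar R}) (D : set T) (f : T -> C) : C :=
  (\int[mu]_(x in D) Re (f x)) +i* (\int[mu]_(x in D) Im (f x)).

Definition hahn_pos (nu : {charge set B -> \bar R}) : set B :=
  sval (cid (Hahn_decomposition nu)).

Definition hahn_neg (nu : {charge set B -> \bar R}) : set B :=
  sval (cid (svalP (cid (Hahn_decomposition nu)))).

Lemma hahnP (nu : {charge set B -> \bar R}) :
  hahn_decomposition nu (hahn_pos nu) (hahn_neg nu).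
Proof. exact: (svalP (cid (svalP (cid (Hahn_decomposition nu))))). Qed.

Definition charge_integral (nu : {charge set B -> \bar R}) (f : R -> R) : R :=
  (\int[jordan_pos (hahnP nu)]_x f x) - (\int[jordan_neg (hahnP nu)]_x f x).

Definition charge_support (nu : {charge set B -> \bar R}) : set R :=
  [set x | forall U : set R, open U -> U x ->
     charge_variation (hahnP nu) U <> 0%E].

Record complex_measure := ComplexMeasure {
  re_charge : {charge set B -> \bar R} ;
  im_charge : {charge set B -> \bar R} }.

Definition cm_val (m : complex_measure) (A : set B) : C :=
  fine (re_charge m A) +i* fine (im_charge m A).

Definition cm_of_charge (nu : {charge set B -> \bar R}) : complex_measure :=
  ComplexMeasure nu czero.

Definition cm_scale (g : C) (m : complex_measure) : complex_measure :=
  ComplexMeasure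
    (cadd (cscale (Re g) (re_charge m)) (cscale (- Im g) (im_charge m)))
    (cadd (cscale (Re g) (im_charge m)) (cscale (Im g) (re_charge m))).

Definition cm_integral (m : complex_measure) (f : R -> C) : C :=
  (charge_integral (re_charge m) (fun a => Re (f a)) -
   charge_integral (im_charge m) (fun a => Im (f a))) +i*
  (charge_integral (re_charge m) (fun a => Im (f a)) +
   charge_integral (im_charge m) (fun a => Re (f a))).

(* |m|(A): supremum over countable Borel partitions of A.  It is only a bare
   set function here, which is all that the library's integral requires.     *)
Definition cm_variation (m : complex_measure) (A : set B) : \bar R :=
  ereal_sup [set (\sum_(0 <= i <oo) (Re `|cm_val m (E i)|)%:E)%E
    | E in [set E : nat -> set B | [/\ forall i, measurable (E i),
        trivIset setT E & \bigcup_i E i = A]]].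

Definition in_K1 (m1 : complex_measure) (V1 : R -> C) : Prop :=
  (forall c : R, 0 < c ->
     (\int[cm_variation m1]_a (expR (c * `|a|))%:E < +oo)%E) /\
  (forall x : R, V1 x = cm_integral m1 (fun a => (expR (a * x))%:C)).

(* V2 is the functional f |-> \int f dm2, so it is represented by m2.        *)
Definition in_K2 (m2 : {charge set B -> \bar R}) : Prop :=
  bounded_set (charge_support m2).

(* n-fold iteration of a one-variable integral; the leftmost entry of the
   sequence is the outermost variable.                                       *)
Fixpoint iterint (I : (R -> C) -> C) (n : nat) (F : seq R -> C) : C :=
  if n is n'.+1 then I (fun a => iterint I n' (fun s => F (a :: s)))
  else F [::].

Section Feynman.
Variables (t0 y t x : R).

Definition eta (m : nat) (s alpha : seq R) (u : R) : C :=
  'i%C * \sum_(l < m) (alpha`_l)%:C * (\1_(`]s`_l, t]%classic : set R) u)%:C.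

(* F_{n,k} with m = n - k; nodes p, q are (tau_j) and (x_j), 0 <= j <= k+1.  *)
Definition feynman_F (m k : nat) (tau s xs alpha : seq R) : C :=
  let p j := nth 0 (t0 :: rcons tau t) j in
  let q j := nth 0 (y :: rcons xs x) j in
  let et := eta m s alpha in
  cexp (x%:C * \sum_(l < m) (alpha`_l)%:C) *
  cexp (- ('i%C / 2%:R) * cintegral leb setT (fun u => et u ^+ 2)) *
  \prod_(1 <= j < k.+2)
    ((sqrtc (2%:R * pi%:C * 'i%C * (p j - p j.-1)%:C))^-1 *
     cexp ('i%C / (2%:R * (p j - p j.-1)%:C) *
       (cintegral leb `[p j.-1, p j] et + (q j - q j.-1)%:C) ^+ 2)).

Definition feynman_term (m1 m2 : complex_measure) (n : nat) : C :=
  (- 'i%C) ^+ n / (n`!)%:R *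
  \sum_(k < n.+1) ('C(n, k))%:R * (k`!)%:R *
    iterint (cintegral leb setT) k (fun tau =>
      if path <%R t0 (rcons tau t) then
        iterint (cintegral leb `[t0, t]) (n - k) (fun s =>
          iterint (cm_integral m2) k (fun xs =>
            iterint (cm_integral m1) (n - k) (fun alpha =>
              feynman_F (n - k) k tau s xs alpha)))
      else 0).

Definition feynman_integral (m1 m2 : complex_measure) : C :=
  limn (series (feynman_term m1 m2 : nat -> C^o)).

End Feynman.

Fixpoint Ck (k : nat) (phi : R * R -> R) : Prop :=
  continuous phi /\
  if k is k'.+1 then
    forall v : R * R, (forall p, derivable phi p v) /\ Ck k' ('D_v phi)
  else True.

(* Points of the plane are pairs (x, t).                                     *)
Definition test_function (t0 : R) (phi : R * R -> R) : Prop :=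
  [/\ forall k, Ck k phi,
      compact (closure [set p | phi p <> 0]) &
      closure [set p | phi p <> 0] `<=` [set p | t0 < p.2]].

(* i d/dt K = (- 1/2 d^2/dx^2 + g (V1 + V2)) K in D'(R x ]t0, +oo[).  Testing
   against real functions suffices by linearity.                             *)
Definition propagator_equation (V1 : R -> C) (m2 : {charge set B -> \bar R})
    (g : C) (t0 : R) (K : R -> R -> C) : Prop :=
  forall phi : R * R -> R, test_function t0 phi ->
  let D_x : (R * R -> R) -> R * R -> R := fun f => 'D_((1, 0) : R * R) f in
  let D_t : (R * R -> R) -> R * R -> R := fun f => 'D_((0, 1) : R * R) f in
  let pairing (f : R * R -> C) (psi : R * R -> R) : C :=
    cintegral (leb \x leb)%E (setT `*` `]t0, +oo[%classic)
      (fun p => f p * (psi p)%:C) in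
  let K2 p := K p.1 p.2 in
  'i%C * - pairing K2 (D_t phi) =
  - 2%:R^-1 * pairing K2 (D_x (D_x phi)) +
  g * (pairing (fun p => V1 p.1 * K2 p) phi +
       cm_integral (cm_of_charge m2) (fun x =>
         cintegral leb `]t0, +oo[ (fun t => K x t * (phi (x, t))%:C))).

End Defs.

(* Main.v *)
(* Put V_1 = \int e^(alpha x) dm_1 and write m_1, m_2 as densities against
   finite positive measures, so that every term is an absolutely convergent
   iterated integral.  The Gaussian integrals over eta are elementary: F_(n,k)
   is a product of k+1 shifted free kernels, whose real exponent is linear in
   the alpha_l with coefficients bounded by the positions of the nodes, because
   it is read off the broken line through the nodes.  The singular factors
   (tau_j - tau_(j-1))^(-1/2) integrate over the simplex to O(mu^(-k)) e^(mu^2 t)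
   for every mu, hence the n-th term is g^n c_n with |c_n| <= A rho^n for every
   rho > 0: the series is entire in g.
   For the propagator equation, test the (m, k) contribution against
   -i d_t phi + phi_xx / 2.  As the last kernel solves the free equation, only
   the boundary term at the latest of the times s_1, ..., s_m, tau_k is left.
   If this is s_l, the l-th exponential becomes V_1(x); if it is tau_k, the
   Fresnel integral yields a delta at x_k.  So c_n is sent to
   V_1 c_(n-1) + V_2 c_(n-1), and summing over n gives the equation. *)
Require Import Defs.
From HB Require Import structures.
From mathcomp Require Import all_boot all_order all_algebra.
From mathcomp Require Import all_classical all_reals all_analysis.
From mathcomp Require Import measurable_realfun complex.
From mathcomp Require Import ring lra zify.

Import Order.TTheory GRing.Theory Num.Theory.
Import numFieldNormedType.Exports.

Local Open Scope classical_set_scope.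
Local Open Scope ring_scope.
Local Open Scope complex_scope.

(** * Integrals of complex functions *)

Section ComplexIntegral.
Context {R : realType}.
Local Notation C := R[i].
Local Notation Re := complex.Re.
Local Notation Im := complex.Im.

(** Three obstacles shape the proof. The definition nests one-dimensional integrals, in a number
    depending on $(n,k)$, and no two may be exchanged before every inner stage is known to be
    finite. Hence variables are named, integrals act on assignments of all names, and majorants are
    products over names. The free kernel is not absolutely integrable in $x$, so its initial value
    $\delta$ has no direct meaning here. It is tested from a time slightly after the node, where the
    weak equation is classical, and the limit is an oscillatory integral with the Fresnel constant.
    Finally, the $k!$ in the series leaves the $V_2$ nodes without a factorial. Their decay is
    extracted by the weight $e^{\mu^2(t-t_0)}$: each node costs $16/\mu$, and $\mu$ is chosen after
    the mass belonging to $m_2$ and the wanted rate. The propagator equation needs more than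
    convergence, namely bounds locally uniform in $(x,t)$ up to the factor $(t-t_0)^{-1/2}$. The
    insertions of $V_1$ carry labels from a list, so that the latest one can be removed. *)

Lemma ReD (z w : C) : Re (z + w) = Re z + Re w. Proof. by case: z w => [? ?] []. Qed.
Lemma ImD (z w : C) : Im (z + w) = Im z + Im w. Proof. by case: z w => [? ?] []. Qed.
Lemma ReN (z : C) : Re (- z) = - Re z. Proof. by case: z. Qed.
Lemma ImN (z : C) : Im (- z) = - Im z. Proof. by case: z. Qed.
Lemma ReM (z w : C) : Re (z * w) = Re z * Re w - Im z * Im w.
Proof. by case: z w => [? ?] []. Qed.
Lemma ImM (z w : C) : Im (z * w) = Re z * Im w + Im z * Re w.
Proof. by case: z w => [? ?] [? ?] /=. Qed.
Lemma Re_sum (I : Type) (s : seq I) (P : pred I) (F : I -> C) :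
  Re (\sum_(i <- s | P i) F i) = \sum_(i <- s | P i) Re (F i).
Proof. by apply: (big_morph _ (id1 := 0) (op1 := +%R)) => // z w; rewrite ReD. Qed.
Lemma Im_sum (I : Type) (s : seq I) (P : pred I) (F : I -> C) :
  Im (\sum_(i <- s | P i) F i) = \sum_(i <- s | P i) Im (F i).
Proof. by apply: (big_morph _ (id1 := 0) (op1 := +%R)) => // z w; rewrite ImD. Qed.
Lemma eqC (z w : C) : Re z = Re w -> Im z = Im w -> z = w.
Proof. by case: z w => [? ?] [? ?] /= -> ->. Qed.

(* the l^1 norm of the plane: submultiplicative and, unlike the modulus,
   trivially subadditive under integrals *)
Definition norm1 (z : C) : R := `|Re z| + `|Im z|.

Lemma norm1_ge0 z : 0 <= norm1 z. Proof. by rewrite addr_ge0. Qed.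
Lemma norm1D z w : norm1 (z + w) <= norm1 z + norm1 w.
Proof.
rewrite /norm1 ReD ImD; have := ler_normD (Re z) (Re w).
have := ler_normD (Im z) (Im w); lra.
Qed.
Lemma norm1N z : norm1 (- z) = norm1 z.
Proof. by rewrite /norm1 ReN ImN !normrN. Qed.
Lemma norm1M z w : norm1 (z * w) <= norm1 z * norm1 w.
Proof.
rewrite /norm1 ReM ImM.
have h1 := ler_normB (Re z * Re w) (Im z * Im w).
have h2 := ler_normD (Re z * Im w) (Im z * Re w).
move: h1 h2; rewrite !normrM; lra.
Qed.
Lemma norm1R (r : R) : norm1 r%:C = `|r|.
Proof. by rewrite /norm1 /= normr0 addr0. Qed.
Lemma norm1RM (r : R) z : norm1 (r%:C * z) = `|r| * norm1 z.
Proof. by rewrite /norm1 ReM ImM /= !mul0r subr0 addr0 !normrM mulrDr. Qed.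
Lemma norm10 : norm1 0 = 0. Proof. by rewrite /norm1 /= normr0 addr0. Qed.
Lemma norm11 : norm1 1 = 1. Proof. by rewrite -[1]/(1%:C) norm1R normr1. Qed.
Lemma norm1i : norm1 'i%C = 1. Proof. by rewrite /norm1 /= normr0 add0r normr1. Qed.
Lemma norm1_eq0 z : norm1 z = 0 -> z = 0.
Proof.
move=> h; apply: eqC => /=; apply/normr0_eq0.
  by have := normr_ge0 (Im z); have := normr_ge0 (Re z); rewrite /norm1 in h; lra.
by have := normr_ge0 (Im z); have := normr_ge0 (Re z); rewrite /norm1 in h; lra.
Qed.
Lemma norm1_sum (I : Type) (s : seq I) (P : pred I) (F : I -> C) :
  norm1 (\sum_(i <- s | P i) F i) <= \sum_(i <- s | P i) norm1 (F i).
Proof.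
elim/big_ind2 : _ => [|x1 x2 y1 y2 h1 h2|//]; first by rewrite norm10.
by rewrite (le_trans (norm1D _ _))// lerD.
Qed.
Lemma norm1X z n : norm1 (z ^+ n) <= norm1 z ^+ n.
Proof.
elim: n => [|n ih]; first by rewrite !expr0 norm11.
by rewrite !exprS (le_trans (norm1M _ _))// ler_wpM2l// norm1_ge0.
Qed.
Lemma le_norm1 z : `|z| <= (norm1 z)%:C.
Proof.
rewrite normc_def lecR /norm1.
rewrite -(ler_pXn2r (n:=2)) ?nnegrE ?sqrtr_ge0 ?addr_ge0//.
rewrite sqr_sqrtr ?addr_ge0 ?sqr_ge0// sqrrD !real_normK ?num_real//.
have : 0 <= `|Re z| * `|Im z| by rewrite mulr_ge0.
rewrite -mulr_natr; lra.
Qed.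
Lemma norm1_le z r : `|z| <= r%:C -> norm1 z <= 2 * r.
Proof.
rewrite normc_def lecR /norm1 => h.
have h1 : `|Re z| <= r.
  by rewrite -sqrtr_sqr (le_trans _ h)// ler_wsqrtr// lerDl sqr_ge0.
have h2 : `|Im z| <= r.
  by rewrite -sqrtr_sqr (le_trans _ h)// ler_wsqrtr// lerDr sqr_ge0.
lra.
Qed.

Lemma Re_le_norm1 z : `|Re z| <= norm1 z. Proof. by rewrite lerDl. Qed.
Lemma Im_le_norm1 z : `|Im z| <= norm1 z. Proof. by rewrite lerDr. Qed.

Lemma cexpD (z w : C) : cexp (z + w) = cexp z * cexp w.
Proof.
rewrite /cexp ReD ImD expRD cosD sinD.
by apply: eqC; rewrite !(ReM, ImM) /=; ring.
Qed.
Lemma norm1_cexp (z : C) : norm1 (cexp z) <= 2 * expR (Re z).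
Proof.
rewrite /cexp norm1RM ger0_norm ?expR_ge0// mulrC ler_wpM2r ?expR_ge0//.
rewrite /norm1 /=; have := cos_max (Im z); have := sin_max (Im z); lra.
Qed.
Lemma Re_cexp (z : C) : Re (cexp z) = expR (Re z) * cos (Im z).
Proof. by rewrite /cexp /=; ring. Qed.
Lemma Im_cexp (z : C) : Im (cexp z) = expR (Re z) * sin (Im z).
Proof. by rewrite /cexp /=; ring. Qed.

Section Measurability.
Context {d} {T : measurableType d}.
Implicit Types f g : T -> C.

Definition cmeas f := measurable_fun setT (fun x => Re (f x)) /\
  measurable_fun setT (fun x => Im (f x)).

Lemma cmeas_eq f g : f =1 g -> cmeas f -> cmeas g.
Proof. by move=> /funext ->. Qed.
Lemma cmeasD f g : cmeas f -> cmeas g -> cmeas (fun x => f x + g x).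
Proof.
move=> [f1 f2] [g1 g2]; split.
  under eq_fun do rewrite ReD; exact: measurable_funD.
under eq_fun do rewrite ImD; exact: measurable_funD.
Qed.
Lemma cmeasM f g : cmeas f -> cmeas g -> cmeas (fun x => f x * g x).
Proof.
move=> [f1 f2] [g1 g2]; split.
  under eq_fun do rewrite ReM.
  by apply: measurable_funB; exact: measurable_funM.
under eq_fun do rewrite ImM.
by apply: measurable_funD; exact: measurable_funM.
Qed.
Lemma cmeas_cst (c : C) : cmeas (fun=> c).
Proof. by split; exact: measurable_cst. Qed.
Lemma cmeasR (h : T -> R) : measurable_fun setT h -> cmeas (fun x => (h x)%:C).
Proof. by move=> mh; split => //=; exact: measurable_cst. Qed.
Lemma cmeas_cexp f : cmeas f -> cmeas (fun x => cexp (f x)).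
Proof.
move=> [f1 f2]; split.
  under eq_fun do rewrite Re_cexp.
  apply: measurable_funM; first exact: measurableT_comp.
  apply: (@measurableT_comp _ _ _ _ _ _ cos) => //.
  by apply: continuous_measurable_fun; exact: continuous_cos.
under eq_fun do rewrite Im_cexp.
apply: measurable_funM; first exact: measurableT_comp.
apply: (@measurableT_comp _ _ _ _ _ _ sin) => //.
by apply: continuous_measurable_fun; exact: continuous_sin.
Qed.
Lemma cmeas_sum (I : Type) (s : seq I) (F : I -> T -> C) :
  (forall i, cmeas (F i)) -> cmeas (fun x => \sum_(i <- s) F i x).
Proof.
move=> mF; elim: s => [|i s ih].
  by apply: (cmeas_eq _ _ _ (cmeas_cst 0)) => x; rewrite big_nil.
by apply: (cmeas_eq _ _ _ (cmeasD _ _ (mF i) ih)) => x; rewrite big_cons.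
Qed.
Lemma cmeas_prod (I : Type) (s : seq I) (F : I -> T -> C) :
  (forall i, cmeas (F i)) -> cmeas (fun x => \prod_(i <- s) F i x).
Proof.
move=> mF; elim: s => [|i s ih].
  by apply: (cmeas_eq _ _ _ (cmeas_cst 1)) => x; rewrite big_nil.
by apply: (cmeas_eq _ _ _ (cmeasM _ _ (mF i) ih)) => x; rewrite big_cons.
Qed.
Lemma cmeas_if (b : T -> bool) f g : measurable_fun setT b ->
  cmeas f -> cmeas g -> cmeas (fun x => if b x then f x else g x).
Proof.
move=> mb [f1 f2] [g1 g2]; split.
  rewrite [X in measurable_fun _ X](_ : _ = fun x => if b x then Re (f x) else Re (g x)).
    exact: measurable_fun_ifT.
  by apply/funext => x; case: (b x).
rewrite [X in measurable_fun _ X](_ : _ = fun x => if b x then Im (f x) else Im (g x)).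
  exact: measurable_fun_ifT.
by apply/funext => x; case: (b x).
Qed.
Lemma measurable_norm1 f : cmeas f -> measurable_fun setT (fun x => norm1 (f x)).
Proof.
by move=> [f1 f2]; apply: measurable_funD; exact: measurableT_comp.
Qed.
Lemma emeasurable_norm1 f : cmeas f ->
  measurable_fun setT (fun x => (norm1 (f x))%:E).
Proof. by move=> mf; apply/measurable_EFinP; exact: measurable_norm1. Qed.
End Measurability.

Lemma cmeas_comp d1 d2 (T1 : measurableType d1) (T2 : measurableType d2)
  (f : T2 -> C) (h : T1 -> T2) : measurable_fun setT h -> cmeas f ->
  cmeas (fun x => f (h x)).
Proof.
move=> mh [f1 f2]; split.
  exact: (@measurableT_comp _ _ _ _ _ _ (fun x => Re (f x))).
exact: (@measurableT_comp _ _ _ _ _ _ (fun x => Im (f x))).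
Qed.

Section Integral.
Context {d} {T : measurableType d}.
Variable mu : {measure set T -> \bar R}.
Implicit Types f g : T -> C.

Definition cint f : C := cintegral mu setT f.
Definition nint f : \bar R := (\int[mu]_x (norm1 (f x))%:E)%E.
Definition cfin f := cmeas f /\ (nint f < +oo)%E.

Lemma nint_ge0 f : (0 <= nint f)%E.
Proof. by apply: integral_ge0 => x _; rewrite lee_fin norm1_ge0. Qed.

Lemma cfin_int f : cfin f -> mu.-integrable setT (fun x => (Re (f x))%:E) /\
   mu.-integrable setT (fun x => (Im (f x))%:E).
Proof.
move=> [[f1 f2] fy]; split; apply/integrableP; split; try exact/measurable_EFinP.
  apply: le_lt_trans fy; apply: ge0_le_integral => //.
  - by apply/measurable_EFinP; exact: measurableT_comp.
  - exact: emeasurable_norm1.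
  - by move=> x _; rewrite abse_EFin lee_fin Re_le_norm1.
apply: le_lt_trans fy; apply: ge0_le_integral => //.
- by apply/measurable_EFinP; exact: measurableT_comp.
- exact: emeasurable_norm1.
- by move=> x _; rewrite abse_EFin lee_fin Im_le_norm1.
Qed.

Lemma le_cfin f (h : T -> R) : cmeas f -> (forall x, norm1 (f x) <= h x) ->
  measurable_fun setT h -> (\int[mu]_x (h x)%:E < +oo)%E -> cfin f.
Proof.
move=> mf fh mh hy; split => //; apply: le_lt_trans hy.
apply: ge0_le_integral => //.
- by move=> x _; rewrite lee_fin norm1_ge0.
- exact: emeasurable_norm1.
- exact/measurable_EFinP.
- by move=> x _; rewrite lee_fin.
Qed.

Lemma cintD f g : cfin f -> cfin g ->
  cint (fun x => f x + g x) = cint f + cint g.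
Proof.
move=> /cfin_int[f1 f2] /cfin_int[g1 g2]; apply: eqC => /=.
  by under eq_Rintegral do rewrite ReD; rewrite RintegralD.
by under eq_Rintegral do rewrite ImD; rewrite RintegralD.
Qed.

Lemma cintZ c f : cfin f -> cint (fun x => c * f x) = c * cint f.
Proof.
move=> /cfin_int[f1 f2].
have iZ r (h : T -> R) : mu.-integrable setT (fun x => (h x)%:E) ->
    mu.-integrable setT (EFin \o (fun x => r * h x)).
  by move=> ih; exact: (integrableZl measurableT r ih).
apply: eqC; rewrite ?(ReM, ImM) /=.
  under eq_Rintegral do rewrite ReM.
  by rewrite RintegralB//; [rewrite !RintegralZl|exact: iZ|exact: iZ].
under eq_Rintegral do rewrite ImM.
by rewrite RintegralD//; [rewrite !RintegralZl|exact: iZ|exact: iZ].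
Qed.

Lemma eq_cint f g : f =1 g -> cint f = cint g.
Proof. by move=> /funext ->. Qed.

Lemma cint0 : cint (fun=> 0) = 0.
Proof. by apply: eqC; rewrite /= /Rintegral integral0. Qed.

Lemma ae_cint f g : cmeas f -> cmeas g -> {ae mu, forall x, f x = g x} ->
  cint f = cint g.
Proof.
move=> [f1 f2] [g1 g2] fg; apply: eqC => /=; congr fine; apply: ae_eq_integral => //.
all: try exact/measurable_EFinP.
all: by apply: filterS fg => x /= -> _.
Qed.

(** Measurability is enough: without integrability the right-hand side is infinite. Otherwise the
    real inequality applies to each component, and [norm1] adds the two. *)
Lemma le_cint f : cmeas f -> ((norm1 (cint f))%:E <= nint f)%E.
Proof.
move=> mf; have [fy|] := boolP (nint f < +oo)%E; last first.
  by rewrite -leNgt leye_eq => /eqP ->; rewrite leey.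
have [f1 f2] := cfin_int _ (conj mf fy).
rewrite /nint /norm1; under eq_integral do rewrite EFinD.
case: (mf) => mf1 mf2.
rewrite ge0_integralD//; last 2 first.
- by apply/measurable_EFinP; exact: measurableT_comp.
- by apply/measurable_EFinP; exact: measurableT_comp.
rewrite EFinD leeD//.
  by rewrite EFin_normr_Rintegral//; apply: le_abse_integral => //; exact/measurable_EFinP.
by rewrite EFin_normr_Rintegral//; apply: le_abse_integral => //; exact/measurable_EFinP.
Qed.
End Integral.

Section Fubini.
Context {d1 d2} {T1 : measurableType d1} {T2 : measurableType d2}.
Variable m2 : {sigma_finite_measure set T2 -> \bar R}.

(** Tonelli is applied to the positive and the negative part separately, so no integrability enters
    and the integral under [fine] may be infinite or undefined. *)
Lemma measurable_fine_integral (f : T1 * T2 -> R) : measurable_fun setT f ->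
  measurable_fun setT (fun x => fine (\int[m2]_y (f (x, y))%:E)).
Proof.
move=> mf; apply: measurableT_comp => //.
rewrite [X in measurable_fun _ X](_ : _ = fun x =>
  (\int[m2]_y (EFin \o f)^\+ (x, y) - \int[m2]_y (EFin \o f)^\- (x, y))%E).
  have mef : measurable_fun setT (EFin \o f) by exact/measurable_EFinP.
  apply: emeasurable_funB.
  - by apply: measurable_fun_fubini_tonelli_F => //; exact: measurable_funepos.
  - by apply: measurable_fun_fubini_tonelli_F => //; exact: measurable_funeneg.
apply/funext => x; rewrite [LHS]integralE.
by congr (_ - _)%E; apply: eq_integral => y _; rewrite ?funeposE ?funenegE.
Qed.

Lemma cmeas_cint (f : T1 * T2 -> C) : cmeas f ->
  cmeas (fun x => cint m2 (fun y => f (x, y))).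
Proof.
move=> [f1 f2]; split => /=.
  exact: (measurable_fine_integral (fun z => Re (f z))).
exact: (measurable_fine_integral (fun z => Im (f z))).
Qed.

End Fubini.

Section Fubini2.
Context {d1 d2} {T1 : measurableType d1} {T2 : measurableType d2}.
Variable m2 : {sigma_finite_measure set T2 -> \bar R}.
Variable m1 : {sigma_finite_measure set T1 -> \bar R}.

(** Fubini for both components. The inner integrals are [fine] of extended real ones; the two agree
    wherever the section is integrable, hence almost everywhere, which the outer integral does not
    notice. *)
Lemma cint_prod (f : T1 * T2 -> C) : cmeas f ->
  (\int[m1]_x nint m2 (fun y => f (x, y)) < +oo)%E ->
  [/\ cfin (m1 \x m2)%E f,
  cint (m1 \x m2)%E f = cint m1 (fun x => cint m2 (fun y => f (x, y))) &
  cint (m1 \x m2)%E f = cint m2 (fun y => cint m1 (fun x => f (x, y)))].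
Proof.
move=> mf fy.
have cf : cfin (m1 \x m2)%E f.
  split => //; apply: le_lt_trans fy.
  rewrite /nint (fubini_tonelli1 (fun z => (norm1 (f z))%:E))//.
    exact: emeasurable_norm1.
  by move=> z; rewrite lee_fin norm1_ge0.
have [i1 i2] := cfin_int _ _ cf.
have key (h : T1 * T2 -> R) : (m1 \x m2)%E.-integrable setT (EFin \o h) ->
   (\int[(m1 \x m2)%E]_z h z = \int[m1]_x \int[m2]_y h (x, y)) /\
   (\int[(m1 \x m2)%E]_z h z = \int[m2]_y \int[m1]_x h (x, y)).
  move=> ih; rewrite /Rintegral; split; congr fine.
    rewrite -(integral12_prod_meas1 ih); apply: ae_eq_integral => //.
    - exact: (measurable_fubini_F ih).
    - have mh : measurable_fun setT h by have := measurable_int _ ih; move/measurable_EFinP.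
      by apply/measurable_EFinP; apply: measurable_fine_integral.
    have := ae_integrable1 ih; apply: filterS => x /= ix _.
    by rewrite fineK//; apply: integrable_fin_num.
  rewrite -(integral21_prod_meas1 ih); apply: ae_eq_integral => //.
  - exact: (measurable_fubini_G ih).
  - have mh : measurable_fun setT h by have := measurable_int _ ih; move/measurable_EFinP.
    apply/measurable_EFinP.
    apply: (measurable_fine_integral m1 (fun z => h (z.2, z.1))).
    by apply: (measurableT_comp mh); apply: measurable_fun_pair.
  have := ae_integrable2 ih; apply: filterS => x /= ix _.
  by rewrite fineK//; apply: integrable_fin_num.
split => //; apply: eqC => /=; by [apply (key (fun z => Re (f z)))|apply (key (fun z => Im (f z)))].
Qed.
End Fubini2.
End ComplexIntegral.

(** * Iterated integrals over named variables *)

Section IteratedIntegrals.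
Context {R : realType}.
Local Notation C := R[i].
Local Notation B := (measurableTypeR R).
Local Notation name := (nat * nat)%type.

(* The number of integration variables changes with (n, k), so an integrand is
   a function of an assignment of reals to all the variable names. *)
Definition env := g_sigma_algebraType [set A : set (name -> R) |
  exists i (U : set B), measurable U /\ A = (fun e => e i) @^-1` U].

Lemma measurable_coord (i : name) : measurable_fun setT (fun e : env => e i : B).
Proof. by move=> _ U mU; rewrite setTI; apply: sub_sigma_algebra; exists i, U. Qed.

Lemma measurable_env d (T : measurableType d) (f : T -> env) :
  (forall i, measurable_fun setT (fun x => f x i : B)) -> measurable_fun setT f.
Proof.
move=> mf; apply: (@measurability _ _ T env setT f [set A : set (name -> R) |
  exists i (U : set B), measurable U /\ A = (fun e => e i) @^-1` U]) => //.
move=> _ [_ [i [U [mU ->]]] <-]; rewrite setTI.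
by have := mf i measurableT _ mU; rewrite setTI.
Qed.

Definition upd (e : env) (i : name) (a : R) : env :=
  fun j => if j == i then a else e j.

Lemma measurable_upd i : measurable_fun setT (fun z : env * B => upd z.1 i z.2).
Proof.
apply: measurable_env => j; rewrite /upd; case: (j == i).
  exact: measurable_snd.
exact: (measurableT_comp (measurable_coord j) measurable_fst).
Qed.

Lemma measurable_upd_comp d (T : measurableType d) (f : T -> env) (g : T -> B) i :
  measurable_fun setT f -> measurable_fun setT g ->
  measurable_fun setT (fun x => upd (f x) i (g x)).
Proof.
move=> mf mg; apply: measurable_env => j; rewrite /upd; case: (j == i) => //.
exact: (measurableT_comp (measurable_coord j) mf).
Qed.

Lemma upd_same e i a : upd e i a i = a. Proof. by rewrite /upd eqxx. Qed.
Lemma upd_diff e i j a : j != i -> upd e i a j = e j.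
Proof. by move=> /negbTE h; rewrite /upd h. Qed.
Lemma updC e i j a b : i != j -> upd (upd e i a) j b = upd (upd e j b) i a.
Proof.
move=> ij; apply/funext => k; rewrite /upd.
by case: (k =P j) => [->|//]; rewrite eq_sym (negbTE ij).
Qed.

Variable mu : name -> {sigma_finite_measure set B -> \bar R}.

(** The result is again a function of the whole assignment, so these operators compose freely.
    [Nint] is the twin for nonnegative functions, where every exchange is unconditional; it measures
    the absolute convergence of [Cint]. *)
Definition Cint i (F : env -> C) (e : env) : C :=
  cint (mu i) (fun a => F (upd e i a)).
Definition Nint i (f : env -> \bar R) (e : env) : \bar R :=
  (\int[mu i]_a f (upd e i a))%E.
Definition Cints l F := foldr Cint F l.
Definition Nints l f := foldr Nint f l.
Definition nnmeas (f : env -> \bar R) :=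
  measurable_fun setT f /\ forall e, (0 <= f e)%E.
Definition enorm1 (F : env -> C) (e : env) : \bar R := (norm1 (F e))%:E.

Lemma nnmeas_enorm1 F : cmeas F -> nnmeas (enorm1 F).
Proof.
by move=> mF; split; [exact: emeasurable_norm1|move=> e; rewrite lee_fin norm1_ge0].
Qed.

Lemma measurable_upd2 i e : measurable_fun setT (fun a : B => upd e i a).
Proof.
by apply: measurable_env => j; rewrite /upd; case: (j == i).
Qed.

Lemma nnmeas_Nint i f : nnmeas f -> nnmeas (Nint i f).
Proof.
move=> [mf f0]; split; last by move=> e; apply: integral_ge0.
apply: (measurable_fun_fubini_tonelli_F (fun z : env * B => f (upd z.1 i z.2))) => //.
by apply: measurableT_comp => //; exact: measurable_upd.
Qed.

Lemma nnmeas_Nints l f : nnmeas f -> nnmeas (Nints l f).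
Proof. by move=> nf; elim: l => // i l; exact: nnmeas_Nint. Qed.

Lemma cmeas_Cint i F : cmeas F -> cmeas (Cint i F).
Proof.
move=> mF; apply: (cmeas_cint (mu i) (fun z : env * B => F (upd z.1 i z.2))).
by apply: cmeas_comp => //; exact: measurable_upd.
Qed.

Lemma cmeas_Cints l F : cmeas F -> cmeas (Cints l F).
Proof. by move=> nf; elim: l => // i l; exact: cmeas_Cint. Qed.

Lemma cmeas_upd (F : env -> C) e i : cmeas F -> cmeas (fun a : B => F (upd e i a)).
Proof. by move=> mF; apply: cmeas_comp => //; exact: measurable_upd2. Qed.

Lemma nnmeas_upd f e i : nnmeas f -> measurable_fun setT (fun a : B => f (upd e i a)).
Proof. by move=> [mf _]; apply: measurableT_comp => //; exact: measurable_upd2. Qed.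

Lemma le_Nint i f g e : nnmeas f -> nnmeas g -> (forall a, (f (upd e i a) <= g (upd e i a))%E) ->
  (Nint i f e <= Nint i g e)%E.
Proof.
move=> nf ng fg; apply: ge0_le_integral => //.
- by move=> a _; case: nf.
- exact: nnmeas_upd.
- exact: nnmeas_upd.
Qed.

(** These are the only assignments at which an integral over [l] evaluates its integrand, so
    comparisons of integrands are required just there. *)
Definition agree (l : seq name) (e e' : env) := forall j, j \notin l -> e' j = e j.

Lemma agree_upd i l e e' a : agree l (upd e i a) e' -> agree (i :: l) e e'.
Proof.
by move=> h j; rewrite inE negb_or => /andP[ji /h]; rewrite upd_diff.
Qed.

Lemma le_Nints l f g e : nnmeas f -> nnmeas g ->
  (forall e', agree l e e' -> (f e' <= g e')%E) -> (Nints l f e <= Nints l g e)%E.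
Proof.
move=> nf ng; elim: l e => [|i l ih] e fg /=; first exact: fg.
apply: le_Nint => [||a]; try exact: nnmeas_Nints.
by apply: ih => e' /agree_upd; exact: fg.
Qed.

Lemma eq_Nints l f g e : (forall e', agree l e e' -> f e' = g e') ->
  Nints l f e = Nints l g e.
Proof.
elim: l e => [|i l ih] e fg /=; first exact: fg.
by apply: eq_integral => a _; apply: ih => e' /agree_upd; exact: fg.
Qed.

Lemma eq_Cints l F G e : (forall e', agree l e e' -> F e' = G e') ->
  Cints l F e = Cints l G e.
Proof.
elim: l e => [|i l ih] e fg /=; first exact: fg.
by apply: eq_cint => a; apply: ih => e' /agree_upd; exact: fg.
Qed.

Lemma le_Cint i F e : cmeas F -> (enorm1 (Cint i F) e <= Nint i (enorm1 F) e)%E.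
Proof. by move=> mF; apply: le_cint; exact: cmeas_upd. Qed.

Lemma le_Cints l F e : cmeas F -> (enorm1 (Cints l F) e <= Nints l (enorm1 F) e)%E.
Proof.
move=> mF; elim: l e => [//|i l ih] e /=.
apply: le_trans (le_Cint _ _ _ _) _; first exact: cmeas_Cints.
apply: le_Nint => //; first by apply: nnmeas_enorm1; exact: cmeas_Cints.
by apply: nnmeas_Nints; exact: nnmeas_enorm1.
Qed.

Lemma NintC i j f e : i != j -> nnmeas f -> Nint i (Nint j f) e = Nint j (Nint i f) e.
Proof.
move=> ij [mf f0]; rewrite /Nint.
have mg : measurable_fun setT (fun z : B * B => f (upd (upd e i z.1) j z.2)).
  apply: (measurableT_comp mf).
  apply: measurable_upd_comp; last exact: measurable_snd.
  exact: (measurableT_comp (measurable_upd2 i e) measurable_fst).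
rewrite (fubini_tonelli (fun z : B * B => f (upd (upd e i z.1) j z.2)) mg); last by move=> z; exact: f0.
by apply: eq_integral => b _; apply: eq_integral => a _; rewrite updC.
Qed.

Lemma CintC i j F e : i != j -> cmeas F -> (Nint i (Nint j (enorm1 F)) e < +oo)%E ->
  Cint i (Cint j F) e = Cint j (Cint i F) e.
Proof.
move=> ij mF fy; rewrite /Cint.
have [|_ <- ->] := cint_prod (mu j) (mu i)
    (fun z : B * B => F (upd (upd e i z.1) j z.2)) _ fy.
- apply: cmeas_comp => //.
  apply: measurable_upd_comp; last exact: measurable_snd.
  exact: (measurableT_comp (measurable_upd2 i e) measurable_fst).
- by apply: eq_cint => b; apply: eq_cint => a; rewrite updC.
Qed.

Lemma Nints_rem i l f e : uniq l -> i \in l -> nnmeas f ->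
  Nints l f e = Nint i (Nints (rem i l) f) e.
Proof.
move=> + + nf; elim: l e => // j l ih e /= /andP[jl ul].
rewrite inE; case: eqVneq => [->|ij] //= il.
rewrite NintC//; last exact: nnmeas_Nints.
by apply: eq_integral => a _; exact: ih.
Qed.

Lemma Nints_perm l l' f e : uniq l -> perm_eq l l' -> nnmeas f ->
  Nints l f e = Nints l' f e.
Proof.
move=> + + nf; elim: l l' e => [|i l ih] l' e ul ll'.
  by move: ll'; rewrite perm_sym => /perm_nilP ->.
have il' : i \in l' by rewrite -(perm_mem ll') mem_head.
have ul' : uniq l' by rewrite -(perm_uniq ll').
rewrite (Nints_rem i l')//=; apply: eq_integral => a _; apply: ih.
  by case/andP : ul.
by rewrite -(perm_cons i) (permPl ll') perm_to_rem.
Qed.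

(** A function with finite integral is finite almost everywhere, and only there need the integrands
    agree. In the uses [h] is an inner norm integral, and its finiteness is what an induction
    hypothesis about inner integrals requires. *)
Lemma ae_Cint i h F G e : nnmeas h -> (Nint i h e < +oo)%E -> cmeas F -> cmeas G ->
  (forall a, (h (upd e i a) < +oo)%E -> F (upd e i a) = G (upd e i a)) ->
  Cint i F e = Cint i G e.
Proof.
move=> nh hy mF mG FG; apply: ae_cint; [exact: cmeas_upd|exact: cmeas_upd|].
have ih : (mu i).-integrable setT (fun a => h (upd e i a)).
  apply/integrableP; split; first exact: nnmeas_upd.
  by under eq_integral do rewrite gee0_abs ?nh.2//.
have := integrable_ae measurableT ih; apply: filterS => a /= /(_ Logic.I) ha.
by apply: FG; rewrite ltey_eq ha.
Qed.

(** Finiteness is asked at one assignment only: once the outermost variable is fixed, it survives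
    for almost every value of that variable, not for all. *)
Definition Cfin l F e := cmeas F /\ (Nints l (enorm1 F) e < +oo)%E.

Lemma Cfin_Cint i l F e : Cfin (i :: l) F e ->
  cfin (mu i) (fun a => Cints l F (upd e i a)).
Proof.
move=> [mF fy]; split; first by apply: cmeas_upd; exact: cmeas_Cints.
apply: le_lt_trans fy; apply: (le_Nint i (enorm1 (Cints l F))) => [||a].
- by apply: nnmeas_enorm1; exact: cmeas_Cints.
- by apply: nnmeas_Nints; exact: nnmeas_enorm1.
- exact: le_Cints.
Qed.

(* inner integrals are finite for almost every value of the outer variable *)
Lemma Cfin_congr i l F G H e : Cfin (i :: l) F e -> cmeas G -> cmeas H ->
  (forall e', Cfin l F e' -> G e' = H e') -> Cint i G e = Cint i H e.
Proof.
move=> [mF fy] mG mH GH.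
apply: (ae_Cint i (Nints l (enorm1 F))) => // [|a ha].
  by apply: nnmeas_Nints; exact: nnmeas_enorm1.
exact: GH.
Qed.

Lemma Cints_rem i l F e : uniq l -> i \in l -> Cfin l F e ->
  Cints l F e = Cint i (Cints (rem i l) F) e.
Proof.
elim: l e => // j l ih e /= /andP[jl ul].
rewrite inE; case: eqVneq => [->|ij] //= il fy.
have [mF _] := fy.
rewrite (Cfin_congr j l F _ (Cint i (Cints (rem i l) F)))//.
- apply: CintC; [by rewrite eq_sym|exact: cmeas_Cints|].
  apply: le_lt_trans fy.2; rewrite /=.
  apply: le_Nint => [||a].
  + by apply: nnmeas_Nint; apply: nnmeas_enorm1; exact: cmeas_Cints.
  + by apply: nnmeas_Nints; exact: nnmeas_enorm1.
  + rewrite (Nints_rem i l)//; last exact: nnmeas_enorm1.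
    apply: le_Nint => [||b].
    * by apply: nnmeas_enorm1; exact: cmeas_Cints.
    * by apply: nnmeas_Nints; exact: nnmeas_enorm1.
    * exact: le_Cints.
- exact: cmeas_Cints.
- by apply: cmeas_Cint; exact: cmeas_Cints.
- by move=> e' fe'; exact: ih.
Qed.

Lemma Cints_perm l l' F e : uniq l -> perm_eq l l' -> Cfin l F e ->
  Cints l F e = Cints l' F e.
Proof.
elim: l l' e => [|i l ih] l' e ul ll' fy.
  by move: ll'; rewrite perm_sym => /perm_nilP ->.
have il' : i \in l' by rewrite -(perm_mem ll') mem_head.
have ul' : uniq l' by rewrite -(perm_uniq ll').
have [mF _] := fy.
rewrite (Cints_rem i l')//=; last first.
  by split => //; rewrite -(Nints_perm (i :: l))//; [exact: fy.2|exact: nnmeas_enorm1].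
apply: (Cfin_congr i l F) => //; try exact: cmeas_Cints.
move=> e' fe'; apply: ih => //; first by case/andP : ul.
by rewrite -(perm_cons i) (permPl ll') perm_to_rem.
Qed.

Lemma Cfin_perm l l' F e : uniq l -> perm_eq l l' -> Cfin l F e -> Cfin l' F e.
Proof.
move=> ul ll' [mF fy]; split => //.
by rewrite -(Nints_perm l)//; exact: nnmeas_enorm1.
Qed.

Lemma CintsD l F G e : Cfin l F e -> Cfin l G e ->
  Cints l (fun e => F e + G e) e = Cints l F e + Cints l G e.
Proof.
elim: l e => [//|i l ih] e fF fG; have [mF yF] := fF; have [mG yG] := fG.
rewrite /= [RHS](_ : _ = Cint i (fun e => Cints l F e + Cints l G e) e); last first.
  by rewrite /Cint cintD//; exact: Cfin_Cint.
apply: (ae_Cint i (fun e => Nints l (enorm1 F) e + Nints l (enorm1 G) e)%E).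
- have [m1 p1] := nnmeas_Nints l _ (nnmeas_enorm1 _ mF).
  have [m2 p2] := nnmeas_Nints l _ (nnmeas_enorm1 _ mG).
  by split; [exact: emeasurable_funD|move=> e'; exact: adde_ge0].
- rewrite /Nint ge0_integralD//; first exact: lte_add_pinfty.
  + by move=> a _; apply: (nnmeas_Nints l _ (nnmeas_enorm1 _ mF)).2.
  + by apply: nnmeas_upd; apply: nnmeas_Nints; exact: nnmeas_enorm1.
  + by move=> a _; apply: (nnmeas_Nints l _ (nnmeas_enorm1 _ mG)).2.
  + by apply: nnmeas_upd; apply: nnmeas_Nints; exact: nnmeas_enorm1.
- by apply: cmeas_Cints; exact: cmeasD.
- by apply: cmeasD; exact: cmeas_Cints.
- move=> a ha; apply: ih; split => //; apply: le_lt_trans ha.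
    by rewrite leeDl//; apply: (nnmeas_Nints l _ (nnmeas_enorm1 _ mG)).2.
  by rewrite leeDr//; apply: (nnmeas_Nints l _ (nnmeas_enorm1 _ mF)).2.
Qed.

Definition indep {T} (l : seq name) (c : env -> T) :=
  forall e e', agree l e e' -> c e' = c e.

Lemma indep_cons i l T (c : env -> T) : indep (i :: l) c -> indep l c.
Proof.
move=> h e e' ee'; apply: h => j; rewrite inE negb_or => /andP[_]; exact: ee'.
Qed.

Lemma indep_upd i l T (c : env -> T) e a : indep (i :: l) c -> c (upd e i a) = c e.
Proof.
by move=> h; apply: h => j; rewrite inE negb_or => /andP[ij _]; rewrite upd_diff.
Qed.

Lemma CintsZ l c F e : cmeas c -> indep l c -> Cfin l F e ->
  Cints l (fun e => c e * F e) e = c e * Cints l F e.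
Proof.
move=> mc; elim: l e => [//|i l ih] e hc fF; have [mF yF] := fF.
rewrite /= [RHS](_ : _ = Cint i (fun e => c e * Cints l F e) e); last first.
  rewrite /Cint -cintZ; last exact: Cfin_Cint.
  by apply: eq_cint => a; rewrite (indep_upd _ _ _ _ _ _ hc).
apply: (Cfin_congr i l F) => //.
- by apply: cmeas_Cints; exact: cmeasM.
- by apply: cmeasM => //; exact: cmeas_Cints.
- by move=> e'; apply: ih; exact: indep_cons hc.
Qed.

(** A change of bound variables. It serves to relabel the insertions of $V_1$ after one of them has
    been removed. *)
Lemma Cints_rename (p : name -> name) l (G : env -> C) e :
  injective p -> (forall i, i \in l -> mu (p i) = mu i) ->
  Cints (map p l) (fun e => G (e \o p)) e = Cints l G (e \o p).
Proof.
move=> pinj; elim: l e => [//|i l ih] e pm /=.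
rewrite /Cint pm ?mem_head//; apply: eq_cint => a.
rewrite ih; last by move=> j jl; apply: pm; rewrite inE jl orbT.
congr (Cints l G _); apply/funext => j /=; rewrite /upd.
by rewrite (inj_eq pinj).
Qed.

Lemma Cints_cat l1 l2 F : Cints (l1 ++ l2) F = Cints l1 (Cints l2 F).
Proof. by rewrite /Cints foldr_cat. Qed.

Lemma Nints_cat l1 l2 f : Nints (l1 ++ l2) f = Nints l1 (Nints l2 f).
Proof. by rewrite /Nints foldr_cat. Qed.

Lemma Cints0 l e : Cints l (fun=> 0) e = 0.
Proof. by elim: l e => [//|i l ih] e /=; rewrite /Cint; under eq_cint do rewrite ih; rewrite cint0. Qed.

Lemma Nints0 l e : Nints l (fun=> 0%E) e = 0%E.
Proof.
by elim: l e => [//|i l ih] e /=; rewrite /Nint; under eq_integral do rewrite ih; rewrite integral0.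
Qed.

Lemma NintsZ l (c : env -> R) f e : (forall e, 0 <= c e) ->
  indep l c -> nnmeas f ->
  Nints l (fun e => (c e)%:E * f e)%E e = ((c e)%:E * Nints l f e)%E.
Proof.
move=> c0 + nf; elim: l e => [//|i l ih] e hc /=.
rewrite /Nint -ge0_integralZl//.
- apply: eq_integral => a _; rewrite ih; last exact: indep_cons hc.
  by rewrite (indep_upd _ _ _ _ _ _ hc).
- by apply: nnmeas_upd; exact: nnmeas_Nints.
- by move=> a _; apply: (nnmeas_Nints l _ nf).2.
- by rewrite lee_fin.
Qed.

Lemma CfinD l F G e : Cfin l F e -> Cfin l G e -> Cfin l (fun e => F e + G e) e.
Proof.
move=> [mF yF] [mG yG]; split; first exact: cmeasD.
suff : (Nints l (fun e => enorm1 F e + enorm1 G e) e = Nints l (enorm1 F) e + Nints l (enorm1 G) e)%E.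
  move=> h; apply: (@le_lt_trans _ _ (Nints l (fun e => enorm1 F e + enorm1 G e)%E e)); last first.
    by rewrite h; exact: lte_add_pinfty.
  apply: le_Nints => [||e' _].
  - by apply: nnmeas_enorm1; exact: cmeasD.
  - split; first by apply: emeasurable_funD; exact: emeasurable_norm1.
    by move=> e'; apply: adde_ge0; rewrite lee_fin norm1_ge0.
  - by rewrite /enorm1 -EFinD lee_fin norm1D.
elim: l e {yF yG} => [//|i l ih] e /=.
rewrite {1}/Nint; under eq_integral do rewrite ih.
by rewrite ge0_integralD//; try (by move=> a _; apply: (nnmeas_Nints l _ (nnmeas_enorm1 _ _)).2);
  apply: nnmeas_upd; apply: nnmeas_Nints; exact: nnmeas_enorm1.
Qed.

Lemma Cfin_le l F G e : cmeas F -> Cfin l G e ->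
  (forall e', agree l e e' -> norm1 (F e') <= norm1 (G e')) -> Cfin l F e.
Proof.
move=> mF [mG yG] FG; split => //; apply: le_lt_trans yG.
apply: le_Nints; try exact: nnmeas_enorm1.
by move=> e' ee'; rewrite lee_fin FG.
Qed.

Lemma Cfin_agree_zero l e : Cfin l (fun=> 0) e.
Proof.
split; first exact: cmeas_cst.
rewrite (eq_Nints _ _ (fun=> 0%E)); first by rewrite Nints0.
by move=> e' _; rewrite /enorm1 norm10.
Qed.

Lemma Cints_sum l (I : Type) (s : seq I) (F : I -> env -> C) e :
  (forall i, Cfin l (F i) e) ->
  Cints l (fun e => \sum_(i <- s) F i e) e = \sum_(i <- s) Cints l (F i) e /\
  Cfin l (fun e => \sum_(i <- s) F i e) e.
Proof.
move=> cF; elim: s => [|i s [ih1 ih2]].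
  under eq_fun do rewrite big_nil; rewrite big_nil Cints0; split => //.
  exact: Cfin_agree_zero.
under eq_fun do rewrite big_cons; rewrite big_cons -ih1; split.
  exact: (CintsD l (F i)).
exact: (CfinD l (F i)).
Qed.

(** The factor [c] is there for the induction: the factor belonging to the outermost variable is
    constant for the remaining integrals and is absorbed into it. *)
Lemma Nints_prod l (b : name -> R -> R) (K : name -> R) (c : env -> R) e :
  uniq l -> (forall e, 0 <= c e) -> measurable_fun setT c -> indep l c ->
  (forall i a, 0 <= b i a) -> (forall i, measurable_fun setT (b i)) ->
  (forall i, i \in l -> (\int[mu i]_a (b i a)%:E <= (K i)%:E)%E) ->
  (Nints l (fun e => (c e * \prod_(i <- l) b i (e i))%:E) e <= (c e * \prod_(i <- l) K i)%:E)%E.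
Proof.
move=> + c0 mc + b0 mb; have mbe i : measurable_fun setT (fun e : env => b i (e i)).
  exact: (measurableT_comp (mb i) (measurable_coord i)).
elim: l c e c0 mc => [|i l ih] c e c0 mc ul hc hK.
  by rewrite /= !big_nil.
move: ul => /= /andP[il ul].
have K0 j : j \in i :: l -> 0 <= K j.
  move=> jl; rewrite -lee_fin; apply: le_trans (hK _ jl).
  by apply: integral_ge0 => a _; rewrite lee_fin.
pose c' e := c e * b i (e i).
have nf : nnmeas (fun e => (c e * \prod_(j <- i :: l) b j (e j))%:E).
  split; last by move=> e'; rewrite lee_fin mulr_ge0// prodr_ge0.
  apply/measurable_EFinP; apply: measurable_funM => //.
  exact: measurable_prod.
apply: (@le_trans _ _ (\int[mu i]_a ((c e * \prod_(j <- l) K j)%:E * (b i a)%:E))%E).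
  apply: ge0_le_integral => //.
  - by move=> a _; exact: (nnmeas_Nints l _ nf).2.
  - by apply: nnmeas_upd; exact: nnmeas_Nints.
  - under eq_fun do rewrite -EFinM; apply/measurable_EFinP.
    by apply: measurable_funM; [exact: measurable_cst|exact: mb].
  - move=> a _; apply: le_trans (_ : _ <= (c' (upd e i a) * \prod_(j <- l) K j)%:E)%E _.
      rewrite (eq_Nints _ _ (fun e => (c' e * \prod_(j <- l) b j (e j))%:E)); last first.
        by move=> e' _; rewrite big_cons /c' mulrA.
      apply: ih => //.
      + by move=> e'; rewrite mulr_ge0.
      + exact: measurable_funM.
      + move=> e1 e2 h; rewrite /c' (indep_cons _ _ _ _ hc _ _ h) (h i)//.
      + by move=> j jl; apply: hK; rewrite inE jl orbT.
    by rewrite -EFinM lee_fin /c' (indep_upd i l) // upd_same; rewrite mulrAC.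
have cK0 : (0 <= (c e * \prod_(j <- l) K j)%:E)%E.
  rewrite lee_fin mulr_ge0// big_seq prodr_ge0// => j jl.
  by rewrite K0// inE jl orbT.
rewrite ge0_integralZl//.
- rewrite big_cons [K i * _]mulrC mulrA [leRHS]EFinM.
  by apply: lee_wpmul2l => //; apply: hK; rewrite mem_head.
- by apply/measurable_EFinP; exact: mb.
- by move=> a _; rewrite lee_fin.
Qed.
End IteratedIntegrals.

(** * Densities of charges and complex measures *)

Section ChargeDensity.
Context {R : realType}.
Local Notation C := R[i].
Local Notation Re := complex.Re.
Local Notation Im := complex.Im.
Local Notation B := (measurableTypeR R).
Implicit Type nu : {charge set B -> \bar R}.

Lemma jordan_sub nu (A : set B) : measurable A ->
  nu A = (jordan_pos (hahnP nu) A - jordan_neg (hahnP nu) A)%E.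
Proof. by move=> mA; rewrite (jordan_decomp (hahnP nu) mA) /cadd /= cscaleN1. Qed.

Lemma jordan_pos_hahn nu (A : set B) : measurable A ->
  jordan_pos (hahnP nu) A = nu (A `&` hahn_pos nu).
Proof.
by move=> mA; rewrite jordan_posE cjordan_posE /crestr0 mem_set.
Qed.

Lemma jordan_neg_hahn nu (A : set B) : measurable A ->
  jordan_neg (hahnP nu) A = (- nu (A `&` hahn_neg nu))%E.
Proof.
by move=> mA; rewrite jordan_negE cjordan_negE /crestr0 mem_set.
Qed.

Lemma integrable_le_measure (p q : {measure set B -> \bar R}) (f : B -> R) :
  (forall A, measurable A -> (p A <= q A)%E) ->
  q.-integrable setT (EFin \o f) -> p.-integrable setT (EFin \o f).
Proof.
move=> pq /integrableP[mf fy]; apply/integrableP; split => //.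
apply: le_lt_trans fy; apply: ge0_le_measure_integral => //.
exact: measurableT_comp.
Qed.

(** The Jordan parts are minimal: on the positive Hahn set [nu] is below [p], on the negative one
    [- nu] is below [q]. Moreover [jp + q] and [jn + p] are the same measure. Thus any decomposition
    computes [charge_integral], which is essential because the Hahn sets of a sum or a multiple are
    chosen independently of those of the given charges. *)
Lemma charge_integral_sub nu (p q : {measure set B -> \bar R}) (f : R -> R) :
  fin_num_fun p -> fin_num_fun q ->
  (forall A, measurable A -> nu A = (p A - q A)%E) ->
  p.-integrable setT (EFin \o f) -> q.-integrable setT (EFin \o f) ->
  [/\ charge_integral nu f = \int[p]_x f x - \int[q]_x f x,
   (jordan_pos (hahnP nu)).-integrable setT (EFin \o f) &
   (jordan_neg (hahnP nu)).-integrable setT (EFin \o f)].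
Proof.
move=> fp fq nupq ip iq; set jp := jordan_pos (hahnP nu); set jn := jordan_neg (hahnP nu).
have [[mP _] [mN _] _ _] := hahnP nu.
have jpp A : measurable A -> (jp A <= p A)%E.
  move=> mA; rewrite /jp jordan_pos_hahn// nupq; last exact: measurableI.
  apply: (@le_trans _ _ (p (A `&` hahn_pos nu))).
    by rewrite leeBlDr; [rewrite leeDl|apply: fq; exact: measurableI].
  by apply: le_measure; rewrite ?inE//; exact: measurableI.
have jnq A : measurable A -> (jn A <= q A)%E.
  move=> mA; rewrite /jn jordan_neg_hahn// nupq; last exact: measurableI.
  have fpA : p (A `&` hahn_neg nu) \is a fin_num by apply: fp; exact: measurableI.
  have fqA : q (A `&` hahn_neg nu) \is a fin_num by apply: fq; exact: measurableI.
  rewrite -(fineK fpA) -(fineK fqA) -EFinB -EFinN.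
  apply: (@le_trans _ _ (q (A `&` hahn_neg nu))).
    by rewrite -(fineK fqA) lee_fin opprB lerBlDr lerDl fine_ge0.
  by apply: le_measure; rewrite ?inE//; exact: measurableI.
have ijp := integrable_le_measure _ _ _ jpp ip.
have ijn := integrable_le_measure _ _ _ jnq iq.
have E : (\int[jp]_x (f x)%:E + \int[q]_x (f x)%:E =
          \int[jn]_x (f x)%:E + \int[p]_x (f x)%:E)%E.
  rewrite -(integral_measure_add measurableT ijp iq).
  rewrite -(integral_measure_add measurableT ijn ip).
  apply: eq_measure_integral => A mA _.
  transitivity (jp A + q A)%E; first exact: measure_addE.
  transitivity (jn A + p A)%E; last by apply/esym/measure_addE.
  have := nupq _ mA; rewrite (jordan_sub nu)//.
  rewrite -/jp -/jn -[jp A]fineK ?fin_num_measure// -[jn A]fineK ?fin_num_measure//.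
  rewrite -[p A]fineK ?fp// -[q A]fineK ?fq//.
  by move=> [] h; congr (_%:E); lra.
split => //; rewrite /charge_integral -/jp -/jn /Rintegral.
move: E; rewrite -[X in (X + _ = _)%E]fineK; last exact: integrable_fin_num ijp.
rewrite -[X in (_ + X = _)%E]fineK; last exact: integrable_fin_num iq.
rewrite -[X in (_ = X + _)%E]fineK; last exact: integrable_fin_num ijn.
rewrite -[X in (_ = _ + X)%E]fineK; last exact: integrable_fin_num ip.
by rewrite -!EFinD => -[]; lra.
Qed.

Lemma integral_mscaleE (k : {nonneg R}) (p : {measure set B -> \bar R}) (f : B -> R) :
  p.-integrable setT (EFin \o f) ->
  (mscale k p).-integrable setT (EFin \o f) /\
  \int[mscale k p]_x f x = k%:num * \int[p]_x f x.
Proof.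
move=> /[dup] ip /integrableP[mf fy].
have K h : measurable_fun setT h -> (forall x, (0 <= h x)%E) ->
    (\int[mscale k p]_x h x = k%:num%:E * \int[p]_x h x)%E.
  by move=> mh h0; rewrite ge0_integral_mscale.
have ik : (mscale k p).-integrable setT (EFin \o f).
  apply/integrableP; split => //; rewrite K//; last exact: measurableT_comp.
  by rewrite lte_mul_pinfty// lee_fin.
split => //; rewrite /Rintegral integralE [in RHS]integralE.
rewrite !K//; [|exact: measurable_funeneg|exact: measurable_funepos].
rewrite -muleBr//; last first.
  apply: fin_num_adde_defl; rewrite fin_numN.
  exact: (integrable_fin_num measurableT (integrable_funeneg measurableT ip)).
rewrite -integralE fineM//; exact: (integrable_fin_num measurableT ip).
Qed.

Lemma Rintegral_measure_add (p q : {measure set B -> \bar R}) (f : B -> R) :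
  p.-integrable setT (EFin \o f) -> q.-integrable setT (EFin \o f) ->
  (measure_add p q).-integrable setT (EFin \o f) /\
  \int[measure_add p q]_x f x = \int[p]_x f x + \int[q]_x f x.
Proof.
move=> ip iq; split; last first.
  rewrite /Rintegral integral_measure_add//.
  by rewrite (fineD (integrable_fin_num measurableT ip) (integrable_fin_num measurableT iq)).
move: ip iq => /integrableP[mf fy] /integrableP[_ gy]; apply/integrableP; split => //.
rewrite ge0_integral_measure_add//; first exact: lte_add_pinfty.
exact: measurableT_comp.
Qed.

Lemma charge_integral_cadd (n1 n2 : {charge set B -> \bar R}) (f : B -> R) :
  (jordan_pos (hahnP n1)).-integrable setT (EFin \o f) ->
  (jordan_neg (hahnP n1)).-integrable setT (EFin \o f) ->
  (jordan_pos (hahnP n2)).-integrable setT (EFin \o f) ->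
  (jordan_neg (hahnP n2)).-integrable setT (EFin \o f) ->
  charge_integral (cadd n1 n2) f = charge_integral n1 f + charge_integral n2 f.
Proof.
move=> i1 i2 i3 i4.
have [j1 e1] := Rintegral_measure_add _ _ _ i1 i3.
have [j2 e2] := Rintegral_measure_add _ _ _ i2 i4.
have addfin (p q : {finite_measure set B -> \bar R}) : fin_num_fun (measure_add p q).
  move=> A mA; have -> : measure_add p q A = (p A + q A)%E by exact: measure_addE.
  by rewrite fin_numD !fin_num_measure.
have [|||-> _ _] := charge_integral_sub (cadd n1 n2) _ _ f _ _ _ j1 j2.
- exact: addfin.
- exact: addfin.
- move=> A mA.
  transitivity ((jordan_pos (hahnP n1) A + jordan_pos (hahnP n2) A) -
     (jordan_neg (hahnP n1) A + jordan_neg (hahnP n2) A))%E; last first.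
    by congr (_ - _)%E; apply/esym; exact: measure_addE.
  have h1 := jordan_sub n1 _ mA; have h2 := jordan_sub n2 _ mA.
  transitivity (n1 A + n2 A)%E; [by []|rewrite h1 h2].
  have a1 : jordan_pos (hahnP n1) A \is a fin_num by rewrite fin_num_measure.
  have a2 : jordan_neg (hahnP n1) A \is a fin_num by rewrite fin_num_measure.
  have a3 : jordan_pos (hahnP n2) A \is a fin_num by rewrite fin_num_measure.
  have a4 : jordan_neg (hahnP n2) A \is a fin_num by rewrite fin_num_measure.
  rewrite -(fineK a1) -(fineK a2) -(fineK a3) -(fineK a4).
  by rewrite -?EFinD -?EFinB -?EFinD; congr (_%:E); ring.
- by rewrite e1 e2 /charge_integral; ring.
Qed.

Lemma charge_integral_cscale (a : R) nu (f : B -> R) :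
  (jordan_pos (hahnP nu)).-integrable setT (EFin \o f) ->
  (jordan_neg (hahnP nu)).-integrable setT (EFin \o f) ->
  [/\ charge_integral (cscale a nu) f = a * charge_integral nu f,
  (jordan_pos (hahnP (cscale a nu))).-integrable setT (EFin \o f) &
  (jordan_neg (hahnP (cscale a nu))).-integrable setT (EFin \o f)].
Proof.
move=> ip iq; pose k := NngNum (normr_ge0 a).
have [jp ep] := integral_mscaleE k _ _ ip.
have [jq eq] := integral_mscaleE k _ _ iq.
have scfin (p : {finite_measure set B -> \bar R}) : fin_num_fun (mscale k p).
  move=> A mA; have -> : mscale k p A = (`|a|%:E * p A)%E by [].
  by rewrite fin_numM// fin_num_measure.
have E A : measurable A -> cscale a nu A = (a%:E * (jordan_pos (hahnP nu) A - jordan_neg (hahnP nu) A))%E.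
  by move=> mA; rewrite /cscale (jordan_sub nu).
have a1 A : measurable A -> jordan_pos (hahnP nu) A \is a fin_num by move=> mA; rewrite fin_num_measure.
have a2 A : measurable A -> jordan_neg (hahnP nu) A \is a fin_num by move=> mA; rewrite fin_num_measure.
have [a0|a0] := leP 0 a.
  have [|||-> ? ?] := charge_integral_sub (cscale a nu) _ _ f _ _ _ jp jq.
  - exact: scfin.
  - exact: scfin.
  - move=> A mA; apply: (etrans (E A mA)).
    transitivity (`|a|%:E * jordan_pos (hahnP nu) A - `|a|%:E * jordan_neg (hahnP nu) A)%E; last by [].
    rewrite -(fineK (a1 _ mA)) -(fineK (a2 _ mA)) ger0_norm//.
    by rewrite -?EFinM -?EFinB -?EFinM; congr (_%:E); ring.
  - by split => //; rewrite ep eq /= ger0_norm// /charge_integral; ring.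
(* For negative [a] the two Jordan parts exchange their roles. *)
have [|||-> ? ?] := charge_integral_sub (cscale a nu) _ _ f _ _ _ jq jp.
- exact: scfin.
- exact: scfin.
- move=> A mA; apply: (etrans (E A mA)).
  transitivity (`|a|%:E * jordan_neg (hahnP nu) A - `|a|%:E * jordan_pos (hahnP nu) A)%E; last by [].
  rewrite -(fineK (a1 _ mA)) -(fineK (a2 _ mA)) ltr0_norm//.
  by rewrite -?EFinM -?EFinB -?EFinM; congr (_%:E); ring.
- by split => //; rewrite ep eq /= ltr0_norm// /charge_integral; ring.
Qed.

Lemma Re_normc (z : C) : Re `|z| = Num.sqrt (Re z ^+ 2 + Im z ^+ 2).
Proof. by rewrite normc_def. Qed.

(** A single partition suffices: [A] cut by [X], filled up with empty sets, and its first term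
    already dominates. Taking a Hahn set for [X] yields a bound on a Jordan part. *)
Lemma le_cm_variation (m : complex_measure R) (nu : {charge set B -> \bar R}) (A X : set B) :
  (forall A : set B, `|fine (nu A)| <= Re `|cm_val m A|) ->
  measurable A -> measurable X -> (`|nu (A `&` X)| <= cm_variation m A)%E.
Proof.
move=> num mA mX.
pose E n := if n is 0%N then A `&` X else if n is 1%N then A `\` X else set0.
have mE n : measurable (E n).
  by case: n => [|[|n]] /=; [exact: measurableI|exact: measurableD|exact: measurable0].
apply: (@le_trans _ _ (\sum_(0 <= i <oo) (Re `|cm_val m (E i)|)%:E)%E); last first.
  apply: ereal_sup_ubound; exists E => //; split => //.
  - apply/trivIsetP => -[|[|i]] [|[|j]] //= _ _ _; rewrite ?set0I ?setI0//.
      by apply/seteqP; split=> x //= -[[_ ?] [_ ?]].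
    by apply/seteqP; split=> x //= -[[_ ?] [_ ?]].
  - apply/seteqP; split => [x [[|[|n]] _ //=]|x Ax]; [by case|by case|].
    have [Xx|nXx] := pselect (X x); first by exists 0%N.
    by exists 1%N.
apply: (@le_trans _ _ (\sum_(0 <= i < 1) (Re `|cm_val m (E i)|)%:E)%E).
  rewrite big_nat1 /= -[nu _]fineK ?fin_num_measure//; last exact: measurableI.
  by rewrite abse_EFin lee_fin.
by apply: nneseries_lim_ge => n _ _; rewrite lee_fin Re_normc sqrtr_ge0.
Qed.

Lemma cm_val0 (m : complex_measure R) : cm_val m set0 = 0.
Proof. by rewrite /cm_val !charge0. Qed.

Lemma cm_variation0 (m : complex_measure R) : cm_variation m set0 = 0%E.
Proof.
apply/eqP; rewrite eq_le; apply/andP; split.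
  apply: ge_ereal_sup => _ [E [mE tE E0] <-].
  rewrite eseries0// => i _ _.
  have -> : E i = set0.
    by apply/seteqP; split => // x Ex; rewrite -E0; exists i.
  by rewrite cm_val0 normr0.
apply: ereal_sup_ubound; exists (fun=> set0).
  split => //; first by apply/trivIsetP => i j _ _ _; rewrite set0I.
  by apply/seteqP; split=> x //= -[].
rewrite eseries0// => i _ _.
by rewrite cm_val0 normr0.
Qed.

Import HBNNSimple.

(** As [cm_variation] is a bare set function, the comparison is made inside the definition of the
    integral, on simple functions. There it needs no more than the inequality on measurable sets and
    the value 0 at the empty set, which reduces [sintegral] to a sum over the range. *)
Lemma le_integral_cm_variation (m : complex_measure R) (p : {measure set B -> \bar R}) (f : B -> R) :
  (forall A : set B, measurable A -> (p A <= cm_variation m A)%E) ->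
  (forall x, 0 <= f x) ->
  (\int[p]_x (f x)%:E <= \int[cm_variation m]_x (f x)%:E)%E.
Proof.
move=> pm f0; rewrite ge0_integralTE; last by move=> x; rewrite lee_fin.
have sE (h : {nnsfun B >-> R}) : sintegral (cm_variation m) h =
    (\sum_(x \in range h) x%:E * cm_variation m (h @^-1` [set x]))%E.
  rewrite /sintegral (fsbig_widen (range h) setT)//= => x [_ Nfx] /=.
  by rewrite preimage10// cm_variation0 mule0.
rewrite /integral patch_setT.
have -> : ((fun x : B => (f x)%:E)^\- = cst 0)%E.
  apply/funext => x; rewrite funenegE; apply/max_idPr.
  by rewrite leeNl oppe0 lee_fin.
have -> : ((fun x : B => (f x)%:E)^\+ = (fun x => (f x)%:E))%E.
  apply/funext => x; rewrite funeposE -EFin_max; congr (_%:E).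
  by apply/max_idPl.
(* The negative part contributes 0: a nonnegative simple function below 0 vanishes identically. *)
rewrite (_ : ereal_sup [set sintegral (cm_variation m) h | h in
    [set h : {nnsfun B >-> R} | forall x, (_ <= cst 0%E x)%E]] = 0%E); last first.
  apply/eqP; rewrite eq_le; apply/andP; split.
    apply: ge_ereal_sup => _ [h /= h0 <-]; rewrite sE fsbig1// => x [a _ <-].
    have v : 0 <= h a by exact: fun_ge0.
    have -> : h a = 0 by apply/eqP; rewrite eq_le v andbT -lee_fin.
    exact: mul0e.
  apply: ereal_sup_ubound; exists nnsfun0; first by [].
  rewrite sE fsbig1// => x [a _ <-] /=; exact: mul0e.
rewrite sube0; apply: ge_ereal_sup => _ [h hf <-].
apply: le_ereal_sup_tmp; exists (sintegral (cm_variation m) h); first by exists h.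
rewrite sE sintegralE; apply: lee_fsum => // x [a _ <-].
by apply: lee_wpmul2l; [rewrite lee_fin; exact: fun_ge0|exact: pm].
Qed.

Section Parts.
Variable m : complex_measure R.
Local Notation p1 := (jordan_pos (hahnP (re_charge m))).
Local Notation n1 := (jordan_neg (hahnP (re_charge m))).
Local Notation p2 := (jordan_pos (hahnP (im_charge m))).
Local Notation n2 := (jordan_neg (hahnP (im_charge m))).

Lemma le_jordan_cm_variation (A : set B) : measurable A ->
  [/\ (p1 A <= cm_variation m A)%E, (n1 A <= cm_variation m A)%E,
      (p2 A <= cm_variation m A)%E & (n2 A <= cm_variation m A)%E].
Proof.
move=> mA.
have Hre (A' : set B) : `|fine (re_charge m A')| <= Re `|cm_val m A'|.
  by rewrite Re_normc /cm_val -sqrtr_sqr ler_wsqrtr//= lerDl sqr_ge0.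
have Him (A' : set B) : `|fine (im_charge m A')| <= Re `|cm_val m A'|.
  by rewrite Re_normc /cm_val -sqrtr_sqr ler_wsqrtr//= lerDr sqr_ge0.
have H1 nu : (forall A' : set B, `|fine (nu A')| <= Re `|cm_val m A'|) ->
    (jordan_pos (hahnP nu) A <= cm_variation m A)%E.
  move=> h; have [[mP _] _ _ _] := hahnP nu; rewrite jordan_pos_hahn//.
  by apply: le_trans (le_cm_variation _ _ _ _ h mA mP); exact: lee_abs.
have H2 nu : (forall A' : set B, `|fine (nu A')| <= Re `|cm_val m A'|) ->
    (jordan_neg (hahnP nu) A <= cm_variation m A)%E.
  move=> h; have [_ [mN _] _ _] := hahnP nu; rewrite jordan_neg_hahn//.
  by apply: le_trans (le_cm_variation _ _ _ _ h mA mN); rewrite -abseN; exact: lee_abs.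
by split; [exact: H1|exact: H2|exact: H1|exact: H2].
Qed.

(** It replaces $|m|$ as reference measure: it is a finite measure by construction, and all four
    Jordan parts are absolutely continuous with respect to it. *)
Definition cm_base : set B -> \bar R := measure_add (measure_add p1 n1) (measure_add p2 n2).
HB.instance Definition _ := Measure.on cm_base.

Lemma cm_baseE A : cm_base A = (p1 A + n1 A + (p2 A + n2 A))%E.
Proof.
transitivity (measure_add p1 n1 A + measure_add p2 n2 A)%E; first exact: measure_addE.
by congr (_ + _)%E; exact: measure_addE.
Qed.

Lemma cm_base_fin : fin_num_fun cm_base.
Proof. by move=> A mA; rewrite cm_baseE !fin_numD !fin_num_measure. Qed.
HB.instance Definition _ := @Measure_isFinite.Build _ _ _ cm_base cm_base_fin.

Lemma cm_base0 (A : set B) : measurable A -> cm_base A = 0%E ->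
  [/\ p1 A = 0%E, n1 A = 0%E, p2 A = 0%E & n2 A = 0%E].
Proof.
move=> mA; rewrite cm_baseE => /eqP.
by rewrite !padde_eq0 ?adde_ge0// => /andP[/andP[/eqP ? /eqP ?] /andP[/eqP ? /eqP ?]].
Qed.

Definition rn (p : {finite_measure set B -> \bar R}) (x : B) : R :=
  fine (Radon_Nikodym_SigmaFinite.f p cm_base x).

Definition cm_density (x : B) : C :=
  (rn p1 x - rn n1 x) +i* (rn p2 x - rn n2 x).
(** A majorant of the density, preferred to its norm because an integral against it splits exactly
    into the integrals against the four Jordan parts. *)
Definition cm_weight (x : B) : R := rn p1 x + rn n1 x + (rn p2 x + rn n2 x).

Section OnePart.
Variable p : {finite_measure set B -> \bar R}.
Hypothesis ppi : p `<< cm_base.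

Lemma rn_ge0 x : 0 <= rn p x.
Proof. by apply: fine_ge0; exact: Radon_Nikodym_SigmaFinite.f_ge0. Qed.

Lemma EFin_rn x : (rn p x)%:E = Radon_Nikodym_SigmaFinite.f p cm_base x.
Proof. by rewrite fineK//; exact: Radon_Nikodym_SigmaFinite.f_fin_num. Qed.

Lemma measurable_rn : measurable_fun setT (rn p : B -> R).
Proof.
apply/measurable_EFinP.
rewrite (_ : _ \o _ = Radon_Nikodym_SigmaFinite.f p cm_base); last first.
  by apply/funext => x; exact: EFin_rn.
by have /measurable_int := Radon_Nikodym_SigmaFinite.f_integrable ppi.
Qed.

Lemma ge0_integral_rn (f : B -> R) : measurable_fun setT f -> (forall x, 0 <= f x) ->
  (\int[cm_base]_x (f x * rn p x)%:E = \int[p]_x (f x)%:E)%E.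
Proof.
move=> mf f0; under eq_integral do rewrite EFinM EFin_rn.
apply: Radon_Nikodym_SigmaFinite.change_of_variables => //.
exact/measurable_EFinP.
Qed.

Lemma integrable_rn (f : B -> R) : measurable_fun setT f ->
  (\int[cm_base]_x (`|f x| * rn p x)%:E < +oo)%E ->
  [/\ p.-integrable setT (EFin \o f),
   cm_base.-integrable setT (EFin \o (fun x => f x * rn p x)) &
   \int[cm_base]_x (f x * rn p x) = \int[p]_x f x].
Proof.
move=> mf; have mr := measurable_rn => fy.
have i1 : p.-integrable setT (EFin \o f).
  apply/integrableP; split; first exact/measurable_EFinP.
  by rewrite -(ge0_integral_rn (fun x => `|f x|))//; exact: measurableT_comp.
split => //.
  apply/integrableP; split; first by apply/measurable_EFinP; exact: measurable_funM.
  by under eq_integral do rewrite /= normrM (ger0_norm (rn_ge0 _)).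
rewrite /Rintegral -(Radon_Nikodym_change_of_variables ppi measurableT i1).
congr fine; apply: ae_eq_integral => //.
- by apply/measurable_EFinP; exact: measurable_funM.
- apply: emeasurable_funM; first exact/measurable_EFinP.
  by apply: measurable_int; apply: Radon_Nikodym_integrable.
- have := ae_eq_Radon_Nikodym_SigmaFinite ppi measurableT.
  by apply: filterS => x /= /(_ Logic.I) <- _; rewrite -EFin_rn.
Qed.
End OnePart.

Lemma jordan_dominated : [/\ p1 `<< cm_base, n1 `<< cm_base, p2 `<< cm_base & n2 `<< cm_base].
Proof.
by split; apply/null_content_dominatesP => A mA /(cm_base0 _ mA)[].
Qed.

Lemma cm_weight_ge0 x : 0 <= cm_weight x.
Proof. by have [? ? ? ?] := jordan_dominated; rewrite /cm_weight !addr_ge0// rn_ge0. Qed.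

Lemma measurable_cm_weight : measurable_fun setT (cm_weight : B -> R).
Proof.
have [? ? ? ?] := jordan_dominated.
by apply: measurable_funD; apply: measurable_funD; exact: measurable_rn.
Qed.

Lemma cmeas_cm_density : cmeas (cm_density : B -> C).
Proof.
have [? ? ? ?] := jordan_dominated.
by split => /=; apply: measurable_funB; exact: measurable_rn.
Qed.

Lemma norm1_cm_density x : norm1 (cm_density x) <= cm_weight x.
Proof.
have [d1 d2 d3 d4] := jordan_dominated; rewrite /norm1 /cm_density /cm_weight /=.
have := ler_normB (rn p1 x) (rn n1 x); have := ler_normB (rn p2 x) (rn n2 x).
by rewrite !(ger0_norm (rn_ge0 _ _ _))//; lra.
Qed.

Lemma integral_cm_weight (f : B -> R) : measurable_fun setT f -> (forall x, 0 <= f x) ->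
  (\int[cm_base]_x (f x * cm_weight x)%:E = \int[p1]_x (f x)%:E + \int[n1]_x (f x)%:E +
     (\int[p2]_x (f x)%:E + \int[n2]_x (f x)%:E))%E.
Proof.
move=> mf f0; have [d1 d2 d3 d4] := jordan_dominated.
rewrite -(ge0_integral_rn _ d1 _ mf f0) -(ge0_integral_rn _ d2 _ mf f0).
rewrite -(ge0_integral_rn _ d3 _ mf f0) -(ge0_integral_rn _ d4 _ mf f0).
have mm (p : {finite_measure set B -> \bar R}) : p `<< cm_base -> measurable_fun setT (fun x : B => (f x * rn p x)%:E).
  by move=> dp; apply/measurable_EFinP; apply: measurable_funM => //; exact: measurable_rn.
have pos (p : {finite_measure set B -> \bar R}) : p `<< cm_base -> forall x : B, setT x -> (0 <= (f x * rn p x)%:E)%E.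
  by move=> dp x _; rewrite lee_fin mulr_ge0// rn_ge0.
rewrite -ge0_integralD//; try (by [exact: mm|exact: pos]).
rewrite -ge0_integralD//; try (by [exact: mm|exact: pos]).
rewrite -ge0_integralD//.
- by apply: eq_integral => x _; rewrite -!EFinD /cm_weight !mulrDr.
- by move=> x _; apply: adde_ge0; exact: pos.
- by apply: emeasurable_funD; exact: mm.
- by move=> x _; apply: adde_ge0; exact: pos.
- by apply: emeasurable_funD; exact: mm.
Qed.

(** One integrability condition, against [cm_weight], covers the eight real integrals that occur, of
    the two components of [f] against the four Jordan parts. The scaled measure is integrated
    through the same parts, so [g] becomes a mere factor. *)
Lemma cm_integral_scale (g : C) (f : B -> C) : cmeas f ->
  (\int[cm_base]_x (norm1 (f x) * cm_weight x)%:E < +oo)%E ->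
  cm_integral (cm_scale g m) f = g * cint cm_base (fun x => f x * cm_density x) /\
  cm_integral m f = cint cm_base (fun x => f x * cm_density x).
Proof.
move=> [mf1 mf2] fy; have [d1 d2 d3 d4] := jordan_dominated.
have mw := measurable_cm_weight.
have mn := measurable_norm1 _ (conj mf1 mf2).
have small (p : {finite_measure set B -> \bar R}) (h : B -> R) : p `<< cm_base ->
    (forall x, rn p x <= cm_weight x) -> measurable_fun setT h ->
    (forall x, `|h x| <= norm1 (f x)) ->
    [/\ p.-integrable setT (EFin \o h),
     cm_base.-integrable setT (EFin \o (fun x => h x * rn p x)) &
     \int[cm_base]_x (h x * rn p x) = \int[p]_x h x].
  move=> dp pw mh hf; apply: integrable_rn => //.
  apply: le_lt_trans fy; apply: ge0_le_integral => //.
  - by move=> x _; rewrite lee_fin mulr_ge0// rn_ge0.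
  - apply/measurable_EFinP; apply: measurable_funM; first exact: measurableT_comp.
    exact: measurable_rn.
  - by apply/measurable_EFinP; exact: measurable_funM.
  - by move=> x _; rewrite lee_fin ler_pM// rn_ge0.
have w1 x : rn p1 x <= cm_weight x.
  by rewrite /cm_weight -addrA lerDl !addr_ge0// rn_ge0.
have w2 x : rn n1 x <= cm_weight x.
  by rewrite /cm_weight addrAC lerDr !addr_ge0// rn_ge0.
have w3 x : rn p2 x <= cm_weight x.
  by rewrite /cm_weight addrCA lerDl !addr_ge0// rn_ge0.
have w4 x : rn n2 x <= cm_weight x.
  by rewrite /cm_weight addrA lerDr !addr_ge0// rn_ge0.
have f1 x : `|Re (f x)| <= norm1 (f x) by exact: Re_le_norm1.
have f2 x : `|Im (f x)| <= norm1 (f x) by exact: Im_le_norm1.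
have [a1 b1 c1] := small _ _ d1 w1 mf1 f1.
have [a2 b2 c2] := small _ _ d2 w2 mf1 f1.
have [a3 b3 c3] := small _ _ d3 w3 mf1 f1.
have [a4 b4 c4] := small _ _ d4 w4 mf1 f1.
have [a5 b5 c5] := small _ _ d1 w1 mf2 f2.
have [a6 b6 c6] := small _ _ d2 w2 mf2 f2.
have [a7 b7 c7] := small _ _ d3 w3 mf2 f2.
have [a8 b8 c8] := small _ _ d4 w4 mf2 f2.
have E : cm_integral m f = cint cm_base (fun x => f x * cm_density x).
  rewrite /cm_integral /charge_integral -c1 -c2 -c3 -c4 -c5 -c6 -c7 -c8.
  have i1 := integrableB measurableT b1 b2.
  have i2 := integrableB measurableT b7 b8.
  have i3 := integrableB measurableT b3 b4.
  have i4 := integrableB measurableT b5 b6.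
  rewrite [RHS]/cint /cintegral; congr (_ +i* _); rewrite -!RintegralB// -?RintegralD//.
    by apply: eq_Rintegral => x _; rewrite ReM /cm_density /=; ring.
  by apply: eq_Rintegral => x _; rewrite ImM /cm_density /=; ring.
split; last exact: E.
rewrite -E /cm_integral /cm_scale /=.
have ci (a b : R) n1 n2 (h : B -> R) :
  (jordan_pos (hahnP n1)).-integrable setT (EFin \o h) ->
  (jordan_neg (hahnP n1)).-integrable setT (EFin \o h) ->
  (jordan_pos (hahnP n2)).-integrable setT (EFin \o h) ->
  (jordan_neg (hahnP n2)).-integrable setT (EFin \o h) ->
  charge_integral (cadd (cscale a n1) (cscale b n2)) h =
    a * charge_integral n1 h + b * charge_integral n2 h.
  move=> h1 h2 h3 h4.
  have [e1 ? ?] := charge_integral_cscale a _ _ h1 h2.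
  have [e2 ? ?] := charge_integral_cscale b _ _ h3 h4.
  by rewrite charge_integral_cadd// e1 e2.
by apply: eqC; rewrite ?ReM ?ImM /= !ci//; ring.
Qed.

End Parts.
End ChargeDensity.

(** * Complex measures as densities against positive measures *)

Section Representation.
Context {R : realType}.
Local Notation C := R[i].
Local Notation B := (measurableTypeR R).

(** The interface through which all later estimates see a complex measure: a density [h], and a
    majorant [w] whose integrals are under control. The scaled measures are included, since they
    produce the powers of the coupling constant. *)
Definition represents (m : complex_measure R) (mu : {sigma_finite_measure set B -> \bar R})
    (h : B -> C) (w : B -> R) :=
  [/\ cmeas h, measurable_fun setT w, forall x, norm1 (h x) <= w x &
   forall (g : C) (f : B -> C), cmeas f ->
     (\int[mu]_x (norm1 (f x) * w x)%:E < +oo)%E ->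
     cm_integral (cm_scale g m) f = g * cint mu (fun x => f x * h x) /\
     cm_integral m f = cint mu (fun x => f x * h x)].

Lemma represents_K1 (m1 : complex_measure R) V1 : in_K1 m1 V1 ->
  exists (mu : {sigma_finite_measure set B -> \bar R}) h w, represents m1 mu h w /\
    forall c, (\int[mu]_x (expR (c * `|x|) * w x)%:E < +oo)%E.
Proof.
move=> [hm1 _]; exists (cm_base m1), (cm_density m1), (cm_weight m1); split.
  split; [exact: cmeas_cm_density|exact: measurable_cm_weight|exact: norm1_cm_density|].
  exact: cm_integral_scale.
move=> c.
have me (k : R) : measurable_fun setT (fun x : B => expR (k * `|x|)).
  by apply: (measurableT_comp (@measurable_expR R)); apply: measurable_funM.
(* Exponential moments are assumed for positive exponents only, and they increase with the
   exponent. *)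
have [k k0 ck] : exists2 k : R, 0 < k & c <= k.
  exists (Num.max 1 c); first by rewrite lt_max ltr01.
  by rewrite le_max lexx orbT.
apply: (@le_lt_trans _ _ (\int[cm_base m1]_x (expR (k * `|x|) * cm_weight m1 x)%:E)%E).
  apply: ge0_le_integral => //.
  - by move=> x _; rewrite lee_fin mulr_ge0 ?expR_ge0// cm_weight_ge0.
  - by apply/measurable_EFinP; apply: measurable_funM => //; exact: measurable_cm_weight.
  - by apply/measurable_EFinP; apply: measurable_funM => //; exact: measurable_cm_weight.
  - move=> x _; rewrite lee_fin ler_wpM2r ?cm_weight_ge0//.
    by rewrite ler_expR ler_wpM2r.
rewrite integral_cm_weight//.
have := hm1 _ k0 => hk.
have le (p : {measure set B -> \bar R}) : (forall A : set B, measurable A -> (p A <= cm_variation m1 A)%E) ->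
   (\int[p]_x (expR (k * `|x|))%:E < +oo)%E.
  by move=> pm; apply: le_lt_trans hk; apply: le_integral_cm_variation.
by apply: lte_add_pinfty; apply: lte_add_pinfty; apply: le => A /(le_jordan_cm_variation m1)[].
Qed.

(** A Lindelof argument: a point outside the support lies in an interval with rational ends and
    variation 0. There are countably many such intervals, so their union is null, and it contains
    everything beyond a bound for the support. *)
Lemma charge_support_null (nu : {charge set B -> \bar R}) : bounded_set (charge_support nu) ->
  exists2 D : R, 0 < D & charge_variation (hahnP nu) [set x : R | D < `|x|] = 0%E.
Proof.
rewrite /bounded_set /bounded_near => /pinfty_ex_gt0[D D0 hD]; exists D => //.
pose var : {measure set B -> \bar R} := charge_variation (hahnP nu).
pose U n : set B := if unpickle n is Some pq then
  let I := `](ratr pq.1 : R), (ratr pq.2 : R)[%classic in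
  if var I == 0%E then I else set0 else set0.
have mU n : measurable (U n).
  rewrite /U; case: unpickle => [pq|]; last exact: measurable0.
  by case: ifP => _ //; exact: measurable_itv.
have nU n : var.-negligible (U n).
  exists (U n); split => //; rewrite /U; case: unpickle => [pq|]; last exact: charge0.
  by case: ifPn => [/eqP//|_]; exact: charge0.
have sub : ([set x : B | D < `|x|] : set B) `<=` \bigcup_n U n.
  move=> x /= xD.
  have : ~ charge_support nu x.
    by move=> /hD; apply/negP; rewrite -ltNge.
  rewrite /charge_support /= => /existsNP[V] /not_implyP[oV] /not_implyP[Vx] /contrapT V0.
  have [e /= e0 eV] := (nbhs_ballP _ _).1 (open_nbhs_nbhs (conj oV Vx)).
  have xe1 : x - e < x by rewrite ltrBlDr ltrDl.
  have xe2 : x < x + e by rewrite ltrDl.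
  have [p /itvP px] := rat_in_itvoo xe1.
  have [q /itvP qx] := rat_in_itvoo xe2.
  have IV : `](ratr p : R), (ratr q : R)[%classic `<=` V.
    move=> z /=; rewrite in_itv /= => /andP[pz zq]; apply: eV.
    rewrite /ball /= ltr_distlC.
    by rewrite (lt_trans _ pz) ?px// (lt_trans zq) ?qx.
  have UE : U (pickle (p, q)) = if var `](ratr p : R), (ratr q : R)[%classic == 0%E
      then `](ratr p : R), (ratr q : R)[%classic else set0.
    by rewrite /U pickleK.
  exists (pickle (p, q)); first by [].
  rewrite UE ifT; first by rewrite /= in_itv /= px qx.
  apply/eqP/le_anti/andP; split; last exact: measure_ge0.
  rewrite -V0; apply: le_measure => //; rewrite inE //=.
  exact: open_measurable.
have mE : measurable [set x : B | D < `|x|].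
  rewrite (_ : [set x : B | D < `|x|] = ~` `[-D, D]%classic).
    by apply: measurableC; exact: measurable_itv.
  apply/seteqP; split => x /=; rewrite in_itv /= -ler_norml ltNge => /negP//.
apply: (@measure_negligible _ _ _ var _ mE).
by apply: (negligibleS sub); exact: negligible_bigcup.
Qed.

(** Density and weight are multiplied by the indicator of $[-D,D]$. Almost nothing changes, but the
    weight now vanishes at every point outside, so the positions of the nodes can be bounded
    pointwise. *)
Lemma represents_K2 (m2 : {charge set B -> \bar R}) : in_K2 m2 ->
  exists (mu : {sigma_finite_measure set B -> \bar R}) h w (D : R),
  [/\ represents (cm_of_charge m2) mu h w, 0 < D,
    (forall x, D < `|x| -> w x = 0) & (\int[mu]_x (w x)%:E < +oo)%E].
Proof.
move=> /charge_support_null[D D0 vD].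
pose m := cm_of_charge m2; pose mu := cm_base m.
pose E : set B := [set x : B | `|x| <= D].
have mE : measurable E.
  rewrite (_ : E = `[-D, D]%classic); first exact: measurable_itv.
  by apply/seteqP; split => x; rewrite /E /= in_itv /= ler_norml.
pose ind (x : B) : R := \1_E x.
have mi : measurable_fun setT ind by exact: measurable_indic.
have ind0 x : 0 <= ind x by rewrite /ind indicE.
have ind1 x : ind x <= 1 by rewrite /ind indicE; case: (x \in E).
have aeE : {ae mu, forall x, ind x = 1}.
  exists (~` E); split; first exact: measurableC.
    have EC : ~` E = [set x : R | D < `|x|].
      by apply/seteqP; split => x /=; rewrite /E /= ltNge => /negP.
    have mEC : measurable (~` E) by exact: measurableC.
    rewrite /mu cm_baseE /=.
    have z A : measurable A -> jordan_pos (hahnP (@czero _ B R)) A = 0%E.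
      by move=> mA; rewrite jordan_pos_hahn.
    have z' A : measurable A -> jordan_neg (hahnP (@czero _ B R)) A = 0%E.
      by move=> mA; rewrite jordan_neg_hahn// /czero oppe0.
    rewrite (z _ mEC) (z' _ mEC) !adde0; move: vD; rewrite -EC.
    by rewrite /charge_variation.
  by move=> x /= hx Ex; apply: hx; rewrite /ind indicE mem_set.
exists mu, (fun x => (ind x)%:C * cm_density m x), (fun x => ind x * cm_weight m x), D.
have mw := measurable_cm_weight m.
have fin : (\int[mu]_x (cm_weight m x)%:E < +oo)%E.
  rewrite (eq_integral (fun x => (1 * cm_weight m x)%:E)); last by move=> x _; rewrite mul1r.
  rewrite (integral_cm_weight m (fun=> 1))//.
  have one (p : {finite_measure set B -> \bar R}) : (\int[p]_x (1%R : R)%:E < +oo)%E.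
    have -> : (\int[p]_x (1%R : R)%:E = 1%:E * p setT)%E by exact: (integral_cst p measurableT 1%:E).
    by rewrite mul1e -ge0_fin_numE// fin_num_measure.
  by apply: lte_add_pinfty; apply: lte_add_pinfty; exact: one.
split => //.
- split.
  + by apply: cmeasM; [exact: cmeasR|exact: cmeas_cm_density].
  + exact: measurable_funM.
  + move=> x; rewrite norm1RM ger0_norm// ler_wpM2l//; exact: norm1_cm_density.
  + move=> g f mf fy.
    have fy' : (\int[mu]_x (norm1 (f x) * cm_weight m x)%:E < +oo)%E.
      rewrite (ae_eq_integral (fun x => (norm1 (f x) * (ind x * cm_weight m x))%:E))//.
      * apply/measurable_EFinP; apply: measurable_funM => //; exact: measurable_norm1.
      * apply/measurable_EFinP; apply: measurable_funM; first exact: measurable_norm1.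
        exact: measurable_funM.
      * by apply: filterS aeE => x /= -> _; rewrite mul1r.
    have [-> ->] := cm_integral_scale m g _ mf fy'.
    have <- : cint mu (fun x => f x * cm_density m x) =
        cint mu (fun x => f x * ((ind x)%:C * cm_density m x)).
      apply: ae_cint.
      * by apply: cmeasM => //; exact: cmeas_cm_density.
      * apply: cmeasM => //; apply: cmeasM; [exact: cmeasR|exact: cmeas_cm_density].
      * by apply: filterS aeE => x /= ->; rewrite mul1r.
    by [].
- move=> x xD; rewrite /ind indicE memNset ?mul0r// /E /=.
  by apply/negP; rewrite -ltNge.
- apply: le_lt_trans fin; apply: ge0_le_integral => //.
  + by move=> x _; rewrite lee_fin mulr_ge0// cm_weight_ge0.
  + by apply/measurable_EFinP; exact: measurable_funM.
  + exact/measurable_EFinP.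
  + by move=> x _; rewrite lee_fin ler_piMl// cm_weight_ge0.
Qed.
End Representation.

(** * Fresnel integrals *)

Section RealCalculus.
Context {R : realType}.
Local Notation leb := (@lebesgue_measure R).

Lemma derC (c x : R) : is_derive x (1 : R) (fun=> c) 0.
Proof. exact: is_derive_cst. Qed.
Lemma derI (x : R) : is_derive x (1 : R) (fun x => x) 1.
Proof. exact: is_derive_id. Qed.
Lemma derD (f g : R -> R) (x a b : R) : is_derive x (1 : R) f a ->
  is_derive x (1 : R) g b -> is_derive x (1 : R) (fun x => f x + g x) (a + b).
Proof. by move=> df dg; exact: is_deriveD. Qed.
Lemma derN (f : R -> R) (x a : R) : is_derive x (1 : R) f a ->
  is_derive x (1 : R) (fun x => - f x) (- a).
Proof. by move=> df; exact: is_deriveN. Qed.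
Lemma derM (f g : R -> R) (x a b : R) : is_derive x (1 : R) f a ->
  is_derive x (1 : R) g b -> is_derive x (1 : R) (fun x => f x * g x) (a * g x + f x * b).
Proof.
move=> df dg; apply: (@is_derive_eq _ _ _ _ _ _ _ _ (is_deriveM df dg)).
by rewrite /GRing.scale /= addrC mulrC.
Qed.
Lemma derV (f : R -> R) (x a : R) : f x != 0 -> is_derive x (1 : R) f a ->
  is_derive x (1 : R) (fun x => (f x)^-1) (- a / f x ^+ 2).
Proof.
move=> f0 df; apply: (@is_derive_eq _ _ _ _ _ _ _ _ (is_deriveV f0 df)).
by rewrite /GRing.scale /= mulNr [RHS]mulNr mulrC.
Qed.
Lemma derX2 (f : R -> R) (x a : R) : is_derive x (1 : R) f a ->
  is_derive x (1 : R) (fun x => f x ^+ 2) (2 * f x * a).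
Proof.
by move=> df; apply: (@is_derive_eq _ _ _ _ _ _ _ _ (derM _ _ _ _ _ df df)); ring.
Qed.
Lemma der_comp (f g : R -> R) (x a b : R) : is_derive (g x) (1 : R) f a ->
  is_derive x (1 : R) g b -> is_derive x (1 : R) (fun x => f (g x)) (a * b).
Proof.
move=> df dg; apply: (@is_derive_eq _ _ _ _ _ _ _ _ (is_derive1_comp df dg)).
by rewrite mulrC.
Qed.
Lemma der_exp (f : R -> R) (x a : R) : is_derive x (1 : R) f a ->
  is_derive x (1 : R) (fun x => expR (f x)) (expR (f x) * a).
Proof. by move=> df; apply: der_comp df; exact: is_derive_expR. Qed.
Lemma der_cos (f : R -> R) (x a : R) : is_derive x (1 : R) f a ->
  is_derive x (1 : R) (fun x => cos (f x)) (- sin (f x) * a).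
Proof. by move=> df; apply: der_comp df; exact: is_derive_cos. Qed.
Lemma der_sin (f : R -> R) (x a : R) : is_derive x (1 : R) f a ->
  is_derive x (1 : R) (fun x => sin (f x)) (cos (f x) * a).
Proof. by move=> df; apply: der_comp df; exact: is_derive_sin. Qed.
Lemma der_eq (f : R -> R) (x a b : R) : is_derive x (1 : R) f a -> a = b ->
  is_derive x (1 : R) f b.
Proof. by move=> df <-. Qed.
Lemma der_continuous (f : R -> R) (x a : R) : is_derive x (1 : R) f a ->
  {for x, continuous f}.
Proof.
by move=> /@ex_derive df; apply/differentiable_continuous/derivable1_diffP.
Qed.

Lemma ftc_within (F g : R -> R) (a b : R) : a <= b -> {within `[a, b], continuous g} ->
  (forall x : R, a < x < b -> is_derive x (1 : R) F (g x)) ->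
  {within `[a, b], continuous F} ->
  \int[leb]_(x in `[a, b]) g x = F b - F a.
Proof.
rewrite le_eqVlt => /predU1P[<- _ _ _|ab cg dF cF].
  by rewrite set_itv1 Rintegral_set1 subrr.
rewrite /Rintegral (@continuous_FTC2 _ g F)//.
- have [cF1 cFa cFb] := (continuous_within_itvP F ab).1 cF.
  split => // x /[!in_itv]/= xab.
  by have /@ex_derive := dF x xab.
- move=> x /[!in_itv]/= xab; rewrite derive1E.
  by have /@derive_val := dF x xab.
Qed.

Lemma ftc (F g : R -> R) (a b : R) : a <= b -> continuous g ->
  (forall x : R, a < x < b -> is_derive x (1 : R) F (g x)) ->
  {within `[a, b], continuous F} ->
  \int[leb]_(x in `[a, b]) g x = F b - F a.
Proof. by move=> ab cg; apply: ftc_within => //; exact: continuous_subspaceT. Qed.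

Lemma is_derive_continuous (F g : R -> R) : (forall x : R, is_derive x (1 : R) F (g x)) ->
  continuous F.
Proof. by move=> dF x; exact: der_continuous (dF x). Qed.

Lemma ftcT (F g : R -> R) (a b : R) : a <= b -> continuous g ->
  (forall x : R, is_derive x (1 : R) F (g x)) ->
  \int[leb]_(x in `[a, b]) g x = F b - F a.
Proof.
move=> ab cg dF; apply: ftc => //; apply: continuous_subspaceT.
exact: is_derive_continuous dF.
Qed.

Lemma continuous_itv_integrable (g : R -> R) (a b : R) : continuous g ->
  leb.-integrable `[a, b] (EFin \o g).
Proof.
move=> cg; apply: continuous_compact_integrable; first exact: segment_compact.
exact: continuous_subspaceT.
Qed.

Lemma continuous_primitive (g : R -> R) (x : R) : continuous g -> 0 < x ->
  is_derive x (1 : R) (fun x => \int[leb]_(t in `[0, x]) g t) (g x).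
Proof.
move=> cg x0.
have xlt : x < x + 1 by rewrite ltrDl.
have [|h1 h2] := @continuous_FTC1 R g (BLeft 0) x (x + 1) xlt
  (continuous_itv_integrable _ _ _ cg) _ (cg x).
  by rewrite /= lte_fin.
by split; [exact: h1|rewrite -derive1E; exact: h2].
Qed.
End RealCalculus.

Section Fresnel.
Context {R : realType}.
Local Notation leb := (@lebesgue_measure R).

Definition fcos (x : R) := cos (x ^+ 2 / 2).
Definition fsin (x : R) := sin (x ^+ 2 / 2).
Definition Fcos (x : R) := \int[leb]_(t in `[0, x]) fcos t.
Definition Fsin (x : R) := \int[leb]_(t in `[0, x]) fsin t.

Lemma der_sqr2 (x : R) : is_derive x (1 : R) (fun x => x ^+ 2 / 2) x.
Proof.
by apply: der_eq (derM _ _ _ _ _ (derX2 _ _ _ (derI x)) (derC 2^-1 x)) _; field.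
Qed.
Lemma is_derive_fcos (x : R) : is_derive x (1 : R) fcos (- x * fsin x).
Proof. by apply: der_eq (der_cos _ _ _ (der_sqr2 x)) _; rewrite /fsin; ring. Qed.
Lemma is_derive_fsin (x : R) : is_derive x (1 : R) fsin (x * fcos x).
Proof. by apply: der_eq (der_sin _ _ _ (der_sqr2 x)) _; rewrite /fcos; ring. Qed.
Lemma continuous_fcos : continuous fcos.
Proof. exact: is_derive_continuous is_derive_fcos. Qed.
Lemma continuous_fsin : continuous fsin.
Proof. exact: is_derive_continuous is_derive_fsin. Qed.

Lemma is_derive_Fcos (x : R) : 0 < x -> is_derive x (1 : R) Fcos (fcos x).
Proof. exact: continuous_primitive continuous_fcos. Qed.
Lemma is_derive_Fsin (x : R) : 0 < x -> is_derive x (1 : R) Fsin (fsin x).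
Proof. exact: continuous_primitive continuous_fsin. Qed.

Lemma Fcos0 : Fcos 0 = 0. Proof. by rewrite /Fcos set_itv1 Rintegral_set1. Qed.
Lemma Fsin0 : Fsin 0 = 0. Proof. by rewrite /Fsin set_itv1 Rintegral_set1. Qed.

Lemma within_Fcos a : {within `[0, a], continuous Fcos}.
Proof.
have [a0|a0] := leP 0 a; last first.
  by rewrite set_itv_ge ?bnd_simp -?ltNge//; exact: continuous_subspace0.
by apply: parameterized_integral_continuous => //; exact: continuous_itv_integrable continuous_fcos.
Qed.
Lemma within_Fsin a : {within `[0, a], continuous Fsin}.
Proof.
have [a0|a0] := leP 0 a; last first.
  by rewrite set_itv_ge ?bnd_simp -?ltNge//; exact: continuous_subspace0.
by apply: parameterized_integral_continuous => //; exact: continuous_itv_integrable continuous_fsin.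
Qed.


Lemma within_scale (F : R -> R) (x s : R) : 0 < x -> (forall a, {within `[0, a], continuous F}) ->
  {within `[0, s], continuous (fun t => F (x * t))}.
Proof.
move=> x0 cF; have [s0|s0] := leP s 0.
  move: s0; rewrite le_eqVlt => /predU1P[->|s0].
    rewrite set_itv1; exact: continuous_subspace1.
  by rewrite set_itv_ge ?bnd_simp -?ltNge//; exact: continuous_subspace0.
have [c1 c2 c3] := (continuous_within_itvP F (mulr_gt0 x0 s0)).1 (cF (x * s)).
have cx (t : R) : {for t, continuous ( *%R x)}.
  by apply: cvgM; [exact: cvg_cst|exact: cvg_id].
apply/(continuous_within_itvP _ s0); split.
- move=> t /[!in_itv]/= /andP[t0 ts].
  apply: (@continuous_comp _ _ _ ( *%R x) F); first exact: cx.
  by apply: c1; rewrite in_itv/= mulr_gt0//= ltr_pM2l.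
- rewrite mulr0; apply/cvg_at_rightP => u [u0 u1].
  move/cvg_at_rightP : c2; apply; split; first by move=> n; rewrite mulr_gt0.
  by rewrite -(mulr0 x); apply: cvgM => //; exact: cvg_cst.
- apply/cvg_at_leftP => u [u0 u1].
  move/cvg_at_leftP : c3; apply; split; first by move=> n; rewrite ltr_pM2l.
  by apply: cvgM => //; exact: cvg_cst.
Qed.

(* substitution u = x t *)
Lemma Fresnel_scale (F f : R -> R) (x s : R) : continuous f ->
  (forall a, {within `[0, a], continuous F}) -> F 0 = 0 ->
  (forall x : R, 0 < x -> is_derive x (1 : R) F (f x)) ->
  0 < x -> 0 <= s -> \int[leb]_(t in `[0, s]) (x * f (x * t)) = F (x * s).
Proof.
move=> cf cF F0 dF x0 s0; transitivity (F (x * s) - F (x * 0)); last by rewrite mulr0 F0 subr0.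
apply: (ftc (fun t => F (x * t))) => //.
- move=> t; apply: cvgM; first exact: cvg_cst.
  apply: (@continuous_comp _ _ _ ( *%R x) f); last exact: cf.
  by apply: cvgM; [exact: cvg_cst|exact: cvg_id].
- move=> t /andP[t0 ts].
  apply: der_eq (der_comp F ( *%R x) t _ _ (dF _ (mulr_gt0 x0 t0)) (derM _ _ _ _ _ (derC x t) (derI t))) _.
  by ring.
- exact: within_scale.
Qed.

Definition oneD (t : R) := 1 + t ^+ 2.
Lemma oneD_gt0 t : 0 < oneD t.
Proof. by rewrite /oneD ltr_wpDr// sqr_ge0. Qed.
Lemma oneD_neq0 t : oneD t != 0. Proof. by rewrite gt_eqF// oneD_gt0. Qed.
Lemma der_oneD (t : R) : is_derive t (1 : R) oneD (2 * t).
Proof. by apply: der_eq (derD _ _ _ _ _ (derC 1 t) (derX2 _ _ _ (derI t))) _; ring. Qed.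
Lemma der_oneDV (t : R) : is_derive t (1 : R) (fun t => (oneD t)^-1) (- (2 * t) / oneD t ^+ 2).
Proof. exact: derV (oneD_neq0 t) (der_oneD t). Qed.

(** The components of $e^{ix^2(1+t^2)/2}/(1+t^2)$, the parameter trick known from the Gaussian
    integral: differentiating in $x$ cancels the denominator, and the integral over $[0,1]$ becomes
    a product of $e^{ix^2/2}$ and a Fresnel integral. *)
Definition uc (x t : R) := cos (x ^+ 2 / 2 * oneD t) / oneD t.
Definition us (x t : R) := sin (x ^+ 2 / 2 * oneD t) / oneD t.
Definition Uc (x : R) := \int[leb]_(t in `[0, 1]) uc x t.
Definition Us (x : R) := \int[leb]_(t in `[0, 1]) us x t.

Lemma uc_dx (x t : R) : is_derive x (1 : R) (uc ^~ t) (- x * sin (x ^+ 2 / 2 * oneD t)).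
Proof.
apply: der_eq (derM _ _ _ _ _ (der_cos _ _ _ (derM _ _ _ _ _ (der_sqr2 x) (derC (oneD t) x))) (derC (oneD t)^-1 x)) _.
by have := oneD_neq0 t => ?; field.
Qed.
Lemma us_dx (x t : R) : is_derive x (1 : R) (us ^~ t) (x * cos (x ^+ 2 / 2 * oneD t)).
Proof.
apply: der_eq (derM _ _ _ _ _ (der_sin _ _ _ (derM _ _ _ _ _ (der_sqr2 x) (derC (oneD t) x))) (derC (oneD t)^-1 x)) _.
by have := oneD_neq0 t => ?; field.
Qed.

Lemma continuous_uc x : continuous (uc x).
Proof.
move=> t; exact: der_continuous (derM _ _ _ _ _
  (der_cos _ _ _ (derM _ _ _ _ _ (derC (x ^+ 2 / 2) t) (der_oneD t))) (der_oneDV t)).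
Qed.
Lemma continuous_us x : continuous (us x).
Proof.
move=> t; exact: der_continuous (derM _ _ _ _ _
  (der_sin _ _ _ (derM _ _ _ _ _ (derC (x ^+ 2 / 2) t) (der_oneD t))) (der_oneDV t)).
Qed.

(** Near [x] the derivative is dominated by the constant $|x|+1$, which permits differentiation
    under the integral. *)
Lemma derive_param01 (u du : R -> R -> R) (x : R) :
  (forall x t : R, is_derive x (1 : R) (u ^~ t) (du x t)) ->
  (forall x, continuous (u x)) ->
  (forall x t : R, 0 <= t <= 1 -> `|du x t| <= `|x|) ->
  is_derive x (1 : R) (fun x => \int[leb]_(t in `[0, 1]) u x t) (\int[leb]_(t in `[0, 1]) du x t).
Proof.
move=> hd cu bu.
have dE (y t : R) : partial1of2 u y t = du y t.
  by rewrite partial1of2E; have /@derive_val := hd y t.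
have xI : `](x - 1), (x + 1)[%classic x.
  by rewrite /= in_itv /= ltrBlDr ltrDl ltr01.
have H1 (y : R) : `](x - 1), (x + 1)[%classic y -> leb.-integrable `[0, 1] (EFin \o u y).
  by move=> _; exact: continuous_itv_integrable.
have H2 (y t : R) : `](x - 1), (x + 1)[%classic y -> `[0%R, 1%R]%classic t -> derivable (u ^~ t) y 1.
  by move=> _ _; have /@ex_derive := hd y t.
have H3 (t : R) : 0 <= `|x| + 1 by rewrite addr_ge0.
have H4 : leb.-integrable `[0, 1] (EFin \o (fun=> `|x| + 1)).
  by apply: continuous_itv_integrable => t; exact: cvg_cst.
have H5 (y t : R) : `](x - 1), (x + 1)[%classic y -> `[0%R, 1%R]%classic t ->
    `|partial1of2 u y t| <= `|x| + 1.
  rewrite /= !in_itv /= => xy t01; rewrite dE (le_trans (bu _ _ t01))//.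
  rewrite -lerBlDl (le_trans (lerB_dist _ _))//.
  by rewrite ltW// ltr_distl.
have m01 : measurable (`[0%R, 1%R]%classic : set (measurableTypeR R)) by exact: measurable_itv.
have E : \int[leb]_(t in `[0, 1]) du x t = \int[leb]_(t in `[0, 1]) partial1of2 u x t.
  by apply: eq_Rintegral => t _; rewrite dE.
have D1 := derivable_under_integral m01 xI H1 H2 H3 H4 H5.
have D2 := differentiation_under_integral m01 xI H1 H2 H3 H4 H5.
by split; [exact: D1|rewrite -derive1E D2 E].
Qed.

Lemma RintegralZlc (c : R) (f : R -> R) (a b : R) : continuous f ->
  \int[leb]_(t in `[a, b]) (c * f t) = c * \int[leb]_(t in `[a, b]) f t.
Proof. by move=> cf; rewrite RintegralZl//; exact: continuous_itv_integrable. Qed.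

Lemma continuous_scale (f : R -> R) (x : R) : continuous f -> continuous (fun t => f (x * t)).
Proof.
move=> cf t; apply: (@continuous_comp _ _ _ ( *%R x) f); last exact: cf.
by apply: cvgM; [exact: cvg_cst|exact: cvg_id].
Qed.

Lemma fscale_add (x t : R) : x ^+ 2 / 2 * oneD t = x ^+ 2 / 2 + (x * t) ^+ 2 / 2.
Proof. by rewrite /oneD; field. Qed.

Lemma Fcos_scale (x : R) : 0 < x -> \int[leb]_(t in `[0, 1]) (x * fcos (x * t)) = Fcos x.
Proof.
move=> x0; rewrite -[in RHS](mulr1 x); apply: Fresnel_scale => //.
- exact: continuous_fcos.
- exact: within_Fcos.
- exact: Fcos0.
- exact: is_derive_Fcos.
Qed.
Lemma Fsin_scale (x : R) : 0 < x -> \int[leb]_(t in `[0, 1]) (x * fsin (x * t)) = Fsin x.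
Proof.
move=> x0; rewrite -[in RHS](mulr1 x); apply: Fresnel_scale => //.
- exact: continuous_fsin.
- exact: within_Fsin.
- exact: Fsin0.
- exact: is_derive_Fsin.
Qed.

Lemma dUc (x : R) : 0 < x -> is_derive x (1 : R) Uc (- (fsin x * Fcos x + fcos x * Fsin x)).
Proof.
move=> x0; apply: (der_eq _ _ _ _ (derive_param01 uc (fun x t => - x * sin (x ^+ 2 / 2 * oneD t)) x _ _ _)).
- exact: uc_dx.
- exact: continuous_uc.
- move=> y t; rewrite normrM normrN ler_piMr//; exact: sin_max.
have c1 := continuous_scale _ x continuous_fcos.
have c2 := continuous_scale _ x continuous_fsin.
rewrite -(Fcos_scale _ x0) -(Fsin_scale _ x0).
rewrite (RintegralZlc x (fun t => fcos (x * t)))// (RintegralZlc x (fun t => fsin (x * t)))//.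
transitivity (\int[leb]_(t in `[0, 1]) (- (fsin x * x) * fcos (x * t) + - (fcos x * x) * fsin (x * t))).
  apply: eq_Rintegral => t _; rewrite fscale_add sinD -/(fsin x) -/(fcos x) -/(fsin (x * t)) -/(fcos (x * t)).
  by ring.
rewrite RintegralD//; first (by rewrite !RintegralZlc//; ring);
  by apply: continuous_itv_integrable => t; apply: cvgM; [exact: cvg_cst|by [exact: c1|exact: c2]].
Qed.

Lemma dUs (x : R) : 0 < x -> is_derive x (1 : R) Us (fcos x * Fcos x - fsin x * Fsin x).
Proof.
move=> x0; apply: (der_eq _ _ _ _ (derive_param01 us (fun x t => x * cos (x ^+ 2 / 2 * oneD t)) x _ _ _)).
- exact: us_dx.
- exact: continuous_us.
- move=> y t; rewrite normrM ler_piMr//; exact: cos_max.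
have c1 := continuous_scale _ x continuous_fcos.
have c2 := continuous_scale _ x continuous_fsin.
rewrite -(Fcos_scale _ x0) -(Fsin_scale _ x0).
rewrite (RintegralZlc x (fun t => fcos (x * t)))// (RintegralZlc x (fun t => fsin (x * t)))//.
transitivity (\int[leb]_(t in `[0, 1]) ((fcos x * x) * fcos (x * t) + - (fsin x * x) * fsin (x * t))).
  apply: eq_Rintegral => t _; rewrite fscale_add cosD -/(fsin x) -/(fcos x) -/(fsin (x * t)) -/(fcos (x * t)).
  by ring.
rewrite RintegralD//; first (by rewrite !RintegralZlc//; ring);
  by apply: continuous_itv_integrable => t; apply: cvgM; [exact: cvg_cst|by [exact: c1|exact: c2]].
Qed.

Lemma Uc0 : Uc 0 = pi / 4.
Proof.
rewrite /Uc -atan1 -[RHS]subr0 -[in RHS]atan0.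
under eq_Rintegral do rewrite /uc expr0n /= !mul0r cos0 mul1r.
apply: ftcT => // t.
by exact: der_continuous (der_oneDV t).
Qed.

Lemma Us0 : Us 0 = 0.
Proof.
rewrite /Us; under eq_Rintegral do rewrite /us expr0n /= !mul0r sin0 mul0r.
by rewrite Rintegral_cst ?mul0r//; exact: measurable_itv.
Qed.

Lemma within_param01 (u du : R -> R -> R) (a : R) :
  (forall x t : R, is_derive x (1 : R) (u ^~ t) (du x t)) ->
  (forall x, continuous (u x)) ->
  (forall x t : R, `|du x t| <= `|x|) ->
  {within `[0, a], continuous (fun x => \int[leb]_(t in `[0, 1]) u x t)}.
Proof.
move=> h1 h2 h3; apply: continuous_subspaceT => x.
exact: der_continuous (derive_param01 _ _ x h1 h2 (fun x t _ => h3 x t)).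
Qed.

(* S(x)^2 = G(x) - G(0) for S = Fcos + i Fsin and
   G(x) = -2 i \int_0^1 exp(i x^2 (1 + t^2) / 2) / (1 + t^2) dt *)
Lemma constant_of_der0 (h : R -> R) (x : R) : 0 < x ->
  (forall y : R, 0 < y -> is_derive y (1 : R) h 0) -> (forall a, {within `[0, a], continuous h}) ->
  h x = h 0.
Proof.
move=> x0 dh ch; apply/eqP; rewrite -subr_eq0; apply/eqP.
transitivity (\int[leb]_(t in `[0, x]) (0 : R)).
  apply/esym; apply: ftc => //; first exact: ltW.
    by move=> t; exact: cvg_cst.
  by move=> t /andP[t0 _]; exact: dh.
by rewrite Rintegral_cst ?mul0r//; exact: measurable_itv.
Qed.

Lemma within_sqr (F G : R -> R) (a : R) : {within `[0, a], continuous F} -> {within `[0, a], continuous G} ->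
  {within `[0, a], continuous (fun x => F x * G x)}.
Proof. by move=> cF cG x; apply: continuousM; [exact: cF|exact: cG]. Qed.
Lemma within_add (F G : R -> R) (a : R) : {within `[0, a], continuous F} -> {within `[0, a], continuous G} ->
  {within `[0, a], continuous (fun x => F x + G x)}.
Proof. by move=> cF cG x; apply: continuousD; [exact: cF|exact: cG]. Qed.
Lemma within_cst (c a : R) : {within `[0, a], continuous (fun=> c : R)}.
Proof. by apply: continuous_subspaceT => x; exact: cvg_cst. Qed.

Lemma Fresnel_re (x : R) : 0 < x -> Fcos x * Fcos x - Fsin x * Fsin x = 2 * Us x.
Proof.
move=> x0; pose h y := Fcos y * Fcos y + (-1) * (Fsin y * Fsin y) + (-2) * Us y.
have : h x = h 0.
  apply: constant_of_der0 => // [y y0|a].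
    have dA := is_derive_Fcos _ y0; have dB := is_derive_Fsin _ y0; have dU := dUs _ y0.
    apply: der_eq (derD _ _ _ _ _ (derD _ _ _ _ _ (derM _ _ _ _ _ dA dA)
      (derM _ _ _ _ _ (derC (-1) y) (derM _ _ _ _ _ dB dB))) (derM _ _ _ _ _ (derC (-2) y) dU)) _.
    by ring.
  apply: within_add; first apply: within_add.
  - by apply: within_sqr; exact: within_Fcos.
  - by apply: within_sqr; [exact: within_cst|apply: within_sqr; exact: within_Fsin].
  - apply: within_sqr; first exact: within_cst.
    apply: (within_param01 us _ _ us_dx continuous_us) => y t.
    by rewrite normrM ler_piMr//; exact: cos_max.
rewrite /h Fcos0 Fsin0 Us0; lra.
Qed.

Lemma Fresnel_im (x : R) : 0 < x -> Fcos x * Fsin x = pi / 4 - Uc x.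
Proof.
move=> x0; pose h y := Fcos y * Fsin y + Uc y.
have : h x = h 0.
  apply: constant_of_der0 => // [y y0|a].
    have dA := is_derive_Fcos _ y0; have dB := is_derive_Fsin _ y0; have dU := dUc _ y0.
    by apply: der_eq (derD _ _ _ _ _ (derM _ _ _ _ _ dA dB) dU) _; ring.
  apply: within_add; first by apply: within_sqr; [exact: within_Fcos|exact: within_Fsin].
  apply: (within_param01 uc _ _ uc_dx continuous_uc) => y t.
  by rewrite normrM normrN ler_piMr//; exact: sin_max.
rewrite /h Fcos0 Fsin0 Uc0; lra.
Qed.

Lemma norm_Rintegral01 (f : R -> R) (M : R) : {within `[0, 1], continuous f} ->
  (forall t, 0 <= t <= 1 -> `|f t| <= M) -> `|\int[leb]_(t in `[0, 1]) f t| <= M.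
Proof.
move=> cf bf.
have i1 : leb.-integrable `[0, 1] (EFin \o f).
  by apply: continuous_compact_integrable => //; exact: segment_compact.
have m01 : measurable (`[0%R, 1%R]%classic : set (measurableTypeR R)) by exact: measurable_itv.
rewrite (le_trans (le_normr_Rintegral m01 i1))//.
have -> : M = \int[leb]_(t in `[0, 1]) M.
  by rewrite Rintegral_cst//= lebesgue_measure_itv/= lte01 oppr0 addr0 mulr1.
apply: le_Rintegral => //.
- by have := integrable_norm i1; apply: eq_integrable.
- by apply: continuous_itv_integrable => t; exact: cvg_cst.
Qed.

Lemma Uc_bound x : `|Uc x| <= 1.
Proof.
apply: norm_Rintegral01 => [|t _]; first by apply: continuous_subspaceT; exact: continuous_uc.
rewrite /uc normrM normfV (gtr0_norm (oneD_gt0 t)) ler_pdivrMr ?oneD_gt0// mul1r.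
by rewrite (le_trans (_ : _ <= 1))// ?lerDl ?sqr_ge0// ler_norml cos_geN1 cos_le1.
Qed.

Lemma Us_bound x : `|Us x| <= 1.
Proof.
apply: norm_Rintegral01 => [|t _]; first by apply: continuous_subspaceT; exact: continuous_us.
rewrite /us normrM normfV (gtr0_norm (oneD_gt0 t)) ler_pdivrMr ?oneD_gt0// mul1r.
by rewrite (le_trans (_ : _ <= 1))// ?lerDl ?sqr_ge0// ler_norml sin_geN1 sin_le1.
Qed.

(** With $S$ = [Fcos] $+\,i$ [Fsin], the components of $S^2$ are expressed by [Us] and [Uc], which
    are at most 1 in absolute value. Hence $|S|^4=|S^2|^2\le 20$ and $|S|^2\le5$. *)
Lemma Fresnel_bound (x : R) : `|Fcos x| <= 3 /\ `|Fsin x| <= 3.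
Proof.
have [x0|] := ltP 0 x; last first.
  rewrite le_eqVlt => /predU1P[->|x0]; first by rewrite Fcos0 Fsin0 normr0.
  rewrite /Fcos /Fsin set_itv_ge ?bnd_simp -?ltNge// !Rintegral_set0 normr0.
  by split.
have h1 := Fresnel_re _ x0; have h2 := Fresnel_im _ x0.
have := Uc_bound x; have := Us_bound x; rewrite !ler_norml => /andP[a1 a2] /andP[b1 b2].
have p4 : pi <= 4 :> R by have := @pihalf_lt2 R; lra.
have p0 := pi_ge0 R.
set A := Fcos x in h1 h2 *; set B := Fsin x in h1 h2 *.
have e : (A ^+ 2 + B ^+ 2) ^+ 2 = (A * A - B * B) ^+ 2 + 4 * (A * B) ^+ 2 by ring.
have s1 : (A * A - B * B) ^+ 2 <= 4 by rewrite h1; nra.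
have s2 : (A * B) ^+ 2 <= 4 by rewrite h2; nra.
have A2 := sqr_ge0 A; have B2 := sqr_ge0 B.
have s3 : A ^+ 2 + B ^+ 2 <= 5 by nra.
by split; apply/andP; split; nra.
Qed.

(** Integration by parts against $k(t)=1/(1+t^2)$. The oscillating factor has the primitive [G], of
    size $6/x$ by [Fresnel_bound]; the boundary term gives $6/x$ and the remaining integral $12/x$,
    as $|k'|\le2$. *)
Lemma U_decay (x : R) : 0 < x -> `|Uc x| <= 18 / x /\ `|Us x| <= 18 / x.
Proof.
move=> x0.
pose k t := (oneD t)^-1; pose dk t : R := - (2 * t) / oneD t ^+ 2.
have key (p q : R) (g : R -> R) : `|p| <= 1 -> `|q| <= 1 ->
   (forall t, g t = p * fcos (x * t) + q * fsin (x * t)) ->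
   `|\int[leb]_(t in `[0, 1]) (k t * g t)| <= 18 / x.
  move=> p1 q1 gE.
  pose G t := x^-1 * (p * Fcos (x * t) + q * Fsin (x * t)).
  have cg : continuous g.
    rewrite (_ : g = fun t => p * fcos (x * t) + q * fsin (x * t)); last exact/funext.
    move=> t; apply: cvgD; apply: cvgM; try exact: cvg_cst.
      exact: continuous_scale continuous_fcos _.
    exact: continuous_scale continuous_fsin _.
  have wG : {within `[0, 1], continuous G}.
    apply: within_sqr; first exact: within_cst.
    apply: within_add.
      apply: within_sqr; first exact: within_cst.
      by apply: (within_scale _ _ _ x0) => a; exact: within_Fcos.
    apply: within_sqr; first exact: within_cst.
    by apply: (within_scale _ _ _ x0) => a; exact: within_Fsin.
  have dG (t : R) : 0 < t -> is_derive t (1 : R) G (g t).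
    move=> t0; have dA := is_derive_Fcos _ (mulr_gt0 x0 t0).
    have dB := is_derive_Fsin _ (mulr_gt0 x0 t0).
    have dx := derM _ _ _ _ _ (derC x t) (derI t).
    apply: der_eq (derM _ _ _ _ _ (derC x^-1 t) (derD _ _ _ _ _
      (derM _ _ _ _ _ (derC p t) (der_comp Fcos _ t _ _ dA dx))
      (derM _ _ _ _ _ (derC q t) (der_comp Fsin _ t _ _ dB dx)))) _.
    by rewrite gE; field; rewrite gt_eqF.
  have ck : continuous k by move=> t; exact: der_continuous (der_oneDV t).
  have cdk : continuous dk.
    move=> t; apply: der_continuous (derM _ _ _ _ _ (derN _ _ _ (derM _ _ _ _ _ (derC 2 t) (derI t)))
      (derV _ _ _ _ (derX2 _ _ _ (der_oneD t)))).
    by rewrite expf_neq0// oneD_neq0.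
  have bG t : `|G t| <= 6 / x.
    have [b1 _] := Fresnel_bound (x * t); have [_ b2] := Fresnel_bound (x * t).
    rewrite /G normrM gtr0_norm ?invr_gt0// mulrC ler_pM2r ?invr_gt0//.
    rewrite (le_trans (ler_normD _ _))// !normrM.
    have := ler_pM (normr_ge0 _) (normr_ge0 _) p1 b1.
    have := ler_pM (normr_ge0 _) (normr_ge0 _) q1 b2; lra.
  have [w1 w2 w3] := (continuous_within_itvP G ltr01).1 wG.
  rewrite (Rintegration_by_parts (F := k) (G := G) (f := dk) ltr01).
  - have G0 : G 0 = 0 by rewrite /G mulr0 Fcos0 Fsin0; ring.
    rewrite G0 mulr0 subr0.
    have d1 : `|k 1 * G 1| <= 6 / x.
      rewrite normrM -[leRHS]mul1r ler_pM// /k normfV gtr0_norm ?oneD_gt0//.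
      by rewrite invf_le1 ?oneD_gt0// lerDl sqr_ge0.
    have d2 : `|\int[leb]_(t in `[0, 1]) (dk t * G t)| <= 12 / x.
      apply: norm_Rintegral01.
        by apply: within_sqr => //; exact: continuous_subspaceT.
      move=> t /andP[t0 t1]; rewrite normrM (_ : 12 / x = 2 * (6 / x)); last first.
        by field; rewrite gt_eqF.
      rewrite ler_pM// /dk normrM normrN normfV ger0_norm ?mulr_ge0//.
      rewrite ger0_norm ?sqr_ge0// ler_pdivrMr ?exprn_gt0 ?oneD_gt0// /oneD.
      by have := sqr_ge0 t; nra.
    rewrite (le_trans (ler_normB _ _))//.
    by rewrite (le_trans (lerD d1 d2))// (_ : 18 / x = 6 / x + 12 / x)//; ring.
  - exact: continuous_subspaceT.
  - split => [t _||].
    + by have /@ex_derive := der_oneDV t.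
    + apply: cvg_at_right_filter; exact: ck.
    + apply: cvg_at_left_filter; exact: ck.
  - by move=> t _; rewrite derive1E; have /@derive_val := der_oneDV t.
  - exact: continuous_subspaceT.
  - split => // t /[!in_itv]/= /andP[t0 _].
    by have /@ex_derive := dG _ t0.
  - move=> t /[!in_itv]/= /andP[t0 _]; rewrite derive1E.
    by have /@derive_val := dG _ t0.
split.
  have -> : Uc x = \int[leb]_(t in `[0, 1]) (k t * (fcos x * fcos (x * t) + - fsin x * fsin (x * t))).
    apply: eq_Rintegral => t _; rewrite /uc fscale_add cosD /k /fcos /fsin.
    by rewrite mulrC mulNr.
  by apply: (key (fcos x) (- fsin x)) => //; rewrite ?normrN; [exact: cos_max|exact: sin_max].
have -> : Us x = \int[leb]_(t in `[0, 1]) (k t * (fsin x * fcos (x * t) + fcos x * fsin (x * t))).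
  by apply: eq_Rintegral => t _; rewrite /us fscale_add sinD /k /fcos /fsin mulrC.
by apply: (key (fsin x) (fcos x)) => //; [exact: sin_max|exact: cos_max].
Qed.

Lemma onem_cos_le (y : R) : 0 <= y -> 1 - cos y <= y.
Proof.
move=> y0; have h : \int[leb]_(t in `[0, y]) (1 - sin t) = (y + cos y) - (0 + cos 0).
  apply: (ftcT (fun t => t + cos t) (fun t => 1 - sin t)) => // t.
    apply: cvgB; [exact: cvg_cst|exact: continuous_sin].
have : 0 <= \int[leb]_(t in `[0, y]) (1 - sin t).
  by apply: Rintegral_ge0 => t _; rewrite subr_ge0 sin_le1.
rewrite h cos0; lra.
Qed.

(* Fsin x - (1 - cos (x^2 / 2)) / x is nondecreasing, which excludes the limit
   - sqrt pi / 2 *)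
Lemma Fsin_lower (x : R) : 1 <= x -> - (2^-1) <= Fsin x.
Proof.
move=> x1; have x0 : 0 < x by lra.
pose D t := Fsin t + (fcos t - 1) / t.
have dD (t : R) : 0 < t -> is_derive t (1 : R) D ((1 - fcos t) / t ^+ 2).
  move=> t0; have tn0 : t != 0 by rewrite gt_eqF.
  apply: der_eq (derD _ _ _ _ _ (is_derive_Fsin _ t0) (derM _ _ _ _ _
    (derD _ _ _ _ _ (is_derive_fcos t) (derC (- 1) t)) (derV _ _ _ tn0 (derI t)))) _.
  by field.
have Fsin1 : 0 <= Fsin 1.
  apply: Rintegral_ge0 => t /=; rewrite in_itv /= => /andP[t0 t1].
  apply: sin_ge0_pi; have := @pi_ge2 R => p2.
  by apply/andP; split; nra.
have D1 : - (2^-1) <= D 1.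
  have h : 1 - cos (2^-1 : R) <= 2^-1 by apply: onem_cos_le; rewrite invr_ge0.
  by rewrite /D /fcos expr1n mul1r divr1; lra.
have mono : D 1 <= D x.
  move: x1; rewrite le_eqVlt => /predU1P[<-//|x1].
  have cD : {within `[1, x], continuous D}.
    apply/continuous_within_itvP => //; split.
    - by move=> t /[!in_itv]/= /andP[t1 _]; apply: der_continuous (dD t _); lra.
    - by apply: cvg_at_right_filter; apply: der_continuous (dD 1 _).
    - by apply: cvg_at_left_filter; apply: der_continuous (dD x _).
  have [|c /[!in_itv]/= /andP[c1 c2] e] := @MVT R D (fun t => (1 - fcos t) / t ^+ 2) 1 x x1 _ cD.
    by move=> t /[!in_itv]/= /andP[t1 _]; apply: dD; lra.
  rewrite -subr_ge0 e mulr_ge0//; last lra.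
  by rewrite divr_ge0 ?sqr_ge0// subr_ge0 cos_le1.
have : fcos x - 1 <= 0 by rewrite subr_le0 cos_le1.
move=> h; have : (fcos x - 1) / x <= 0 by rewrite mulr_le0_ge0// invr_ge0 ltW.
by rewrite /D in mono D1 *; lra.
Qed.

(** The decay of [Uc] and [Us] gives $S^2\to i\pi/2$, which determines $S$ up to its sign. The limit
    $-\sqrt\pi/2$ of [Fsin] is excluded by [Fsin_lower], because $\sqrt\pi/2>1/2$; then [Fcos] is
    positive too, since the product is near $\pi/4$. *)
Lemma Fresnel_cvg : Fcos x @[x --> +oo] --> Num.sqrt pi / 2 /\
  Fsin x @[x --> +oo] --> Num.sqrt pi / 2.
Proof.
have decay (U : R -> R) : (forall x : R, 0 < x -> `|U x| <= 18 / x) -> U x @[x --> +oo] --> 0.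
  move=> hU; apply/cvgr0Pnorm_le => e e0; near=> x.
  have x0 : 0 < x by near: x; exact: nbhs_pinfty_gt.
  have xe : 18 / e <= x by near: x; apply: nbhs_pinfty_ge; rewrite num_real.
  by rewrite (le_trans (hU _ x0))// ler_pdivrMr// mulrC -ler_pdivrMr.
have cUc := decay _ (fun x x0 => (U_decay x x0).1).
have cUs := decay _ (fun x x0 => (U_decay x x0).2).
(* Under the root stands $|S^2|^2$ written with [Us] and [Uc], so [s x] is $|S|^2$. *)
pose s x := Num.sqrt ((2 * Us x) * (2 * Us x) + 4 * ((pi / 4 - Uc x) * (pi / 4 - Uc x))).
have cs : s x @[x --> +oo] --> pi / 2.
  have e : pi / 2 = Num.sqrt ((2 * 0) * (2 * 0) + 4 * ((pi / 4 - 0) * (pi / 4 - 0))) :> R.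
    rewrite (_ : (2 * 0) * (2 * 0) + 4 * ((pi / 4 - 0) * (pi / 4 - 0)) = (pi / 2) ^+ 2); last by field.
    by rewrite sqrtr_sqr ger0_norm// divr_ge0// pi_ge0.
  rewrite e; apply: (@continuous_cvg _ _ _ _ _ _ (fun y => Num.sqrt y)).
    exact: sqrt_continuous.
  apply: cvgD.
    by apply: cvgM; apply: cvgM => //; exact: cvg_cst.
  apply: cvgM; first exact: cvg_cst.
  by apply: cvgM; apply: cvgB => //; exact: cvg_cst.
have sE (x : R) : 0 < x -> s x = Fcos x ^+ 2 + Fsin x ^+ 2.
  move=> x0; rewrite /s -Fresnel_re// -Fresnel_im//.
  rewrite (_ : _ + _ = (Fcos x ^+ 2 + Fsin x ^+ 2) ^+ 2); last by ring.
  by rewrite sqrtr_sqr ger0_norm// addr_ge0// sqr_ge0.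
pose a x := Num.sqrt ((s x + 2 * Us x) / 2); pose b x := Num.sqrt ((s x - 2 * Us x) / 2).
have spi : Num.sqrt pi / 2 = Num.sqrt (pi / 2 / 2) :> R.
  rewrite (_ : pi / 2 / 2 = (Num.sqrt pi / 2) ^+ 2); last first.
    by rewrite exprMn sqr_sqrtr ?pi_ge0// exprVn; field.
  by rewrite sqrtr_sqr ger0_norm// divr_ge0// sqrtr_ge0.
have ca : a x @[x --> +oo] --> Num.sqrt pi / 2.
  rewrite spi -[pi / 2 in X in _ --> X]addr0 -[X in pi / 2 + X](mulr0 2).
  apply: (@continuous_cvg _ _ _ _ _ _ (fun y => Num.sqrt y)); first exact: sqrt_continuous.
  apply: cvgM; last exact: cvg_cst.
  by apply: cvgD => //; apply: cvgM => //; exact: cvg_cst.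
have cb : b x @[x --> +oo] --> Num.sqrt pi / 2.
  rewrite spi -[pi / 2 in X in _ --> X]subr0 -[X in pi / 2 - X](mulr0 2).
  apply: (@continuous_cvg _ _ _ _ _ _ (fun y => Num.sqrt y)); first exact: sqrt_continuous.
  apply: cvgM; last exact: cvg_cst.
  by apply: cvgB => //; apply: cvgM => //; exact: cvg_cst.
have half : 2^-1 < Num.sqrt pi / 2 :> R.
  have : 1 < Num.sqrt pi :> R.
    by rewrite -[ltLHS]sqrtr1 ltr_sqrt ?pi_gt0//; have := @pi_ge2 R; lra.
  lra.
have fin : \forall x \near +oo, Fcos x = a x /\ Fsin x = b x.
  near=> x.
  have x0 : 0 < x by near: x; exact: nbhs_pinfty_gt.
  have x1 : 1 <= x by near: x; exact: nbhs_pinfty_ge.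
  have b2 : 2^-1 < b x by near: x; apply: (cvgr_gt _ cb).
  have U14 : Uc x < 2^-1 by near: x; apply: (cvgr_lt _ cUc); rewrite invr_gt0.
  have e2 : s x - 2 * Us x = 2 * Fsin x ^+ 2 by rewrite sE// -Fresnel_re//; ring.
  have e1 : s x + 2 * Us x = 2 * Fcos x ^+ 2 by rewrite sE// -Fresnel_re//; ring.
  have bE : b x = `|Fsin x|.
    by rewrite /b e2 (_ : _ / 2 = Fsin x ^+ 2) ?sqrtr_sqr//; field.
  have aE : a x = `|Fcos x|.
    by rewrite /a e1 (_ : _ / 2 = Fcos x ^+ 2) ?sqrtr_sqr//; field.
  have Bpos : 0 < Fsin x.
    rewrite ltNge; apply/negP => B0; move: b2; rewrite bE ler0_norm//.
    by have := Fsin_lower _ x1; lra.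
  have ABpos : 0 < Fcos x * Fsin x.
    by rewrite Fresnel_im//; have := @pi_ge2 R; lra.
  have Apos : 0 < Fcos x by move: ABpos; rewrite pmulr_lgt0.
  by rewrite aE bE !gtr0_norm.
split.
  apply: cvg_trans ca; apply: near_eq_cvg; near=> x.
  by have [] : Fcos x = a x /\ Fsin x = b x by near: x.
apply: cvg_trans cb; apply: near_eq_cvg; near=> x.
by have [] : Fcos x = a x /\ Fsin x = b x by near: x.
Unshelve. all: by end_near.
Qed.
End Fresnel.

(** * The free kernel *)

Section FreeKernel.
Context {R : realType}.
Local Notation C := R[i].
Local Notation Re := complex.Re.
Local Notation Im := complex.Im.
Local Notation B := (measurableTypeR R).
Local Notation leb := (@lebesgue_measure R).

Definition ksqrt (D : R) : C := (sqrtc (2%:R * pi%:C * 'i%C * D%:C))^-1.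
(** The free propagator over the time [D] at the complex displacement $b-ig$. The imaginary part is
    the contribution of $\int\eta$, which is purely imaginary. *)
Definition kernel (g D b : R) : C :=
  ksqrt D * cexp ('i%C / (2%:R * D%:C) * (b%:C - 'i%C * g%:C) ^+ 2).

Lemma sqrt_pi_gt0 : 0 < Num.sqrt (pi : R).
Proof. by rewrite sqrtr_gt0 pi_gt0. Qed.

Lemma ksqrtE (D : R) : 0 < D ->
  ksqrt D = ((2 * Num.sqrt pi * Num.sqrt D)^-1)%:C * (1 -i* 1).
Proof.
move=> D0; have sD : 0 < Num.sqrt D by rewrite sqrtr_gt0.
have sp := sqrt_pi_gt0.
rewrite /ksqrt.
have -> : 2%:R * pi%:C * 'i%C * D%:C = 0 +i* (2 * pi * D) :> C.
  by apply: eqC; rewrite !(ReM, ImM) /=; ring.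
have p0 : 0 < 2 * pi * D :> R by rewrite !mulr_gt0 ?pi_gt0.
have E : sqrtc (0 +i* (2 * pi * D)) = (Num.sqrt pi * Num.sqrt D)%:C * (1 +i* 1) :> C.
  rewrite /sqrtc /= expr0n /= add0r sqrtr_sqr (gtr0_norm p0) addr0 subr0.
  rewrite (_ : 2 * pi * D / 2 = (Num.sqrt pi * Num.sqrt D) ^+ 2); last first.
    by rewrite exprMn !sqr_sqrtr ?ltW ?pi_gt0//; field.
  rewrite gtr0_sg// sqrtr_sqr ger0_norm; last by rewrite mulr_ge0 ?sqrtr_ge0.
  by rewrite gt_eqF// mul1r; apply: eqC; rewrite !(ReM, ImM) /=; ring.
rewrite E; apply: (mulfI (x := (Num.sqrt pi * Num.sqrt D)%:C * (1 +i* 1))).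
  apply/eqP => /(congr1 (@complex.Re _)); rewrite ReM /= => /eqP.
  by rewrite mulr1 mul0r subr0 mulf_eq0 !gt_eqF.
rewrite divff; last first.
  apply/eqP => /(congr1 (@complex.Re _)); rewrite ReM /= => /eqP.
  by rewrite mulr1 mul0r subr0 mulf_eq0 !gt_eqF.
apply: eqC; rewrite !(ReM, ImM) /=; field; by rewrite !gt_eqF.
Qed.

Lemma half_real (D : R) : (2%:R * D%:C)^-1 = ((2 * D)^-1)%:C :> C.
Proof.
have -> : 2%:R * D%:C = (2 * D)%:C :> C by apply: eqC; rewrite !(ReM, ImM) /=; ring.
by rewrite -[in RHS]/(real_complex R _) fmorphV.
Qed.

(** The factor $D^{-1/2}$ sits in the exponential, which simplifies the derivative in time. The
    modulus of the kernel is $\sqrt2$ times this, from the factor $1-i$ in [ksqrtE]. *)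
Definition amp (g D b : R) := expR (b * g / D - ln D / 2) / (2 * Num.sqrt pi).
Definition phase (g D b : R) := (b ^+ 2 - g ^+ 2) / (2 * D).

Lemma kernelE g D b : 0 < D -> kernel g D b =
  (amp g D b * (cos (phase g D b) + sin (phase g D b))) +i*
  (amp g D b * (sin (phase g D b) - cos (phase g D b))).
Proof.
move=> D0; rewrite /kernel ksqrtE//.
have -> : 'i%C / (2%:R * D%:C) * (b%:C - 'i%C * g%:C) ^+ 2 = (b * g / D) +i* phase g D b :> C.
  have -> : (2%:R * D%:C)^-1 = ((2 * D)^-1)%:C :> C by exact: half_real.
  rewrite expr2 /phase; apply: eqC; rewrite !(ReD, ImD, ReN, ImN, ReM, ImM) /= ?(ReD, ImD, ReN, ImN, ReM, ImM) /=; field; by rewrite gt_eqF.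
have -> : amp g D b = (2 * Num.sqrt pi * Num.sqrt D)^-1 * expR (b * g / D).
  have E : Num.sqrt D = expR (ln D / 2).
    rewrite -[LHS]lnK ?posrE ?sqrtr_gt0//; congr expR.
    have -> : ln D = 2 * ln (Num.sqrt D).
      by rewrite -[in LHS](sqr_sqrtr (ltW D0)) expr2 lnM ?posrE ?sqrtr_gt0//; ring.
    by field.
  rewrite /amp expRD expRN E; field.
  by rewrite !gt_eqF ?expR_gt0 ?sqrt_pi_gt0.
by rewrite /cexp; apply: eqC; rewrite !(ReM, ImM) /=; ring.
Qed.

Section Derivatives.
Variables (g tau z : R).
Local Notation P := (fun t x => Re (kernel g (t - tau) (x - z))).

Definition kP (t x : R) := amp g (t - tau) (x - z) *
  (cos (phase g (t - tau) (x - z)) + sin (phase g (t - tau) (x - z))).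
Definition kQ (t x : R) := amp g (t - tau) (x - z) *
  (sin (phase g (t - tau) (x - z)) - cos (phase g (t - tau) (x - z))).
(* the kernel solves i u_t + u_xx / 2 = 0 *)
Definition kPx (t x : R) := g / (t - tau) * kP t x - (x - z) / (t - tau) * kQ t x.
Definition kQx (t x : R) := g / (t - tau) * kQ t x + (x - z) / (t - tau) * kP t x.
Definition kPxx (t x : R) :=
  ((g ^+ 2 - (x - z) ^+ 2) * kP t x - (2 * g * (x - z) + (t - tau)) * kQ t x) / (t - tau) ^+ 2.
Definition kQxx (t x : R) :=
  ((g ^+ 2 - (x - z) ^+ 2) * kQ t x + (2 * g * (x - z) + (t - tau)) * kP t x) / (t - tau) ^+ 2.

Variables (t x : R).
Hypothesis taut : tau < t.
Let D0 : t - tau != 0. Proof. by rewrite gt_eqF// subr_gt0. Qed.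

Let dxz : is_derive x (1 : R) (fun x => x - z) 1.
Proof. by apply: der_eq (derD _ _ _ _ _ (derI x) (derC (- z) x)) _; ring. Qed.
Let dtt : is_derive t (1 : R) (fun t => t - tau) 1.
Proof. by apply: der_eq (derD _ _ _ _ _ (derI t) (derC (- tau) t)) _; ring. Qed.

Lemma amp_dx : is_derive x (1 : R) (fun x => amp g (t - tau) (x - z)) (g / (t - tau) * amp g (t - tau) (x - z)).
Proof.
apply: der_eq (derM _ _ _ _ _ (der_exp _ _ _ (derD _ _ _ _ _ (derM _ _ _ _ _
  (derM _ _ _ _ _ dxz (derC g x)) (derC (t - tau)^-1 x)) (derC (- (ln (t - tau) / 2)) x)))
  (derC (2 * Num.sqrt pi)^-1 x)) _.
by rewrite /amp; field; rewrite D0 gt_eqF ?sqrt_pi_gt0.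
Qed.
Lemma phase_dx : is_derive x (1 : R) (fun x => phase g (t - tau) (x - z)) ((x - z) / (t - tau)).
Proof.
apply: der_eq (derM _ _ _ _ _ (derD _ _ _ _ _ (derX2 _ _ _ dxz) (derC (- g ^+ 2) x))
  (derC (2 * (t - tau))^-1 x)) _.
by field; rewrite D0.
Qed.
Lemma amp_dt : is_derive t (1 : R) (fun t => amp g (t - tau) (x - z))
  ((- (x - z) * g / (t - tau) ^+ 2 - (2 * (t - tau))^-1) * amp g (t - tau) (x - z)).
Proof.
have t0 : 0 < t - tau by rewrite subr_gt0.
have dln := der_comp (@ln R) (fun t => t - tau) t _ _ (is_derive1_ln t0) dtt.
apply: der_eq (derM _ _ _ _ _ (der_exp _ _ _ (derD _ _ _ _ _ (derM _ _ _ _ _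
  (derC ((x - z) * g) t) (derV (fun t => t - tau) _ _ D0 dtt)) (derN _ _ _ (derM _ _ _ _ _ dln (derC 2^-1 t)))))
  (derC (2 * Num.sqrt pi)^-1 t)) _.
by rewrite /amp; field; rewrite D0 gt_eqF ?sqrt_pi_gt0.
Qed.
Lemma phase_dt : is_derive t (1 : R) (fun t => phase g (t - tau) (x - z))
  (- ((x - z) ^+ 2 - g ^+ 2) / (2 * (t - tau) ^+ 2)).
Proof.
have d2 : 2 * (t - tau) != 0 by rewrite mulf_neq0.
apply: der_eq (derM _ _ _ _ _ (derC ((x - z) ^+ 2 - g ^+ 2) t)
  (derV (fun t => 2 * (t - tau)) _ _ d2 (derM _ _ _ _ _ (derC 2 t) dtt))) _.
by field; rewrite D0.
Qed.

Lemma kP_dx : is_derive x (1 : R) (kP t) (kPx t x).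
Proof.
apply: der_eq (derM _ _ _ _ _ amp_dx (derD _ _ _ _ _ (der_cos _ _ _ phase_dx) (der_sin _ _ _ phase_dx))) _.
by rewrite /kPx /kP /kQ; ring.
Qed.
Lemma kQ_dx : is_derive x (1 : R) (kQ t) (kQx t x).
Proof.
apply: der_eq (derM _ _ _ _ _ amp_dx (derD _ _ _ _ _ (der_sin _ _ _ phase_dx) (derN _ _ _ (der_cos _ _ _ phase_dx)))) _.
by rewrite /kQx /kP /kQ; ring.
Qed.
Lemma kP_dxx : is_derive x (1 : R) (kPx t) (kPxx t x).
Proof.
apply: der_eq (derD _ _ _ _ _ (derM _ _ _ _ _ (derC (g / (t - tau)) x) kP_dx)
  (derN _ _ _ (derM _ _ _ _ _ (derM _ _ _ _ _ dxz (derC (t - tau)^-1 x)) kQ_dx))) _.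
by rewrite /kPxx /kPx /kQx; field.
Qed.
Lemma kQ_dxx : is_derive x (1 : R) (kQx t) (kQxx t x).
Proof.
apply: der_eq (derD _ _ _ _ _ (derM _ _ _ _ _ (derC (g / (t - tau)) x) kQ_dx)
  (derM _ _ _ _ _ (derM _ _ _ _ _ dxz (derC (t - tau)^-1 x)) kP_dx)) _.
by rewrite /kQxx /kPx /kQx; field.
Qed.
Lemma kP_dt : is_derive t (1 : R) (kP ^~ x) (- (2^-1 * kQxx t x)).
Proof.
apply: der_eq (derM _ _ _ _ _ amp_dt (derD _ _ _ _ _ (der_cos _ _ _ phase_dt) (der_sin _ _ _ phase_dt))) _.
by rewrite /kQxx /kP /kQ; field.
Qed.
Lemma kQ_dt : is_derive t (1 : R) (kQ ^~ x) (2^-1 * kPxx t x).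
Proof.
apply: der_eq (derM _ _ _ _ _ amp_dt (derD _ _ _ _ _ (der_sin _ _ _ phase_dt) (derN _ _ _ (der_cos _ _ _ phase_dt)))) _.
by rewrite /kPxx /kP /kQ; field.
Qed.
End Derivatives.
End FreeKernel.

(** * Test functions and the weak free equation *)

Section TestFunctions.
Context {R : realType}.
Local Notation B := (measurableTypeR R).
Local Notation leb := (@lebesgue_measure R).

(** [B * B] carries the product sigma-algebra, so the open preimage of an interval is written as the
    countable union of the rational boxes that it contains. *)
Lemma continuous_measurable2 (f : R * R -> R) : continuous f ->
  measurable_fun setT (f : B * B -> B).
Proof.
move=> /continuousP cf; apply: (measurability _ (RGenOpens.measurableE R)).
move=> _ [_ [a [b ->] <-]]; rewrite setTI.
have oV : open (f @^-1` `]a, b[%classic) by apply: cf; exact: interval_open.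
set V := f @^-1` _ in oV *.
pose box (s : (rat * rat) * (rat * rat)) : set (B * B) :=
  `](ratr s.1.1 : R), (ratr s.1.2 : R)[%classic `*` `](ratr s.2.1 : R), (ratr s.2.2 : R)[%classic.
pose U n : set (B * B) := if unpickle n is Some s then
  if `[< box s `<=` V >] then box s else set0 else set0.
have -> : V = \bigcup_n U n.
  apply/seteqP; split => [[x t] Vp|p [n _]]; last first.
    rewrite /U; case: unpickle => [s|//]; case: asboolP => // h; exact: h.
  have [e /= e0 eV] := (nbhs_ballP _ _).1 (open_nbhs_nbhs (conj oV Vp)).
  have lt1 (z : R) : z - e < z by rewrite ltrBlDr ltrDl.
  have lt2 (z : R) : z < z + e by rewrite ltrDl.
  have [p1 /itvP h1] := rat_in_itvoo (lt1 x). have [q1 /itvP h2] := rat_in_itvoo (lt2 x).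
  have [p2 /itvP h3] := rat_in_itvoo (lt1 t). have [q2 /itvP h4] := rat_in_itvoo (lt2 t).
  have bV : box ((p1, q1), (p2, q2)) `<=` V.
    move=> [x' t'] [] /=; rewrite !in_itv /= => /andP[a1 a2] /andP[a3 a4]; apply: eV.
    split; rewrite /ball /= ltr_distlC.
      by rewrite (lt_trans _ a1) ?h1// (lt_trans a2) ?h2.
    by rewrite (lt_trans _ a3) ?h3// (lt_trans a4) ?h4.
  have UE : U (pickle ((p1, q1), (p2, q2))) = box ((p1, q1), (p2, q2)).
    by rewrite /U pickleK ifT//; exact/asboolP.
  exists (pickle ((p1, q1), (p2, q2))); first by []. rewrite UE; split => /=.
    by rewrite in_itv /= h1 h2.
  by rewrite in_itv /= h3 h4.
apply: bigcupT_measurable => n; rewrite /U; case: unpickle => [s|]; last exact: measurable0.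
by case: ifP => _; [apply: measurableX; exact: measurable_itv|exact: measurable0].
Qed.

Lemma is_derive_dx (f : R * R -> R) (x t : R) : derivable f (x, t) ((1, 0) : R * R) ->
  is_derive x (1 : R) (fun x => f (x, t)) ('D_((1, 0) : R * R) f (x, t)).
Proof.
have E : (fun h : R => h^-1 *: (((fun x => f (x, t)) \o shift x) (h *: (1 : R)) - f (x, t))) =
    (fun h => h^-1 *: ((f \o shift (x, t)) (h *: ((1, 0) : R * R)) - f (x, t))).
  apply/funext => h /=; congr (_ *: (f _ - _)).
  by rewrite /= -[RHS]/(h *: 1 + x, h *: 0 + t) scaler0 add0r.
by move=> df; split; rewrite /derivable /derive E.
Qed.

Lemma is_derive_dt (f : R * R -> R) (x t : R) : derivable f (x, t) ((0, 1) : R * R) ->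
  is_derive t (1 : R) (fun t => f (x, t)) ('D_((0, 1) : R * R) f (x, t)).
Proof.
have E : (fun h : R => h^-1 *: (((fun t => f (x, t)) \o shift t) (h *: (1 : R)) - f (x, t))) =
    (fun h => h^-1 *: ((f \o shift (x, t)) (h *: ((0, 1) : R * R)) - f (x, t))).
  apply/funext => h /=; congr (_ *: (f _ - _)).
  by rewrite /= -[RHS]/(h *: 0 + x, h *: 1 + t) scaler0 add0r.
by move=> df; split; rewrite /derivable /derive E.
Qed.

Lemma derive_vanish (K : set (R * R)) (f : R * R -> R) (v : R * R) : closed K ->
  (forall p, ~ K p -> f p = 0) -> forall p, ~ K p -> 'D_v f p = 0.
Proof.
move=> cK fK p nKp; rewrite /derive; apply/cvg_lim => //.
have oK : open (~` K) by exact: closed_openC.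
have nK : \forall q \near p, ~ K q by apply: open_nbhs_nbhs; split.
have cv : (h *: v + p) @[h --> (0 : R)] --> p.
  rewrite -[X in _ --> X]add0r -(scale0r v).
  by apply: cvgD; [apply: cvgZr_tmp; exact: cvg_id|exact: cvg_cst].
have h0 : \forall h \near (0 : R), ~ K (h *: v + p) by exact: (cv _ nK).
have nz : {near 0^', (fun=> (0 : R)) =1 (fun h : R => h^-1 *: ((f \o shift p) (h *: v) - f p))}.
  by apply: cvg_within; apply: filterS h0 => h /fK /= ->; rewrite fK// subrr scaler0.
by apply: (cvg_trans (near_eq_cvg nz)); exact: cvg_cst.
Qed.


(** What the weak equation uses of a test function: the derivatives that occur in it, the first
    $x$-derivative for integration by parts, one box for all supports, away from $t_0$, and one
    common bound. *)
Record tdata (t0 : R) (phi phix phixx phit : R * R -> R) (X s0 T M : R) : Prop := TData {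
  td_dx : forall x t : R, is_derive x (1 : R) (fun x => phi (x, t)) (phix (x, t)) ;
  td_dxx : forall x t : R, is_derive x (1 : R) (fun x => phix (x, t)) (phixx (x, t)) ;
  td_dt : forall x t : R, is_derive t (1 : R) (fun t => phi (x, t)) (phit (x, t)) ;
  td_c : continuous phi ; td_cx : continuous phix ;
  td_cxx : continuous phixx ; td_ct : continuous phit ;
  td_supp : forall p, ~~ ((`|p.1| < X) && (s0 < p.2 < T)) ->
    [/\ phi p = 0, phix p = 0, phixx p = 0 & phit p = 0] ;
  td_bnd : forall p, [/\ `|phi p| <= M, `|phix p| <= M, `|phixx p| <= M & `|phit p| <= M] ;
  td_X : 0 < X ; td_s0 : t0 < s0 ; td_T : s0 < T ; td_M : 0 < M }.

Lemma compact_bound (K : set (R * R)) (f : R * R -> R) : compact K ->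
  {within K, continuous f} -> exists2 M : R, 0 < M & forall p, K p -> `|f p| < M.
Proof.
move=> cK cf; have := compact_bounded (continuous_compact cf cK).
rewrite /bounded_set /bounded_near => /pinfty_ex_gt0[M M0 hM].
exists (M + 1); first by rewrite addr_gt0.
move=> p Kp; apply: (@le_lt_trans _ _ M); last by rewrite ltrDl.
by apply: hM; exists p.
Qed.

Lemma le_sum4 (a b c d : R) : 0 <= a -> 0 <= b -> 0 <= c -> 0 <= d ->
  [/\ a <= a + b + c + d, b <= a + b + c + d, c <= a + b + c + d & d <= a + b + c + d].
Proof. by move=> *; split; lra. Qed.

Lemma test_function_data (t0 : R) (phi : R * R -> R) : test_function t0 phi ->
  exists X s0 T M, tdata t0 phi ('D_((1, 0) : R * R) phi)
    ('D_((1, 0) : R * R) ('D_((1, 0) : R * R) phi)) ('D_((0, 1) : R * R) phi) X s0 T M.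
Proof.
move=> [Cphi cK sK]; set K := closure _ in cK sK.
have clK : closed K by exact: closed_closure.
have phi0 p : ~ K p -> phi p = 0.
  by move=> nK; apply: contrapT => h; apply: nK; exact: subset_closure.
have dx0 := derive_vanish K phi (1, 0) clK phi0.
have dt0 := derive_vanish K phi (0, 1) clK phi0.
have dxx0 := derive_vanish K _ (1, 0) clK dx0.
have [cphi h2] := Cphi 2%N.
have [dx [cx /(_ (1, 0))[dxx [cxx _]]]] := h2 (1, 0).
have [dt [ct _]] := h2 (0, 1).
have bnd (f : R * R -> R) : continuous f -> (forall p, ~ K p -> f p = 0) ->
    exists2 M : R, 0 < M & forall p, `|f p| <= M.
  move=> cf f0; have [|M M0 hM] := compact_bound K f cK.
    exact: continuous_subspaceT.
  exists M => // p; have [/hM/ltW//|/f0 ->] := pselect (K p).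
  by rewrite normr0 ltW.
have [M1 M10 hM1] := bnd _ cphi phi0.
have [M2 M20 hM2] := bnd _ cx dx0.
have [M3 M30 hM3] := bnd _ cxx dxx0.
have [M4 M40 hM4] := bnd _ ct dt0.
have [|X X0 hX] := compact_bound K fst cK.
  by apply: continuous_subspaceT => p; exact: cvg_fst.
have [|T T0 hT] := compact_bound K snd cK.
  by apply: continuous_subspaceT => p; exact: cvg_snd.
(* A bound on $1/(t-t_0)$ over the compact support keeps it at distance [N^-1] from the initial
   time. *)
have [|N N0 hN] := compact_bound K (fun p => (p.2 - t0)^-1) cK.
  apply: continuous_in_subspaceT => p; rewrite inE => /sK /= tp.
  apply: cvgV; first by rewrite gt_eqF// subr_gt0.
  by apply: cvgB; [exact: cvg_snd|exact: cvg_cst].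
have iN : 0 < N^-1 by rewrite invr_gt0.
(* The terms added to [T] make the upper end exceed the lower one even if the support is empty. *)
have box p : ~~ ((`|p.1| < X) && (t0 + N^-1 < p.2 < T + `|t0 + N^-1| + 1)) -> ~ K p.
  move=> + Kp => /negP; apply; rewrite hX//=; apply/andP; split.
    have tp : 0 < p.2 - t0 by rewrite subr_gt0; exact: sK.
    have := hN _ Kp; rewrite gtr0_norm ?invr_gt0// => h.
    by rewrite addrC -ltrBrDr -[ltRHS]invrK ltf_pV2 ?posrE ?invr_gt0.
  have := hT _ Kp; have := ler_norm p.2; have := normr_ge0 (t0 + N^-1); lra.
exists X, (t0 + N^-1), (T + `|t0 + N^-1| + 1), (M1 + M2 + M3 + M4).
have [s1 s2 s3 s4] := le_sum4 _ _ _ _ (ltW M10) (ltW M20) (ltW M30) (ltW M40).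
split.
- by move=> x t; apply: is_derive_dx; exact: dx.
- by move=> x t; apply: is_derive_dx; exact: dxx.
- by move=> x t; apply: is_derive_dt; exact: dt.
- exact: cphi.
- exact: cx.
- exact: cxx.
- exact: ct.
- by move=> p /box nK; split; [exact: phi0|exact: dx0|exact: dxx0|exact: dt0].
- move=> p; split; [exact: le_trans (hM1 p) s1|exact: le_trans (hM2 p) s2|
    exact: le_trans (hM3 p) s3|exact: le_trans (hM4 p) s4].
- exact: X0.
- by rewrite ltrDl.
- apply: le_lt_trans (ler_norm _) _; rewrite addrAC -[ltLHS]add0r ltrD2r.
  by rewrite addr_gt0.
- by rewrite !addr_gt0.
Qed.

(** For integrands such as $(t-\tau)^{-1/2}$ that blow up at an end. The fundamental theorem is used
    on closed subintervals exhausting the open one, and monotone convergence passes to the limit;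
    only the increments of the primitive have to be bounded. *)
Lemma ge0_integral_derive_le (F f : R -> R) (a b K : R) : a < b ->
  (forall x : R, a < x < b -> is_derive x (1 : R) F (f x)) ->
  (forall x : R, a < x < b -> 0 <= f x) ->
  (forall x : R, a < x < b -> {for x, continuous f}) ->
  (forall x y : R, a < x -> x <= y -> y < b -> F y - F x <= K) ->
  measurable_fun `]a, b[ f ->
  (\int[leb]_(x in `]a, b[) (f x)%:E <= K%:E)%E.
Proof.
move=> ab dF f0 cf FK mf.
pose d n : R := (b - a) / 2 / n.+1%:R.
have d0 n : 0 < d n by rewrite !divr_gt0 ?subr_gt0.
have d1 n : d n <= (b - a) / 2.
  by rewrite /d ler_pdivrMr// ler_peMr ?ler1n// divr_ge0 ?subr_ge0 ?ltW.
pose S n : set R := `[a + d n, b - d n]%classic.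
have US : `]a, b[%classic = \bigcup_n S n.
  apply/seteqP; split => [x|x [n _]]; rewrite /S /= !in_itv /=; last first.
    by move=> /andP[h1 h2]; have := d0 n; lra.
  move=> /andP[ax xb]; pose e := Num.min (x - a) (b - x).
  have e0 : 0 < e by rewrite lt_min !subr_gt0 ax.
  pose n := Num.truncn ((b - a) / 2 / e); exists n => //=.
  have dn : d n < e.
    have h : (b - a) / 2 / e < n.+1%:R.
      have e1 : 0 <= (b - a) / 2 / e by rewrite !divr_ge0 ?subr_ge0 ?ltW.
      by have /andP[] := truncn_itv e1.
    move: h; rewrite (ltr_pdivrMr _ _ e0) => h.
    by rewrite /d (ltr_pdivrMr _ _ (ltr0Sn _ _)) [e * _]mulrC.
  move: dn; rewrite lt_min /S /= in_itv /= => /andP[]; lra.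
have mS n : measurable (S n : set B) by exact: measurable_itv.
have Sab n x : S n x -> a < x < b.
  by rewrite /S /= in_itv /= => /andP[h1 h2]; have := d0 n; lra.
have abd n : a + d n <= b - d n by have := d1 n; lra.
have iS n : ((\int[leb]_(x in S n) (f x)%:E) <= K%:E)%E.
  have cS : {within S n, continuous f}.
    by apply: continuous_in_subspaceT => x; rewrite inE => /Sab; exact: cf.
  have := ftc_within F f _ _ (abd n) cS.
  have -> : (\int[leb]_(x in S n) (f x)%:E = (\int[leb]_(x in S n) f x)%R%:E)%E.
    by rewrite /Rintegral fineK//; apply: integrable_fin_num => //;
       apply: continuous_compact_integrable => //; exact: segment_compact.
  move=> E; have -> : \int[leb]_(x in S n) f x = F (b - d n) - F (a + d n); last first.
    by rewrite lee_fin; apply: FK; rewrite ?abd//; have := d0 n; lra.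
  apply: E.
  - by move=> x h; apply: dF; have := d0 n; lra.
  - apply: continuous_in_subspaceT => x; rewrite inE => /Sab h.
    exact: der_continuous (dF _ h).
have ndS : {homo S : n m / (n <= m)%N >-> (n <= m)%O}.
  move=> n m nm; apply/subsetPset => x; rewrite /S /= !in_itv /= => /andP[h1 h2].
  have : d m <= d n by rewrite /d ler_pM2l ?divr_gt0 ?subr_gt0// lef_pV2 ?posrE// ler_nat.
  by move=> dmn; apply/andP; split; lra.
have mSf n : measurable_fun (S n : set B) (fun x : B => (f x)%:E).
  apply/measurable_EFinP; apply: measurable_funS mf; first exact: measurable_itv.
  by move=> x /Sab; rewrite /= in_itv.
have f0' n (x : B) : S n x -> (0 <= (f x)%:E)%E by move=> /Sab h; rewrite lee_fin f0.
rewrite US; have c := @ge0_nondecreasing_set_cvg_integral _ B R S (fun x => (f x)%:E) leb ndS mS mSf f0'.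
by apply: (cvge_to_le c); apply: nearW => n; exact: iS.
Qed.

Lemma continuous_fst_slice (f : R * R -> R) (t : R) : continuous f -> continuous (fun x => f (x, t)).
Proof.
move=> cf x; apply: (@continuous_comp _ _ _ (fun x : R => (x, t)) f); last exact: cf.
exact: (@cvg_pair _ _ _ (nbhs x) (nbhs x) (nbhs t) _ _ _ (fun x : R => x) (fun=> t) cvg_id (cvg_cst _)).
Qed.
Lemma continuous_snd_slice (f : R * R -> R) (x : R) : continuous f -> continuous (fun t => f (x, t)).
Proof.
move=> cf t; apply: (@continuous_comp _ _ _ (fun t : R => (x, t)) f); last exact: cf.
exact: (@cvg_pair _ _ _ (nbhs t) (nbhs x) (nbhs t) _ _ _ (fun=> x) (fun x : R => x) (cvg_cst _) cvg_id).
Qed.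

Local Notation C := R[i].
Lemma cintR d (U : measurableType d) (mu : {measure set U -> \bar R}) (h : U -> R) :
  cint mu (fun x => (h x)%:C) = (\int[mu]_x h x)%:C.
Proof. by apply: eqC => //=; rewrite /Rintegral integral0. Qed.

Lemma Rintegral_support d (U : measurableType d) (mu : {measure set U -> \bar R}) (D : set U) (h : U -> R) :
  measurable D -> (forall x, ~ D x -> h x = 0) -> \int[mu]_x h x = \int[mu]_(x in D) h x.
Proof.
move=> mD hD; rewrite [RHS]Rintegral_mkcond; apply: eq_Rintegral => x _.
by rewrite patchE; case: ifPn => // /negP; rewrite inE => /hD.
Qed.

Lemma dom_fubini (f : B * B -> C) (u v : R -> R) : cmeas f ->
  (forall x t, norm1 (f (x, t)) <= u x * v t) -> (forall x, 0 <= u x) -> (forall t, 0 <= v t) ->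
  measurable_fun setT (u : B -> B) -> measurable_fun setT (v : B -> B) ->
  (\int[leb]_x (u x)%:E < +oo)%E -> (\int[leb]_t (v t)%:E < +oo)%E ->
  (\int[leb]_x nint leb (fun t => f (x, t)) < +oo)%E.
Proof.
move=> mf fuv u0 v0 mu mv uy vy.
have v0' : (0 <= \int[leb]_t (v t)%:E)%E by apply: integral_ge0 => t _; rewrite lee_fin.
have u0' : (0 <= \int[leb]_t (u t)%:E)%E by apply: integral_ge0 => t _; rewrite lee_fin.
apply: (@le_lt_trans _ _ (\int[leb]_x ((u x)%:E * \int[leb]_t (v t)%:E))%E); last first.
  rewrite ge0_integralZr//; last 2 first.
  - exact/measurable_EFinP.
  - by move=> x _; rewrite lee_fin.
  by rewrite lte_mul_pinfty// ge0_fin_numE.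
have mn : measurable_fun setT (fun x : B => nint leb (fun t => f (x, t))).
  apply: (measurable_fun_fubini_tonelli_F (fun z : B * B => (norm1 (f z))%:E)) => //.
    exact: emeasurable_norm1.
  by move=> z; rewrite lee_fin norm1_ge0.
apply: ge0_le_integral => //.
- by move=> x _; exact: nint_ge0.
- by apply: emeasurable_funM => //; exact/measurable_EFinP.
- move=> x _; rewrite -ge0_integralZl//; last 3 first.
  + exact/measurable_EFinP.
  + by move=> t _; rewrite lee_fin.
  + by rewrite lee_fin.
  apply: ge0_le_integral => //.
  + by move=> t _; rewrite lee_fin norm1_ge0.
  + apply: emeasurable_norm1; apply: (cmeas_comp _ _ _ _ f (fun t => (x, t))) => //.
    exact: pair1_measurable.
  + by apply/measurable_EFinP; exact: measurable_funM.
  + by move=> t _; rewrite -EFinM lee_fin.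
Qed.

Lemma measurable_dom (D : set R) (L : R) : measurable (D : set B) ->
  measurable_fun setT (fun x : B => L * \1_D x).
Proof. by move=> mD; apply: measurable_funM => //; exact: measurable_indic. Qed.
Lemma integral_dom (a b L : R) : 0 <= L -> (\int[leb]_x (L * \1_(`[a, b]%classic) x)%:E < +oo)%E.
Proof.
move=> L0; under eq_integral do rewrite EFinM.
rewrite ge0_integralZl//.
- rewrite integral_indic// setIT.
  rewrite [X in (_ * X < _)%E](_ : _ = @lebesgue_measure R [set` `[a, b]%R]); last by [].
  rewrite lebesgue_measure_itv/=.
  case: ifP => _; rewrite ?mule0//.
  by rewrite -EFinB -EFinM ltry.
by apply/measurable_EFinP; exact: measurable_indic.
Qed.

Section WeakReal.
Variables (t0 : R) (phi phix phixx phit : R * R -> R) (X s0 T M : R).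
Hypothesis td : tdata t0 phi phix phixx phit X s0 T M.
Variables (P Px Pxx Q : R -> R -> R) (sg N : R).
Hypothesis dP : forall t x : R, sg <= t -> is_derive x (1 : R) (P t) (Px t x).
Hypothesis dPx : forall t x : R, sg <= t -> is_derive x (1 : R) (Px t) (Pxx t x).
Hypothesis cPxx : forall t : R, sg <= t -> continuous (Pxx t).
Hypothesis dQ : forall t x : R, sg <= t -> is_derive t (1 : R) (Q ^~ x) (2^-1 * Pxx t x).
Hypothesis cPxxt : forall t x : R, sg <= t -> {for t, continuous (Pxx ^~ x)}.
Hypothesis mP : measurable_fun setT (fun p : B * B => P p.2 p.1).
Hypothesis mPxx : measurable_fun setT (fun p : B * B => Pxx p.2 p.1).
Hypothesis mQ : measurable_fun setT (fun p : B * B => Q p.2 p.1).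
Hypothesis bnd : forall t x : R, sg <= t <= T -> `|x| <= X ->
  [/\ `|P t x| <= N, `|Pxx t x| <= N & `|Q t x| <= N].

(** The tested expression $\frac12P\phi_{xx}+Q\phi_t$ is [f1 + f2]. The first summand is an
    $x$-derivative and integrates to 0 in $x$; the second is $\partial_t(Q\phi)$ and leaves the
    boundary value at [sg]. The two are integrated in opposite orders. *)
Let f1 (p : B * B) : R := if sg < p.2 then 2^-1 * (P p.2 p.1 * phixx p - Pxx p.2 p.1 * phi p) else 0.
Let f2 (p : B * B) : R := if sg < p.2 then 2^-1 * Pxx p.2 p.1 * phi p + Q p.2 p.1 * phit p else 0.

Let msg : measurable_fun setT (fun p : B * B => sg < p.2).
Proof. by apply: measurable_fun_ltr => //; exact: measurable_snd. Qed.
Let mphi := continuous_measurable2 phi (td_c _ _ _ _ _ _ _ _ _ td).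
Let mphixx := continuous_measurable2 phixx (td_cxx _ _ _ _ _ _ _ _ _ td).
Let mphit := continuous_measurable2 phit (td_ct _ _ _ _ _ _ _ _ _ td).

Let mf1 : measurable_fun setT f1.
Proof.
apply: measurable_fun_ifT => //; apply: measurable_funM => //.
by apply: measurable_funB; exact: measurable_funM.
Qed.
Let mf2 : measurable_fun setT f2.
Proof.
apply: measurable_fun_ifT => //; apply: measurable_funD; last exact: measurable_funM.
by apply: measurable_funM => //; exact: measurable_funM.
Qed.

Let N0 : sg <= T -> 0 <= N.
Proof.
move=> sT; have [| |h _ _] := bnd T 0; last exact: le_trans h.
- by rewrite sT lexx.
- by rewrite normr0 ltW// (td_X _ _ _ _ _ _ _ _ _ td).
Qed.

Let cf (f : B * B -> R) : measurable_fun setT f ->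
  (forall p, `|p.1| <= X -> sg <= p.2 <= T -> `|f p| <= 4 * (N * M)) ->
  (forall p, ~~ [&& `|p.1| < X, s0 < p.2 < T & sg < p.2] -> f p = 0) ->
  (\int[leb]_x nint leb (fun t => (f (x, t))%:C) < +oo)%E.
Proof.
move=> mf fb f0.
have M0 := td_M _ _ _ _ _ _ _ _ _ td.
have [Tsg|sgT] := leP T sg.
  rewrite integral0_eq// => x _; rewrite /nint integral0_eq// => t _.
  rewrite f0 ?norm10//=; apply/negP => /and3P[_ /andP[_ h1] h2].
  by have := lt_le_trans h1 Tsg; rewrite ltNge ltW.
have NM : 0 <= 4 * (N * M) by rewrite !mulr_ge0 ?N0// ltW.
apply: (dom_fubini (fun p => (f p)%:C) (fun x => 4 * (N * M) * \1_(`[- X, X]%classic) x) (fun t => 1 * \1_(`[sg, T]%classic) t)).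
- exact: cmeasR.
- move=> x t; rewrite norm1R !indicE mul1r !mem_setE !in_itv /=.
  have [/and3P[h1 /andP[h2 h3] h4]|h] := boolP [&& `|x| < X, s0 < t < T & sg < t].
    have h5 : `|x| <= X by exact: ltW.
    by rewrite -ler_norml h5 (ltW h4) (ltW h3) /= !mulr1; apply: fb => //=; rewrite !ltW.
  by rewrite (f0 (x, t) h) normr0; apply: mulr_ge0; [apply: mulr_ge0|].
- by move=> x; rewrite mulr_ge0.
- by move=> x; rewrite mulr_ge0.
- by apply: measurable_dom; exact: measurable_itv.
- by apply: measurable_dom; exact: measurable_itv.
- exact: integral_dom.
- exact: integral_dom.
Qed.

Let supp (p : R * R) : ~~ [&& `|p.1| < X, s0 < p.2 < T & sg < p.2] ->
  (sg < p.2) = false \/ (phi p = 0 /\ phixx p = 0 /\ phit p = 0).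
Proof.
rewrite andbA negb_and => /orP[|/negbTE]; last by left.
by move=> /(td_supp _ _ _ _ _ _ _ _ _ td)[? _ ? ?]; right.
Qed.

Let cf1 : (\int[leb]_x nint leb (fun t => (f1 (x, t))%:C) < +oo)%E.
Proof.
apply: cf => // [p px pt|p /supp]; last first.
  by rewrite /f1 => -[->//|[-> [-> _]]]; rewrite !mulr0 subrr mulr0 if_same.
have [h1 h2 _] := bnd _ _ pt px; have [h3 _ h4 _] := td_bnd _ _ _ _ _ _ _ _ _ td p.
have a1 : `|P p.2 p.1 * phixx p| <= N * M by rewrite normrM ler_pM.
have a2 : `|Pxx p.2 p.1 * phi p| <= N * M by rewrite normrM ler_pM.
have NM : 0 <= N * M by apply: le_trans a1; exact: normr_ge0.
rewrite /f1; case: ifP => _; last by rewrite normr0 mulr_ge0.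
rewrite normrM; have := ler_normB (P p.2 p.1 * phixx p) (Pxx p.2 p.1 * phi p).
rewrite (ger0_norm (_ : 0 <= 2^-1 :> R))//; lra.
Qed.
Let cf2 : (\int[leb]_x nint leb (fun t => (f2 (x, t))%:C) < +oo)%E.
Proof.
apply: cf => // [p px pt|p /supp]; last first.
  by rewrite /f2 => -[->//|[-> [_ ->]]]; rewrite !mulr0 addr0 if_same.
have [h1 h2 h5] := bnd _ _ pt px; have [h3 _ _ h4] := td_bnd _ _ _ _ _ _ _ _ _ td p.
have a1 : `|Q p.2 p.1 * phit p| <= N * M by rewrite normrM ler_pM.
have a2 : `|Pxx p.2 p.1 * phi p| <= N * M by rewrite normrM ler_pM.
have NM : 0 <= N * M by apply: le_trans a1; exact: normr_ge0.
rewrite /f2; case: ifP => _; last by rewrite normr0 mulr_ge0.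
have := ler_normD (2^-1 * Pxx p.2 p.1 * phi p) (Q p.2 p.1 * phit p).
rewrite -mulrA normrM (ger0_norm (_ : 0 <= 2^-1 :> R))//; lra.
Qed.

Let int_f1 (t : R) : cint leb (fun x => (f1 (x, t))%:C) = 0.
Proof.
have [st|st] := ltP sg t; last first.
  by rewrite -[RHS](cint0 leb) ; apply: eq_cint => x; rewrite /f1 /= ltNge st.
rewrite cintR (Rintegral_support _ B leb `[- X, X]%classic)//; last first.
  move=> x /= nx; have [h1 _ h2 _] : [/\ phi (x, t) = 0, phix (x, t) = 0, phixx (x, t) = 0 & phit (x, t) = 0].
    apply: (td_supp _ _ _ _ _ _ _ _ _ td); apply/negP => /andP[/= xX _]; apply: nx.
    by rewrite in_itv /= -ler_norml ltW.
  by rewrite /f1 /= h1 h2 !mulr0 subrr mulr0 if_same.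
have X0 := td_X _ _ _ _ _ _ _ _ _ td.
pose g x := 2^-1 * (P t x * phixx (x, t) - Pxx t x * phi (x, t)).
transitivity ((\int[leb]_(x in `[- X, X]) g x)%:C).
  by congr (_%:C); apply: eq_Rintegral => x _; rewrite /f1 /= st.
have dF (x : R) : is_derive x (1 : R) (fun x => 2^-1 * (P t x * phix (x, t) - Px t x * phi (x, t))) (g x).
  apply: der_eq (derM _ _ _ _ _ (derC 2^-1 x) (derD _ _ _ _ _
    (derM _ _ _ _ _ (dP t x (ltW st)) (td_dxx _ _ _ _ _ _ _ _ _ td x t))
    (derN _ _ _ (derM _ _ _ _ _ (dPx t x (ltW st)) (td_dx _ _ _ _ _ _ _ _ _ td x t))))) _.
  by rewrite /g; ring.
rewrite (ftcT _ g _ _ _ _ dF).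
- have z (x : R) : `|x| = X -> phi (x, t) = 0 /\ phix (x, t) = 0.
    move=> xX; have [] // := td_supp _ _ _ _ _ _ _ _ _ td (x, t).
    by rewrite /= xX ltxx.
  have [-> ->] := z X (gtr0_norm X0); have [|-> ->] := z (- X); first by rewrite normrN gtr0_norm.
  by apply: eqC => //=; ring.
- lra.
- move=> x; apply: cvgM; first exact: cvg_cst.
  apply: cvgB; apply: cvgM.
  + exact: der_continuous (dP t x (ltW st)).
  + exact: (continuous_fst_slice _ _ (td_cxx _ _ _ _ _ _ _ _ _ td)).
  + exact: cPxx (ltW st) x.
  + exact: (continuous_fst_slice _ _ (td_c _ _ _ _ _ _ _ _ _ td)).
Qed.

Let int_f2 (x : R) : cint leb (fun t => (f2 (x, t))%:C) = - (Q sg x * phi (x, sg))%:C.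
Proof.
have zT (t : R) : T <= t -> phi (x, t) = 0 /\ phit (x, t) = 0.
  move=> xX; have [] // := td_supp _ _ _ _ _ _ _ _ _ td (x, t).
  by rewrite /= [t < T]ltNge xX !andbF.
have [Tsg|sgT] := leP T sg.
  have [-> _] := zT _ Tsg; rewrite mulr0 oppr0 -[RHS](cint0 leb); apply: eq_cint => t.
  rewrite /f2 /=; case: ltP => // st.
  by have [-> ->] := zT _ (le_trans Tsg (ltW st)); rewrite !mulr0 addr0.
rewrite cintR (Rintegral_support _ B leb `]sg, T]%classic)//; last first.
  move=> t /= nt; rewrite /f2 /=; case: ltP => // st.
  have [|-> ->] := zT t; last by rewrite !mulr0 addr0.
  by rewrite leNgt; apply/negP => tT; apply: nt; rewrite in_itv /= st ltW.
pose g t := 2^-1 * Pxx t x * phi (x, t) + Q t x * phit (x, t).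
have cg (t : R) : sg <= t -> {for t, continuous g}.
  move=> st; apply: cvgD; apply: cvgM.
  + by apply: cvgM; [exact: cvg_cst|exact: cPxxt].
  + exact: (continuous_snd_slice _ _ (td_c _ _ _ _ _ _ _ _ _ td)).
  + exact: der_continuous (dQ t x st).
  + exact: (continuous_snd_slice _ _ (td_ct _ _ _ _ _ _ _ _ _ td)).
have cg' : {within `[sg, T], continuous g}.
  by apply: continuous_in_subspaceT => t; rewrite inE /= in_itv /= => /andP[/cg].
transitivity ((\int[leb]_(t in `[sg, T]) g t)%:C).
  congr (_%:C); rewrite -Rintegral_itv_obnd_cbnd.
    by apply: eq_Rintegral => t; rewrite inE /= in_itv /= => /andP[st _]; rewrite /f2 /= st.
  apply: integrableS (continuous_compact_integrable (@segment_compact _ _ _) cg') => //.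
  by move=> t; rewrite /= !in_itv /= => /andP[/ltW -> ->].
have dF (t : R) : sg <= t -> is_derive t (1 : R) (fun t => Q t x * phi (x, t)) (g t).
  move=> st; apply: der_eq (derM _ _ _ _ _ (dQ t x st) (td_dt _ _ _ _ _ _ _ _ _ td x t)) _.
  by rewrite /g; ring.
have -> : \int[leb]_(t in `[sg, T]) g t = Q T x * phi (x, T) - Q sg x * phi (x, sg); last first.
  have [-> _] := zT T (lexx _); by apply: eqC => //=; ring.
apply: (ftc_within (fun t => Q t x * phi (x, t)) g _ _ (ltW sgT) cg').
- by move=> t /andP[/ltW st _]; exact: dF.
- apply: continuous_in_subspaceT => t; rewrite inE /= in_itv /= => /andP[st _].
  exact: der_continuous (dF t st).
Qed.

(** One real component of the free equation, tested after the time [sg]. It will be applied to the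
    pair of the real and imaginary part of the kernel, and to the pair of the imaginary part and
    minus the real part. *)
Lemma weak_real : cint leb (fun x => cint leb (fun t =>
   (if sg < t then 2^-1 * P t x * phixx (x, t) + Q t x * phit (x, t) else 0)%:C)) =
  cint leb (fun x => - (Q sg x * phi (x, sg))%:C).
Proof.
have [c1 _ e1] := cint_prod leb leb (fun p => (f1 p)%:C) (cmeasR _ mf1) cf1.
have [c2 e2 _] := cint_prod leb leb (fun p => (f2 p)%:C) (cmeasR _ mf2) cf2.
have mf12 : measurable_fun setT (fun p => f1 p + f2 p) by exact: measurable_funD.
have f12E p : f1 p + f2 p = if sg < p.2 then 2^-1 * P p.2 p.1 * phixx p + Q p.2 p.1 * phit p else 0.
  by rewrite /f1 /f2; case: ifP => _; [ring|rewrite addr0].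
have cf12 : (\int[leb]_x nint leb (fun t => (f1 (x, t) + f2 (x, t))%:C) < +oo)%E.
  apply: (cf (fun p => f1 p + f2 p)) => // [p px pt|p /supp]; last first.
    by rewrite f12E => -[->//|[_ [-> ->]]]; rewrite !mulr0 addr0 if_same.
  have [h1 h2 h5] := bnd _ _ pt px; have [h3 _ h4 h6] := td_bnd _ _ _ _ _ _ _ _ _ td p.
  have a1 : `|Q p.2 p.1 * phit p| <= N * M by rewrite normrM ler_pM.
  have a2 : `|P p.2 p.1 * phixx p| <= N * M by rewrite normrM ler_pM.
  have NM : 0 <= N * M by apply: le_trans a1; exact: normr_ge0.
  rewrite f12E; case: ifP => _; last by rewrite normr0 mulr_ge0.
  have := ler_normD (2^-1 * P p.2 p.1 * phixx p) (Q p.2 p.1 * phit p).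
  rewrite -mulrA normrM (ger0_norm (_ : 0 <= 2^-1 :> R))//; lra.
have [_ e12 _] := cint_prod leb leb (fun p => (f1 p + f2 p)%:C) (cmeasR _ mf12) cf12.
transitivity (cint leb (fun x => cint leb (fun t => (f1 (x, t) + f2 (x, t))%:C))).
  by apply: eq_cint => x; apply: eq_cint => t; rewrite f12E.
rewrite -e12 (eq_cint _ _ (fun p => (f1 p)%:C + (f2 p)%:C)); last by move=> p; rewrite rmorphD.
rewrite cintD// e1 e2 (eq_cint _ _ (fun=> 0)) ?cint0 ?add0r; last by move=> t; exact: int_f1.
by apply: eq_cint => x; exact: int_f2.
Qed.
End WeakReal.
End TestFunctions.

(** * Bounds for the free kernel, and its weak equation away from the singular time *)

Section KernelEstimates.
Context {R : realType}.
Local Notation C := R[i].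
Local Notation Re := complex.Re.
Local Notation Im := complex.Im.
Local Notation B := (measurableTypeR R).
Local Notation leb := (@lebesgue_measure R).

(** There is no continuity at 0, but on each half-line the inverse is, up to sign, an exponential of
    a logarithm. *)
Lemma measurable_inv : measurable_fun setT (fun x : B => x^-1 : B).
Proof.
have mln : measurable_fun setT (@ln R : B -> B) by exact: measurable_ln.
have m1 : measurable_fun setT (fun x : B => expR (- ln x)).
  by apply: measurableT_comp => //; exact: measurable_funN.
have m2 : measurable_fun setT (fun x : B => - expR (- ln (- x))).
  apply: measurable_funN; apply: measurableT_comp => //; apply: measurable_funN.
  by apply: measurableT_comp => //; exact: measurable_funN.
rewrite (_ : (fun x : B => x^-1 : B) = fun x => if 0 < x then expR (- ln x) else
   if x < 0 then - expR (- ln (- x)) else 0).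
  apply: measurable_fun_ifT => //; first exact: measurable_fun_ltr.
  by apply: measurable_fun_ifT => //; exact: measurable_fun_ltr.
apply/funext => x; case: (ltrgtP x 0) => [x0|x0|->]; last by rewrite invr0.
  by rewrite expRN lnK ?posrE ?oppr_gt0// invrN opprK.
by rewrite expRN lnK.
Qed.

Lemma measurable_invf d (U : measurableType d) (f : U -> R) : measurable_fun setT (f : U -> B) ->
  measurable_fun setT (fun x => (f x)^-1 : B).
Proof. by move=> mf; exact: (measurableT_comp measurable_inv mf). Qed.

Lemma measurable_amp d (U : measurableType d) (g D b : U -> R) :
  measurable_fun setT (g : U -> B) -> measurable_fun setT (D : U -> B) ->
  measurable_fun setT (b : U -> B) -> measurable_fun setT (fun u => amp (g u) (D u) (b u) : B).
Proof.
move=> mg mD mb; apply: measurable_funM => //.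
have mln : measurable_fun setT (fun u => ln (D u)) by exact: (measurableT_comp (@measurable_ln R) mD).
apply: measurableT_comp => //; apply: measurable_funB.
  by apply: measurable_funM; [exact: measurable_funM|exact: measurable_invf].
by apply: measurable_funM.
Qed.

Lemma measurable_phase d (U : measurableType d) (g D b : U -> R) :
  measurable_fun setT (g : U -> B) -> measurable_fun setT (D : U -> B) ->
  measurable_fun setT (b : U -> B) -> measurable_fun setT (fun u => phase (g u) (D u) (b u) : B).
Proof.
move=> mg mD mb; apply: measurable_funM => //.
  by apply: measurable_funB; exact: measurable_funX.
by apply: measurable_invf; exact: measurable_funM.
Qed.

Lemma measurable_cos_comp d (U : measurableType d) (f : U -> R) :
  measurable_fun setT (f : U -> B) -> measurable_fun setT (fun u => cos (f u) : B).
Proof.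
move=> mf; apply: (@measurableT_comp _ _ _ _ _ _ cos) => //.
by apply: continuous_measurable_fun; exact: continuous_cos.
Qed.
Lemma measurable_sin_comp d (U : measurableType d) (f : U -> R) :
  measurable_fun setT (f : U -> B) -> measurable_fun setT (fun u => sin (f u) : B).
Proof.
move=> mf; apply: (@measurableT_comp _ _ _ _ _ _ sin) => //.
by apply: continuous_measurable_fun; exact: continuous_sin.
Qed.

Lemma cmeas_kernel d (U : measurableType d) (g D b : U -> R) :
  measurable_fun setT (g : U -> B) -> measurable_fun setT (D : U -> B) ->
  measurable_fun setT (b : U -> B) ->
  cmeas (fun u => if 0 < D u then kernel (g u) (D u) (b u) else 0).
Proof.
move=> mg mD mb.
have ma := measurable_amp _ _ _ _ _ mg mD mb.
have mp := measurable_phase _ _ _ _ _ mg mD mb.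
apply: (cmeas_eq (fun u => if 0 < D u then
    (amp (g u) (D u) (b u) * (cos (phase (g u) (D u) (b u)) + sin (phase (g u) (D u) (b u)))) +i*
    (amp (g u) (D u) (b u) * (sin (phase (g u) (D u) (b u)) - cos (phase (g u) (D u) (b u)))) else 0) _).
  by move=> u; case: ifP => // h; rewrite kernelE.
apply: cmeas_if; [exact: measurable_fun_ltr| |exact: cmeas_cst].
have mc := measurable_cos_comp _ _ _ mp; have ms := measurable_sin_comp _ _ _ mp.
split => /=; apply: measurable_funM => //; first exact: measurable_funD.
exact: measurable_funB.
Qed.

Lemma sqrt_pi_ge1 : 1 <= Num.sqrt (pi : R).
Proof. by rewrite -[leLHS]sqrtr1 ler_wsqrtr// (le_trans _ (@pi_ge2 R))// ler1n. Qed.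

Lemma ampE (g D b : R) : 0 < D ->
  amp g D b = (2 * Num.sqrt pi)^-1 * (Num.sqrt D)^-1 * expR (b * g / D).
Proof.
move=> D0.
have E : Num.sqrt D = expR (ln D / 2).
  rewrite -[LHS]lnK ?posrE ?sqrtr_gt0//; congr expR.
  have -> : ln D = 2 * ln (Num.sqrt D).
    by rewrite -[in LHS](sqr_sqrtr (ltW D0)) expr2 lnM ?posrE ?sqrtr_gt0//; ring.
  by field.
rewrite /amp expRD expRN E; field.
by rewrite !gt_eqF ?expR_gt0 ?sqrt_pi_gt0.
Qed.

Lemma amp_ge0 (g D b : R) : 0 <= amp g D b.
Proof. by rewrite divr_ge0 ?expR_ge0// mulr_ge0// sqrtr_ge0. Qed.

Lemma amp_le (g D b : R) : 0 < D -> 2 * amp g D b <= (Num.sqrt D)^-1 * expR (b * g / D).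
Proof.
move=> D0; rewrite ampE// (_ : 2 * _ = (2 * (2 * Num.sqrt pi)^-1) * ((Num.sqrt D)^-1 * expR (b * g / D))); last by ring.
apply: ler_piMl; first by rewrite mulr_ge0 ?invr_ge0 ?sqrtr_ge0 ?expR_ge0.
have := sqrt_pi_ge1; have := sqrt_pi_gt0 (R := R) => s0 s1.
by rewrite -[leLHS](_ : (Num.sqrt pi)^-1 = _) ?invf_le1//; field; rewrite gt_eqF.
Qed.

Lemma kernel_parts (g D b : R) : 0 < D ->
  `|Re (kernel g D b)| <= 2 * amp g D b /\ `|Im (kernel g D b)| <= 2 * amp g D b.
Proof.
move=> D0; rewrite kernelE//=; have a0 := amp_ge0 g D b.
have := cos_max (phase g D b); have := sin_max (phase g D b) => h1 h2.
rewrite !(normrM (amp g D b)) !(ger0_norm a0) [2 * _]mulrC.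
split; rewrite ler_wpM2l//.
  by have := ler_normD (cos (phase g D b)) (sin (phase g D b)); lra.
by have := ler_normB (sin (phase g D b)) (cos (phase g D b)); lra.
Qed.

Lemma norm1_kernel (g D b : R) : 0 < D ->
  norm1 (kernel g D b) <= 2 * ((Num.sqrt D)^-1 * expR (b * g / D)).
Proof.
move=> D0; have [h1 h2] := kernel_parts g D b D0; have := amp_le g D b D0.
by rewrite /norm1; lra.
Qed.

Lemma Rdominated d (U : measurableType d) (mu : {measure set U -> \bar R}) (D : set U)
    (f_ : nat -> U -> R) (f g : U -> R) : measurable D ->
  (forall n, measurable_fun D (f_ n)) -> measurable_fun D f ->
  (forall x, D x -> f_ ^~ x @ \oo --> f x) -> (forall n x, D x -> `|f_ n x| <= g x) ->
  measurable_fun D g -> (\int[mu]_(x in D) (g x)%:E < +oo)%E ->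
  (fun n => \int[mu]_(x in D) f_ n x) @ \oo --> \int[mu]_(x in D) f x.
Proof.
move=> mD mf_ mf ff fg mg gy.
have ig : mu.-integrable D (EFin \o g).
  apply/integrableP; split; first exact/measurable_EFinP.
  apply: le_lt_trans gy; apply: ge0_le_integral => //.
  - by apply: measurableT_comp => //; exact/measurable_EFinP.
  - exact/measurable_EFinP.
  - by move=> x Dx /=; rewrite lee_fin ger0_norm// (le_trans _ (fg 0%N x Dx)).
have [|||||h1 _ h3] := @dominated_convergence _ U R mu D mD
   (fun n x => (f_ n x)%:E) (EFin \o f) (EFin \o g).
- by move=> n; exact/measurable_EFinP.
- exact/measurable_EFinP.
- by apply: aeW => x Dx; apply: cvg_EFin; [exact: nearW|exact: ff].
- exact: ig.
- by apply: aeW => x n Dx /=; rewrite lee_fin; exact: fg.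
apply: fine_cvg; rewrite /Rintegral fineK//.
exact: integrable_fin_num h1.
Qed.

Section Weak.
Variables (t0 : R) (phi phix phixx phit : R * R -> R) (X s0 T M : R).
Hypothesis td : tdata t0 phi phix phixx phit X s0 T M.
Variables (g tau z sg : R).
Hypothesis tausg : tau < sg.

Let ltt t : sg <= t -> tau < t. Proof. exact: lt_le_trans. Qed.
Let cx t x : sg <= t -> {for x, continuous (kP g tau z t)}.
Proof. by move=> /ltt st; exact: der_continuous (kP_dx g tau z t x st). Qed.
Let cx' t x : sg <= t -> {for x, continuous (kQ g tau z t)}.
Proof. by move=> /ltt st; exact: der_continuous (kQ_dx g tau z t x st). Qed.
Let ct t x : sg <= t -> {for t, continuous (kP g tau z ^~ x)}.
Proof. by move=> /ltt st; exact: der_continuous (kP_dt g tau z t x st). Qed.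
Let ct' t x : sg <= t -> {for t, continuous (kQ g tau z ^~ x)}.
Proof. by move=> /ltt st; exact: der_continuous (kQ_dt g tau z t x st). Qed.

Let cpoly (a b c : R) (x : R) : {for x, continuous (fun x : R => a + b * (x - z) + c * (x - z) ^+ 2)}.
Proof.
apply: der_continuous (derD _ _ _ _ _ (derD _ _ _ _ _ (derC a x) (derM _ _ _ _ _ (derC b x)
  (derD _ _ _ _ _ (derI x) (derC (- z) x)))) (derM _ _ _ _ _ (derC c x) (derX2 _ _ _
  (derD _ _ _ _ _ (derI x) (derC (- z) x))))).
Qed.
Let cpolyt (a b : R) (t : R) : sg <= t -> {for t, continuous (fun t : R => (a + b * (t - tau)) / (t - tau) ^+ 2)}.
Proof.
move=> /ltt st; have d0 : (t - tau) ^+ 2 != 0 by rewrite expf_neq0// gt_eqF// subr_gt0.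
have dt := derD _ _ _ _ _ (derI t) (derC (- tau) t).
exact: der_continuous (derM _ _ _ _ _ (derD _ _ _ _ _ (derC a t) (derM _ _ _ _ _ (derC b t) dt))
  (derV (fun t => (t - tau) ^+ 2) _ _ d0 (derX2 _ _ _ dt))).
Qed.

(** Two normal forms of each second derivative: with polynomials in $x-z$ for continuity in $x$, and
    below with polynomials in $t-\tau$ for continuity in $t$. *)
Let kPxxE t x : kPxx g tau z t x =
  ((g ^+ 2 + 0 * (x - z) + (-1) * (x - z) ^+ 2) * kP g tau z t x -
   ((t - tau) + 2 * g * (x - z) + 0 * (x - z) ^+ 2) * kQ g tau z t x) * ((t - tau) ^+ 2)^-1.
Proof. by rewrite /kPxx; congr (_ / _); ring. Qed.
Let kQxxE t x : kQxx g tau z t x =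
  ((g ^+ 2 + 0 * (x - z) + (-1) * (x - z) ^+ 2) * kQ g tau z t x +
   ((t - tau) + 2 * g * (x - z) + 0 * (x - z) ^+ 2) * kP g tau z t x) * ((t - tau) ^+ 2)^-1.
Proof. by rewrite /kQxx; congr (_ / _); ring. Qed.
Let kPxxE' t x : kPxx g tau z t x =
  (g ^+ 2 - (x - z) ^+ 2 + 0 * (t - tau)) / (t - tau) ^+ 2 * kP g tau z t x -
  (2 * g * (x - z) + 1 * (t - tau)) / (t - tau) ^+ 2 * kQ g tau z t x.
Proof. by rewrite /kPxx; ring. Qed.
Let kQxxE' t x : kQxx g tau z t x =
  (g ^+ 2 - (x - z) ^+ 2 + 0 * (t - tau)) / (t - tau) ^+ 2 * kQ g tau z t x +
  (2 * g * (x - z) + 1 * (t - tau)) / (t - tau) ^+ 2 * kP g tau z t x.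
Proof. by rewrite /kQxx; ring. Qed.

Let cPxx t : sg <= t -> continuous (kPxx g tau z t).
Proof.
move=> st x; rewrite (funext (kPxxE t)).
apply: cvgM; last exact: cvg_cst.
by apply: cvgB; apply: cvgM; [exact: cpoly|exact: cx|exact: cpoly|exact: cx'].
Qed.
Let cQxx t : sg <= t -> continuous (kQxx g tau z t).
Proof.
move=> st x; rewrite (funext (kQxxE t)).
apply: cvgM; last exact: cvg_cst.
by apply: cvgD; apply: cvgM; [exact: cpoly|exact: cx'|exact: cpoly|exact: cx].
Qed.
Let cPxxt t x : sg <= t -> {for t, continuous (kPxx g tau z ^~ x)}.
Proof.
move=> st; rewrite (funext (kPxxE' ^~ x)).
by apply: cvgB; apply: cvgM; [exact: cpolyt|exact: ct|exact: cpolyt|exact: ct'].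
Qed.
Let cQxxt t x : sg <= t -> {for t, continuous (kQxx g tau z ^~ x)}.
Proof.
move=> st; rewrite (funext (kQxxE' ^~ x)).
by apply: cvgD; apply: cvgM; [exact: cpolyt|exact: ct'|exact: cpolyt|exact: ct].
Qed.

Let mx : measurable_fun setT (fun p : B * B => p.1 - z).
Proof. by apply: measurable_funB => //; exact: measurable_fst. Qed.
Let mt : measurable_fun setT (fun p : B * B => p.2 - tau).
Proof. by apply: measurable_funB => //; exact: measurable_snd. Qed.
Let mP : measurable_fun setT (fun p : B * B => kP g tau z p.2 p.1).
Proof.
have mp := measurable_phase _ _ _ _ _ (measurable_cst g) mt mx.
apply: measurable_funM; first exact: (measurable_amp _ _ _ _ _ (measurable_cst g) mt mx).
by apply: measurable_funD; [exact: measurable_cos_comp|exact: measurable_sin_comp].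
Qed.
Let mQ : measurable_fun setT (fun p : B * B => kQ g tau z p.2 p.1).
Proof.
have mp := measurable_phase _ _ _ _ _ (measurable_cst g) mt mx.
apply: measurable_funM; first exact: (measurable_amp _ _ _ _ _ (measurable_cst g) mt mx).
by apply: measurable_funB; [exact: measurable_sin_comp|exact: measurable_cos_comp].
Qed.
Let mPxx : measurable_fun setT (fun p : B * B => kPxx g tau z p.2 p.1).
Proof.
apply: measurable_funM; last by apply: measurable_invf; exact: measurable_funX.
apply: measurable_funB; apply: measurable_funM => //.
  by apply: measurable_funB => //; exact: measurable_funX.
by apply: measurable_funD => //; exact: measurable_funM.
Qed.
Let mQxx : measurable_fun setT (fun p : B * B => kQxx g tau z p.2 p.1).
Proof.
apply: measurable_funM; last by apply: measurable_invf; exact: measurable_funX.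
apply: measurable_funD; apply: measurable_funM => //.
  by apply: measurable_funB => //; exact: measurable_funX.
by apply: measurable_funD => //; exact: measurable_funM.
Qed.

(** Uniform constants on the test box: from [sg] on, the distance to the singular time is at least
    [de]. [A] bounds the kernel, and [N] also its second $x$-derivative. *)
Let Y := X + `|z|.
Let de := sg - tau.
Let A := (Num.sqrt de)^-1 * expR (Y * `|g| / de).
Let N := A + ((g ^+ 2 + Y ^+ 2) * A + (2 * `|g| * Y + (T - tau)) * A) / de ^+ 2.
Let de0 : 0 < de. Proof. by rewrite subr_gt0. Qed.
Let X0 := td_X _ _ _ _ _ _ _ _ _ td.
Let A0 : 0 <= A.
Proof. by rewrite mulr_ge0 ?expR_ge0// invr_ge0 sqrtr_ge0. Qed.
Let Y0 : 0 <= Y. Proof. by rewrite addr_ge0// ltW. Qed.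

Let bPQ t x : sg <= t -> `|x| <= X -> `|kP g tau z t x| <= A /\ `|kQ g tau z t x| <= A.
Proof.
move=> st xX; have D0 : 0 < t - tau by rewrite subr_gt0 ltt.
have dD : de <= t - tau by rewrite lerB.
have := kernel_parts g _ (x - z) D0; rewrite kernelE//= -/(kP g tau z t x) -/(kQ g tau z t x).
have h : 2 * amp g (t - tau) (x - z) <= A.
  apply: le_trans (amp_le _ _ _ D0) _; apply: ler_pM; rewrite ?expR_ge0 ?invr_ge0 ?sqrtr_ge0//.
    by rewrite lef_pV2 ?posrE ?sqrtr_gt0// ler_wsqrtr.
  rewrite ler_expR; apply: (@le_trans _ _ (`|x - z| * `|g| / (t - tau))).
    by rewrite ler_pM2r ?invr_gt0// -normrM ler_norm.
  apply: ler_pM; rewrite ?mulr_ge0 ?invr_ge0 ?(ltW D0)// ?lef_pV2 ?posrE//.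
  by rewrite ler_wpM2r// (le_trans (ler_normB _ _))// lerD2r.
by move=> [h1 h2]; split; [exact: le_trans h1 h|exact: le_trans h2 h].
Qed.

Let bN t x u v : sg <= t <= T -> `|x| <= X -> `|u| <= A -> `|v| <= A ->
  `|((g ^+ 2 - (x - z) ^+ 2) * u + (2 * g * (x - z) + (t - tau)) * v) / (t - tau) ^+ 2| <= N.
Proof.
move=> /andP[st tT] xX uA vA; have D0 : 0 < t - tau by rewrite subr_gt0 ltt.
have dD : de <= t - tau by rewrite lerB.
have xY : `|x - z| <= Y by rewrite (le_trans (ler_normB _ _))// lerD2r.
apply: (@le_trans _ _ (((g ^+ 2 + Y ^+ 2) * A + (2 * `|g| * Y + (T - tau)) * A) / de ^+ 2)); last by rewrite lerDr.
rewrite normrM; apply: ler_pM => //.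
  apply: le_trans (ler_normD _ _) _; rewrite !normrM; apply: lerD; apply: ler_pM => //.
    apply: le_trans (ler_normB _ _) _; rewrite !normrX real_normK ?num_real// lerD2l.
    by rewrite ler_pXn2r ?nnegrE.
  apply: le_trans (ler_normD _ _) _; apply: lerD; last by rewrite gtr0_norm// lerD2r.
  by rewrite !normrM normr_nat ler_wpM2l// mulr_ge0.
rewrite ger0_norm ?invr_ge0 ?sqr_ge0// lef_pV2 ?posrE ?exprn_gt0//.
by rewrite ler_pXn2r ?nnegrE// ltW.
Qed.

Let AN : sg <= T -> A <= N.
Proof.
move=> sT; have tT : 0 <= T - tau by rewrite subr_ge0 (le_trans (ltW tausg)).
rewrite /N lerDl divr_ge0 ?sqr_ge0// addr_ge0// mulr_ge0// addr_ge0 ?sqr_ge0//.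
by rewrite !mulr_ge0.
Qed.

(** From [sg > tau] on, the kernel is smooth and bounded on the test box, so only the boundary term
    at [sg] is left. The real part of the claim is [weak_real] for [(kP, kQ)], the imaginary part is
    [weak_real] for [kQ] and minus [kP]. *)
Lemma kernel_weak : cint leb (fun x => cint leb (fun t =>
    if sg < t then kernel g (t - tau) (x - z) *
      (- 'i%C * (phit (x, t))%:C + (2^-1 * phixx (x, t))%:C) else 0)) =
  cint leb (fun x => 'i%C * (kernel g (sg - tau) (x - z) * (phi (x, sg))%:C)).
Proof.
have e1 := weak_real t0 _ _ _ _ _ _ _ _ td (kP g tau z) (kPx g tau z) (kPxx g tau z) (kQ g tau z) sg N
  (fun t x st => kP_dx g tau z t x (ltt t st)) (fun t x st => kP_dxx g tau z t x (ltt t st))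
  cPxx (fun t x st => kQ_dt g tau z t x (ltt t st)) cPxxt mP mPxx mQ.
have e2 := weak_real t0 _ _ _ _ _ _ _ _ td (kQ g tau z) (kQx g tau z) (kQxx g tau z)
  (fun t x => - kP g tau z t x) sg N
  (fun t x st => kQ_dx g tau z t x (ltt t st)) (fun t x st => kQ_dxx g tau z t x (ltt t st))
  cQxx _ cQxxt mQ mQxx (measurable_funN mP).
have E1 h := congr1 (@complex.Re R) (e1 h); rewrite /= in E1.
have E2 h h' := congr1 (@complex.Re R) (e2 h h'); rewrite /= in E2.
have kE t x : sg <= t -> kernel g (t - tau) (x - z) = kP g tau z t x +i* kQ g tau z t x.
  by move=> st; rewrite kernelE ?subr_gt0 ?ltt.
apply: eqC.
  transitivity (\int[leb]_x \int[leb]_t (if sg < t then 2^-1 * kP g tau z t x * phixx (x, t) + kQ g tau z t x * phit (x, t) else 0)).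
    apply: eq_Rintegral => x _; apply: eq_Rintegral => t _; case: ifP => // st.
    by rewrite kE ?ltW// !(ReM, ImM, ReD, ImD, ReN, ImN) /=; ring.
  rewrite E1 => [|t x sT xX].
    transitivity (\int[leb]_x Re ('i%C * (kernel g (sg - tau) (x - z) * (phi (x, sg))%:C))); last by [].
    by apply: eq_Rintegral => x _; rewrite kE// !(ReM, ImM, ReD, ImD, ReN, ImN) /=; ring.
  have /andP[st tT] := sT; have sgT := le_trans st tT; have [h1 h2] := bPQ t x st xX.
  split; [exact: le_trans h1 (AN sgT)| |exact: le_trans h2 (AN sgT)].
  have := bN t x (kP g tau z t x) (- kQ g tau z t x) sT xX h1.
  by rewrite normrN => /(_ h2); rewrite /kPxx mulrN.
transitivity (\int[leb]_x \int[leb]_t (if sg < t then 2^-1 * kQ g tau z t x * phixx (x, t) + - kP g tau z t x * phit (x, t) else 0)).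
  apply: eq_Rintegral => x _; apply: eq_Rintegral => t _; case: ifP => // st.
  by rewrite kE ?ltW// !(ReM, ImM, ReD, ImD, ReN, ImN) /=; ring.
have H1 (t x : R) : sg <= t -> is_derive t (1 : R) (fun t => - kP g tau z t x) (2^-1 * kQxx g tau z t x).
  by move=> st; apply: der_eq (derN _ _ _ (kP_dt g tau z t x (ltt t st))) _; rewrite opprK.
have H2 t x : sg <= t <= T -> `|x| <= X ->
    [/\ `|kQ g tau z t x| <= N, `|kQxx g tau z t x| <= N & `|- kP g tau z t x| <= N].
  move=> sT xX; have /andP[st tT] := sT; have sgT := le_trans st tT; have [h1 h2] := bPQ t x st xX.
  by split; [exact: le_trans h2 (AN sgT)|exact: bN|by rewrite normrN (le_trans h1 (AN sgT))].
apply: etrans (E2 H1 H2) _.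
transitivity (\int[leb]_x Im ('i%C * (kernel g (sg - tau) (x - z) * (phi (x, sg))%:C))); last by [].
by apply: eq_Rintegral => x _; rewrite kE// !(ReM, ImM, ReD, ImD, ReN, ImN) /=; ring.
Qed.
End Weak.
End KernelEstimates.

(** * The initial value of the free kernel *)

Section Delta.
Context {R : realType}.
Local Notation C := R[i].
Local Notation Re := complex.Re.
Local Notation Im := complex.Im.
Local Notation B := (measurableTypeR R).
Local Notation leb := (@lebesgue_measure R).

(* \int_0^x f, written so that it also makes sense for x < 0 *)
Definition Fodd (f : R -> R) (x : R) : R := x * \int[leb]_(t in `[0, 1]) f (x * t).

Section Odd.
Variables (f df F : R -> R) (L : R).
Hypothesis dfP : forall x : R, is_derive x (1 : R) f (df x).
Hypothesis dfb : forall x : R, `|df x| <= `|x|.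
Hypothesis feven : forall x, f (- x) = f x.
Hypothesis dF : forall x : R, 0 < x -> is_derive x (1 : R) F (f x).
Hypothesis FE : forall x : R, 0 < x -> Fodd f x = F x.
Hypothesis Fb : forall x : R, `|F x| <= 3.
Hypothesis Flim : F x @[x --> +oo] --> L.

Let cf : continuous f. Proof. exact: is_derive_continuous dfP. Qed.

Lemma FoddN x : Fodd f (- x) = - Fodd f x.
Proof.
rewrite /Fodd mulNr; congr (- (_ * _)); apply: eq_Rintegral => t _.
by rewrite mulNr feven.
Qed.
Lemma Fodd0 : Fodd f 0 = 0. Proof. by rewrite /Fodd mul0r. Qed.

Let dpos (x : R) : 0 < x -> is_derive x (1 : R) (Fodd f) (f x).
Proof.
move=> x0; apply: (@near_eq_is_derive R R R F (Fodd f) x 1 (f x)); last exact: dF.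
by apply: filterS (lt_nbhsr x0) => y y0; exact/esym/FE.
Qed.

(** Away from 0 this comes from [F] and from oddness. At 0 itself the product form of [Fodd] is
    differentiated, with the derivative taken under the integral. *)
Lemma is_derive_Fodd (x : R) : is_derive x (1 : R) (Fodd f) (f x).
Proof.
have [x0|x0|->] := ltrgtP x 0; last first.
- apply: der_eq (derM _ _ _ _ _ (derI (0 : R)) (derive_param01 (fun x t => f (x * t)) (fun x t => df (x * t) * t) 0 _ _ _)) _.
  + move=> y t; apply: der_eq (der_comp f (fun y => y * t) y _ _ (dfP (y * t)) (derM _ _ _ _ _ (derI y) (derC t y))) _.
    by ring.
  + by move=> y; exact: continuous_scale.
  + move=> y t /andP[t0 t1]; rewrite normrM (le_trans (ler_wpM2r (normr_ge0 _) (dfb _)))//.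
    by rewrite normrM -mulrA ler_piMr// (ger0_norm t0) mulr_ile1.
  + rewrite mul0r addr0 mul1r; under eq_Rintegral do rewrite mul0r.
    by rewrite Rintegral_cst//= lebesgue_measure_itv/= lte_fin ltr01 -EFinB subr0 mulr1.
- exact: dpos.
- have nx : 0 < - x by rewrite oppr_gt0.
  rewrite (_ : Fodd f = fun x => - Fodd f (- x)); last by apply/funext => y; rewrite FoddN opprK.
  apply: der_eq (derN _ _ _ (der_comp (Fodd f) (fun x => - x) x _ _ (dpos _ nx) (derN _ _ _ (derI x)))) _.
  by rewrite feven; ring.
Qed.

Lemma Fodd_bound x : `|Fodd f x| <= 3.
Proof.
have [x0|x0|->] := ltrgtP x 0; last by rewrite Fodd0 normr0.
  by rewrite -[x]opprK FoddN normrN FE ?oppr_gt0.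
by rewrite FE.
Qed.

Lemma Fodd_cvg (y : R) : y != 0 -> Fodd f (y * n.+1%:R) @[n --> \oo] --> (Num.sg y * L).
Proof.
have pos (u : R) : 0 < u -> Fodd f (u * n.+1%:R) @[n --> \oo] --> L.
  move=> u0; rewrite (_ : (fun n : nat => Fodd f (u * n.+1%:R)) = fun n => F (u * n.+1%:R)); last first.
    by apply/funext => n; rewrite FE// mulr_gt0.
  apply: (cvg_comp (fun n : nat => u * n.+1%:R) F _ Flim).
  apply/cvgryPge => A; near=> n; rewrite mulrC -ler_pdivrMr//.
  apply: (@le_trans _ _ n%:R); last by rewrite ler_nat.
  by near: n; exact: nbhs_infty_ger.
case: (ltrgtP y 0) => // y0 _.
  rewrite ltr0_sg// mulN1r (_ : (fun n : nat => Fodd f (y * n.+1%:R)) = fun n => - Fodd f (- y * n.+1%:R)); last first.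
    by apply/funext => n; rewrite mulNr FoddN opprK.
  by apply: cvgN; apply: pos; rewrite oppr_gt0.
by rewrite gtr0_sg// mul1r; exact: pos.
Unshelve. all: by end_near. Qed.

Variables (t0 : R) (phi phix phixx phit : R * R -> R) (X s0 T M : R).
Hypothesis td : tdata t0 phi phix phixx phit X s0 T M.
Variables (tau z : R).

(** Inverse squares, so that the kernel at time [tau + eps n] is a fixed profile in $(x-z)(n+1)$
    multiplied by exactly $n+1$. *)
Definition eps n : R := (n.+1%:R ^+ 2)^-1.
Lemma eps_gt0 n : 0 < eps n. Proof. by rewrite invr_gt0 exprn_gt0. Qed.
Lemma eps_cvg : tau + eps n @[n --> \oo] --> tau.
Proof.
rewrite -[X in _ --> X]addr0; apply: cvgD; first exact: cvg_cst.
have c : (n.+1%:R^-1 : R) @[n --> \oo] --> (0 : R) by exact: cvg_harmonic.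
rewrite (_ : eps = fun n => n.+1%:R^-1 * n.+1%:R^-1); last first.
  by apply/funext => n; rewrite /eps expr2 invfM.
by rewrite -[X in _ --> X](mulr0 0); exact: cvgM.
Qed.

Let Y := X + `|z| + 1.
Let a := z - Y. Let b := z + Y.
Let az : a < z. Proof. by rewrite /a /Y; have := normr_ge0 z; have := td_X _ _ _ _ _ _ _ _ _ td; lra. Qed.
Let zb : z < b. Proof. by rewrite /b /Y; have := normr_ge0 z; have := td_X _ _ _ _ _ _ _ _ _ td; lra. Qed.
Let outX x : ~ `[a, b]%classic x \/ x = a \/ x = b -> ~~ (`|x| < X).
Proof.
move=> h; apply/negP; rewrite ltr_norml => /andP[h1 h2].
have := ler_norm z; have := ler_norm (- z); rewrite normrN => h3 h4.
case: h => [h|]; last by rewrite /a /b /Y; lra.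
by apply: h; rewrite /= in_itv /= /a /b /Y; apply/andP; split; lra.
Qed.
Let z0 x t : ~ `[a, b]%classic x \/ x = a \/ x = b -> phi (x, t) = 0.
Proof. by move=> /outX h; have [] // := td_supp _ _ _ _ _ _ _ _ _ td (x, t); rewrite (negbTE h). Qed.

Let cphi t : continuous (fun x => phi (x, t)).
Proof. exact: continuous_fst_slice (td_c _ _ _ _ _ _ _ _ _ td). Qed.
Let cphix t : continuous (fun x => phix (x, t)).
Proof. exact: continuous_fst_slice (td_cx _ _ _ _ _ _ _ _ _ td). Qed.
Let dsc (n : nat) (x : R) : is_derive x (1 : R) (fun x => (x - z) * n.+1%:R) n.+1%:R.
Proof.
apply: der_eq (derM _ _ _ _ _ (derD _ _ _ _ _ (derI x) (derC (- z) x)) (derC (n.+1%:R) x)) _; ring.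
Qed.
Let csc (h : R -> R) n : continuous h -> continuous (fun x => h ((x - z) * n.+1%:R)).
Proof.
move=> ch x; apply: (@continuous_comp _ _ _ (fun x => (x - z) * n.+1%:R) h); last exact: ch.
exact: der_continuous (dsc n x).
Qed.
Let cFodd : continuous (Fodd f).
Proof. exact: is_derive_continuous is_derive_Fodd. Qed.

Let ibp n t : \int[leb]_x (n.+1%:R * f ((x - z) * n.+1%:R) * phi (x, t)) =
  - \int[leb]_(x in `[a, b]) (Fodd f ((x - z) * n.+1%:R) * phix (x, t)).
Proof.
have ab : a <= b by rewrite ltW// (lt_trans az).
rewrite (Rintegral_support _ B leb `[a, b]%classic)//; last by move=> x nx; rewrite z0 ?mulr0//; left.
have c1 : continuous (fun x => n.+1%:R * f ((x - z) * n.+1%:R) * phi (x, t)).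
  move=> x; apply: cvgM; last exact: cphi.
  by apply: cvgM; [exact: cvg_cst|exact: csc].
have c2 : continuous (fun x => Fodd f ((x - z) * n.+1%:R) * phix (x, t)).
  by move=> x; apply: cvgM; [exact: csc|exact: cphix].
apply/eqP; rewrite -addr_eq0 -RintegralD//; try exact: continuous_itv_integrable.
apply/eqP; transitivity (Fodd f ((b - z) * n.+1%:R) * phi (b, t) - Fodd f ((a - z) * n.+1%:R) * phi (a, t)).
  apply: (ftcT (fun x => Fodd f ((x - z) * n.+1%:R) * phi (x, t))) => //.
    by move=> x; apply: cvgD; [exact: c1|exact: c2].
  move=> x; apply: der_eq (derM _ _ _ _ _ (der_comp (Fodd f) (fun x => (x - z) * n.+1%:R) x _ _ (is_derive_Fodd _) (dsc n x))
    (td_dx _ _ _ _ _ _ _ _ _ td x t)) _.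
  by ring.
by rewrite !z0 ?mulr0 ?subrr//; right; [left|right].
Qed.

Let half (c d : R) (sgn : R) (I : set R) : c < d -> sgn != 0 -> I = `]c, d[%classic ->
  (forall x, c < x < d -> Num.sg (x - z) = sgn) ->
  \int[leb]_(x in I) (Fodd f ((x - z) * n.+1%:R) * phix (x, tau + eps n)) @[n --> \oo] -->
  sgn * L * (phi (d, tau) - phi (c, tau)).
Proof.
move=> cd sn0 -> hs.
have E : \int[leb]_(x in `]c, d[) (sgn * L * phix (x, tau)) =
    sgn * L * (phi (d, tau) - phi (c, tau)).
  have ci : continuous (fun x => sgn * L * phix (x, tau)).
    by move=> x; apply: cvgM; [exact: cvg_cst|exact: cphix].
  have ii := continuous_itv_integrable _ c d ci.
  rewrite Rintegral_itv_obnd_cbnd ?Rintegral_itv_bndo_bndc; last 2 first.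
  - by apply: integrableS ii => // x; rewrite /= !in_itv /= => /andP[-> /ltW].
  - by apply: integrableS ii => // x; rewrite /= !in_itv /= => /andP[/ltW -> /ltW].
  apply: etrans (ftcT (fun x => sgn * L * phi (x, tau)) _ _ _ (ltW cd) ci _) _; last by ring.
  move=> x; apply: der_eq (derM _ _ _ _ _ (derC _ x) (td_dx _ _ _ _ _ _ _ _ _ td x tau)) _; ring.
rewrite -E; apply: (Rdominated _ _ _ _ _ _ (fun=> 3 * M)).
- exact: measurable_itv.
- move=> n; apply: measurable_funTS; apply: continuous_measurable_fun => x.
  by apply: cvgM; [exact: csc|exact: cphix].
- apply: measurable_funTS; apply: continuous_measurable_fun => x.
  by apply: cvgM; [exact: cvg_cst|exact: cphix].
- move=> x; rewrite /= in_itv /= => xcd; apply: cvgM.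
    rewrite -(hs x xcd); apply: Fodd_cvg.
    by apply: contraNneq sn0 => xz; rewrite -(hs x xcd) xz sgr0.
  exact: (cvg_comp _ _ eps_cvg (continuous_snd_slice _ x (td_cx _ _ _ _ _ _ _ _ _ td) tau)).
- move=> n x _; rewrite normrM; apply: ler_pM => //; first exact: Fodd_bound.
  by have [_ ? _ _] := td_bnd _ _ _ _ _ _ _ _ _ td (x, tau + eps n).
- exact: measurable_cst.
- rewrite integral_cst; last exact: measurable_itv.
  rewrite [X in (_ * X < _)%E](_ : _ = @lebesgue_measure R [set` `]c, d[%R]); last by [].
  by rewrite lebesgue_measure_itv/= lte_fin cd -EFinB -EFinM ltry.
Qed.

Let split_z (h : R -> R) : continuous h -> \int[leb]_(x in `[a, b]) h x =
  \int[leb]_(x in `]a, z[) h x + \int[leb]_(x in `]z, b[) h x.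
Proof.
move=> ch; have ih c d := continuous_itv_integrable h c d ch.
have E := @Rintegral_itvB R h (BLeft a) (BRight b) z (ih a b).
have := E _ _; rewrite !bnd_simp => /(_ (ltW az) (ltW zb)) {}E.
have open_itv c d : \int[leb]_(x in `]c, d[) h x = \int[leb]_(x in `[c, d]) h x.
  rewrite Rintegral_itv_obnd_cbnd ?Rintegral_itv_bndo_bndc//.
  - by apply: integrableS (ih c d) => // x; rewrite /= !in_itv /= => /andP[-> /ltW].
  - by apply: integrableS (ih c d) => // x; rewrite /= !in_itv /= => /andP[/ltW -> /ltW].
rewrite !open_itv -(Rintegral_itv_obnd_cbnd (r := z)).
  by rewrite -E addrC subrK.
by apply: integrableS (ih z b) => // x; rewrite /= !in_itv /= => /andP[/ltW -> ->].
Qed.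

(** Integration by parts moves the growing factor into the bounded primitive [Fodd], which tends to
    $-L$ on the left of [z] and to $L$ on the right. Dominated convergence leaves $L$ times
    integrals of $\phi_x$ over the two sides, and these add up to $2L\phi(z)$. *)
Lemma oscillatory_limit :
  \int[leb]_x (n.+1%:R * f ((x - z) * n.+1%:R) * phi (x, tau + eps n)) @[n --> \oo] -->
  2 * L * phi (z, tau).
Proof.
rewrite (_ : (fun n => _) = fun n : nat =>
   - (\int[leb]_(x in `]a, z[) (Fodd f ((x - z) * n.+1%:R) * phix (x, tau + eps n)) +
      \int[leb]_(x in `]z, b[) (Fodd f ((x - z) * n.+1%:R) * phix (x, tau + eps n)))); last first.
  apply/funext => n; rewrite ibp split_z// => x.
  by apply: cvgM; [exact: csc|exact: cphix].
have -> : 2 * L * phi (z, tau) = - ((-1) * L * (phi (z, tau) - phi (a, tau)) +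
    1 * L * (phi (b, tau) - phi (z, tau))).
  by rewrite (z0 a) ?(z0 b); [ring|right; right|right; left].
apply: cvgN; apply: cvgD; apply: half => //; rewrite ?oppr_eq0 ?oner_eq0//.
  by move=> x /andP[_ xz]; rewrite ltr0_sg// subr_lt0.
by move=> x /andP[zx _]; rewrite gtr0_sg// subr_gt0.
Qed.
End Odd.

Section KernelDelta.
Variables (t0 : R) (phi phix phixx phit : R * R -> R) (X s0 T M : R).
Hypothesis td : tdata t0 phi phix phixx phit X s0 T M.
Variables (tau z : R).

Let k : R := (2 * Num.sqrt pi)^-1.
Let k0 : 0 < k. Proof. by rewrite invr_gt0 mulr_gt0// sqrt_pi_gt0. Qed.
Let k1 : k <= 2^-1.
Proof. by rewrite lef_pV2 ?posrE ?mulr_gt0 ?sqrt_pi_gt0// ler_peMr// sqrt_pi_ge1. Qed.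

(** With coefficients [k] and [k], or [k] and [- k], the profile is the imaginary or the real part
    of the kernel. Both Fresnel integrals have the limit $\sqrt\pi/2$. *)
Let osc (c1 c2 : R) : `|c1| = k -> `|c2| = k ->
  \int[leb]_x (n.+1%:R * (c1 * fcos ((x - z) * n.+1%:R) + c2 * fsin ((x - z) * n.+1%:R)) * phi (x, tau + eps n)) @[n --> \oo] -->
  2 * ((c1 + c2) * (Num.sqrt pi / 2)) * phi (z, tau).
Proof.
move=> e1 e2; apply: (oscillatory_limit (fun x => c1 * fcos x + c2 * fsin x)
  (fun x => c1 * (- x * fsin x) + c2 * (x * fcos x)) (fun x => c1 * Fcos x + c2 * Fsin x) _ _ _ _ _ _ _ _ _ _ _ _ _ _ _ _ _ td).
- move=> x; apply: der_eq (derD _ _ _ _ _ (derM _ _ _ _ _ (derC c1 x) (is_derive_fcos x))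
    (derM _ _ _ _ _ (derC c2 x) (is_derive_fsin x))) _; ring.
- move=> x; apply: le_trans (ler_normD _ _) _; rewrite !normrM normrN e1 e2.
  have h1 : `|x| * `|fsin x| <= `|x| by rewrite ler_piMr// sin_max.
  have h2 : `|x| * `|fcos x| <= `|x| by rewrite ler_piMr// cos_max.
  have h3 : k * (`|x| * `|fsin x|) <= 2^-1 * `|x| by rewrite ler_pM ?mulr_ge0// ltW.
  have h4 : k * (`|x| * `|fcos x|) <= 2^-1 * `|x| by rewrite ler_pM ?mulr_ge0// ltW.
  lra.
- by move=> x; rewrite /fcos /fsin sqrrN.
- move=> x x0; apply: der_eq (derD _ _ _ _ _ (derM _ _ _ _ _ (derC c1 x) (is_derive_Fcos x x0))
    (derM _ _ _ _ _ (derC c2 x) (is_derive_Fsin x x0))) _; ring.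
- move=> x x0; rewrite -(Fcos_scale _ x0) -(Fsin_scale _ x0).
  have c1' := continuous_scale _ x continuous_fcos.
  have c2' := continuous_scale _ x continuous_fsin.
  rewrite (RintegralZlc x (fun t => fcos (x * t)))// (RintegralZlc x (fun t => fsin (x * t)))// /Fodd.
  rewrite RintegralD//; last 2 first.
  + by apply: continuous_itv_integrable => t; apply: cvgM; [exact: cvg_cst|exact: c1'].
  + by apply: continuous_itv_integrable => t; apply: cvgM; [exact: cvg_cst|exact: c2'].
  by rewrite !RintegralZlc//; ring.
- move=> x; have [h1 h2] := Fresnel_bound x; apply: le_trans (ler_normD _ _) _.
  rewrite !normrM e1 e2.
  have h3 : k * `|Fcos x| <= 2^-1 * 3 by rewrite ler_pM// ltW.
  have h4 : k * `|Fsin x| <= 2^-1 * 3 by rewrite ler_pM// ltW.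
  lra.
- have [l1 l2] := @Fresnel_cvg R; rewrite mulrDl.
  by apply: cvgD; apply: cvgM => //; exact: cvg_cst.
Qed.

Let w (p : R * R) : C := - 'i%C * (phit p)%:C + (2^-1 * phixx p)%:C.
Let fs (sg : R) (p : B * B) : C := if sg < p.2 then kernel 0 (p.2 - tau) (p.1 - z) * w p else 0.

Let mw : cmeas (w : B * B -> C).
Proof.
apply: cmeasD.
  apply: cmeasM; first exact: cmeas_cst.
  by apply: cmeasR; exact: continuous_measurable2 (td_ct _ _ _ _ _ _ _ _ _ td).
apply: cmeasR; apply: measurable_funM => //.
exact: continuous_measurable2 (td_cxx _ _ _ _ _ _ _ _ _ td).
Qed.

Let mfs sg : tau <= sg -> cmeas (fs sg).
Proof.
move=> tsg; have mt : measurable_fun setT (fun p : B * B => p.2 - tau) by apply: measurable_funB => //; exact: measurable_snd.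
have mx : measurable_fun setT (fun p : B * B => p.1 - z) by apply: measurable_funB => //; exact: measurable_fst.
have mc : measurable_fun setT (fun _ : B * B => 0 : B) by exact: measurable_cst.
have h := cmeasM _ _ (cmeas_kernel _ _ (fun=> 0) _ _ mc mt mx) mw.
apply: (cmeas_eq (fun p : B * B => if sg < p.2 then (if 0 < p.2 - tau then kernel 0 (p.2 - tau) (p.1 - z) else 0) * w p else 0)).
  by move=> p; rewrite /fs; case: ifP => // sp; rewrite subr_gt0 (le_lt_trans tsg).
apply: cmeas_if; [|exact: h|exact: cmeas_cst].
by apply: measurable_fun_ltr => //; exact: measurable_snd.
Qed.

(** A product majorant valid down to [sg = tau]. As the displacement is real, the kernel is of size
    $(t-\tau)^{-1/2}$ for every $x$, which is integrable over the bounded support; the constant is 2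
    from the kernel times $2M$ from the test function. *)
Let u (x : R) : R := 4 * M * \1_(`[- X, X]%classic) x.
Let v (t : R) : R := if (tau < t) && (t < T) then (Num.sqrt (t - tau))^-1 else 0.
Let M0 := td_M _ _ _ _ _ _ _ _ _ td.
Let u0 x : 0 <= u x. Proof. by rewrite /u mulr_ge0// mulr_ge0// ltW. Qed.
Let v0 t : 0 <= v t. Proof. by rewrite /v; case: ifP => // _; rewrite invr_ge0 sqrtr_ge0. Qed.

Let fuv sg : tau <= sg -> forall x t, norm1 (fs sg (x, t)) <= u x * v t.
Proof.
move=> tsg x t; rewrite /fs /=; case: ifPn => [st|_]; last by rewrite norm10 mulr_ge0.
have tt : tau < t by exact: le_lt_trans st.
have [/andP[/= xX /andP[_ tT]]|out] := boolP ((`|x| < X) && (s0 < t < T)); last first.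
  have [_ _ e1 e2] := td_supp _ _ _ _ _ _ _ _ _ td (x, t) out.
  have -> : w (x, t) = 0 by rewrite /w e1 e2; apply: eqC; rewrite !(ReM, ImM, ReD, ImD, ReN, ImN) /=; ring.
  by rewrite mulr0 norm10 mulr_ge0.
rewrite /u /v tt tT /= indicE mem_setE in_itv /= -ler_norml (ltW xX) mulr1.
apply: le_trans (norm1M _ _) _; rewrite [leRHS]mulrC.
have wM (p : R * R) : norm1 (w p) <= 2 * M.
  have [_ _ h1 h2] := td_bnd _ _ _ _ _ _ _ _ _ td p.
  rewrite /norm1 /w ReD ImD !(ReM, ImM, ReN, ImN) /=.
  rewrite !(mul0r, oppr0, mulr0, sub0r, add0r, subr0, addr0, mulN1r, mul1r, opprK).
  by rewrite normrN normrM (ger0_norm (_ : 0 <= 2^-1 :> R))//; have := M0; lra.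
have kv := norm1_kernel 0 (t - tau) (x - z); rewrite subr_gt0 mulr0 mul0r expR0 mulr1 in kv.
apply: le_trans (ler_pM _ _ (kv tt) (wM (x, t))) _; rewrite ?norm1_ge0//.
by rewrite -subr_ge0 (_ : _ - _ = 0)//; ring.
Qed.

Let mu' : measurable_fun setT (u : B -> B).
Proof. by apply: measurable_dom; exact: measurable_itv. Qed.
Let mv' : measurable_fun setT (v : B -> B).
Proof.
apply: measurable_fun_ifT => //.
  by apply: measurable_and; exact: measurable_fun_ltr.
apply: measurable_invf; apply: (@measurableT_comp _ _ _ _ _ _ (@Num.sqrt R)).
  by apply: continuous_measurable_fun; exact: sqrt_continuous.
exact: measurable_funB.
Qed.
Let uy : (\int[leb]_x (u x)%:E < +oo)%E.
Proof. by apply: integral_dom; rewrite mulr_ge0// ltW. Qed.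
Let vy : (\int[leb]_x (v x)%:E < +oo)%E.
Proof.
have [Tt|tT] := leP T tau.
  rewrite integral0_eq// => t _; rewrite /v; case: ifP => // /andP[h1 h2].
  by have := lt_trans h1 h2; rewrite ltNge Tt.
have D t : tau < t < T -> is_derive t (1 : R) (fun t => 2 * Num.sqrt (t - tau)) (v t).
  move=> tt; have /andP[h1 h2] := tt; have d0 : 0 < t - tau by rewrite subr_gt0.
  apply: der_eq (derM _ _ _ _ _ (derC 2 t) (der_comp (@Num.sqrt R) (fun t => t - tau) t _ _
     (is_derive1_sqrt d0) (derD _ _ _ _ _ (derI t) (derC (- tau) t)))) _.
  by rewrite /v tt; field; rewrite gt_eqF// sqrtr_gt0.
rewrite [X in (X < _)%E](_ : _ = \int[leb]_(t in `]tau, T[) (v t)%:E)%E; last first.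
  rewrite [RHS]integral_mkcond; apply: eq_integral => t _.
  rewrite patchE mem_setE in_itv /= /v; by case: ifP.
apply: le_lt_trans (ltry (2 * Num.sqrt (T - tau))).
apply: (ge0_integral_derive_le (fun t => 2 * Num.sqrt (t - tau)) v) => //.
- move=> t tt; have /andP[h1 h2] := tt; have d0 : 0 < t - tau by rewrite subr_gt0.
  have ds := der_comp (@Num.sqrt R) (fun t => t - tau) t _ _
     (is_derive1_sqrt d0) (derD _ _ _ _ _ (derI t) (derC (- tau) t)).
  have sn0 : Num.sqrt (t - tau) != 0 by rewrite gt_eqF// sqrtr_gt0.
  have dv := derV (fun t => Num.sqrt (t - tau)) t _ sn0 ds.
  apply: (der_continuous v t _ (@near_eq_is_derive R R R _ v t 1 _ _ dv)).
  have tI : t \in `]tau, T[ by rewrite in_itv.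
  apply: filterS (near_in_itvoo tI) => y; rewrite in_itv /= => yy.
  by rewrite /v yy.
- move=> x y tx xy yT.
  have h1 : Num.sqrt (y - tau) <= Num.sqrt (T - tau) by apply: ler_wsqrtr; lra.
  by have := sqrtr_ge0 (x - tau); lra.
- exact: measurable_funTS.
Qed.

Let prodfs sg : tau <= sg -> cfin (leb \x leb)%E (fs sg) /\
  cint (leb \x leb)%E (fs sg) = cint leb (fun x => cint leb (fun t => fs sg (x, t))).
Proof.
move=> tsg; have [h1 h2 _] := cint_prod leb leb (fs sg) (mfs sg tsg)
  (dom_fubini (fs sg) u v (mfs sg tsg) (fuv sg tsg) u0 v0 mu' mv' uy vy).
by split.
Qed.

Let lim_fs (pr : C -> R) : (forall c, `|pr c| <= norm1 c) -> pr 0 = 0 ->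
  (forall sg, tau <= sg -> measurable_fun setT (fun p : B * B => pr (fs sg p))) ->
  \int[(leb \x leb)%E]_p pr (fs (tau + eps n) p) @[n --> \oo] --> \int[(leb \x leb)%E]_p pr (fs tau p).
Proof.
move=> hpr pr0 mpr; have tn n : tau <= tau + eps n by rewrite lerDl ltW// eps_gt0.
have [[m1 f1] _] := prodfs tau (lexx _).
apply: (Rdominated _ _ _ _ _ _ (fun p => norm1 (fs tau p))) => //.
- by move=> n; exact: mpr.
- exact: mpr.
- move=> [x t] _; rewrite /fs /=; case: ltP => tt; last first.
    by rewrite (_ : (fun n => _) = fun=> pr 0); [exact: cvg_cst|apply/funext => n; rewrite ltNge (le_trans tt)].
  apply: cvg_near_cst; have : \forall s \near tau, s < t by exact: lt_nbhsl.
  by move=> nt; near=> n; rewrite ifT//; near: n; exact: (eps_cvg tau _ nt).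
- move=> n p _; apply: le_trans (hpr _) _; rewrite /fs; case: ifPn => [h|_]; last by rewrite norm10 norm1_ge0.
  by rewrite (le_lt_trans (tn n) h).
- exact: measurable_norm1.
Unshelve. all: by end_near. Qed.

(** At [sg = tau] the boundary term of [kernel_weak] has no pointwise meaning. The identity is taken
    at [tau + eps n] instead: the left-hand sides converge by domination, the boundary terms by
    [oscillatory_limit]. *)
Lemma kernel_delta : cint leb (fun x => cint leb (fun t =>
    if tau < t then kernel 0 (t - tau) (x - z) *
      (- 'i%C * (phit (x, t))%:C + (2^-1 * phixx (x, t))%:C) else 0)) =
  'i%C * (phi (z, tau))%:C.
Proof.
have tn n : tau < tau + eps n by rewrite ltrDl eps_gt0.
have [_ <-] := prodfs tau (lexx _).
have W n : cint (leb \x leb)%E (fs (tau + eps n)) =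
    cint leb (fun x => 'i%C * (kernel 0 (tau + eps n - tau) (x - z) * (phi (x, tau + eps n))%:C)).
  have [_ ->] := prodfs _ (ltW (tn n)).
  exact: (kernel_weak t0 _ _ _ _ _ _ _ _ td 0 tau z _ (tn n)).
have kE n x : kernel 0 (tau + eps n - tau) (x - z) =
   (n.+1%:R * (k * fcos ((x - z) * n.+1%:R) + k * fsin ((x - z) * n.+1%:R))) +i*
   (n.+1%:R * (- k * fcos ((x - z) * n.+1%:R) + k * fsin ((x - z) * n.+1%:R))).
  have e0 := eps_gt0 n.
  rewrite (_ : tau + eps n - tau = eps n); last by ring.
  rewrite kernelE// ampE// mulr0 mul0r expR0 mulr1 -/k.
  have -> : (Num.sqrt (eps n))^-1 = n.+1%:R by rewrite /eps sqrtrV ?exprn_ge0// sqrtr_sqr ger0_norm// invrK.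
  have -> : phase 0 (eps n) (x - z) = ((x - z) * n.+1%:R) ^+ 2 / 2.
    have : n.+1%:R != 0 :> R by rewrite pnatr_eq0.
    by rewrite /phase /eps; move: (n.+1%:R) => m m0; field.
  by rewrite -/(fcos _) -/(fsin _); apply: eqC => /=; ring.
have pk : `|k| = k by rewrite gtr0_norm.
have L1 := osc k k pk pk; have L2 := osc k (- k) pk (etrans (normrN _) pk).
have kp : k * Num.sqrt pi = 2^-1 by rewrite /k; field; rewrite gt_eqF// sqrt_pi_gt0.
apply: eqC.
  (* In the real part the two equal Fresnel limits cancel. In the imaginary part they add up, and
     $2k\sqrt\pi=1$ is the normalisation of the delta. *)
  have := lim_fs (@complex.Re R) (@Re_le_norm1 R) erefl (fun sg h => (mfs sg h).1).
  have -> : (fun n => \int[(leb \x leb)%E]_p Re (fs (tau + eps n) p)) =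
     fun n : nat => \int[leb]_x (n.+1%:R * (k * fcos ((x - z) * n.+1%:R) + - k * fsin ((x - z) * n.+1%:R)) * phi (x, tau + eps n)).
    apply/funext => n; apply: etrans (congr1 (@complex.Re R) (W n)) _.
    by apply: eq_Rintegral => x _; rewrite kE !(ReM, ImM, ReD, ImD, ReN, ImN) /=; ring.
  move=> l; apply: etrans (cvg_unique _ l L2) _ => //.
  by rewrite !(ReM, ImM) /=; ring.
have := lim_fs (@complex.Im R) (@Im_le_norm1 R) erefl (fun sg h => (mfs sg h).2).
have -> : (fun n => \int[(leb \x leb)%E]_p Im (fs (tau + eps n) p)) =
   fun n : nat => \int[leb]_x (n.+1%:R * (k * fcos ((x - z) * n.+1%:R) + k * fsin ((x - z) * n.+1%:R)) * phi (x, tau + eps n)).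
  apply/funext => n; apply: etrans (congr1 (@complex.Im R) (W n)) _.
  by apply: eq_Rintegral => x _; rewrite kE !(ReM, ImM, ReD, ImD, ReN, ImN) /=; ring.
move=> l; apply: etrans (cvg_unique _ l L1) _ => //.
rewrite !(ReM, ImM) /= (_ : 2 * ((k + k) * (Num.sqrt pi / 2)) = 2 * (k * Num.sqrt pi)); last by field.
by rewrite kp; field.
Qed.
End KernelDelta.
End Delta.

(** * The Feynman integrand in closed form *)

Section ClosedForm.
Context {R : realType}.
Local Notation C := R[i].
Local Notation Re := complex.Re.
Local Notation Im := complex.Im.
Local Notation B := (measurableTypeR R).
Local Notation leb := (@lebesgue_measure R).
Local Notation env := (@env R).
Variables (t0 y : R).
Implicit Types (e : env) (L : seq nat) (k : nat).

(* Variable names: (0, j) and (2, j) stand for tau_(j+1) and x_(j+1), while (1, l)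
   and (3, l) stand for s_l and alpha_l, with l in a list L of labels. *)
Definition nodeT e j : R := if j is j'.+1 then e (0%N, j') else t0.
Definition nodeX e j : R := if j is j'.+1 then e (2%N, j') else y.
(* the length of [a, b] `&` ]s, +oo[ *)
Definition overlap (s a b : R) : R := Num.max (b - Num.max s a) 0.
Definition charge_sum L e : R := \sum_(l <- L) e (3%N, l).
(** The integral of $\eta/i$ over $[a,b]$, for $b\le t$. *)
Definition action L e (a b : R) : R := \sum_(l <- L) e (3%N, l) * overlap (e (1%N, l)) a b.
(** This is $-\int\eta^2$ when all $s_l\le t$: the product of two of the indicators is the indicator
    from the later of the two times on. *)
Definition self_energy L e (t : R) : R := \sum_(l <- L) \sum_(l' <- L)
  e (3%N, l) * e (3%N, l') * (t - Num.max (e (1%N, l)) (e (1%N, l'))).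
(** The value 0 for nonpositive times encodes the ordering of the nodes: a product of such kernels
    vanishes off the simplex, so the time integrals may run over the whole line. *)
Definition kern0 (g D b : R) : C := if 0 < D then kernel g D b else 0.
Definition link L e j : C := kern0 (- action L e (nodeT e j) (nodeT e j.+1))
  (nodeT e j.+1 - nodeT e j) (nodeX e j.+1 - nodeX e j).
Definition chain L k e : C := \prod_(j <- iota 0 k) link L e j.
(* F_(n,k) once the integrals of eta and eta^2 have been computed *)
Definition Fxt L k e (x t : R) : C :=
  cexp ((x * charge_sum L e) +i* (self_energy L e t / 2)) * chain L k e *
  kern0 (- action L e (nodeT e k) t) (t - nodeT e k) (x - nodeX e k).

Lemma chainS L k e : chain L k.+1 e = chain L k e * link L e k.
Proof. by rewrite /chain -addn1 iotaD big_cat big_seq1. Qed.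

Lemma measurable_sum_seq d (U : measurableType d) (I : Type) (s : seq I) (h : I -> U -> R) :
  (forall i, measurable_fun setT (h i : U -> B)) -> measurable_fun setT (fun u => \sum_(i <- s) h i u : B).
Proof.
move=> mh; elim: s => [|i s ih].
  by rewrite (_ : (fun u => _) = fun=> 0)//; apply/funext => u; rewrite big_nil.
have -> : (fun u => \sum_(j <- i :: s) h j u) = (fun u => h i u + \sum_(j <- s) h j u).
  by apply/funext => u; rewrite big_cons.
by apply: measurable_funD; [exact: mh|exact: ih].
Qed.

Lemma measurable_nodeT j : measurable_fun setT (fun e : env => nodeT e j : B).
Proof. by case: j => [|j]; [exact: measurable_cst|exact: measurable_coord]. Qed.
Lemma measurable_nodeX j : measurable_fun setT (fun e : env => nodeX e j : B).
Proof. by case: j => [|j]; [exact: measurable_cst|exact: measurable_coord]. Qed.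
Lemma measurable_action L (a b : env -> R) : measurable_fun setT (a : env -> B) ->
  measurable_fun setT (b : env -> B) -> measurable_fun setT (fun e => action L e (a e) (b e) : B).
Proof.
move=> ma mb; apply: measurable_sum_seq => l; apply: measurable_funM; first exact: measurable_coord.
apply: measurable_maxr => //; apply: measurable_funB => //; apply: measurable_maxr => //.
exact: measurable_coord.
Qed.
Lemma cmeas_link L j : cmeas (link L ^~ j : env -> C).
Proof.
apply: cmeas_kernel.
- by apply: measurable_funN; apply: measurable_action; exact: measurable_nodeT.
- by apply: measurable_funB; exact: measurable_nodeT.
- by apply: measurable_funB; exact: measurable_nodeX.
Qed.
Lemma cmeas_Fxt L k (x t : env -> R) : measurable_fun setT (x : env -> B) ->
  measurable_fun setT (t : env -> B) -> cmeas (fun e : env => Fxt L k e (x e) (t e)).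
Proof.
move=> mx mt; apply: cmeasM; first apply: cmeasM.
- apply: cmeas_cexp; split => /=; apply: measurable_funM => //.
    by apply: measurable_sum_seq => l; exact: measurable_coord.
  apply: measurable_sum_seq => l; apply: measurable_sum_seq => l'.
  apply: measurable_funM; first by apply: measurable_funM; exact: measurable_coord.
  by apply: measurable_funB => //; apply: measurable_maxr; exact: measurable_coord.
- by apply: cmeas_prod => j; exact: cmeas_link.
- apply: cmeas_kernel.
  + by apply: measurable_funN; apply: measurable_action => //; exact: measurable_nodeT.
  + by apply: measurable_funB => //; exact: measurable_nodeT.
  + by apply: measurable_funB => //; exact: measurable_nodeX.
Qed.

Lemma overlap_eq0 (s a b : R) : b <= s -> overlap s a b = 0.
Proof.
by move=> bs; rewrite /overlap max_r// subr_le0 le_max bs.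
Qed.

(** It reduces comparisons between integrands with different labels to ordered nodes, because off
    the simplex everything vanishes. *)
Lemma Fxt_guard L L' k e x t c :
  (forall j, (j < k)%N -> nodeT e j < nodeT e j.+1) /\ nodeT e k < t \/
  Fxt L k e x t = 0 /\ c * Fxt L' k e x t = 0.
Proof.
have [/allP h|/allPn[j jk nj]] := boolP (all (fun j => nodeT e j < nodeT e j.+1) (iota 0 k)).
  have [kt|tk] := ltP (nodeT e k) t.
    by left; split => // j jk; apply: h; rewrite mem_iota.
  by right; rewrite /Fxt /kern0 subr_gt0 ltNge tk /= !mulr0.
have z M : chain M k e = 0.
  by rewrite /chain (big_rem j)//= /link /kern0 subr_gt0 (negbTE nj) mul0r.
by right; rewrite /Fxt !z !(mulr0, mul0r).
Qed.

Lemma node_le e k : (forall j, (j < k)%N -> nodeT e j < nodeT e j.+1) ->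
  forall j, (j <= k)%N -> nodeT e j <= nodeT e k.
Proof.
elim: k => [|k ih] h j; first by rewrite leqn0 => /eqP ->.
rewrite leq_eqVlt => /predU1P[->//|]; rewrite ltnS => jk.
apply: le_trans (ih _ j jk) _; last exact/ltW/h.
by move=> i ik; apply: h; exact: ltnW.
Qed.

(** For $s_l=t$ the interval $]s_l,t]$ is empty, so $\alpha_l$ disappears from $\eta$ and survives
    only in the prefactor $e^{x\sum\alpha}$. Integrated over $\alpha_l$, the factor split off
    becomes $V_1(x)$. *)
Lemma Fxt_top L k e x t l : uniq L -> l \in L -> e (1%N, l) = t ->
  (forall l', l' \in L -> e (1%N, l') <= t) ->
  Fxt L k e x t = cexp ((x * e (3%N, l))%:C) * Fxt (rem l L) k e x t.
Proof.
move=> uL lL et hL.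
have [[pj pt]|[-> ->]//] := Fxt_guard L (rem l L) k e x t (cexp ((x * e (3%N, l))%:C)).
have aE a b : b <= t -> action L e a b = action (rem l L) e a b.
  by move=> bt; rewrite /action (big_rem l)//= overlap_eq0 ?et// mulr0 add0r.
have cE : chain L k e = chain (rem l L) k e.
  apply: eq_big_seq => j; rewrite mem_iota add0n => /= jk.
  by rewrite /link aE// (le_trans (node_le _ _ pj _ jk))// ltW.
have sE : self_energy L e t = self_energy (rem l L) e t.
  rewrite /self_energy (big_rem l)//= [X in X + _]big1_seq ?add0r; last first.
    by move=> l' /= l'L; rewrite et max_l ?hL// subrr mulr0.
  apply: eq_big_seq => l' l'L; rewrite (big_rem l)//= et max_r ?subrr ?mulr0 ?add0r// hL//.
  exact: mem_rem l'L.
rewrite /Fxt cE aE// sE.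
rewrite (_ : (x * charge_sum L e) +i* _ = (x * e (3%N, l))%:C +
    ((x * charge_sum (rem l L) e) +i* (self_energy (rem l L) e t / 2))); first by rewrite cexpD !mulrA.
by rewrite /charge_sum (big_rem l)//=; apply: eqC; rewrite !(ReD, ImD) /=; ring.
Qed.

(** For $t$ after all insertions and after [tau], [action] over $[\tau,t]$ is affine in $t$: the
    total charge times $t-\tau$, minus this constant. It is the imaginary displacement that remains
    once the affine part has been removed. *)
Definition shift_g L e (tau : R) : R := \sum_(l <- L) e (3%N, l) * (Num.max (e (1%N, l)) tau - tau).
Definition Fcst L k e : C :=
  cexp ((nodeX e k * charge_sum L e) +i*
    (charge_sum L e * shift_g L e (nodeT e k) + self_energy L e (nodeT e k) / 2)) * chain L k e.

(** The defining formula is affine in time, so it may be used formally at a time [s] before some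
    insertions, where it is no longer an integral of $\eta^2$. *)
Lemma self_energyB L e (s t : R) :
  self_energy L e t = self_energy L e s + charge_sum L e ^+ 2 * (t - s).
Proof.
rewrite /self_energy /charge_sum expr2 -mulrA mulr_suml -big_split /=; apply: eq_bigr => l _.
rewrite mulr_suml mulr_sumr -big_split /=; apply: eq_bigr => l' _; ring.
Qed.

(** Completing the square: with total charge $b$ and $D=t-\tau$, the part $bD$ of [action] yields
    $-b(x-z)$ and $-ib^2D/2$, with $z$ the last position. These cancel the growth of $e^{xb}$ and of
    the self-energy. After all insertions, $(x,t)$ therefore enters through a single solution of the
    free equation. *)
Lemma Fxt_kernel L k e x t : (forall l, l \in L -> e (1%N, l) <= t) -> nodeT e k < t ->
  Fxt L k e x t = Fcst L k e * kernel (shift_g L e (nodeT e k)) (t - nodeT e k) (x - nodeX e k).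
Proof.
move=> hL kt; rewrite /Fxt /Fcst /kern0 subr_gt0 kt.
set D := t - nodeT e k; have D0 : 0 < D by rewrite subr_gt0.
set g := shift_g _ _ _; set b := charge_sum _ _; set z := x - _.
have -> : action L e (nodeT e k) t = b * D - g.
  rewrite /action /b /charge_sum /g /shift_g mulr_suml -sumrB; apply: eq_big_seq => l lL.
  rewrite /overlap max_l; first by rewrite /D; ring.
  by rewrite subr_ge0 ge_max hL// ltW.
rewrite mulrAC [RHS]mulrAC; congr (_ * _).
rewrite /kernel mulrCA [RHS]mulrCA; congr (_ * _); rewrite -!cexpD; congr cexp.
rewrite (self_energyB _ _ (nodeT e k) t) -/b -/D half_real.
have -> : x = z + nodeX e k by rewrite /z subrK.
rewrite !expr2; apply: eqC; rewrite !(ReM, ImM, ReD, ImD, ReN, ImN) /=.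
  by field; rewrite gt_eqF.
by field; rewrite gt_eqF.
Qed.

Lemma shift_g0 L e tau : (forall l, l \in L -> e (1%N, l) <= tau) -> shift_g L e tau = 0.
Proof. by move=> h; rewrite /shift_g big1_seq// => l /= lL; rewrite max_r ?h// subrr mulr0. Qed.

(** If the new node is later than all insertions, the constant in front of the last kernel is the
    integrand with one node fewer, evaluated at that node. This produces the $V_2$ part of the
    recursion. *)
Lemma Fcst_delta L k e : (forall l, l \in L -> e (1%N, l) <= nodeT e k.+1) ->
  Fcst L k.+1 e = Fxt L k e (nodeX e k.+1) (nodeT e k.+1).
Proof. by move=> h; rewrite /Fcst /Fxt chainS mulrA shift_g0// mulr0 add0r. Qed.

Section Bound.
Variables (p q : nat -> R) (s D : R) (n : nat).
Hypothesis p_lt : forall j, (j < n)%N -> p j < p j.+1.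
Hypothesis q_le : forall j, (j <= n)%N -> `|q j| <= D.

Definition interpolant n := q n - \sum_(j <- iota 0 n) (q j.+1 - q j) * (overlap s (p j) (p j.+1) / (p j.+1 - p j)).

(* [interpolant] is the value at time s of the piecewise linear path through the nodes *)
Lemma interpolant_le : `|interpolant n| <= D.
Proof.
have H m : (m <= n)%N -> `|interpolant m| <= D /\ (p m <= s -> interpolant m = q m).
  elim: m => [|m ih] mn; first by rewrite /interpolant big_nil subr0; split => //; exact: q_le.
  have [h1 h2] := ih (ltnW mn); have d0 : 0 < p m.+1 - p m by rewrite subr_gt0 p_lt.
  have E : interpolant m.+1 = interpolant m + (q m.+1 - q m) * (1 - overlap s (p m) (p m.+1) / (p m.+1 - p m)).
    by rewrite /interpolant -addn1 iotaD big_cat big_seq1 /= add0n addn1; ring.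
  have [sm|ms] := leP (p m.+1) s.
    have pm : p m <= s by rewrite (le_trans _ sm)// ltW// p_lt.
    have e1 : interpolant m.+1 = q m.+1.
      by rewrite E h2// overlap_eq0// mul0r subr0 mulr1 addrC subrK.
    by rewrite e1; split => //; exact: q_le.
  split; last by [].
  have [sm|{}sm] := leP s (p m).
    rewrite E (_ : overlap _ _ _ = p m.+1 - p m) ?divff ?gt_eqF// ?subrr ?mulr0 ?addr0//.
    by rewrite /overlap [Num.max s _]max_r// max_l// ltW.
  have th : overlap s (p m) (p m.+1) = p m.+1 - s.
    by rewrite /overlap [Num.max s _]max_l ?(ltW sm)// max_l// subr_ge0 ltW.
  rewrite E h2 ?(ltW sm)// th; set th' := _ / _.
  have t1 : 0 <= th' by apply: divr_ge0; [rewrite subr_ge0 ltW|exact: ltW].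
  have t2 : th' <= 1 by rewrite ler_pdivrMr// mul1r lerD2l lerN2 ltW.
  have := q_le m (ltnW mn); have := q_le m.+1 mn; rewrite !ler_norml => /andP[a1 a2] /andP[a3 a4].
  by apply/andP; split; nra.
exact: (H n (leqnn _)).1.
Qed.
End Bound.

Definition isqrt0 (D : R) : R := if 0 < D then (Num.sqrt D)^-1 else 0.
Definition sing_chain k e t : R :=
  (\prod_(j <- iota 0 k) isqrt0 (nodeT e j.+1 - nodeT e j)) * isqrt0 (t - nodeT e k).

Lemma isqrt0_ge0 D : 0 <= isqrt0 D.
Proof. by rewrite /isqrt0; case: ifP => // _; rewrite invr_ge0 sqrtr_ge0. Qed.

Lemma prodr_seq_ge0 (I : Type) (s : seq I) (f : I -> R) : (forall i, 0 <= f i) -> 0 <= \prod_(i <- s) f i.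
Proof. by move=> f0; apply: prodr_ge0 => i _. Qed.
Lemma sing_chain_ge0 k e t : 0 <= sing_chain k e t.
Proof. by rewrite mulr_ge0 ?isqrt0_ge0// prodr_seq_ge0// => j; exact: isqrt0_ge0. Qed.

Lemma norm1_kern0 (g D b : R) : norm1 (kern0 g D b) <= 2 * (isqrt0 D * expR (b * g / D)).
Proof.
rewrite /kern0 /isqrt0; case: ifP => D0; first exact: norm1_kernel.
by rewrite norm10 mul0r mulr0.
Qed.

Lemma norm1_prod (I : Type) (s : seq I) (f : I -> C) (h : I -> R) : (forall i, norm1 (f i) <= h i) ->
  norm1 (\prod_(i <- s) f i) <= \prod_(i <- s) h i.
Proof.
move=> fh; elim: s => [|i s ih]; first by rewrite !big_nil norm11.
rewrite !big_cons (le_trans (norm1M _ _))// ler_pM ?norm1_ge0//.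
Qed.

(** The power of 2 counts the prefactor and the $k+1$ kernels, each of which costs a factor 2 in
    [norm1]. *)
Lemma norm1_Fxt L k e x t (D : R) : `|x| <= D -> (forall j, (j <= k)%N -> `|nodeX e j| <= D) ->
  norm1 (Fxt L k e x t) <= 2 ^+ k.+2 * sing_chain k e t * \prod_(l <- L) expR (D * `|e (3%N, l)|).
Proof.
move=> xD qD.
have R0 : 0 <= 2 ^+ k.+2 * sing_chain k e t * \prod_(l <- L) expR (D * `|e (3%N, l)|).
  apply: mulr_ge0; first by apply: mulr_ge0; [exact: exprn_ge0|exact: sing_chain_ge0].
  by apply: prodr_seq_ge0 => l; exact: expR_ge0.
have [[pj pt]|[-> _]] := Fxt_guard L L k e x t 0; last by rewrite norm10.
(* The end point $(x,t)$ is appended as node $k+1$, so that [interpolant_le] sees the whole path. *)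
pose p j := if (j <= k)%N then nodeT e j else t.
pose q j := if (j <= k)%N then nodeX e j else x.
have p_lt j : (j < k.+1)%N -> p j < p j.+1.
  rewrite ltnS /p => jk; rewrite jk; case: ltnP => [|kj]; first exact: pj.
  by rewrite (_ : j = k)//; apply/eqP; rewrite eqn_leq jk.
have q_le j : (j <= k.+1)%N -> `|q j| <= D by move=> _; rewrite /q; case: ifP => // /qD.
pose ex j := (q j.+1 - q j) * - action L e (p j) (p j.+1) / (p j.+1 - p j).
have cb : norm1 (chain L k e) <= \prod_(j <- iota 0 k) (2 * (isqrt0 (nodeT e j.+1 - nodeT e j) *
   expR ((nodeX e j.+1 - nodeX e j) * - action L e (nodeT e j) (nodeT e j.+1) / (nodeT e j.+1 - nodeT e j)))).
  by apply: norm1_prod => j; exact: norm1_kern0.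
have kb := norm1_kern0 (- action L e (nodeT e k) t) (t - nodeT e k) (x - nodeX e k).
have eb := norm1_cexp ((x * charge_sum L e) +i* (self_energy L e t / 2)).
have S : x * charge_sum L e + \sum_(j <- iota 0 k.+1) ex j <= \sum_(l <- L) D * `|e (3%N, l)|.
  have -> : x * charge_sum L e + \sum_(j <- iota 0 k.+1) ex j =
      \sum_(l <- L) e (3%N, l) * interpolant p q (e (1%N, l)) k.+1.
    rewrite /charge_sum mulr_sumr [X in _ + X](eq_bigr (fun j => \sum_(l <- L) - (e (3%N, l) * ((q j.+1 - q j) *
        (overlap (e (1%N, l)) (p j) (p j.+1) / (p j.+1 - p j)))))); last first.
      by move=> j _; rewrite /ex /action -sumrN mulr_sumr mulr_suml; apply: eq_bigr => l _; ring.
    rewrite exchange_big -big_split /=; apply: eq_bigr => l _.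
    by rewrite /interpolant (_ : q k.+1 = x) ?/q ?ltnn// mulrBr mulr_sumr sumrN [x * _]mulrC.
  apply: ler_sum => l _; rewrite (le_trans (ler_norm _))// normrM mulrC ler_wpM2r//.
  exact: interpolant_le.
apply: le_trans (norm1M _ _) _; apply: le_trans (ler_wpM2r (norm1_ge0 _) (norm1M _ _)) _.
apply: le_trans (ler_pM _ _ (ler_pM _ _ eb cb) kb) _; rewrite ?mulr_ge0 ?norm1_ge0//.
rewrite !big_split /= big_const_seq count_predT size_iota iter_mulr_1 -expR_sum.
set E1 := \sum_(j <- _) _; set E2 := _ / _.
have Sk : \sum_(j <- iota 0 k.+1) ex j = E1 + E2.
  rewrite (_ : iota 0 k.+1 = iota 0 k ++ [:: k]); last by rewrite -[in LHS]addn1 iotaD.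
  rewrite big_cat big_seq1 /ex /p /q leqnn ltnn; congr (_ + _).
  by apply: eq_big_seq => j; rewrite mem_iota add0n => /= jk; rewrite (ltnW jk) jk.
rewrite Sk in S.
have SE : expR (x * charge_sum L e) * expR E1 * expR E2 <= \prod_(l <- L) expR (D * `|e (3%N, l)|).
  by rewrite -expR_sum -!expRD ler_expR -addrA.
rewrite /sing_chain; set P1 := \prod_(j <- iota 0 k) _; set I2 := isqrt0 _.
apply: le_trans (ler_wpM2l _ SE); last first.
  by apply: mulr_ge0; [exact: exprn_ge0|apply: mulr_ge0; [apply: prodr_seq_ge0 => j|]; exact: isqrt0_ge0].
by rewrite !exprS -subr_ge0 (_ : _ - _ = 0)//; ring.
Qed.

Section FeynmanF.
Lemma Rint_sum d (U : measurableType d) (mu : {measure set U -> \bar R}) (D : set U)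
    (I : eqType) (s : seq I) (h : I -> U -> R) : measurable D ->
  (forall i, i \in s -> mu.-integrable D (EFin \o h i)) ->
  \int[mu]_(x in D) (\sum_(i <- s) h i x) = \sum_(i <- s) \int[mu]_(x in D) h i x /\
  mu.-integrable D (EFin \o (fun x => \sum_(i <- s) h i x)).
Proof.
move=> mD; elim: s => [|i s ih] hi.
  split; first by rewrite big_nil; under eq_Rintegral do rewrite big_nil; rewrite /Rintegral integral0.
  by apply: (eq_integrable mD (fun=> 0%E)); [move=> x _ /=; rewrite big_nil|exact: integrable0].
have [|ih1 ih2] := ih; first by move=> j js; apply: hi; rewrite inE js orbT.
have h1 := hi i (mem_head _ _); split.
  by rewrite big_cons -ih1 -RintegralD//; apply: eq_Rintegral => x _; rewrite big_cons.
apply: (eq_integrable mD (fun x => (h i x)%:E + (\sum_(j <- s) h j x)%:E)%E); last exact: integrableD.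
by move=> x _ /=; rewrite big_cons EFinD.
Qed.

Lemma ind_itv (s t u : R) : (\1_(`]s, t]%classic : set R) u : R) = (s < u <= t)%R%:R.
Proof. by rewrite indicE mem_setE in_itv. Qed.

Lemma integrable_ind (D : set R) (c s t : R) : measurable (D : set B) ->
  leb.-integrable D (EFin \o (fun u : R => c * \1_(`]s, t]%classic) u)).
Proof.
move=> mD; apply: (integrableS measurableT) => //.
exact: (integrableZl measurableT c (integrable_indic_itv s t false false)).
Qed.

Lemma int_ind_itv (a b s t : R) : a <= b -> b <= t ->
  \int[leb]_(u in `[a, b]) (\1_(`]s, t]%classic) u) = overlap s a b.
Proof.
move=> ab bt; rewrite /Rintegral integral_indic; try exact: measurable_itv.
rewrite [X in fine X](_ : _ = @lebesgue_measure R (`]s, t]%classic `&` `[a, b]%classic)); last by [].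
have [sa|as_] := ltP s a.
  have -> : `]s, t]%classic `&` `[a, b]%classic = [set` `[a, b]].
    apply/seteqP; split => [u [] //|u]; rewrite /= !in_itv /= => /andP[au ub]; split; last exact/andP.
    by rewrite (lt_le_trans sa)// (le_trans ub).
  rewrite lebesgue_measure_itv/= lte_fin /overlap max_l ?max_r ?(ltW sa) ?subr_ge0//.
  move: ab; rewrite le_eqVlt => /predU1P[->|ab]; first by rewrite ltxx subrr.
  by rewrite ab -EFinB.
have -> : `]s, t]%classic `&` `[a, b]%classic = [set` `]s, b]].
  apply/seteqP; split => u; rewrite /= !in_itv /=; first by move=> [/andP[-> _] /andP[_ ->]].
  move=> /andP[su ub]; rewrite su ub (le_trans ub)// (le_trans as_)//; exact: ltW.
rewrite lebesgue_measure_itv/= lte_fin /overlap [Num.max s a]max_l//.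
by case: ltP => sb /=; [rewrite max_l// subr_ge0 ltW|rewrite max_r// subr_le0].
Qed.

Lemma int_ind_T (s t : R) : s <= t -> \int[leb]_u (\1_(`]s, t]%classic) u) = t - s.
Proof.
move=> st; rewrite /Rintegral integral_indic; try exact: measurable_itv; last exact: measurableT.
rewrite setIT [X in fine X](_ : _ = @lebesgue_measure R [set` `]s, t]]); last by [].
rewrite lebesgue_measure_itv/= lte_fin.
move: st; rewrite le_eqVlt => /predU1P[->|st]; first by rewrite ltxx subrr.
by rewrite st -EFinB.
Qed.

Let r L e (t u : R) : R := \sum_(l <- L) e (3%N, l) * \1_(`]e (1%N, l), t]%classic) u.

Lemma int_r L e a b t : a <= b -> b <= t ->
  \int[leb]_(u in `[a, b]) r L e t u = action L e a b.
Proof.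
move=> ab bt; have m1 : measurable (`[a, b]%classic : set B) by exact: measurable_itv.
have [|-> _] := Rint_sum _ B leb `[a, b]%classic _ L (fun l u => e (3%N, l) * \1_(`]e (1%N, l), t]%classic) u) m1.
  by move=> l _; exact: integrable_ind.
apply: eq_bigr => l _; rewrite RintegralZl ?int_ind_itv//.
apply: (integrableS measurableT) => //; exact: integrable_indic_itv.
Qed.

Let rE L e t u : r L e t u ^+ 2 = \sum_(l <- L) \sum_(l' <- L) e (3%N, l) * e (3%N, l') *
    \1_(`]Num.max (e (1%N, l)) (e (1%N, l')), t]%classic) u.
Proof.
rewrite /r expr2 mulr_suml; apply: eq_bigr => l _; rewrite mulr_sumr; apply: eq_bigr => l' _.
rewrite !ind_itv gt_max mulrACA -natrM mulnb; congr (_ * (nat_of_bool _)%:R).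
by case: (u <= t); rewrite ?andbT ?andbF.
Qed.

Lemma int_rr L e t : (forall l, l \in L -> e (1%N, l) <= t) ->
  \int[leb]_u (r L e t u ^+ 2) = self_energy L e t.
Proof.
move=> hL.
transitivity (\int[leb]_u (\sum_(l <- L) \sum_(l' <- L) e (3%N, l) * e (3%N, l') *
    \1_(`]Num.max (e (1%N, l)) (e (1%N, l')), t]%classic) u)).
  by apply: eq_Rintegral => u _.
have inner l := Rint_sum _ B leb setT _ L (fun l' u => e (3%N, l) * e (3%N, l') *
    \1_(`]Num.max (e (1%N, l)) (e (1%N, l')), t]%classic) u) measurableT
    (fun l' _ => integrable_ind _ _ _ _ measurableT).
have [|-> _] := Rint_sum _ B leb setT _ L (fun l u => \sum_(l' <- L) e (3%N, l) * e (3%N, l') *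
    \1_(`]Num.max (e (1%N, l)) (e (1%N, l')), t]%classic) u) measurableT.
  by move=> l _; exact: (inner l).2.
apply: eq_big_seq => l lL; rewrite (inner l).1; apply: eq_big_seq => l' l'L.
rewrite RintegralZl//; last exact: integrable_indic_itv.
by rewrite int_ind_T// ge_max !hL.
Qed.

Lemma int_rr_integrable L e t : leb.-integrable setT (EFin \o (fun u => r L e t u ^+ 2)).
Proof.
rewrite (_ : (fun u => _) = fun u => \sum_(l <- L) \sum_(l' <- L) e (3%N, l) * e (3%N, l') *
    \1_(`]Num.max (e (1%N, l)) (e (1%N, l')), t]%classic) u); last exact/funext/rE.
have inner l := Rint_sum _ B leb setT _ L (fun l' u => e (3%N, l) * e (3%N, l') *
    \1_(`]Num.max (e (1%N, l)) (e (1%N, l')), t]%classic) u) measurableT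
    (fun l' _ => integrable_ind _ _ _ _ measurableT).
by apply: (Rint_sum _ B leb setT _ L _ measurableT _).2 => l _; exact: (inner l).2.
Qed.

Definition vals e (c m : nat) : seq R := [seq e (c, j) | j <- iota 0 m].
Lemma nth_vals e c m j : (j < m)%N -> (vals e c m)`_j = e (c, j).
Proof. by move=> jm; rewrite (nth_map 0%N) ?size_iota// nth_iota. Qed.
Lemma size_vals e c m : size (vals e c m) = m. Proof. by rewrite size_map size_iota. Qed.

Lemma sum_vals (V : nmodType) m (F : nat -> V) : \sum_(l < m) F l = \sum_(l <- iota 0 m) F l.
Proof. by rewrite -(big_mkord xpredT F) /index_iota subn0. Qed.

Lemma etaE e m t u : Defs.eta t m (vals e 1 m) (vals e 3 m) u = 'i%C * (r (iota 0 m) e t u)%:C.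
Proof.
rewrite /Defs.eta /r (rmorph_sum (real_complex R)) /= -sum_vals; congr (_ * _); apply: eq_bigr => l _.
by rewrite !nth_vals// (rmorphM (real_complex R)).
Qed.

Lemma cintegral_eta e m (t a b : R) : a <= b -> b <= t ->
  cintegral leb `[a, b] (Defs.eta t m (vals e 1 m) (vals e 3 m)) = 'i%C * (action (iota 0 m) e a b)%:C.
Proof.
move=> ab bt; rewrite -(int_r _ _ _ _ t)//; apply: eqC.
  rewrite !(ReM, ImM) /=; transitivity (\int[leb]_(u in `[a, b]) (0 : R)).
    by apply: eq_Rintegral => u _; rewrite etaE !(ReM, ImM) /=; ring.
  by rewrite /Rintegral integral0 /=; ring.
rewrite !(ReM, ImM) /= mul0r add0r mul1r.
by apply: eq_Rintegral => u _; rewrite etaE !(ReM, ImM) /=; ring.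
Qed.

Lemma cintegral_eta2 e m (t : R) : (forall l, (l < m)%N -> e (1%N, l) <= t) ->
  cintegral leb setT (fun u => Defs.eta t m (vals e 1 m) (vals e 3 m) u ^+ 2) =
  - (self_energy (iota 0 m) e t)%:C.
Proof.
move=> hm; rewrite -int_rr; last by move=> l; rewrite mem_iota add0n => /= /hm.
apply: eqC; last first.
  rewrite ImN /= oppr0; transitivity (\int[leb]_u (0 : R)).
    by apply: eq_Rintegral => u _; rewrite etaE expr2 !(ReM, ImM) /=; ring.
  by rewrite /Rintegral integral0.
have i2 : leb.-integrable setT (EFin \o (fun u => r (iota 0 m) e t u ^+ 2)).
  exact: int_rr_integrable.
rewrite ReN /=.
transitivity (\int[leb]_u (-1 * r (iota 0 m) e t u ^+ 2)).
  by apply: eq_Rintegral => u _; rewrite etaE !expr2 !(ReM, ImM) /=; ring.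
by rewrite RintegralZl// mulN1r.
Qed.

(** Both restrictions matter: for some $s_l>t$ the formula for $\int\eta^2$ fails, and for unordered
    nodes [kern0] is not the factor of the definition. The integrals of the series only visit the
    region described here. *)
Lemma feynman_FE m k e (x t : R) : (forall l, (l < m)%N -> e (1%N, l) <= t) ->
  (forall j, (j < k)%N -> nodeT e j < nodeT e j.+1) -> nodeT e k < t ->
  feynman_F t0 y t x m k (vals e 0 k) (vals e 1 m) (vals e 2 k) (vals e 3 m) = Fxt (iota 0 m) k e x t.
Proof.
move=> hm pj pt.
have pE j : (j <= k)%N -> nth 0 (t0 :: rcons (vals e 0 k) t) j = nodeT e j.
  by case: j => [//|j] jk; rewrite /= nth_rcons size_vals jk nth_vals.
have qE j : (j <= k)%N -> nth 0 (y :: rcons (vals e 2 k) x) j = nodeX e j.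
  by case: j => [//|j] jk; rewrite /= nth_rcons size_vals jk nth_vals.
have pk : nth 0 (rcons (vals e 0 k) t) k = t by rewrite nth_rcons size_vals ltnn eqxx.
have qk : nth 0 (rcons (vals e 2 k) x) k = x by rewrite nth_rcons size_vals ltnn eqxx.
have lE (a b qa qb : R) : a < b -> b <= t ->
    (sqrtc (2%:R * pi%:C * 'i%C * (b - a)%:C))^-1 *
     cexp ('i%C / (2%:R * (b - a)%:C) *
       (cintegral leb `[a, b] (Defs.eta t m (vals e 1 m) (vals e 3 m)) + (qb - qa)%:C) ^+ 2) =
    kern0 (- action (iota 0 m) e a b) (b - a) (qb - qa).
  move=> ab bt; rewrite cintegral_eta ?(ltW ab)// /kern0 subr_gt0 ab /kernel /ksqrt.
  congr (_ * cexp (_ * _ ^+ 2)); rewrite (rmorphN (real_complex R)) mulrN opprK addrC.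
  by [].
rewrite /feynman_F cintegral_eta2// big_add1 /= big_nat_recr//= pE ?qE// pk qk lE// mulrA.
congr (_ * _ * _).
  rewrite -cexpD; congr cexp; rewrite (sum_vals _ m (fun l => ((vals e 3 m)`_l)%:C)) /=.
  have -> : \sum_(l <- iota 0 m) ((vals e 3 m)`_l)%:C = (charge_sum (iota 0 m) e)%:C :> C.
    rewrite /charge_sum (rmorph_sum (real_complex R)) /=; apply: eq_big_seq => l.
    by rewrite mem_iota add0n => /= lm; rewrite nth_vals.
  have -> : 'i%C / 2%:R = 0 +i* 2^-1 :> C.
    have := half_real (1 : R); rewrite mulr1 (_ : (1 : R)%:C = 1)// mulr1 => ->.
    by apply: eqC; rewrite !(ReM, ImM) /=; ring.
  by apply: eqC; rewrite !(ReM, ImM, ReD, ImD, ReN, ImN) /=; ring.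
rewrite /chain /index_iota subn0; apply: eq_big_seq => j; rewrite mem_iota add0n => /= jk.
rewrite (pE j) ?(ltnW jk)// (qE j) ?(ltnW jk)// -[nth 0 (rcons _ t) j]/(nth 0 (t0 :: rcons (vals e 0 k) t) j.+1).
rewrite -[nth 0 (rcons _ x) j]/(nth 0 (y :: rcons (vals e 2 k) x) j.+1) pE// qE// lE ?pj//.
by rewrite (le_trans (node_le _ _ pj _ jk))// ltW.
Qed.
End FeynmanF.
End ClosedForm.

(** * Bounds for the simplex integrals *)

Section SimplexBound.
Context {R : realType}.
Local Notation C := R[i].
Local Notation B := (measurableTypeR R).
Local Notation leb := (@lebesgue_measure R).
Local Notation env := (@env R).
Local Notation name := (nat * nat)%type.

Lemma measurable_isqrt0 d (U : measurableType d) (f : U -> R) : measurable_fun setT (f : U -> B) ->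
  measurable_fun setT (fun u => isqrt0 (f u) : B).
Proof.
move=> mf; apply: measurable_fun_ifT => //; first exact: measurable_fun_ltr.
apply: measurable_invf; apply: (@measurableT_comp _ _ _ _ _ _ (@Num.sqrt R)) => //.
by apply: continuous_measurable_fun; exact: sqrt_continuous.
Qed.

Section OneStep.
Variables (mu : R) (a b : R).
Hypotheses (mu0 : 0 < mu) (ab : a < b).

(** An elementary majorant of $r^{-1/2}e^{-\mu^2r}$, by $(1+x)^2\le2(1+x^2)\le2e^{x^2}$ at
    $x=\mu\sqrt r$. It has the explicit primitive [G], which is bounded by $4/\mu$. *)
Let f (r : R) : R := 2 * isqrt0 r / (1 + mu * Num.sqrt r) ^+ 2.
Let G (r : R) : R := 4 * Num.sqrt r / (1 + mu * Num.sqrt r).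

Let den0 r : 0 < 1 + mu * Num.sqrt r.
Proof. by rewrite ltr_wpDr// mulr_ge0 ?sqrtr_ge0 ?ltW. Qed.

Let dG (r : R) : 0 < r -> is_derive r (1 : R) G (f r).
Proof.
move=> r0; have ds := @is_derive1_sqrt R r r0.
have sr : 0 < Num.sqrt r by rewrite sqrtr_gt0.
have d0 := den0 r.
have nz : 1 + mu * Num.sqrt r != 0 by rewrite gt_eqF.
have dd := derD _ _ _ _ _ (derC 1 r) (derM _ _ _ _ _ (derC mu r) ds).
apply: der_eq (derM _ _ _ _ _ (derM _ _ _ _ _ (derC 4 r) ds) (derV (fun r => 1 + mu * Num.sqrt r) _ _ nz dd)) _.
rewrite /f /isqrt0 r0; move: (Num.sqrt r) sr nz => s s0 nz; field.
by rewrite nz gt_eqF.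
Qed.

Let f0 r : 0 <= f r.
Proof. by rewrite /f divr_ge0 ?sqr_ge0// mulr_ge0// isqrt0_ge0. Qed.

Let mf : measurable_fun setT (f : B -> B).
Proof.
have ms : measurable_fun setT (@Num.sqrt R : B -> B).
  by apply: continuous_measurable_fun; exact: sqrt_continuous.
apply: measurable_funM; first by apply: measurable_funM => //; exact: measurable_isqrt0.
apply: measurable_invf; apply: measurable_funX; apply: measurable_funD => //.
exact: measurable_funM.
Qed.

Let cf (r : R) : 0 < r -> {for r, continuous f}.
Proof.
move=> r0; have ds := @is_derive1_sqrt R r r0.
have sr : Num.sqrt r != 0 by rewrite gt_eqF// sqrtr_gt0.
have nz : (1 + mu * Num.sqrt r) ^+ 2 != 0 by rewrite expf_neq0// gt_eqF.
have dd := derX2 _ _ _ (derD _ _ _ _ _ (derC 1 r) (derM _ _ _ _ _ (derC mu r) ds)).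
have df := derM _ _ _ _ _ (derM _ _ _ _ _ (derC 2 r) (derV (@Num.sqrt R) r _ sr ds))
   (derV (fun r => (1 + mu * Num.sqrt r) ^+ 2) _ _ nz dd).
apply: (der_continuous f r _ (@near_eq_is_derive R R R _ f r 1 _ _ df)).
by apply: filterS (lt_nbhsr r0) => s s0; rewrite /f /isqrt0 s0.
Qed.

Let G_le r s : 0 <= r -> G s - G r <= 4 / mu.
Proof.
move=> r0; have gr : 0 <= G r by rewrite /G divr_ge0 ?(ltW (den0 _))// mulr_ge0// sqrtr_ge0.
have gs : G s <= 4 / mu.
  rewrite /G ler_pdivrMr// mulrDr mulr1 (_ : 4 / mu * (mu * _) = 4 * Num.sqrt s); last by field; rewrite gt_eqF.
  by rewrite lerDr divr_ge0// ltW.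
lra.
Qed.

Let psi_le (r : R) : 0 < r -> (Num.sqrt r)^-1 * expR (- (mu ^+ 2 * r)) <= f r.
Proof.
move=> r0; have sr : 0 < Num.sqrt r by rewrite sqrtr_gt0.
rewrite /f /isqrt0 r0 [2 * _]mulrC -[leRHS]mulrA ler_wpM2l ?invr_ge0 ?sqrtr_ge0//.
rewrite expRN -[leRHS]invrK lef_pV2 ?posrE ?invr_gt0 ?expR_gt0 ?divr_gt0 ?exprn_gt0//.
rewrite invfM invrK mulrC ler_pdivrMr//.
have h := expR_ge1Dx (mu ^+ 2 * r).
have e : mu ^+ 2 * r = (mu * Num.sqrt r) ^+ 2 by rewrite exprMn sqr_sqrtr// ltW.
move: h; rewrite e; set x := mu * _ => h.
have h2 := sqr_ge0 (1 - x); nra.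
Qed.

Let sqrt_half (u T : R) : 0 < T -> T / 2 <= u -> isqrt0 u <= 2 * isqrt0 T.
Proof.
move=> T0 Tu; have u0 : 0 < u by apply: lt_le_trans Tu; rewrite divr_gt0.
rewrite /isqrt0 u0 T0 -[2]invrK -invfM lef_pV2 ?posrE ?mulr_gt0 ?sqrtr_gt0//.
have -> : 2^-1 * Num.sqrt T = Num.sqrt (T / 4).
  rewrite mulrC sqrtrM ?(ltW T0)//; congr (_ * _).
  by rewrite (_ : 4^-1 = 2^-1 ^+ 2 :> R) ?sqrtr_sqr ?ger0_norm//; field.
by apply: ler_wsqrtr; lra.
Qed.

(** The longer of the two gaps $t-a$ and $b-t$ is at least $(b-a)/2$, so its singular factor is at
    most $2(b-a)^{-1/2}$. For the shorter gap, the weight relative to its value at [b] supplies the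
    decay needed in [psi_le]. *)
Let pw (t : R) : isqrt0 (b - t) * isqrt0 (t - a) * expR (mu ^+ 2 * (t - a)) <=
  2 * isqrt0 (b - a) * expR (mu ^+ 2 * (b - a)) *
  ((f (t - a) + f (b - t)) * (a < t < b)%R%:R).
Proof.
have [/andP[ta tb]|h] := boolP (a < t < b); last first.
  rewrite !mulr0; move: h; rewrite negb_and -!leNgt => /orP[ta|bt].
    by rewrite {2}/isqrt0 subr_gt0 ltNge ta /= mulr0 mul0r.
  by rewrite {1}/isqrt0 subr_gt0 ltNge bt /= !mul0r.
have ba : 0 < b - a by rewrite subr_gt0.
have u0 : 0 < t - a by rewrite subr_gt0.
have v0 : 0 < b - t by rewrite subr_gt0.
have E : expR (mu ^+ 2 * (t - a)) = expR (- (mu ^+ 2 * (b - t))) * expR (mu ^+ 2 * (b - a)).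
  by rewrite -expRD; congr expR; ring.
rewrite E mulr1 mulrA [leRHS]mulrAC ler_wpM2r ?expR_ge0//.
have [h|h] := leP ((b - a) / 2) (t - a).
  have h1 := sqrt_half _ _ ba h; have h2 := psi_le _ v0.
  rewrite mulrAC -[X in X * isqrt0 (t - a)]/(isqrt0 (b - t) * _) mulrC.
  apply: (@le_trans _ _ (2 * isqrt0 (b - a) * f (b - t))).
    apply: ler_pM => //; rewrite ?isqrt0_ge0 ?mulr_ge0 ?isqrt0_ge0 ?expR_ge0//.
    by rewrite /isqrt0 v0.
  by apply: ler_wpM2l; [rewrite mulr_ge0 ?isqrt0_ge0|rewrite lerDr].
have {}h : (b - a) / 2 <= b - t by lra.
have h1 := sqrt_half _ _ ba h; have h2 := psi_le _ u0.
apply: (@le_trans _ _ (2 * isqrt0 (b - a) * f (t - a))).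
  rewrite -mulrA; apply: ler_pM => //; rewrite ?isqrt0_ge0 ?mulr_ge0 ?isqrt0_ge0 ?expR_ge0//.
  rewrite /isqrt0 u0; apply: le_trans h2; rewrite ler_pM2l ?invr_gt0 ?sqrtr_gt0// ler_expR lerN2.
  by rewrite ler_pM2l ?exprn_gt0//; lra.
by apply: ler_wpM2l; [rewrite mulr_ge0 ?isqrt0_ge0|rewrite lerDl].
Qed.

Let int1 : (\int[leb]_(t in `]a, b[) (f (t - a))%:E <= (4 / mu)%:E)%E.
Proof.
apply: (ge0_integral_derive_le (fun t => G (t - a)) (fun t => f (t - a))).
- exact: ab.
- move=> t /andP[ta _]; apply: der_eq (der_comp G (fun t => t - a) t _ _ (dG (t - a) _)
    (derD _ _ _ _ _ (derI t) (derC (- a) t))) _; last by ring.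
  by rewrite subr_gt0.
- by move=> t _; exact: f0.
- move=> t /andP[ta _]; apply: (@continuous_comp _ _ _ (fun t => t - a) f).
    by apply: cvgB; [exact: cvg_id|exact: cvg_cst].
  by apply: cf; rewrite subr_gt0.
- by move=> x z ax xz zb; apply: G_le; rewrite subr_ge0 ltW.
- apply: measurable_funTS; apply: (measurableT_comp mf); exact: measurable_funB.
Qed.
Let int2 : (\int[leb]_(t in `]a, b[) (f (b - t))%:E <= (4 / mu)%:E)%E.
Proof.
apply: (ge0_integral_derive_le (fun t => - G (b - t)) (fun t => f (b - t))).
- exact: ab.
- move=> t /andP[_ tb]; apply: der_eq (derN _ _ _ (der_comp G (fun t => b - t) t _ _ (dG (b - t) _)
    (derD _ _ _ _ _ (derC b t) (derN _ _ _ (derI t))))) _; last by ring.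
  by rewrite subr_gt0.
- by move=> t _; exact: f0.
- move=> t /andP[_ tb]; apply: (@continuous_comp _ _ _ (fun t => b - t) f).
    by apply: cvgB; [exact: cvg_cst|exact: cvg_id].
  by apply: cf; rewrite subr_gt0.
- move=> x z ax xz zb; rewrite opprK addrC; apply: G_le; rewrite subr_ge0 ltW//.
- apply: measurable_funTS; apply: (measurableT_comp mf); exact: measurable_funB.
Qed.

(** Each of the two summands in [pw] integrates to at most $4/\mu$, and the prefactor 2 makes
    $16/\mu$. *)
Lemma one_step_lt : (\int[leb]_t (isqrt0 (b - t) * isqrt0 (t - a) * expR (mu ^+ 2 * (t - a)))%:E <=
  (16 / mu * (isqrt0 (b - a) * expR (mu ^+ 2 * (b - a))))%:E)%E.
Proof.
set K := 2 * isqrt0 (b - a) * expR (mu ^+ 2 * (b - a)).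
have K0 : 0 <= K by rewrite mulr_ge0 ?expR_ge0// mulr_ge0 ?isqrt0_ge0.
have m1 : measurable_fun setT (fun t : B => f (t - a)).
  by apply: (measurableT_comp mf); exact: measurable_funB.
have m2 : measurable_fun setT (fun t : B => f (b - t)).
  by apply: (measurableT_comp mf); exact: measurable_funB.
have mi : measurable_fun setT (fun t : B => (a < t < b)%R%:R : R).
  rewrite (_ : (fun t : B => _) = \1_(`]a, b[%classic)); first by apply: measurable_indic; exact: measurable_itv.
  by apply/funext => t; rewrite indicE mem_setE in_itv.
apply: (@le_trans _ _ (\int[leb]_t (K * ((f (t - a) + f (b - t)) * (a < t < b)%R%:R))%:E)%E).
  apply: ge0_le_integral => //.
  - by move=> t _; rewrite lee_fin mulr_ge0 ?expR_ge0// mulr_ge0 ?isqrt0_ge0.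
  - apply/measurable_EFinP; apply: measurable_funM.
      apply: measurable_funM; apply: measurable_isqrt0; exact: measurable_funB.
    by apply: measurableT_comp => //; apply: measurable_funM => //; exact: measurable_funB.
  - apply/measurable_EFinP; apply: measurable_funM => //; apply: measurable_funM => //.
    exact: measurable_funD.
  - by move=> t _; rewrite lee_fin; exact: pw.
under eq_integral do rewrite EFinM.
rewrite ge0_integralZl//; last 2 first.
- apply/measurable_EFinP; apply: measurable_funM => //; exact: measurable_funD.
- by move=> t _; rewrite lee_fin mulr_ge0 ?ler0n// addr_ge0.
rewrite (_ : \int[leb]_t ((f (t - a) + f (b - t)) * (a < t < b)%R%:R)%:E =
   \int[leb]_(t in `]a, b[) ((f (t - a))%:E + (f (b - t))%:E))%E; last first.
  rewrite [RHS]integral_mkcond; apply: eq_integral => t _; rewrite patchE mem_setE in_itv /=.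
  by case: ifP => _; rewrite ?mulr1 ?mulr0 ?EFinD.
rewrite ge0_integralD; last 5 first.
- exact: measurable_itv.
- by move=> t _; rewrite lee_fin.
- by apply/measurable_EFinP; exact: measurable_funTS.
- by move=> t _; rewrite lee_fin.
- by apply/measurable_EFinP; exact: measurable_funTS.
apply: le_trans (lee_wpmul2l _ (leeD int1 int2)) _; first by rewrite lee_fin.
rewrite -EFinD -EFinM lee_fin /K -subr_ge0 (_ : _ - _ = 0)//.
by field; rewrite gt_eqF.
Qed.
End OneStep.

(** Convolution with $r^{-1/2}$ maps the profile $r^{-1/2}e^{\mu^2r}$ to at most $16/\mu$ times
    itself, so the step can be iterated at a fixed cost per node. *)
Lemma one_step (mu a b : R) : 0 < mu ->
  (\int[leb]_t (isqrt0 (b - t) * isqrt0 (t - a) * expR (mu ^+ 2 * (t - a)))%:E <=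
  (16 / mu * (isqrt0 (b - a) * expR (mu ^+ 2 * (b - a))))%:E)%E.
Proof.
move=> mu0; have [ba|ab] := leP b a; last exact: one_step_lt.
rewrite integral0_eq => [|t _].
  rewrite lee_fin mulr_ge0//; first by rewrite divr_ge0// ltW.
  by rewrite mulr_ge0 ?expR_ge0 ?isqrt0_ge0.
rewrite /isqrt0 !subr_gt0; case: ltP => tb; last by rewrite !mul0r.
by rewrite ltNge (ltW (lt_le_trans tb ba)) mulr0 mul0r.
Qed.

Variables (mu : name -> {sigma_finite_measure set B -> \bar R}) (t0 : R).
Hypothesis mu0 : forall j, mu (0%N, j) = leb.

Definition tnames k : seq name := [seq (0%N, j) | j <- iota 0 k].

Lemma tnamesS k : tnames k.+1 = tnames k ++ [:: (0%N, k)].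
Proof. by rewrite /tnames -addn1 iotaD map_cat. Qed.
Lemma uniq_tnames k : uniq (tnames k).
Proof. by rewrite map_inj_uniq ?iota_uniq// => i j []. Qed.
Lemma mem_tnames k (i : name) : (i \in tnames k) = (i.1 == 0%N) && (i.2 < k)%N.
Proof.
case: i => c j /=; apply/mapP/andP => [[l]|[/eqP -> jk]]; last by exists j; rewrite ?mem_iota.
by rewrite mem_iota add0n => /= lk [-> ->].
Qed.

Lemma measurable_sing_chain k (t : env -> R) : measurable_fun setT (t : env -> B) ->
  measurable_fun setT (fun e : env => sing_chain t0 k e (t e) : B).
Proof.
move=> mt; apply: measurable_funM.
  elim: (iota 0 k) => [|j s ih].
    rewrite (_ : (fun e : env => _) = fun=> 1)//; by apply/funext => e; rewrite big_nil.
  have -> : (fun e : env => \prod_(j0 <- j :: s) isqrt0 (nodeT t0 e j0.+1 - nodeT t0 e j0)) =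
     (fun e : env => isqrt0 (nodeT t0 e j.+1 - nodeT t0 e j) * \prod_(j0 <- s) isqrt0 (nodeT t0 e j0.+1 - nodeT t0 e j0)).
    by apply/funext => e; rewrite big_cons.
  apply: measurable_funM; last exact: ih.
  by apply: measurable_isqrt0; apply: measurable_funB; exact: measurable_nodeT.
by apply: measurable_isqrt0; apply: measurable_funB => //; exact: measurable_nodeT.
Qed.

Lemma simplex_bound (m : R) k t e : 0 < m ->
  (Nints mu (tnames k) (fun e => (sing_chain t0 k e t)%:E) e <=
   ((16 / m) ^+ k * (isqrt0 (t - t0) * expR (m ^+ 2 * (t - t0))))%:E)%E.
Proof.
move=> m0; elim: k t e => [|k ih] t e.
  rewrite /= /sing_chain big_nil expr0 !mul1r /= lee_fin.
  have [tt|tt] := leP t t0; first by rewrite /isqrt0 subr_gt0 ltNge tt mul0r.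
  rewrite ler_peMr ?isqrt0_ge0// -[leLHS]expR0 ler_expR mulr_ge0 ?sqr_ge0// subr_ge0 ltW//.
have nm k' t' : nnmeas (fun e : env => (sing_chain t0 k' e t')%:E).
  split; last by move=> e'; rewrite lee_fin sing_chain_ge0.
  by apply/measurable_EFinP; apply: (measurable_sing_chain k' (fun=> t')).
(* The latest time is integrated outermost: the induction hypothesis, with this time as the end
   point, then leaves exactly the integral of [one_step]. *)
rewrite (Nints_perm _ _ ((0%N, k) :: tnames k)) ?uniq_tnames//; last first.
  by rewrite tnamesS perm_catC.
set M := (16 / m) ^+ k.
have M0 : 0 <= M by rewrite exprn_ge0// divr_ge0// ltW.
rewrite /= /Nint mu0.
apply: (@le_trans _ _ (\int[leb]_s (M * (isqrt0 (t - s) * isqrt0 (s - t0) * expR (m ^+ 2 * (s - t0))))%:E)%E).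
  apply: ge0_le_integral => //.
  - move=> s _; have [_] := nnmeas_Nints mu (tnames k) _ (nm k.+1 t); exact.
  - exact: (nnmeas_upd _ e (0%N, k) (nnmeas_Nints mu (tnames k) _ (nm k.+1 t))).
  - apply/measurable_EFinP; apply: measurable_funM => //; apply: measurable_funM.
      apply: measurable_funM; apply: measurable_isqrt0; exact: measurable_funB.
    by apply: measurableT_comp => //; apply: measurable_funM => //; exact: measurable_funB.
  move=> s _.
  rewrite (eq_Nints mu _ _ (fun e' => (isqrt0 (t - s))%:E * (sing_chain t0 k e' s)%:E)%E); last first.
    move=> e' ee'; have es : e' (0%N, k) = s.
      by rewrite ee' ?upd_same// mem_tnames /= ltnn.
    rewrite -EFinM /sing_chain (_ : iota 0 k.+1 = iota 0 k ++ [:: k]); last by rewrite -[in LHS]addn1 iotaD.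
    by rewrite big_cat big_seq1 /= es; congr (_%:E); ring.
  rewrite (NintsZ mu _ (fun=> isqrt0 (t - s)) _ _ (fun=> isqrt0_ge0 _))//.
  apply: le_trans (lee_wpmul2l _ (ih s _)) _; first by rewrite lee_fin isqrt0_ge0.
  by rewrite -EFinM lee_fin -/M mulrCA !mulrA lexx.
under eq_integral do rewrite EFinM.
rewrite ge0_integralZl//; last 2 first.
- apply/measurable_EFinP; apply: measurable_funM.
    apply: measurable_funM; apply: measurable_isqrt0; exact: measurable_funB.
  by apply: measurableT_comp => //; apply: measurable_funM => //; exact: measurable_funB.
- by move=> s _; rewrite lee_fin mulr_ge0 ?expR_ge0// mulr_ge0 ?isqrt0_ge0.
apply: le_trans (lee_wpmul2l _ (one_step m t0 t m0)) _; first by rewrite lee_fin.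
rewrite -EFinM le_eqVlt; apply/orP; left; apply/eqP; congr (_%:E).
rewrite (exprSr (16 / m) k); exact: mulrA.
Qed.
End SimplexBound.

(** * Absolute convergence of the contribution with given numbers of insertions *)

Section Majorant.
Context {R : realType}.
Local Notation C := R[i].
Local Notation B := (measurableTypeR R).
Local Notation leb := (@lebesgue_measure R).
Local Notation env := (@env R).
Local Notation name := (nat * nat)%type.
Variables (mu1 mu2 : {sigma_finite_measure set B -> \bar R}) (h1 h2 : R -> C) (w1 w2 : R -> R).
Variables (D2 t0 y : R).
Hypotheses (mh1 : cmeas (h1 : B -> C)) (mh2 : cmeas (h2 : B -> C)).
Hypotheses (mw1 : measurable_fun setT (w1 : B -> B)) (mw2 : measurable_fun setT (w2 : B -> B)).
Hypotheses (hw1 : forall x, norm1 (h1 x) <= w1 x) (hw2 : forall x, norm1 (h2 x) <= w2 x).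
Hypothesis w1y : forall c, (\int[mu1]_x (expR (c * `|x|) * w1 x)%:E < +oo)%E.
Hypothesis w2y : (\int[mu2]_x (w2 x)%:E < +oo)%E.
Hypothesis w2D : forall x, D2 < `|x| -> w2 x = 0.

Definition fmu (i : name) : {sigma_finite_measure set B -> \bar R} :=
  if i.1 == 2%N then mu2 else if i.1 == 3%N then mu1 else leb.
(** For the insertion times the density is an indicator, so that the domain $[t_0,t]$ becomes part
    of the integrand and every variable ranges over the line. *)
Definition fh (t : R) (i : name) (a : R) : C :=
  if i.1 == 1%N then (if t0 <= a <= t then 1 else 0) else
  if i.1 == 2%N then h2 a else if i.1 == 3%N then h1 a else 1.
Definition fw (t : R) (i : name) (a : R) : R :=
  if i.1 == 1%N then (if t0 <= a <= t then 1 else 0) else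
  if i.1 == 2%N then w2 a else if i.1 == 3%N then w1 a else 1.
(** The share of each variable in the exponential bound of [norm1_Fxt], to which only the $\alpha_l$
    contribute. *)
Definition fb (D : R) (i : name) (a : R) : R := if i.1 == 3%N then expR (D * `|a|) else 1.
Definition fK (D t : R) (i : name) : R :=
  if i.1 == 1%N then Num.max (t - t0) 0 else
  if i.1 == 2%N then fine (\int[mu2]_x (w2 x)%:E) else fine (\int[mu1]_x (expR (D * `|x|) * w1 x)%:E).

(** All variables behind the test of the time ordering, nested as in the definition of the series:
    insertion times, positions of the nodes, exponents. *)
Definition inames (L : seq nat) k : seq name :=
  [seq (1%N, l) | l <- L] ++ [seq (2%N, j) | j <- iota 0 k] ++ [seq (3%N, l) | l <- L].

Lemma fw1_ge0 x : 0 <= w1 x. Proof. exact: le_trans (norm1_ge0 _) (hw1 x). Qed.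
Lemma fw2_ge0 x : 0 <= w2 x. Proof. exact: le_trans (norm1_ge0 _) (hw2 x). Qed.
Lemma fw_ge0 t i a : 0 <= fw t i a.
Proof.
rewrite /fw; case: ifP => _; first by case: ifP.
by case: ifP => _; [exact: fw2_ge0|case: ifP => // _; exact: fw1_ge0].
Qed.
Lemma fb_ge0 D i a : 0 <= fb D i a.
Proof. by rewrite /fb; case: ifP => // _; exact: expR_ge0. Qed.
Lemma norm1_fh t i a : norm1 (fh t i a) <= fw t i a.
Proof.
rewrite /fh /fw; case: ifP => _; first by case: ifP => _; rewrite ?norm11 ?norm10.
by case: ifP => // _; case: ifP => // _; rewrite norm11.
Qed.

Lemma measurable_itv_ind (t : R) d (U : measurableType d) (a : U -> R) : measurable_fun setT (a : U -> B) ->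
  measurable_fun setT (fun u => t0 <= a u <= t).
Proof. by move=> ma; apply: measurable_and; exact: measurable_fun_ler. Qed.

Lemma cmeas_fh t i : cmeas (fh t i : B -> C).
Proof.
rewrite /fh; case: (i.1 == 1%N).
  by apply: cmeas_if; [exact: measurable_itv_ind|exact: cmeas_cst|exact: cmeas_cst].
by case: (i.1 == 2%N) => //; case: (i.1 == 3%N) => //; exact: cmeas_cst.
Qed.
Lemma measurable_fw t i : measurable_fun setT (fw t i : B -> B).
Proof.
rewrite /fw; case: (i.1 == 1%N); last by case: (i.1 == 2%N) => //; case: (i.1 == 3%N).
by apply: measurable_fun_ifT => //; exact: measurable_itv_ind.
Qed.
Lemma measurable_fb D i : measurable_fun setT (fb D i : B -> B).
Proof.
rewrite /fb; case: (i.1 == 3%N) => //; by apply: measurableT_comp => //; apply: measurable_funM.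
Qed.

Lemma fK_ge0 D t i : 0 <= fK D t i.
Proof.
rewrite /fK; case: ifP => _; first by rewrite le_max lexx orbT.
case: ifP => _; apply: fine_ge0; apply: integral_ge0 => x _; rewrite lee_fin ?fw2_ge0//.
by rewrite mulr_ge0 ?expR_ge0// fw1_ge0.
Qed.

Lemma fK_bound D t L k i : i \in inames L k ->
  (\int[fmu i]_a (fb D i a * fw t i a)%:E <= (fK D t i)%:E)%E.
Proof.
rewrite !mem_cat => /or3P[/mapP[l _ ->]|/mapP[j _ ->]|/mapP[l _ ->]]; rewrite /fmu /fb /fw /fK /=.
- rewrite (_ : \int[_]_a _ = \int[leb]_a (1 * \1_(`[t0, t]%classic) a)%:E)%E; last first.
    by apply: eq_integral => a _; rewrite mul1r mul1r indicE mem_setE in_itv /=; case: ifP.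
  under eq_integral do rewrite mul1r.
  rewrite integral_indic; try exact: measurableT; last exact: measurable_itv.
  rewrite setIT [X in (X <= _)%E](_ : _ = @lebesgue_measure R [set` `[t0, t]]); last by [].
  rewrite lebesgue_measure_itv/= lte_fin; case: ltP => tt; rewrite ?lee_fin ?le_max ?lexx ?orbT//.
- rewrite (_ : \int[_]_a _ = \int[mu2]_a (w2 a)%:E)%E; last by apply: eq_integral => a _; rewrite mul1r.
  rewrite fineK// ge0_fin_numE//; apply: integral_ge0 => a _; rewrite lee_fin; exact: fw2_ge0.
- rewrite fineK// ge0_fin_numE//; apply: integral_ge0 => a _; rewrite lee_fin mulr_ge0 ?expR_ge0//; exact: fw1_ge0.
Qed.

Lemma uniq_inames L k : uniq L -> uniq (inames L k).
Proof.
move=> uL; rewrite !cat_uniq !map_inj_uniq ?iota_uniq ?uL//; try by move=> ? ? [].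
rewrite /= andbT; apply/andP; split; apply/hasPn => i.
  by rewrite mem_cat => /orP[] /mapP[l _ ->]; apply/mapP => -[].
by move=> /mapP[l _ ->]; apply/mapP => -[].
Qed.
Lemma inames_not0 L k j : (0%N, j) \notin inames L k.
Proof. by rewrite !mem_cat !negb_or; apply/and3P; split; apply/mapP => -[]. Qed.
Lemma inames_2 L k j : ((2%N, j) \in inames L k) = (j < k)%N.
Proof.
rewrite !mem_cat; apply/or3P/idP.
  by case=> /mapP[l]; rewrite ?mem_iota ?add0n /= => // lk [->].
by move=> jk; apply: Or32; apply/mapP; exists j; rewrite ?mem_iota.
Qed.

Lemma prod_fb D L k e : \prod_(i <- inames L k) fb D i (e i) = \prod_(l <- L) expR (D * `|e (3%N, l)|).
Proof.
rewrite !big_cat !big_map /= [X in X * _]big1 ?mul1r; last by move=> l _.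
by rewrite [X in X * _]big1 ?mul1r// => l _.
Qed.

Lemma measurable_prod_seq (s : seq name) (f : name -> R -> R) : (forall i, measurable_fun setT (f i : B -> B)) ->
  measurable_fun setT (fun e : env => \prod_(i <- s) f i (e i) : B).
Proof.
move=> mf; elim: s => [|i s ih].
  by rewrite (_ : (fun e : env => _) = fun=> 1)//; apply/funext => e; rewrite big_nil.
have -> : (fun e : env => \prod_(j <- i :: s) f j (e j)) = (fun e : env => f i (e i) * \prod_(j <- s) f j (e j)).
  by apply/funext => e; rewrite big_cons.
by apply: measurable_funM; [exact: (measurableT_comp (mf i) (measurable_coord i))|exact: ih].
Qed.

(** The bound is needed for every suffix [l2], with the variables of [l1] fixed: the nested
    integrals are evaluated one variable at a time, and each stage has to be finite. *)
Lemma tail_bound L k (x t D : R) l1 l2 (e : env) : uniq L -> inames L k = l1 ++ l2 ->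
  `|x| <= D -> `|y| <= D -> D2 <= D -> (forall j, (2%N, j) \in l1 -> `|e (2%N, j)| <= D) ->
  (Nints fmu l2 (fun e => (norm1 (Fxt t0 y L k e x t) * \prod_(i <- l2) fw t i (e i))%:E) e <=
   (2 ^+ k.+2 * sing_chain t0 k e t * (\prod_(i <- l1) fb D i (e i)) * \prod_(i <- l2) fK D t i)%:E)%E.
Proof.
move=> uL El xD yD D2D l1D.
have uI := uniq_inames L k uL; have ul2 : uniq l2 by move: uI; rewrite El cat_uniq => /and3P[].
have l12 i : i \in l1 -> i \notin l2.
  move: uI; rewrite El cat_uniq => /and3P[_ /hasPn h _] il; apply/negP => /h.
  by rewrite /= il.
have mF : cmeas (fun e : env => Fxt t0 y L k e x t).
  exact: (cmeas_Fxt t0 y L k (fun=> x) (fun=> t) (measurable_cst _) (measurable_cst _)).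
have P0 : 0 <= \prod_(i <- l1) fb D i (e i) by apply: prodr_seq_ge0 => i; exact: fb_ge0.
set c := 2 ^+ k.+2 * sing_chain t0 k e t * \prod_(i <- l1) fb D i (e i).
have c0 : 0 <= c by apply: mulr_ge0 => //; apply: mulr_ge0; [exact: exprn_ge0|exact: sing_chain_ge0].
have mb i : measurable_fun setT (fun a : B => fb D i a * fw t i a : B).
  by apply: measurable_funM; [exact: measurable_fb|exact: measurable_fw].
have b0 i a : 0 <= fb D i a * fw t i a by rewrite mulr_ge0 ?fb_ge0 ?fw_ge0.
have hK i : i \in l2 -> (\int[fmu i]_a (fb D i a * fw t i a)%:E <= (fK D t i)%:E)%E.
  by move=> il; apply: (fK_bound D t L k); rewrite El mem_cat il orbT.
apply: le_trans (Nints_prod fmu l2 (fun i a => fb D i a * fw t i a) (fK D t) (fun=> c) e ul2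
   (fun=> c0) (measurable_cst _) (fun _ _ _ => erefl) b0 mb hK).
apply: le_Nints.
- split; last by move=> e'; rewrite lee_fin mulr_ge0 ?norm1_ge0// prodr_seq_ge0// => i; exact: fw_ge0.
  apply/measurable_EFinP; apply: measurable_funM; first exact: measurable_norm1.
  by apply: measurable_prod_seq => i; exact: measurable_fw.
- split; last by move=> e'; rewrite lee_fin mulr_ge0// prodr_seq_ge0.
  apply/measurable_EFinP; apply: measurable_funM => //.
  exact: (measurable_prod_seq l2 (fun i a => fb D i a * fw t i a) mb).
move=> e' ee'; rewrite lee_fin.
have Pw : 0 <= \prod_(i <- l2) fw t i (e' i) by apply: prodr_seq_ge0 => i; exact: fw_ge0.
(* If an integrated position lies beyond [D2], its weight is 0. Otherwise all nodes are within [D]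
   and [norm1_Fxt] applies. *)
have [big|] := boolP (has (fun i => (i.1 == 2%N) && (D2 < `|e' i|)) l2).
  have /hasP[i il /andP[/eqP i2 Di]] := big.
  by rewrite (big_rem i)//= {1}/fw i2 /= w2D// mul0r mulr0 mulr_ge0// prodr_seq_ge0.
move=> /hasPn small; rewrite big_split /= mulrA; apply: ler_wpM2r => //.
have xjD j : (j <= k)%N -> `|nodeX y e' j| <= D.
  case: j => [//|j] jk /=.
  have : (2%N, j) \in inames L k by rewrite inames_2.
  rewrite El mem_cat => /orP[jl|jl].
    by rewrite ee' ?l12//; exact: l1D.
  by have := small _ jl; rewrite /= -leNgt => h; exact: le_trans h D2D.
apply: le_trans (norm1_Fxt _ _ _ _ _ _ _ _ xD xjD) _.
have eT j : nodeT t0 e' j = nodeT t0 e j.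
  case: j => [//|j] /=; rewrite ee'//; have := inames_not0 L k j.
  by rewrite El mem_cat negb_or => /andP[].
rewrite -(prod_fb _ L k) El big_cat /= /c /sing_chain eT.
under eq_bigr do rewrite !eT.
rewrite [X in _ * (X * _)](_ : _ = \prod_(i <- l1) fb D i (e i)); first by rewrite !mulrA.
by apply: eq_big_seq => i il; rewrite ee'// l12.
Qed.

(* L labels the insertions of V_1, and k counts those of V_2 *)
Definition Wxt L k (x t : R) (e : env) : C := Fxt t0 y L k e x t * \prod_(i <- inames L k) fh t i (e i).
Definition vnames L k := tnames k ++ inames L k.
Definition Jxt L k (x t : R) (e : env) : C := Cints fmu (vnames L k) (Wxt L k x t) e.

Lemma norm1_Wxt L k x t e :
  norm1 (Wxt L k x t e) <= norm1 (Fxt t0 y L k e x t) * \prod_(i <- inames L k) fw t i (e i).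
Proof.
apply: le_trans (norm1M _ _) _; apply: ler_wpM2l; first exact: norm1_ge0.
by apply: norm1_prod => i; exact: norm1_fh.
Qed.

Lemma uniq_vnames L k : uniq L -> uniq (vnames L k).
Proof.
move=> uL; rewrite cat_uniq uniq_tnames uniq_inames// andbT /=.
by apply/hasPn => -[c j] h; rewrite mem_tnames /=; apply/negP => /andP[/eqP c0 _]; move: h; rewrite c0 (negbTE (inames_not0 _ _ _)).
Qed.

Lemma cmeas_fh_prod (s : seq name) t : cmeas (fun e : env => \prod_(i <- s) fh t i (e i)).
Proof.
apply: cmeas_prod => i; apply: (cmeas_comp _ _ _ _ (fh t i) (fun e : env => e i)); last exact: cmeas_fh.
exact: measurable_coord.
Qed.

Lemma cmeas_Wxt L k x t : cmeas (Wxt L k x t).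
Proof.
apply: cmeasM; last exact: cmeas_fh_prod.
exact: (cmeas_Fxt t0 y L k (fun=> x) (fun=> t) (measurable_cst _) (measurable_cst _)).
Qed.

Lemma Wxt_bound L k (x t D m : R) (e : env) : uniq L -> 0 < m ->
  `|x| <= D -> `|y| <= D -> D2 <= D ->
  (Nints fmu (vnames L k) (enorm1 (Wxt L k x t)) e <=
   (2 ^+ k.+2 * (16 / m) ^+ k * (\prod_(i <- inames L k) fK D t i) *
     (isqrt0 (t - t0) * expR (m ^+ 2 * (t - t0))))%:E)%E.
Proof.
move=> uL m0 xD yD D2D; rewrite Nints_cat.
have nW : nnmeas (enorm1 (Wxt L k x t)) by apply: nnmeas_enorm1; exact: cmeas_Wxt.
set K := \prod_(i <- inames L k) fK D t i.
have K0 : 0 <= 2 ^+ k.+2 * K.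
  by apply: mulr_ge0; [exact: exprn_ge0|apply: prodr_seq_ge0 => i; exact: fK_ge0].
have ns : nnmeas (fun e : env => (sing_chain t0 k e t)%:E).
  split; last by move=> e'; rewrite lee_fin sing_chain_ge0.
  by apply/measurable_EFinP; apply: (measurable_sing_chain t0 k (fun=> t)).
apply: (@le_trans _ _ (Nints fmu (tnames k) (fun e => (2 ^+ k.+2 * K)%:E * (sing_chain t0 k e t)%:E)%E e)).
  apply: le_Nints => [||e' _].
  - exact: nnmeas_Nints.
  - split; last by move=> e'; apply: mule_ge0; rewrite lee_fin// sing_chain_ge0.
    by apply: emeasurable_funM => //; case: ns.
  apply: le_trans (_ : Nints fmu (inames L k) (fun e => (norm1 (Fxt t0 y L k e x t) * \prod_(i <- inames L k) fw t i (e i))%:E) e' <= _)%E.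
    apply: le_Nints => // [|e'' _]; last by rewrite lee_fin norm1_Wxt.
    split; last by move=> e''; rewrite lee_fin mulr_ge0 ?norm1_ge0// prodr_seq_ge0// => i; exact: fw_ge0.
    apply/measurable_EFinP; apply: measurable_funM.
      apply: measurable_norm1.
      exact: (cmeas_Fxt t0 y L k (fun=> x) (fun=> t) (measurable_cst _) (measurable_cst _)).
    by apply: measurable_prod_seq => i; exact: measurable_fw.
  apply: le_trans (tail_bound L k x t D [::] (inames L k) e' uL _ xD yD D2D _) _ => //.
  by rewrite big_nil mulr1 -EFinM lee_fin -/K mulrAC.
rewrite (NintsZ fmu _ (fun=> 2 ^+ k.+2 * K))//.
apply: le_trans (lee_wpmul2l _ (simplex_bound fmu t0 (fun j => erefl) m k t e m0)) _; first by rewrite lee_fin.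
rewrite -EFinM lee_fin; move: (2 ^+ k.+2) ((16 / m) ^+ k) (isqrt0 _) (expR _) => b c d f.
by rewrite -subr_ge0 (_ : _ - _ = 0)//; ring.
Qed.

Lemma prod_fK D t L k : \prod_(i <- inames L k) fK D t i =
  (Num.max (t - t0) 0 * fK D t (3%N, 0%N)) ^+ size L * (fK D t (2%N, 0%N)) ^+ k.
Proof.
have cst (c : R) (s : seq nat) : \prod_(i <- s) c = c ^+ size s.
  by rewrite big_const_seq count_predT iter_mulr_1.
by rewrite !big_cat !big_map /= /fK /= !cst size_iota exprMn; ring.
Qed.

(** The left-hand side is $\rho^n$ times one term of the exponential series at $a/\rho$. *)
Lemma exp_fact_le (a rho : R) n : 0 <= a -> 0 < rho -> a ^+ n / n`!%:R <= rho ^+ n * expR (a / rho).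
Proof.
move=> a0 r0; have x0 : 0 <= a / rho by rewrite divr_ge0// ltW.
have -> : a ^+ n = rho ^+ n * (a / rho) ^+ n by rewrite -exprMn; congr (_ ^+ _); field; rewrite gt_eqF.
rewrite -mulrA ler_wpM2l ?exprn_ge0 ?(ltW r0)//.
case: n => [|n]; first by rewrite expr0 fact0 divr1 -expR0 ler_expR.
by have := expR_ge1Dxn n x0; lra.
Qed.
End Majorant.

(** * Entire series *)

Section EntireSeries.
Context {R : realType}.
Local Notation C := R[i].
Local Notation Re := complex.Re.
Local Notation Im := complex.Im.

Lemma cvg_norm1 (u : nat -> C) (l : C) :
  (forall e : R, 0 < e -> exists N, forall n, (N <= n)%N -> norm1 (u n - l) < e) ->
  (u : nat -> C^o) @ \oo --> (l : C^o).
Proof.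
move=> h; apply/cvgrPdist_lt => e e0.
have eR : e = (Re e)%:C by apply/eqP; rewrite eq_complex /= eqxx /= eq_sym; have := ger0_Im (ltW e0); move=> ->.
have e0' : 0 < Re e by move: e0; rewrite eR ltcR.
have [N hN] := h _ e0'; near=> n.
rewrite distrC eR; apply: le_lt_trans (le_norm1 _) _; rewrite ltcR; apply: hN.
by near: n; exact: nbhs_infty_ge.
Unshelve. all: by end_near. Qed.

Lemma half_pow_small (A e : R) : 0 < e -> exists N, forall n, (N <= n)%N -> A / 2 ^+ n < e.
Proof.
move=> e0; have [N hN] : exists N : nat, A / e < N%:R.
  exists (Num.truncn `|A / e|).+1; apply: le_lt_trans (ler_norm _) _.
  by have /andP[] := truncn_itv (normr_ge0 (A / e)).
exists N => n Nn; rewrite ltr_pdivrMr ?exprn_gt0// mulrC -ltr_pdivrMr//.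
apply: lt_le_trans hN _; rewrite -natrX ler_nat (leq_trans Nn)// ltnW// ltn_expl//.
Qed.

Lemma geometric_tail (A : R) N M : 0 <= A -> \sum_(N <= n < M) A / 2 ^+ n <= 2 * A / 2 ^+ N.
Proof.
move=> A0; have [NM|MN] := leqP N M; last first.
  by rewrite big_geq ?(ltnW MN)// divr_ge0 ?mulr_ge0// exprn_ge0.
have -> : \sum_(N <= n < M) A / 2 ^+ n = 2 * A / 2 ^+ N - 2 * A / 2 ^+ M.
  rewrite -[RHS]opprB -[in RHS]mulN1r -(telescope_sumr (fun n => 2 * A / 2 ^+ n) NM) mulr_sumr.
  by apply: eq_bigr => n _; rewrite exprS; field; rewrite expf_neq0.
by rewrite gerBl divr_ge0 ?mulr_ge0 ?exprn_ge0.
Qed.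

(** Nested intervals: every [S N - d N] lies below every [S M + d M], and the limit is the supremum
    of the lower ends. The explicit rate is what later limits are taken with. *)
Lemma geometric_limitR (u : nat -> R) (A : R) : (forall n, `|u n| <= A / 2 ^+ n) ->
  exists l : R, forall N, `|\sum_(0 <= n < N) u n - l| <= 2 * A / 2 ^+ N.
Proof.
move=> hu; pose S N := \sum_(0 <= n < N) u n; pose d N : R := 2 * A / 2 ^+ N.
have A0 : 0 <= A by have := hu 0%N; rewrite expr0 divr1; apply: le_trans.
have d0 N : 0 <= d N by rewrite divr_ge0 ?mulr_ge0 ?exprn_ge0.
have SM N M : (N <= M)%N -> `|S M - S N| <= d N.
  move=> NM; rewrite /S (big_cat_nat (n := N) (p := M))//= addrAC subrr add0r.
  apply: le_trans (ler_norm_sum _ _ _) _; apply: le_trans (geometric_tail _ _ M A0).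
  by apply: ler_sum => n _; exact: hu.
pose a N := S N - d N.
have ab N M : a N <= S M + d M.
  have [NM|/ltnW MN] := leqP N M.
    by have := SM _ _ NM; have := d0 N; have := d0 M; rewrite ler_norml /a => ? ? /andP[]; lra.
  by have := SM _ _ MN; have := d0 N; have := d0 M; rewrite ler_norml /a => ? ? /andP[]; lra.
have sa : has_sup (range a).
  by split; [exists (a 0%N), 0%N|exists (S 0%N + d 0%N) => _ [N _ <-]; exact: ab].
exists (sup (range a)) => N; rewrite -/(S N) -/(d N).
have h1 : a N <= sup (range a) by apply: sup_upper_bound => //; exists N.
have h2 : sup (range a) <= S N + d N.
  by apply: ge_sup; [exact: sa.1|move=> _ [M _ <-]; exact: ab].
by rewrite ler_norml; move: h1; rewrite /a => h1; apply/andP; split; lra.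
Qed.

Lemma geometric_limit (u : nat -> C) (A : R) : (forall n, norm1 (u n) <= A / 2 ^+ n) ->
  exists l : C, forall N, norm1 (\sum_(0 <= n < N) u n - l) <= 4 * A / 2 ^+ N.
Proof.
move=> hu.
have [|a ha] := geometric_limitR (fun n => Re (u n)) A.
  by move=> n; exact: le_trans (Re_le_norm1 _) (hu n).
have [|b hb] := geometric_limitR (fun n => Im (u n)) A.
  by move=> n; exact: le_trans (Im_le_norm1 _) (hu n).
exists (a +i* b) => N; rewrite /norm1 ReD ImD ReN ImN Re_sum Im_sum /=.
have := ha N; have := hb N; lra.
Qed.

Lemma norm1_lim (u v : nat -> C) (l : C) (A c : R) : 0 <= A ->
  (forall n, norm1 (u n - l) <= A / 2 ^+ n) -> (forall n, norm1 (u n) <= c) -> norm1 l <= c.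
Proof.
move=> A0 hu hc; rewrite leNgt; apply/negP => cl.
have [N hN] := half_pow_small A (norm1 l - c) (ltac:(by rewrite subr_gt0)).
have h1 := hN N (leqnn N); have h2 := hu N; have h3 := hc N.
have h4 := norm1D (u N) (- (u N - l)); rewrite norm1N in h4.
rewrite (_ : u N + - (u N - l) = l) in h4; last by ring.
lra.
Qed.

Section Analytic.
Variables (c : nat -> C) (S : C -> C).
Hypothesis c_small : forall rho : R, 0 < rho -> exists2 A : R, 0 <= A & forall n, norm1 (c n) <= A * rho ^+ n.
Hypothesis S_lim : forall g, S g = limn (series (fun n => g ^+ n * c n) : nat -> C^o).

Lemma entire_term (q : R) : 0 < q -> exists2 A : R, 0 <= A & forall n, norm1 (c n) * q ^+ n <= A / 2 ^+ n.
Proof.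
move=> q0; have [|A A0 hA] := c_small (2 * q)^-1; first by rewrite invr_gt0 mulr_gt0.
exists A => // n; apply: le_trans (ler_wpM2r (exprn_ge0 _ (ltW q0)) (hA n)) _.
rewrite exprVn exprMn -mulrA le_eqVlt; apply/orP; left; apply/eqP.
by field; rewrite !expf_neq0 ?gt_eqF.
Qed.

Lemma entire_limit g : exists (l : C) (A : R), 0 <= A /\
  forall N, norm1 (\sum_(0 <= n < N) g ^+ n * c n - l) <= A / 2 ^+ N.
Proof.
have q0 : 0 < norm1 g + 1 by rewrite ltr_wpDl ?norm1_ge0.
have [A A0 hA] := entire_term _ q0.
have [|l hl] := geometric_limit (fun n => g ^+ n * c n) A.
  move=> n; apply: le_trans (norm1M _ _) _; rewrite mulrC; apply: le_trans (hA n).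
  apply: ler_wpM2l; rewrite ?norm1_ge0//; apply: le_trans (norm1X _ _) _.
  by rewrite lerXn2r ?nnegrE ?norm1_ge0// ?ltW//; lra.
by exists l, (4 * A); split => //; rewrite mulr_ge0.
Qed.

Lemma entire_cvg g (l : C) (A : R) :
  (forall N, norm1 (\sum_(0 <= n < N) g ^+ n * c n - l) <= A / 2 ^+ N) ->
  (series (fun n => g ^+ n * c n) : nat -> C^o) @ \oo --> (l : C^o).
Proof.
move=> hl; apply: cvg_norm1 => e e0; have [N hN] := half_pow_small A e e0.
by exists N => n Nn; apply: le_lt_trans (hl n) (hN n Nn).
Qed.

Lemma entire_S g : exists A : R, 0 <= A /\
  forall N, norm1 (\sum_(0 <= n < N) g ^+ n * c n - S g) <= A / 2 ^+ N.
Proof.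
have [l [A [A0 hA]]] := entire_limit g; exists A; split => // N.
have -> : S g = l; last exact: hA.
by rewrite S_lim; have /cvg_lim := entire_cvg _ _ _ hA; apply; exact: norm_hausdorff.
Qed.

Lemma entire_cvgn g : cvgn (series (fun n => g ^+ n * c n) : nat -> C^o).
Proof. by have [l [A [A0 hA]]] := entire_limit g; apply/cvg_ex; exists l; exact: entire_cvg hA. Qed.

(** Re-expansion at [g0]: the new coefficients are $d_k=\sum_n\binom nkc_ng_0^{n-k}$, and the double
    series is rearranged through finite sections. The radius 1 is arbitrary, as [c] decays faster
    than any geometric sequence. *)
Lemma entire_analytic : analytic S.
Proof.
(* A displacement of modulus below 1 has [norm1] at most 2, so [q] bounds the sum of the norms of
   [g0] and [h]. The rate is taken for [2 * q] so that a factor $2^n$ pays for the binomial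
   coefficients. *)
move=> g0; exists 1 => //; pose q := norm1 g0 + 2.
have q0 : 0 < q by rewrite ltr_wpDl ?norm1_ge0.
have [|A A0 hA] := entire_term (2 * q); first by rewrite mulr_gt0.
pose b n k : C := c n * ('C(n, k))%:R * g0 ^+ (n - k).
have C2 n k : (('C(n, k))%:R : R) <= 2 ^+ n.
  rewrite -natrX ler_nat; have [kn|nk] := leqP k n; last by rewrite bin_small.
  have -> : (2 ^ n = \sum_(i < n.+1) 'C(n, i))%N.
    by rewrite (_ : 2 = 1 + 1)%N// expnDn; apply: eq_bigr => i _; rewrite !exp1n !muln1.
  by rewrite (bigD1 (Ordinal (kn : (k < n.+1)%N)))//= leq_addr.
have nC m : norm1 (m%:R : C) = m%:R.
  by rewrite -(rmorph_nat (real_complex R)) norm1R ger0_norm.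
have g0q : norm1 g0 <= q by rewrite /q; lra.
have q1 : 1 <= q by rewrite /q; have := norm1_ge0 g0; lra.
have bb n k : norm1 (b n k) <= A / 2 ^+ n.
  apply: le_trans (hA n); apply: le_trans (norm1M _ _) _.
  apply: le_trans (ler_wpM2r (norm1_ge0 _) (norm1M _ _)) _; rewrite nC -mulrA.
  apply: ler_wpM2l; first exact: norm1_ge0.
  rewrite exprMn; apply: ler_pM; rewrite ?norm1_ge0//.
  apply: le_trans (norm1X _ _) _; apply: (@le_trans _ _ (q ^+ (n - k))).
    by rewrite lerXn2r ?nnegrE ?norm1_ge0// ltW.
  by rewrite ler_weXn2l// leq_subr.
have /choice[d hd] : forall k, exists l, forall N, norm1 (\sum_(0 <= n < N) b n k - l) <= 4 * A / 2 ^+ N.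
  by move=> k; exact: geometric_limit.
exists d => g; set h := g - g0 => hh.
have h2 : norm1 h <= 2 by have := norm1_le h 1 (ltW hh); rewrite mulr1.
have [A' [A'0 hS]] := entire_S g.
have bin n N : (n < N)%N -> \sum_(0 <= k < N) b n k * h ^+ k = g ^+ n * c n.
  move=> nN; have -> : g = g0 + h by rewrite /h; ring.
  rewrite exprDn mulr_suml (big_cat_nat (n := n.+1))//= [X in _ + X]big1_seq ?addr0; last first.
    by move=> k /=; rewrite mem_index_iota => /andP[nk _]; rewrite /b bin_small// mulr0n !(mulr0, mul0r).
  rewrite big_mkord; apply: eq_bigr => k _; rewrite /b mulr_natr -[in RHS]mulr_natr; ring.
have part n N : norm1 (\sum_(0 <= k < N) b n k * h ^+ k) <= A / 2 ^+ n.
  apply: le_trans (norm1_sum _ _ _ _) _; apply: le_trans (hA n).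
  apply: (@le_trans _ _ (norm1 (c n) * \sum_(0 <= k < N) ('C(n, k))%:R * (norm1 g0 ^+ (n - k) * 2 ^+ k))).
    rewrite mulr_sumr; apply: ler_sum => k _.
    apply: le_trans (norm1M _ _) _; rewrite /b.
    apply: le_trans (ler_wpM2r (norm1_ge0 _) (norm1M _ _)) _.
    apply: le_trans (ler_wpM2r (norm1_ge0 _) (ler_wpM2r (norm1_ge0 _) (norm1M _ _))) _.
    rewrite nC -!mulrA; apply: ler_wpM2l; first exact: norm1_ge0.
    apply: ler_wpM2l; first exact: ler0n.
    apply: ler_pM; rewrite ?norm1_ge0 ?norm1X//.
    by apply: le_trans (norm1X _ _) _; rewrite lerXn2r ?nnegrE ?norm1_ge0.
  apply: ler_wpM2l; first exact: norm1_ge0.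
  apply: (@le_trans _ _ (\sum_(0 <= k < maxn N n.+1) ('C(n, k))%:R * (norm1 g0 ^+ (n - k) * 2 ^+ k))).
    rewrite [leRHS](big_cat_nat (n := N)) ?leq_maxl//= lerDl; apply: sumr_ge0 => k _.
    by rewrite !mulr_ge0 ?exprn_ge0 ?norm1_ge0.
  have -> : \sum_(0 <= k < maxn N n.+1) ('C(n, k))%:R * (norm1 g0 ^+ (n - k) * 2 ^+ k) = q ^+ n.
    rewrite (big_cat_nat (n := n.+1)) ?leq_maxr//= [X in _ + X]big1_seq ?addr0; last first.
      by move=> k /=; rewrite mem_index_iota => /andP[nk _]; rewrite bin_small// mul0r.
    by rewrite /q exprDn big_mkord; apply: eq_bigr => k _; rewrite mulr_natl.
  by rewrite lerXn2r ?nnegrE ?mulr_ge0 ?(ltW q0)//; lra.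
have main N : norm1 (\sum_(0 <= k < N) d k * h ^+ k - S g) <= 4 * A / 2 ^+ N.
  (* The section with $N$ powers of [h] and $N+M$ terms of the given series. Terms with $n<N$
     cancel, as the binomial expansion of $g^n$ then fits into the $N$ powers; the rest is a
     geometric tail, uniform in $M$. *)
  pose X M := \sum_(0 <= k < N) (\sum_(0 <= n < N + M) b n k) * h ^+ k - \sum_(0 <= n < N + M) g ^+ n * c n.
  have XE M : X M = \sum_(0 <= n < N + M) (\sum_(0 <= k < N) b n k * h ^+ k - g ^+ n * c n).
    rewrite /X sumrB; congr (_ - _); under eq_bigr do rewrite mulr_suml.
    by rewrite exchange_big.
  have tailN n M : norm1 (\sum_(0 <= k < N) b n k * h ^+ k - g ^+ n * c n) <= 2 * A / 2 ^+ n.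
    apply: le_trans (norm1D _ _) _; rewrite norm1N -(bin n (maxn N n.+1)) ?leq_maxr//.
    by have := part n N; have := part n (maxn N n.+1); lra.
  have Xb M : norm1 (X M) <= 4 * A / 2 ^+ N.
    rewrite XE (big_cat_nat (n := N)) ?leq_addr//= big_nat big1 ?add0r; last first.
      by move=> n /andP[_ nN]; rewrite bin// subrr.
    apply: le_trans (norm1_sum _ _ _ _) _.
    apply: le_trans (_ : \sum_(N <= n < N + M) (2 * A) / 2 ^+ n <= _); first by apply: ler_sum => n _; exact: tailN.
    by rewrite (_ : 4 * A = 2 * (2 * A)); [apply: geometric_tail; rewrite mulr_ge0|ring].
  pose A2 := \sum_(0 <= k < N) 4 * A * 2 ^+ k + A'.
  have A20 : 0 <= A2.
    by rewrite addr_ge0// sumr_ge0// => k _; rewrite !mulr_ge0// exprn_ge0.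
  apply: (norm1_lim X (fun=> 0) _ A2 _ A20) => // M.
  have -> : X M - (\sum_(0 <= k < N) d k * h ^+ k - S g) =
     \sum_(0 <= k < N) (\sum_(0 <= n < N + M) b n k - d k) * h ^+ k -
     (\sum_(0 <= n < N + M) g ^+ n * c n - S g).
    rewrite /X; under [in RHS]eq_bigr do rewrite mulrBl.
    by rewrite sumrB; ring.
  apply: le_trans (norm1D _ _) _; rewrite norm1N /A2 mulrDl mulr_suml; apply: lerD.
    apply: le_trans (norm1_sum _ _ _ _) _; apply: ler_sum => k _.
    apply: le_trans (norm1M _ _) _; rewrite mulrAC; apply: ler_pM; rewrite ?norm1_ge0//.
      apply: le_trans (hd k _) _; apply: ler_wpM2l; first by rewrite mulr_ge0.
      by rewrite lef_pV2 ?posrE ?exprn_gt0// ler_weXn2l ?ler1n// leq_addl.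
    by apply: le_trans (norm1X _ _) _; rewrite lerXn2r ?nnegrE ?norm1_ge0.
  apply: le_trans (hS _) _; apply: ler_wpM2l => //.
  by rewrite lef_pV2 ?posrE ?exprn_gt0// ler_weXn2l ?ler1n// leq_addl.
apply: cvg_norm1 => e e0; have [N hN] := half_pow_small (4 * A) e e0.
by exists N => n Nn; apply: le_lt_trans (main n) (hN n Nn).
Qed.
End Analytic.
End EntireSeries.

(** * The terms of the Feynman series *)

Section Iterated.
Context {R : realType}.
Local Notation C := R[i].
Local Notation B := (measurableTypeR R).
Local Notation leb := (@lebesgue_measure R).
Local Notation env := (@env R).
Local Notation name := (nat * nat)%type.

(** The same iteration with arbitrary functionals: integrals against complex measures are not given
    as a [cint] and become one only where integrability is known. *)
Definition Iints (I : name -> (R -> C) -> C) (l : seq name) (F : env -> C) : env -> C :=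
  foldr (fun i acc e => I i (fun a => acc (upd e i a))) F l.

(** [D i] is the set on which the functional of the name [i] depends. For an insertion time it is
    $[t_0,t]$, outside of which the closed form of the integrand fails. *)
Lemma eq_Iints_on (D : name -> set R) (I : name -> (R -> C) -> C) l F G e :
  (forall i f f', (forall a, D i a -> f a = f' a) -> I i f = I i f') -> uniq l ->
  (forall e', agree l e e' -> (forall i, i \in l -> D i (e' i)) -> F e' = G e') ->
  Iints I l F e = Iints I l G e.
Proof.
move=> ID; elim: l e => [|i l ih] e /=; first by move=> _; apply => // i.
move=> /andP[il ul] FG; apply: ID => a Da; apply: ih => // e' ee' De'.
apply: FG; first exact: agree_upd ee'.
move=> j; rewrite inE => /predU1P[->|]; last exact: De'.
by rewrite ee'// upd_same.
Qed.

Lemma eq_Iints (I : name -> (R -> C) -> C) l F G e :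
  (forall e', agree l e e' -> F e' = G e') -> Iints I l F e = Iints I l G e.
Proof.
elim: l e => [|i l ih] e FG /=; first exact: FG.
by congr (I i); apply/funext => a; apply: ih => e' /agree_upd; exact: FG.
Qed.

Lemma Iints_cat I l1 l2 F : Iints I (l1 ++ l2) F = Iints I l1 (Iints I l2 F).
Proof. by rewrite /Iints foldr_cat. Qed.

(** The offset [o] is for the induction: the outermost integral binds the first name of the range,
    and the remaining range starts one later. *)
Lemma iterint_Iints (I : name -> (R -> C) -> C) (Ic : (R -> C) -> C) c o n (Phi : seq R -> C) e :
  (forall j, I (c, j) = Ic) ->
  iterint Ic n Phi = Iints I [seq (c, j) | j <- iota o n] (fun e => Phi [seq e (c, j) | j <- iota o n]) e.
Proof.
move=> IE; elim: n o Phi e => [//|n ih] o Phi e /=; rewrite IE; congr Ic; apply/funext => a.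
rewrite (ih o.+1 (fun s => Phi (a :: s)) (upd e (c, o) a)).
apply: eq_Iints => e' ee'; rewrite ee' ?upd_same//.
by apply/mapP => -[j]; rewrite mem_iota => /andP[oj _] [oE]; move: oj; rewrite oE ltnn.
Qed.

Lemma vals_agree l (e e' : env) c n : (forall j, (c, j) \notin l) -> agree l e e' -> vals e' c n = vals e c n.
Proof. by move=> cl ee'; apply/eq_map => j; rewrite ee'. Qed.

Section ToCints.
Variables (mu : name -> {sigma_finite_measure set B -> \bar R}) (I : name -> (R -> C) -> C).
Variables (g : name -> C) (h : name -> R -> C) (w : name -> R -> R).
Hypotheses (mh : forall i, cmeas (h i : B -> C)) (mw : forall i, measurable_fun setT (w i : B -> B)).
Hypothesis hw : forall i a, norm1 (h i a) <= w i a.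
Hypothesis IE : forall i (f : B -> C), cmeas f ->
  (\int[mu i]_x (norm1 (f x) * w i x)%:E < +oo)%E -> I i f = g i * cint (mu i) (fun x => f x * h i x).

Let w0 i a : 0 <= w i a. Proof. exact: le_trans (norm1_ge0 _) (hw i a). Qed.
Let mcoord i (f : B -> B) : measurable_fun setT f -> measurable_fun setT (fun e : env => f (e i)).
Proof. by move=> mf; exact: (measurableT_comp mf (measurable_coord i)). Qed.
Let cprod l : cmeas (fun e : env => \prod_(i <- l) h i (e i)).
Proof.
by apply: cmeas_prod => i; apply: (cmeas_comp _ _ _ _ (h i) (fun e : env => e i)); [exact: measurable_coord|exact: mh].
Qed.
Let nnw (F : env -> C) l : cmeas F -> nnmeas (fun e : env => (norm1 (F e) * \prod_(i <- l) w i (e i))%:E).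
Proof.
move=> mF; split; last by move=> e; rewrite lee_fin mulr_ge0 ?norm1_ge0// prodr_seq_ge0.
by apply/measurable_EFinP; apply: measurable_funM; [exact: measurable_norm1|exact: measurable_prod_seq].
Qed.

(** Each functional may be replaced by its density only after the inner integral is known to be
    integrable, which explains the hypothesis on all suffixes of [l]. *)
Lemma Iints_Cints l F e : uniq l -> cmeas F ->
  (forall l1 l2 e, l = l1 ++ l2 ->
    (Nints mu l2 (fun e => (norm1 (F e) * \prod_(i <- l2) w i (e i))%:E) e < +oo)%E) ->
  Iints I l F e = (\prod_(i <- l) g i) * Cints mu l (fun e => F e * \prod_(i <- l) h i (e i)) e.
Proof.
move=> + mF; elim: l e => [|i l ih] e; first by rewrite /= !big_nil mul1r mulr1.
move=> /= /andP[il ul] fin.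
have fin' l1 l2 e' : l = l1 ++ l2 ->
    (Nints mu l2 (fun e => (norm1 (F e) * \prod_(i <- l2) w i (e i))%:E) e' < +oo)%E.
  by move=> lE; apply: (fin (i :: l1)); rewrite lE.
have mW : cmeas (fun e : env => F e * \prod_(i <- l) h i (e i)) by apply: cmeasM => //; exact: cprod.
pose G := \prod_(j <- l) g j.
pose W := fun e : env => F e * \prod_(j <- l) h j (e j).
have wW e' : norm1 (W e') <= norm1 (F e') * \prod_(j <- l) w j (e' j).
  apply: le_trans (norm1M _ _) _; apply: ler_wpM2l; first exact: norm1_ge0.
  exact: norm1_prod.
have CW e' : Cfin mu l W e'.
  split => //; apply: le_lt_trans (fin' [::] l e' erefl).
  apply: le_Nints; [exact: nnmeas_enorm1|exact: nnw|].
  by move=> e'' _; rewrite lee_fin.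
pose f := fun a : B => Cints mu l W (upd e i a).
have mf : cmeas f by apply: cmeas_upd; exact: cmeas_Cints.
have mnf : measurable_fun setT (fun a : B => norm1 (f a)) by exact: measurable_norm1.
have mnw : measurable_fun setT (fun a : B => norm1 (f a) * w i a).
  by apply: measurable_funM; [exact: mnf|exact: mw].
have fy : (\int[mu i]_a (norm1 (f a) * w i a)%:E < +oo)%E.
  apply: le_lt_trans (fin [::] (i :: l) e erefl) => /=.
  apply: ge0_le_integral => //.
  - by move=> a _; rewrite lee_fin mulr_ge0 ?norm1_ge0.
  - exact/measurable_EFinP.
  - apply: nnmeas_upd; apply: nnmeas_Nints; exact: (nnw F (i :: l)).
  - move=> a _.
    rewrite (eq_Nints mu _ _ (fun e' => (w i (e' i))%:E * (norm1 (F e') * \prod_(j <- l) w j (e' j))%:E)%E); last first.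
      by move=> e' _; rewrite big_cons -EFinM; congr (_%:E); ring.
    rewrite (NintsZ mu l (fun e' => w i (e' i)) _ _ (fun e' => w0 i _)); last 2 first.
    + by move=> e1 e2 e12; rewrite e12.
    + exact: nnw.
    rewrite upd_same mulrC EFinM; apply: lee_wpmul2l; first by rewrite lee_fin.
    apply: le_trans (le_Cints mu l W _ mW) _.
    apply: le_Nints; [exact: nnmeas_enorm1|exact: nnw|].
    by move=> e'' _; rewrite lee_fin.
transitivity (I i (fun a => G * f a)).
  by congr (I i); apply/funext => a; rewrite ih.
have mGf : cmeas (fun a : B => G * f a) by apply: cmeasM => //; exact: cmeas_cst.
rewrite IE//; last first.
  apply: (@le_lt_trans _ _ ((norm1 G)%:E * \int[mu i]_a (norm1 (f a) * w i a)%:E)%E); last first.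
    by rewrite lte_mul_pinfty// lee_fin norm1_ge0.
  rewrite -ge0_integralZl//; last 3 first.
  - exact/measurable_EFinP.
  - by move=> a _; rewrite lee_fin mulr_ge0 ?norm1_ge0.
  - by rewrite lee_fin norm1_ge0.
  apply: ge0_le_integral => //.
  - by move=> a _; rewrite lee_fin mulr_ge0 ?norm1_ge0.
  - by apply/measurable_EFinP; apply: measurable_funM; [exact: measurable_norm1|exact: mw].
  - by apply: emeasurable_funM => //; exact/measurable_EFinP.
  - by move=> a _; rewrite -EFinM lee_fin mulrA ler_wpM2r// norm1M.
have cfh : cfin (mu i) (fun a => f a * h i a).
  apply: (le_cfin _ _ (fun a => norm1 (f a) * w i a)) => //.
  - exact: cmeasM.
  - by move=> a; apply: le_trans (norm1M _ _) _; apply: ler_wpM2l => //; exact: norm1_ge0.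
rewrite big_cons -mulrA; congr (_ * _).
transitivity (cint (mu i) (fun a => G * (f a * h i a))).
  by apply: eq_cint => a; rewrite mulrA.
rewrite cintZ//; congr (_ * _); apply: eq_cint => a.
rewrite (eq_Cints mu l _ (fun e' => h i (e' i) * W e')); last first.
  by move=> e' _; rewrite big_cons /W; ring.
rewrite (CintsZ mu l (fun e' => h i (e' i)))//; last 2 first.
- by apply: (cmeas_comp _ _ _ _ (h i) (fun e : env => e i)); [exact: measurable_coord|exact: mh].
- by move=> e1 e2 e12; rewrite e12.
by rewrite upd_same mulrC.
Qed.
End ToCints.

Lemma cintegral_ind (D : set R) (f : B -> C) : measurable (D : set B) -> cmeas f ->
  cintegral leb D f = cint leb (fun a => f a * (\1_D a)%:C).
Proof.
move=> mD mf; rewrite /cint /cintegral; apply: eqC => /=; rewrite Rintegral_mkcond; apply: eq_Rintegral => a _.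
  by rewrite patchE indicE; case: (a \in D) => /=; rewrite !(ReM, ImM) /= ?(mulr1, mulr0, subr0, addr0, mul0r, add0r, sub0r, oppr0).
by rewrite patchE indicE; case: (a \in D) => /=; rewrite !(ReM, ImM) /= ?(mulr1, mulr0, subr0, addr0, mul0r, add0r, sub0r, oppr0).
Qed.
End Iterated.

(** * The Feynman series as a power series in the coupling constant *)

Section Terms.
Context {R : realType}.
Local Notation C := R[i].
Local Notation B := (measurableTypeR R).
Local Notation leb := (@lebesgue_measure R).
Local Notation env := (@env R).
Local Notation name := (nat * nat)%type.
Variables (m1 M2 : complex_measure R).
Variables (mu1 mu2 : {sigma_finite_measure set B -> \bar R}) (h1 h2 : R -> C) (w1 w2 : R -> R).
Variables (D2 t0 y : R).
Hypothesis r1 : represents m1 mu1 h1 w1.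
Hypothesis r2 : represents M2 mu2 h2 w2.
Hypothesis w1y : forall c, (\int[mu1]_x (expR (c * `|x|) * w1 x)%:E < +oo)%E.
Hypothesis w2y : (\int[mu2]_x (w2 x)%:E < +oo)%E.
Hypothesis w2D : forall x, D2 < `|x| -> w2 x = 0.

Let mh1 : cmeas (h1 : B -> C). Proof. by case: r1. Qed.
Let mh2 : cmeas (h2 : B -> C). Proof. by case: r2. Qed.
Let mw1 : measurable_fun setT (w1 : B -> B). Proof. by case: r1. Qed.
Let mw2 : measurable_fun setT (w2 : B -> B). Proof. by case: r2. Qed.
Let hw1 x : norm1 (h1 x) <= w1 x. Proof. by case: r1. Qed.
Let hw2 x : norm1 (h2 x) <= w2 x. Proof. by case: r2. Qed.
Let mu := fmu mu1 mu2.
Let h t := fh h1 h2 t0 t.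
Let w t := fw w1 w2 t0 t.

(** The four kinds of integrals in a term of the series, selected by the class of the name. Only the
    two complex measures carry the coupling constant, which [fg] records. *)
Definition fI (g : C) (t : R) (i : name) : (R -> C) -> C :=
  if i.1 == 1%N then cintegral leb `[t0, t] else
  if i.1 == 2%N then cm_integral (cm_scale g M2) else
  if i.1 == 3%N then cm_integral (cm_scale g m1) else cintegral leb setT.
Definition fg (g : C) (i : name) : C := if (i.1 == 2%N) || (i.1 == 3%N) then g else 1.

Lemma fIE g t (i : name) (f : B -> C) : cmeas f ->
  (\int[mu i]_x (norm1 (f x) * w t i x)%:E < +oo)%E ->
  fI g t i f = fg g i * cint (mu i) (fun x => f x * h t i x).
Proof.
move=> mf; rewrite /fI /fg /mu /fmu /w /fw /h /fh.
have [i1|_] := eqVneq i.1 1%N.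
  have mI : measurable (`[t0, t]%classic : set B) by exact: measurable_itv.
  rewrite i1 /= => _; rewrite (cintegral_ind _ f mI mf).
  rewrite mul1r; apply: eq_cint => a; rewrite indicE mem_setE in_itv /=.
  by case: ifP.
have [i2|_] := eqVneq i.1 2%N => /=.
  by move=> fy; have [_ _ _ /(_ g f mf fy)[]] := r2.
have [i3|_] := eqVneq i.1 3%N => /=.
  by move=> fy; have [_ _ _ /(_ g f mf fy)[]] := r1.
by move=> _; rewrite mul1r; apply: eq_cint => a; rewrite mulr1.
Qed.

Let Wx := Wxt h1 h2 t0 y.
Let J := Jxt mu1 mu2 h1 h2 t0 y.

Lemma inames_iota m k : inames (iota 0 m) k =
  [seq (1%N, j) | j <- iota 0 m] ++ [seq (2%N, j) | j <- iota 0 k] ++ [seq (3%N, j) | j <- iota 0 m].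
Proof. by []. Qed.

Let e0 : env := fun=> 0.

Lemma Wxt_Cfin L k x t e : uniq L -> Cfin mu (vnames L k) (Wx L k x t) e.
Proof.
move=> uL; split; first exact: (cmeas_Wxt h1 h2 t0 y mh1 mh2).
have b1 : `|x| <= `|x| + `|y| + `|D2| by rewrite -addrA lerDl addr_ge0.
have b2 : `|y| <= `|x| + `|y| + `|D2| by rewrite addrAC lerDr addr_ge0.
have b3 : D2 <= `|x| + `|y| + `|D2|.
  by rewrite (le_trans (ler_norm _))// lerDr addr_ge0.
apply: le_lt_trans (Wxt_bound mu1 mu2 h1 h2 w1 w2 D2 t0 y mh1 mh2 mw1 mw2 hw1 hw2 w1y w2y w2D
   L k x t _ 1 e uL ltr01 b1 b2 b3) _.
exact: ltry.
Qed.

Lemma inner_Iints g m k x t (e : env) :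
  (forall j, (j < k)%N -> nodeT t0 e j < nodeT t0 e j.+1) -> nodeT t0 e k < t ->
  Iints (fI g t) (inames (iota 0 m) k) (fun e => feynman_F t0 y t x m k (vals e 0 k) (vals e 1 m) (vals e 2 k) (vals e 3 m)) e =
  g ^+ (k + m) * Cints mu (inames (iota 0 m) k) (Wx (iota 0 m) k x t) e.
Proof.
move=> pj pt; have uI : uniq (inames (iota 0 m) k) by apply: uniq_inames; exact: iota_uniq.
pose D (i : name) : set R := if i.1 == 1%N then `[t0, t]%classic else setT.
rewrite (eq_Iints_on D (fI g t) _ _ (fun e => Fxt t0 y (iota 0 m) k e x t))//; last 2 first.
- move=> i f f' ff'; rewrite /fI; move: ff'; rewrite /D; case: ifP => _ ff'.
    apply: eqC => /=; apply: eq_Rintegral => a; rewrite inE => /ff' -> //.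
  have -> : f = f' by apply/funext => a; exact: ff'.
  by [].
- move=> e' ee' De'.
  have eT j : nodeT t0 e' j = nodeT t0 e j by case: j => [//|j] /=; rewrite ee'// inames_not0.
  apply: feynman_FE => [l lm|j jk|]; rewrite ?eT//; last exact: pj.
  have : (1%N, l) \in inames (iota 0 m) k by rewrite mem_cat map_f// mem_iota.
  by move=> /De'; rewrite /D /= in_itv /= => /andP[].
rewrite (Iints_Cints mu (fI g t) (fg g) (h t) (w t))//.
- congr (_ * _); rewrite inames_iota !big_cat !big_map /= /fg /= !big_const_seq !count_predT !iter_mulr_1 !size_iota.
  by rewrite expr1n mul1r -exprD.
- by move=> i; exact: (cmeas_fh h1 h2 t0 mh1 mh2).
- by move=> i; exact: (measurable_fw w1 w2 t0 mw1 mw2).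
- by move=> i a; exact: (norm1_fh h1 h2 w1 w2 t0 hw1 hw2).
- exact: fIE.
- exact: (cmeas_Fxt t0 y (iota 0 m) k (fun=> x) (fun=> t) (measurable_cst _) (measurable_cst _)).
move=> l1 l2 e' lE.
(* In this stage some positions are fixed at arbitrary values; adding up their absolute values gives
   a crude radius that contains them all. *)
pose D' := `|x| + `|y| + `|D2| + \sum_(j <- iota 0 k) `|e' (2%N, j)|.
have s0 : 0 <= \sum_(j <- iota 0 k) `|e' (2%N, j)| by apply: sumr_ge0.
have n1 := normr_ge0 x; have n2 := normr_ge0 y; have n3 := normr_ge0 D2; have n4 := ler_norm D2.
apply: le_lt_trans (tail_bound mu1 mu2 h1 h2 w1 w2 D2 t0 y mw1 mw2 hw1 hw2 w1y w2y w2D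
   (iota 0 m) k x t D' l1 l2 e' (iota_uniq _ _) lE _ _ _ _) _; rewrite /D' ?ltry//; try lra.
move=> j jl; have : (2%N, j) \in inames (iota 0 m) k by rewrite lE mem_cat jl.
rewrite inames_2 => jk; rewrite (big_rem j) ?mem_iota//=.
have : 0 <= \sum_(i <- rem j (iota 0 k)) `|e' (2%N, i)| by apply: sumr_ge0.
lra.
Qed.

Lemma path_vals k (e : env) t : reflect
  ((forall j, (j < k)%N -> nodeT t0 e j < nodeT t0 e j.+1) /\ nodeT t0 e k < t)
  (path <%R t0 (rcons (vals e 0 k) t)).
Proof.
have pE j : (j <= k)%N -> nth 0 (t0 :: rcons (vals e 0 k) t) j = nodeT t0 e j.
  by case: j => [//|j] jk; rewrite /= nth_rcons size_vals jk nth_vals.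
have pS j : (j < k)%N -> nth 0 (rcons (vals e 0 k) t) j = nodeT t0 e j.+1.
  by move=> jk; rewrite nth_rcons size_vals jk nth_vals.
have pk : nth 0 (rcons (vals e 0 k) t) k = t by rewrite nth_rcons size_vals ltnn eqxx.
have sz : size (rcons (vals e 0 k) t) = k.+1 by rewrite size_rcons size_vals.
apply: (iffP (pathP 0)) => [hh|[a1 a2] j].
  rewrite sz in hh; split; last by have := hh k (ltnSn k); rewrite pE// pk.
  by move=> j jk; have := hh j (ltnW jk); rewrite pE ?(ltnW jk)// pS.
rewrite sz ltnS leq_eqVlt => /predU1P[->|jk]; first by rewrite pE// pk.
by rewrite pE ?(ltnW jk)// pS// a1.
Qed.

Lemma Iints_tnames g t k F e : Iints (fI g t) (tnames k) F e = Cints mu (tnames k) F e.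
Proof.
rewrite /tnames; elim: (iota 0 k) e => [//|j s ih] e /=; rewrite /Cint.
by apply: eq_cint => a; exact: ih.
Qed.

Lemma Fxt_no_path L k (e : env) x t :
  ~ ((forall j, (j < k)%N -> nodeT t0 e j < nodeT t0 e j.+1) /\ nodeT t0 e k < t) -> Fxt t0 y L k e x t = 0.
Proof. by move=> np; have [/np|[]] := Fxt_guard t0 y L L k e x t 0. Qed.

Lemma Cfin_tnames L k x t e : uniq L -> Cfin mu (tnames k) (Cints mu (inames L k) (Wx L k x t)) e.
Proof.
move=> uL; have [mW fy] := Wxt_Cfin L k x t e uL; split; first exact: cmeas_Cints.
apply: le_lt_trans fy; rewrite Nints_cat; apply: le_Nints.
- by apply: nnmeas_enorm1; exact: cmeas_Cints.
- by apply: nnmeas_Nints; exact: nnmeas_enorm1.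
- by move=> e' _; exact: le_Cints.
Qed.

Lemma iterint_Jxt g m k x t :
  iterint (cintegral leb setT) k (fun tau =>
    if path <%R t0 (rcons tau t) then
      iterint (cintegral leb `[t0, t]) m (fun s =>
        iterint (cm_integral (cm_scale g M2)) k (fun xs =>
          iterint (cm_integral (cm_scale g m1)) m (fun alpha =>
            feynman_F t0 y t x m k tau s xs alpha)))
    else 0) = g ^+ (k + m) * J (iota 0 m) k x t e0.
Proof.
rewrite (iterint_Iints (fI g t) _ 0 0 k _ e0)//.
transitivity (Iints (fI g t) (tnames k) (fun e => g ^+ (k + m) * Cints mu (inames (iota 0 m) k) (Wx (iota 0 m) k x t) e) e0).
  apply: eq_Iints => e _; rewrite -/(vals e 0 k).
  case: path_vals => [[pj pt]|np]; last first.
    rewrite (eq_Cints mu _ _ (fun=> 0)) ?Cints0 ?mulr0// => e' ee'.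
    rewrite /Wx /Wxt Fxt_no_path ?mul0r//; move: np; apply: contra_not.
    have eT j : nodeT t0 e' j = nodeT t0 e j by case: j => [//|j] /=; rewrite ee'// inames_not0.
    by move=> [h1' h2']; split=> [j jk|]; rewrite -!eT//; exact: h1'.
  rewrite -inner_Iints// inames_iota !Iints_cat.
  apply: etrans (iterint_Iints (fI g t) (cintegral leb `[t0, t]) 1 0 m _ e (fun j => erefl)) _.
  apply: eq_Iints => e1 ee1; rewrite -?/(vals e1 1 m).
  apply: etrans (iterint_Iints (fI g t) (cm_integral (cm_scale g M2)) 2 0 k _ e1 (fun j => erefl)) _.
  apply: eq_Iints => e2 ee2; rewrite -?/(vals e2 2 k).
  apply: etrans (iterint_Iints (fI g t) (cm_integral (cm_scale g m1)) 3 0 m (feynman_F t0 y t x m k (vals e 0 k) (vals e1 1 m) (vals e2 2 k)) e2 (fun j => erefl)) _.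
  apply: eq_Iints => e3 ee3.
  have no c d s (j : nat) : c != d -> (c, j) \notin [seq (d, j) | j <- s].
    by move=> cd; apply/mapP => -[j' _ [/eqP]]; rewrite (negbTE cd).
  change ([seq e3 (3%N, j) | j <- iota 0 m]) with (vals e3 3 m).
  have E0 : vals e 0 k = vals e3 0 k.
    rewrite (vals_agree _ _ _ 0 k _ ee3); last by move=> j; exact: no.
    rewrite (vals_agree _ _ _ 0 k _ ee2); last by move=> j; exact: no.
    by rewrite (vals_agree _ _ _ 0 k _ ee1)// => j; exact: no.
  have E1 : vals e1 1 m = vals e3 1 m.
    rewrite (vals_agree _ _ _ 1 m _ ee3); last by move=> j; exact: no.
    by rewrite (vals_agree _ _ _ 1 m _ ee2)// => j; exact: no.
  have E2 : vals e2 2 k = vals e3 2 k.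
    by rewrite (vals_agree _ _ _ 2 k _ ee3)// => j; exact: no.
  by rewrite E0 E1 E2.
rewrite Iints_tnames.
rewrite (_ : J _ _ _ _ _ = Cints mu (tnames k) (Cints mu (inames (iota 0 m) k) (Wx (iota 0 m) k x t)) e0).
  apply: (CintsZ mu (tnames k) (fun=> g ^+ (k + m))); [exact: cmeas_cst|by []|].
  by apply: Cfin_tnames; exact: iota_uniq.
by rewrite /J /Jxt /vnames Cints_cat.
Qed.

(** The combinatorial factor is $\binom nkk!/n!=1/(n-k)!$: only the unordered insertion times keep a
    factorial. *)
Definition cterm (n : nat) (x t : R) : C :=
  (- 'i%C) ^+ n * \sum_(k < n.+1) ((n - k)`!%:R)^-1 * J (iota 0 (n - k)) k x t e0.

Lemma feynman_termE g n x t :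
  feynman_term t0 y t x (cm_scale g m1) (cm_scale g M2) n = g ^+ n * cterm n x t.
Proof.
rewrite /feynman_term /cterm [RHS]mulrCA -mulrA; congr (_ * _).
rewrite !mulr_sumr; apply: eq_bigr => k _; have kn : (k <= n)%N by rewrite -ltnS.
rewrite iterint_Jxt subnKC//; have := bin_fact kn.
move=> /(congr1 (fun m : nat => m%:R : C)); rewrite !natrM => <-.
have z (m : nat) : (m`!)%:R != 0 :> C by rewrite pnatr_eq0 -lt0n fact_gt0.
have zb : ('C(n, k))%:R != 0 :> C by rewrite pnatr_eq0 -lt0n bin_gt0.
by field; rewrite zb !z.
Qed.

Lemma Jxt_norm1 L k (x t D m : R) e : uniq L -> 0 < m -> `|x| <= D -> `|y| <= D -> D2 <= D ->
  norm1 (J L k x t e) <= 2 ^+ k.+2 * (16 / m) ^+ k * (\prod_(i <- inames L k) fK mu1 mu2 w1 w2 t0 D t i) *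
     (isqrt0 (t - t0) * expR (m ^+ 2 * (t - t0))).
Proof.
move=> uL m0 xD yD D2D; rewrite -lee_fin.
apply: le_trans (Wxt_bound mu1 mu2 h1 h2 w1 w2 D2 t0 y mh1 mh2 mw1 mw2 hw1 hw2 w1y w2y w2D
   L k x t D m e uL m0 xD yD D2D).
by apply: le_Cints; exact: (cmeas_Wxt h1 h2 t0 y mh1 mh2).
Qed.

(** The $V_1$ factors decay factorially, by [exp_fact_le]. The $V_2$ factors decay geometrically
    with the ratio $32W/m$, where $W$ is the total weight of the second density. Half of [rho] is
    reserved for the $n+1\le2^n$ summands. All costs go into the exponential rate [kap], which
    depends neither on [n] nor on [t]. *)
Lemma cterm_bound (D rho : R) : 0 < rho -> exists2 kap : R, 0 <= kap & forall n x t, `|x| <= D ->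
  norm1 (cterm n x t) <= rho ^+ n * (4 * (isqrt0 (t - t0) * expR (kap * (t - t0)))).
Proof.
move=> rho0; pose D' := `|D| + `|y| + `|D2|.
pose W := fine (\int[mu2]_x (w2 x)%:E); pose M := fine (\int[mu1]_x (expR (D' * `|x|) * w1 x)%:E).
have W0 : 0 <= W by exact: (fK_ge0 mu1 mu2 h1 h2 w1 w2 t0 hw1 hw2 D' 0 (2%N, 0%N)).
have M0 : 0 <= M by exact: (fK_ge0 mu1 mu2 h1 h2 w1 w2 t0 hw1 hw2 D' 0 (3%N, 0%N)).
pose r0 := rho / 2; have r00 : 0 < r0 by rewrite divr_gt0.
(* The 32 is the 16 of [simplex_bound] times the 2 that each kernel costs in [norm1]; the summand 1
   keeps [m] positive for $W=0$. *)
pose m := 32 * W / r0 + 1; have m0 : 0 < m by rewrite ltr_wpDl// divr_ge0 ?mulr_ge0// ltW.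
have Wm : 32 * W / m <= r0.
  rewrite ler_pdivrMr// (_ : r0 * m = 32 * W + r0) ?lerDl ?ltW//.
  by rewrite /m; field; rewrite gt_eqF.
exists (m ^+ 2 + M / r0); first by rewrite addr_ge0 ?sqr_ge0// divr_ge0// ltW.
move=> n x t xD.
have b1 : `|x| <= D' by rewrite /D' (le_trans xD)// (le_trans (ler_norm D))// -addrA lerDl addr_ge0.
have b2 : `|y| <= D' by rewrite /D' addrAC lerDr addr_ge0.
have b3 : D2 <= D' by rewrite /D' (le_trans (ler_norm _))// lerDr addr_ge0.
set H := 4 * _; have H0 : 0 <= H by rewrite mulr_ge0// mulr_ge0 ?expR_ge0 ?isqrt0_ge0.
have term (k : 'I_n.+1) : norm1 (((n - k)`!%:R)^-1 * J (iota 0 (n - k)) k x t e0) <= r0 ^+ n * H.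
  have kn : (k <= n)%N by rewrite -ltnS.
  have -> : ((n - k)`!%:R)^-1 = (((n - k)`!%:R)^-1)%:C :> C.
    by rewrite -[in RHS]/(real_complex R _) fmorphV rmorph_nat.
  rewrite norm1RM ger0_norm ?invr_ge0//.
  apply: le_trans (ler_wpM2l _ (Jxt_norm1 _ _ _ _ _ _ _ (iota_uniq _ _) m0 b1 b2 b3)) _.
    by rewrite invr_ge0.
  rewrite prod_fK size_iota -/W -/M.
  have [tt|tt] := leP t t0.
    by rewrite /isqrt0 subr_gt0 ltNge tt /= mul0r !mulr0 mulr_ge0// exprn_ge0// ltW.
  have T0 : 0 < t - t0 by rewrite subr_gt0.
  rewrite max_l ?(ltW T0)// /H /fK /= -/W -/M.
  set T := t - t0 in T0 *; set I := isqrt0 T; set p := (n - k)%N.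
  have I0 : 0 <= I := isqrt0_ge0 _.
  have e1 := exp_fact_le (T * M) r0 p (mulr_ge0 (ltW T0) M0) r00.
  have e2 : (32 * W / m) ^+ k <= r0 ^+ k.
    by rewrite lerXn2r ?nnegrE ?(ltW r00)// divr_ge0 ?mulr_ge0// ltW.
  have -> : expR ((m ^+ 2 + M / r0) * T) = expR (T * M / r0) * expR (m ^+ 2 * T).
    by rewrite -expRD; congr expR; ring.
  have -> : (p`!%:R)^-1 * (2 ^+ k.+2 * (16 / m) ^+ k * ((T * M) ^+ p * W ^+ k) * (I * expR (m ^+ 2 * T))) =
     ((T * M) ^+ p / p`!%:R) * (32 * W / m) ^+ k * (4 * (I * expR (m ^+ 2 * T))).
    have -> : 32 * W / m = 2 * (16 / m) * W by ring.
    rewrite !exprMn !exprS; move: ((T * M) ^+ p) (2 ^+ k) (W ^+ k) => a1 a2 a3.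
    by ring.
  have -> : r0 ^+ n = r0 ^+ p * r0 ^+ k by rewrite -exprD subnK.
  have -> : r0 ^+ p * r0 ^+ k * (4 * (I * (expR (T * M / r0) * expR (m ^+ 2 * T)))) =
     (r0 ^+ p * expR (T * M / r0)) * r0 ^+ k * (4 * (I * expR (m ^+ 2 * T))) by ring.
  apply: ler_wpM2r; first by rewrite mulr_ge0// mulr_ge0 ?expR_ge0.
  apply: ler_pM => //; first by rewrite divr_ge0// exprn_ge0// mulr_ge0// ltW.
  by rewrite exprn_ge0// divr_ge0 ?mulr_ge0// ltW.
rewrite /cterm; apply: le_trans (norm1M _ _) _.
have i1 : norm1 ((- 'i%C) ^+ n : C) <= 1.
  by apply: le_trans (norm1X _ _) _; rewrite norm1N norm1i expr1n.
apply: (@le_trans _ _ (1 * \sum_(k < n.+1) r0 ^+ n * H)).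
  apply: ler_pM; rewrite ?norm1_ge0//; apply: le_trans (norm1_sum _ _ _ _) _.
  by apply: ler_sum => k _; exact: term.
rewrite mul1r sumr_const card_ord -mulr_natl mulrA; apply: ler_wpM2r => //.
have -> : rho = 2 * r0 by rewrite /r0; field.
have -> : (2 * r0) ^+ n = 2 ^+ n * r0 ^+ n by exact: exprMn.
by apply: ler_wpM2r; [rewrite exprn_ge0// ltW|rewrite -natrX ler_nat ltn_expl].
Qed.

Definition propagator (g : C) (x t : R) : C := feynman_integral t0 y t x (cm_scale g m1) (cm_scale g M2).

Lemma propagatorE g x t : propagator g x t = limn (series (fun n => g ^+ n * cterm n x t) : nat -> C^o).
Proof.
rewrite /propagator /feynman_integral.
by have -> : feynman_term t0 y t x (cm_scale g m1) (cm_scale g M2) = (fun n => g ^+ n * cterm n x t)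
  by apply/funext => n; exact: feynman_termE.
Qed.

Lemma cterm_small x t rho : 0 < rho ->
  exists2 A : R, 0 <= A & forall n, norm1 (cterm n x t) <= A * rho ^+ n.
Proof.
move=> r0; have [kap k0 hk] := cterm_bound `|x| rho r0.
exists (4 * (isqrt0 (t - t0) * expR (kap * (t - t0)))).
  by rewrite mulr_ge0// mulr_ge0 ?expR_ge0 ?isqrt0_ge0.
by move=> n; rewrite mulrC; exact: hk.
Qed.

Lemma feynman_cvgn g x t :
  cvgn (series (feynman_term t0 y t x (cm_scale g m1) (cm_scale g M2) : nat -> C^o)).
Proof.
have := entire_cvgn (fun n => cterm n x t) (cterm_small x t) g.
by have -> : (fun n => g ^+ n * cterm n x t) = feynman_term t0 y t x (cm_scale g m1) (cm_scale g M2)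
  by apply/funext => n; rewrite feynman_termE.
Qed.

Lemma propagator_analytic x t : analytic (fun g => propagator g x t).
Proof. by apply: (entire_analytic (fun n => cterm n x t)) => [rho|g]; [exact: cterm_small|exact: propagatorE]. Qed.

(** A rate of convergence locally uniform in $x$, with the singularity at $t_0$ kept explicit, since
    it has to be integrated against test functions when the series is summed in the weak
    equation. *)
Lemma propagator_tail (g : C) (D : R) : exists2 kap : R, 0 <= kap & forall x t, `|x| <= D -> forall N,
  (norm1 (g ^+ N * cterm N x t) <= (4 * (isqrt0 (t - t0) * expR (kap * (t - t0)))) / 2 ^+ N) /\
  (norm1 (\sum_(0 <= n < N) g ^+ n * cterm n x t - propagator g x t) <=
    4 * (4 * (isqrt0 (t - t0) * expR (kap * (t - t0)))) / 2 ^+ N).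
Proof.
pose q := norm1 g + 1; have q0 : 0 < q by rewrite ltr_wpDl ?norm1_ge0.
have [|kap k0 hk] := cterm_bound D (2 * q)^-1; first by rewrite invr_gt0 mulr_gt0.
exists kap => // x t xD; set A := 4 * _.
have tb n : norm1 (g ^+ n * cterm n x t) <= A / 2 ^+ n.
  apply: le_trans (norm1M _ _) _.
  apply: (@le_trans _ _ (q ^+ n * ((2 * q)^-1 ^+ n * A))).
    apply: ler_pM; rewrite ?norm1_ge0 ?hk//; apply: le_trans (norm1X _ _) _.
    by rewrite lerXn2r ?nnegrE ?norm1_ge0 ?(ltW q0)// /q lerDl.
  rewrite exprVn exprMn le_eqVlt; apply/orP; left; apply/eqP.
  by field; rewrite !expf_neq0 ?gt_eqF.
move=> N; split; first exact: tb.
have [l hl] := geometric_limit (fun n => g ^+ n * cterm n x t) A tb.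
have -> : propagator g x t = l; last exact: hl.
by rewrite propagatorE; have /cvg_lim := entire_cvg (fun n => cterm n x t) g l (4 * A) hl; apply; exact: norm_hausdorff.
Qed.
End Terms.

(** * Weak form of the recursion *)

Section Ties.
Context {R : realType}.
Local Notation C := R[i].
Local Notation B := (measurableTypeR R).
Local Notation leb := (@lebesgue_measure R).
Local Notation env := (@env R).
Local Notation name := (nat * nat)%type.
Variable mu : name -> {sigma_finite_measure set B -> \bar R}.

(** [N] plays the part of an indicator of the exceptional set. A vanishing iterated integral means,
    stage by stage, a vanishing inner integral for almost every value of the outer variable. *)
Lemma Cints_ae l (N : env -> \bar R) F G e : nnmeas N -> cmeas F -> cmeas G ->
  (forall e, N e = 0%E -> F e = G e) -> Nints mu l N e = 0%E -> Cints mu l F e = Cints mu l G e.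
Proof.
move=> nN mF mG FG; elim: l e => [|i l ih] e /=; first exact: FG.
move=> N0; apply: ae_cint.
- by apply: cmeas_upd; exact: cmeas_Cints.
- by apply: cmeas_upd; exact: cmeas_Cints.
have mN := nnmeas_upd _ e i (nnmeas_Nints mu l N nN).
have N1 : (\int[mu i]_a `|Nints mu l N (upd e i a)| = 0)%E.
  rewrite -[RHS]N0; apply: eq_integral => a _; rewrite gee0_abs//.
  by case: (nnmeas_Nints mu l N nN).
have h := (ae_eq_integral_abs (mu i) measurableT mN).1 N1.
by apply: filterS h => a /(_ I); exact: ih.
Qed.

(** By Tonelli the Lebesgue variable [i] is integrated innermost, where the tie is a single
    point. *)
Lemma Nints_tie l (i j : name) e : uniq l -> i \in l -> i != j -> mu i = leb ->
  Nints mu l (fun e => if e i == e j then +oo else 0)%E e = 0%E.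
Proof.
move=> ul il ij mi.
have mt : nnmeas (fun e : env => if e i == e j then +oo else 0)%E.
  split; last by move=> e'; case: ifP.
  apply: measurable_fun_ifT => //.
  by apply: measurable_fun_eqr; exact: measurable_coord.
have pl : perm_eq l (rem i l ++ [:: i]) by rewrite (permPl (perm_to_rem il)) perm_sym perm_catC.
rewrite (Nints_perm mu l (rem i l ++ [:: i]))// Nints_cat.
rewrite (eq_Nints mu _ _ (fun=> 0%E)) ?Nints0// => e' _.
rewrite /= /Nint mi; apply: (etrans _ (integral0 leb setT)).
apply: ae_eq_integral => //; first exact: (nnmeas_upd _ e' i mt).
exists [set e' j]; split; [exact: measurable_set1|exact: lebesgue_measure_set1|].
move=> a /= h; apply: contrapT => /eqP aj; apply: h => _.
by rewrite upd_same upd_diff ?(negbTE aj)// eq_sym.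
Qed.

Lemma Cints_ties l (ps : seq (name * name)) F G e : uniq l -> cmeas F -> cmeas G ->
  (forall p, p \in ps -> [/\ p.1 \in l, p.1 != p.2 & mu p.1 = leb]) ->
  (forall e : env, (forall p, p \in ps -> e p.1 != e p.2) -> F e = G e) ->
  Cints mu l F e = Cints mu l G e.
Proof.
move=> ul + mG; elim: ps F => [|p ps ih] F mF hp FG.
  by apply: eq_Cints => e' _; apply: FG.
have [p1 p2 p3] := hp p (mem_head _ _).
pose F' := fun e : env => if e p.1 == e p.2 then G e else F e.
have mE : measurable_fun setT (fun e : env => e p.1 == e p.2).
  by apply: measurable_fun_eqr; exact: measurable_coord.
have mF' : cmeas F' by exact: cmeas_if.
transitivity (Cints mu l F' e).
  apply: (Cints_ae l (fun e => if e p.1 == e p.2 then +oo else 0)%E) => //.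
  - split; last by move=> e'; case: ifP.
    exact: measurable_fun_ifT.
  - by move=> e'; rewrite /F'; case: ifP.
  - exact: Nints_tie.
apply: ih => // [q qp|e' he']; first by apply: hp; rewrite inE qp orbT.
rewrite /F'; case: ifPn => // ne; apply: FG => q; rewrite inE => /predU1P[->//|]; exact: he'.
Qed.

Lemma Cints_closed l F e e' : (forall e1 e2 : env, (forall i, i \in l -> e1 i = e2 i) -> F e1 = F e2) ->
  Cints mu l F e = Cints mu l F e'.
Proof.
move=> hF.
have H s : forall e1 e2 : env, (forall i, i \in l -> i \notin s -> e1 i = e2 i) -> Cints mu s F e1 = Cints mu s F e2.
  elim: s => [|i s ih] e1 e2 h12 /=; first by apply: hF => i il; exact: h12.
  apply: eq_cint => a; apply: ih => j jl js; have [->|ji] := eqVneq j i; first by rewrite !upd_same.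
  by rewrite !upd_diff//; apply: h12 => //; rewrite inE negb_or ji.
by apply: H => i il; rewrite il.
Qed.
End Ties.

(** * Inner integrals under an outer weight, and relabelling of insertions *)

Section Pull.
Context {R : realType}.
Local Notation C := R[i].
Local Notation B := (measurableTypeR R).
Local Notation leb := (@lebesgue_measure R).
Local Notation env := (@env R).
Local Notation name := (nat * nat)%type.
Variables (m1 M2 : complex_measure R).
Variables (mu1 mu2 : {sigma_finite_measure set B -> \bar R}) (h1 h2 : R -> C) (w1 w2 : R -> R).
Variables (D2 t0 y : R).
Hypothesis r1 : represents m1 mu1 h1 w1.
Hypothesis r2 : represents M2 mu2 h2 w2.
Hypothesis w1y : forall c, (\int[mu1]_x (expR (c * `|x|) * w1 x)%:E < +oo)%E.
Hypothesis w2y : (\int[mu2]_x (w2 x)%:E < +oo)%E.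
Hypothesis w2D : forall x, D2 < `|x| -> w2 x = 0.

Let mh1 : cmeas (h1 : B -> C). Proof. by case: r1. Qed.
Let mh2 : cmeas (h2 : B -> C). Proof. by case: r2. Qed.
Let mw1 : measurable_fun setT (w1 : B -> B). Proof. by case: r1. Qed.
Let mw2 : measurable_fun setT (w2 : B -> B). Proof. by case: r2. Qed.
Let hw1 x : norm1 (h1 x) <= w1 x. Proof. by case: r1. Qed.
Let hw2 x : norm1 (h2 x) <= w2 x. Proof. by case: r2. Qed.
Local Notation mu := (fmu mu1 mu2).
Local Notation Wx := (Wxt h1 h2 t0 y).
Local Notation J := (Jxt mu1 mu2 h1 h2 t0 y).
Let e0 : env := fun=> 0.

Lemma Fxt_congr L k (e1 e2 : env) x t : (forall i, i \in vnames L k -> e1 i = e2 i) ->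
  Fxt t0 y L k e1 x t = Fxt t0 y L k e2 x t.
Proof.
move=> h.
have eT j : (j <= k)%N -> nodeT t0 e1 j = nodeT t0 e2 j.
  by case: j => [//|j] jk /=; apply: h; rewrite mem_cat mem_tnames /= jk.
have eX j : (j <= k)%N -> nodeX y e1 j = nodeX y e2 j.
  by case: j => [//|j] jk /=; apply: h; rewrite mem_cat inames_2 jk orbT.
have eS l : l \in L -> e1 (1%N, l) = e2 (1%N, l).
  by move=> lL; apply: h; rewrite !mem_cat map_f// orbT.
have eA l : l \in L -> e1 (3%N, l) = e2 (3%N, l).
  by move=> lL; apply: h; rewrite !mem_cat (map_f (fun l => (3%N, l)))// !orbT.
have ac a b : action L e1 a b = action L e2 a b.
  by apply: eq_big_seq => l lL; rewrite eS ?eA.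
have cs : charge_sum L e1 = charge_sum L e2 by apply: eq_big_seq => l lL; exact: eA.
have se : self_energy L e1 t = self_energy L e2 t.
  by apply: eq_big_seq => l lL; apply: eq_big_seq => l' l'L; rewrite !eS ?eA.
have ch : chain t0 y L k e1 = chain t0 y L k e2.
  by apply: eq_big_seq => j; rewrite mem_iota add0n => /= jk; rewrite /link !ac !eT ?eX// ltnW.
by rewrite /Fxt cs se ch !ac !eT ?eX.
Qed.

Lemma Wxt_congr L k (e1 e2 : env) x t : (forall i, i \in vnames L k -> e1 i = e2 i) -> Wx L k x t e1 = Wx L k x t e2.
Proof.
move=> h; rewrite /Wxt (Fxt_congr _ _ _ e2)//; congr (_ * _).
by apply: eq_big_seq => i il; rewrite h// mem_cat il orbT.
Qed.

Lemma Jxt_closed L k x t e e' : J L k x t e = J L k x t e'.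
Proof. by apply: Cints_closed => e1 e2; exact: Wxt_congr. Qed.

Lemma cmeas_Wvar L k (x t : env -> R) : measurable_fun setT (x : env -> B) -> measurable_fun setT (t : env -> B) ->
  cmeas (fun e => Wx L k (x e) (t e) e).
Proof.
move=> mx mt; apply: cmeasM; first exact: cmeas_Fxt.
apply: cmeas_prod => -[c l]; rewrite /fh /=.
case: (c == 1%N).
  apply: cmeas_if; [|exact: cmeas_cst|exact: cmeas_cst].
  by apply: measurable_and; apply: measurable_fun_ler => //; exact: measurable_coord.
case: (c == 2%N); first by apply: (cmeas_comp _ _ _ _ h2 (fun e : env => e (c, l))) => //; exact: measurable_coord.
case: (c == 3%N); first by apply: (cmeas_comp _ _ _ _ h1 (fun e : env => e (c, l))) => //; exact: measurable_coord.
exact: cmeas_cst.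
Qed.

(** The end point consists of two named variables outside the inner ones, so it is constant for the
    inner integrals. Evaluating [J] at [e0] is harmless because it integrates out every name that it
    reads. *)
Lemma Cints_pull pre (xn tn : name) L k (c : env -> C) e : uniq L -> cmeas c ->
  xn \notin vnames L k -> tn \notin vnames L k -> indep (vnames L k) c ->
  Cints mu (pre ++ vnames L k) (fun e => c e * Wx L k (e xn) (e tn) e) e =
  Cints mu pre (fun e => c e * J L k (e xn) (e tn) e0) e.
Proof.
move=> uL mc nx nt ic; rewrite Cints_cat; apply: eq_Cints => e1 _.
rewrite (eq_Cints mu _ _ (fun e => c e * Wx L k (e1 xn) (e1 tn) e)); last by move=> e2 h; rewrite !h.
rewrite CintsZ//; last exact: (Wxt_Cfin m1 M2 mu1 mu2 h1 h2 w1 w2 D2 t0 y r1 r2 w1y w2y w2D).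
by congr (_ * _); exact: Jxt_closed.
Qed.

Lemma Wxt_box L k (X T : R) : uniq L -> exists2 A : R, 0 <= A &
  forall x t e, `|x| <= X -> t <= T ->
    (Nints mu (vnames L k) (enorm1 (Wx L k x t)) e <= (A * isqrt0 (t - t0))%:E)%E.
Proof.
move=> uL; pose D := `|X| + `|y| + `|D2|.
pose A := 2 ^+ k.+2 * 16 ^+ k * ((Num.max (T - t0) 0 * fK mu1 mu2 w1 w2 t0 D 0 (3%N, 0%N)) ^+ size L *
   (fK mu1 mu2 w1 w2 t0 D 0 (2%N, 0%N)) ^+ k) * expR `|T - t0|.
have f0 t i : 0 <= fK mu1 mu2 w1 w2 t0 D t i by exact: (fK_ge0 mu1 mu2 h1 h2 w1 w2 t0 hw1 hw2).
have max0 : 0 <= Num.max (T - t0) 0 by rewrite le_max lexx orbT.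
have A0 : 0 <= A.
  apply: mulr_ge0; last exact: expR_ge0.
  apply: mulr_ge0; first by apply: mulr_ge0; exact: exprn_ge0.
  by apply: mulr_ge0; apply: exprn_ge0; rewrite ?mulr_ge0.
exists A => // x t e xX tT.
have b1 : `|x| <= D by rewrite /D (le_trans xX)// (le_trans (ler_norm X))// -addrA lerDl addr_ge0.
have b2 : `|y| <= D by rewrite /D addrAC lerDr addr_ge0.
have b3 : D2 <= D by rewrite /D (le_trans (ler_norm _))// lerDr addr_ge0.
apply: le_trans (Wxt_bound mu1 mu2 h1 h2 w1 w2 D2 t0 y mh1 mh2 mw1 mw2 hw1 hw2 w1y w2y w2D
  L k x t D 1 e uL ltr01 b1 b2 b3) _.
rewrite lee_fin [leRHS]mulrC mulrCA /A divr1 expr1n mul1r; apply: ler_wpM2l; first exact: isqrt0_ge0.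
rewrite prod_fK; apply: ler_pM; rewrite ?expR_ge0//.
- apply: mulr_ge0; first by apply: mulr_ge0; exact: exprn_ge0.
  by apply: mulr_ge0; apply: exprn_ge0; rewrite ?mulr_ge0// le_max lexx orbT.
- apply: ler_wpM2l; first by rewrite mulr_ge0 ?exprn_ge0.
  apply: ler_wpM2r; first by rewrite exprn_ge0.
  apply: lerXn2r; rewrite ?nnegrE ?mulr_ge0 ?le_max ?lexx ?orbT//; try exact: f0.
  apply: ler_wpM2r; first exact: f0.
  by rewrite ge_max !le_max lerD2r tT lexx !orbT.
- by rewrite ler_expR (le_trans _ (ler_norm _))// lerD2r.
Qed.

(** The labels are interchangeable. The increasing map [bump l] skips [l] and renames insertion
    times and exponents together, since the two share their labels. *)
Lemma Jxt_bump m k l x t : (l < m.+1)%N ->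
  J (rem l (iota 0 m.+1)) k x t e0 = J (iota 0 m) k x t e0.
Proof.
move=> lm; pose p (i : name) : name := if (i.1 == 1%N) || (i.1 == 3%N) then (i.1, bump l i.2) else i.
have pinj : injective p.
  have g c : ((c == 1%N) || (c == 3%N)) = false -> c != 1%N /\ c != 3%N by move=> /negbT; rewrite negb_or => /andP[].
  move=> [a b] [c d]; rewrite /p /=; case: ifP => h; case: ifP => h' //.
  - by move=> [-> /(can_inj (bumpK l)) ->].
  - by move=> [ac _]; move: h h'; rewrite ac => ->.
  - by move=> [ac _]; move: h h'; rewrite ac => ->.
have remE : rem l (iota 0 m.+1) = [seq bump l i | i <- iota 0 m].
  have -> : iota 0 m.+1 = iota 0 l ++ l :: iota l.+1 (m - l).
    by rewrite -{1}(subnKC (ltnW lm)) iotaD add0n subSn.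
  rewrite remE index_cat mem_iota ltnn andbF /= eqxx addn0 size_iota take_size_cat ?size_iota//.
  rewrite drop_cat size_iota ltnNge leqnSn /= subSn// subnn /= drop0.
  rewrite -{2}(subnKC (_ : l <= m)%N)// iotaD map_cat add0n; congr (_ ++ _).
    rewrite -[LHS]map_id; apply/eq_in_map => i; rewrite mem_iota => /andP[_ il].
    by rewrite /bump leqNgt (_ : (i < l)%N).
  rewrite -addn1 addnC iotaDl; apply/eq_in_map => i; rewrite mem_iota => /andP[il _].
  by rewrite /bump il.
have vE : vnames (rem l (iota 0 m.+1)) k = map p (vnames (iota 0 m) k).
  rewrite remE /vnames /inames !map_cat -!map_comp.
  by congr (_ ++ (_ ++ (_ ++ _))); apply: eq_map.
rewrite /Jxt vE; apply: (etrans _ (Cints_rename mu p (vnames (iota 0 m) k) (Wx (iota 0 m) k x t) e0 pinj _)); last first.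
  by move=> [c j] _; rewrite /p /=; case: ifP => // /orP[]/eqP->.
apply: eq_Cints => e _.
have bS c j : (c == 1%N) || (c == 3%N) -> e (c, bump l j) = (e \o p) (c, j) by rewrite /p /= => ->.
rewrite remE /Wxt; congr (_ * _).
  have eT j : nodeT t0 e j = nodeT t0 (e \o p) j by case: j.
  have eX j : nodeX y e j = nodeX y (e \o p) j by case: j.
  have ac a b : action [seq bump l i | i <- iota 0 m] e a b = action (iota 0 m) (e \o p) a b.
    by rewrite /action big_map.
  have cs : charge_sum [seq bump l i | i <- iota 0 m] e = charge_sum (iota 0 m) (e \o p).
    by rewrite /charge_sum big_map.
  have se : self_energy [seq bump l i | i <- iota 0 m] e t = self_energy (iota 0 m) (e \o p) t.
    by rewrite /self_energy big_map; apply: eq_bigr => i _; rewrite big_map.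
  have ch : chain t0 y [seq bump l i | i <- iota 0 m] k e = chain t0 y (iota 0 m) k (e \o p).
    by apply: eq_bigr => j _; rewrite /link ac !eT !eX.
  by rewrite /Fxt cs se ch ac eT eX.
by rewrite /inames !big_cat /= !big_map.
Qed.
End Pull.

(** * Weights against which the contributions can be integrated *)

Section Admissible.
Context {R : realType}.
Local Notation C := R[i].
Local Notation B := (measurableTypeR R).
Local Notation leb := (@lebesgue_measure R).
Local Notation env := (@env R).
Local Notation name := (nat * nat)%type.
Variables (m1 M2 : complex_measure R).
Variables (mu1 mu2 : {sigma_finite_measure set B -> \bar R}) (h1 h2 : R -> C) (w1 w2 : R -> R).
Variables (D2 t0 y : R).
Hypothesis r1 : represents m1 mu1 h1 w1.
Hypothesis r2 : represents M2 mu2 h2 w2.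
Hypothesis w1y : forall c, (\int[mu1]_x (expR (c * `|x|) * w1 x)%:E < +oo)%E.
Hypothesis w2y : (\int[mu2]_x (w2 x)%:E < +oo)%E.
Hypothesis w2D : forall x, D2 < `|x| -> w2 x = 0.

Let mh1 : cmeas (h1 : B -> C). Proof. by case: r1. Qed.
Let mh2 : cmeas (h2 : B -> C). Proof. by case: r2. Qed.
Let mw1 : measurable_fun setT (w1 : B -> B). Proof. by case: r1. Qed.
Let mw2 : measurable_fun setT (w2 : B -> B). Proof. by case: r2. Qed.
Let hw1 x : norm1 (h1 x) <= w1 x. Proof. by case: r1. Qed.
Let hw2 x : norm1 (h2 x) <= w2 x. Proof. by case: r2. Qed.
Local Notation mu := (fmu mu1 mu2).
Local Notation Wx := (Wxt h1 h2 t0 y).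
Local Notation J := (Jxt mu1 mu2 h1 h2 t0 y).
Let e0 : env := fun=> 0.


(* weights whose product with a function of size isqrt0 (t - t0) is absolutely integrable *)
Definition adm (pre : seq name) (xn tn : name) (c : env -> C) := exists (X T : R) (b : name -> R -> R),
  [/\ uniq pre, cmeas c, forall e, c e != 0 -> `|e xn| <= X /\ e tn <= T,
   forall i, [/\ forall a, 0 <= b i a, measurable_fun setT (b i : B -> B) &
     i \in pre -> (\int[mu i]_a (b i a)%:E < +oo)%E] &
   forall e, norm1 (c e) * isqrt0 (e tn - t0) <= \prod_(i <- pre) b i (e i)].

Lemma adm_prod pre xn tn c A e : adm pre xn tn c -> 0 <= A ->
  (Nints mu pre (fun e => ((norm1 (c e) * isqrt0 (e tn - t0)) * A)%:E) e < +oo)%E.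
Proof.
move=> [X [T [b [upre mc cXT hb cb]]]] A0.
have b0 i a : 0 <= b i a by case: (hb i).
have mb i : measurable_fun setT (b i : B -> B) by case: (hb i).
have mtn : measurable_fun setT (fun e : env => e tn : B) by exact: measurable_coord.
have nP : nnmeas (fun e : env => (A * \prod_(i <- pre) b i (e i))%:E).
  split; last by move=> e'; rewrite lee_fin; apply: mulr_ge0 => //; exact: prodr_seq_ge0.
  apply/measurable_EFinP; apply: measurable_funM => //; exact: measurable_prod_seq.
apply: (@le_lt_trans _ _ (Nints mu pre (fun e => (A * \prod_(i <- pre) b i (e i))%:E) e)).
  apply: le_Nints => // [|e' _]; last by rewrite lee_fin mulrC; exact: ler_wpM2l.
  split; last by move=> e'; rewrite lee_fin; do 2?apply: mulr_ge0 => //; [exact: norm1_ge0|exact: isqrt0_ge0].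
  apply/measurable_EFinP; apply: measurable_funM => //; apply: measurable_funM.
    exact: measurable_norm1.
  by apply: measurable_isqrt0; exact: measurable_funB.
apply: le_lt_trans (Nints_prod mu pre b (fun i => fine (\int[mu i]_a (b i a)%:E)) (fun=> A) e upre
   (fun=> A0) (measurable_cst _) (fun _ _ _ => erefl) b0 mb _) (ltry _).
move=> i ip; have [_ _ bi] := hb i.
by rewrite fineK// ge0_fin_numE ?bi//; apply: integral_ge0 => a _; rewrite lee_fin.
Qed.

Lemma nnmeas_adm pre xn tn c A : adm pre xn tn c -> 0 <= A ->
  nnmeas (fun e : env => ((norm1 (c e) * isqrt0 (e tn - t0)) * A)%:E).
Proof.
move=> [X [T [b [upre mc _ _ _]]]] A0.
have mtn : measurable_fun setT (fun e : env => e tn : B) by exact: measurable_coord.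
split; last by move=> e'; rewrite lee_fin; do 2?apply: mulr_ge0 => //; [exact: norm1_ge0|exact: isqrt0_ge0].
apply/measurable_EFinP; apply: measurable_funM => //; apply: measurable_funM.
  exact: measurable_norm1.
by apply: measurable_isqrt0; exact: measurable_funB.
Qed.

Lemma adm_pull pre xn tn c L k e : adm pre xn tn c -> uniq L ->
  xn \notin vnames L k -> tn \notin vnames L k -> indep (vnames L k) c ->
  Cfin mu (pre ++ vnames L k) (fun e => c e * Wx L k (e xn) (e tn) e) e.
Proof.
move=> ad uL nx nt ic; have [X [T [b [upre mc cXT hb cb]]]] := ad.
have [A A0 hA] := Wxt_box m1 M2 mu1 mu2 h1 h2 w1 w2 D2 t0 y r1 r2 w1y w2y w2D L k X T uL.
have mF : cmeas (fun e : env => c e * Wx L k (e xn) (e tn) e).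
  apply: cmeasM => //; apply: (cmeas_Wvar m1 M2 mu1 mu2 h1 h2 w1 w2 t0 y r1 r2); exact: measurable_coord.
split => //; rewrite Nints_cat; apply: le_lt_trans (adm_prod _ _ _ _ A e ad A0).
apply: le_Nints; [by apply: nnmeas_Nints; exact: nnmeas_enorm1|exact: nnmeas_adm ad A0|move=> e1 _].
apply: (@le_trans _ _ (Nints mu (vnames L k) (fun e => (norm1 (c e1))%:E * enorm1 (Wx L k (e1 xn) (e1 tn)) e)%E e1)).
  apply: le_Nints; first exact: nnmeas_enorm1.
    split; last by move=> e'; apply: mule_ge0; rewrite lee_fin norm1_ge0.
    apply: emeasurable_funM => //; apply: emeasurable_norm1.
    exact: (cmeas_Wxt h1 h2 t0 y mh1 mh2).
  by move=> e2 h; rewrite /enorm1 -EFinM lee_fin !h// (ic _ _ h) norm1M.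
rewrite (NintsZ mu _ (fun=> norm1 (c e1)))//; last 2 first.
- by move=> _; exact: norm1_ge0.
- by apply: nnmeas_enorm1; exact: (cmeas_Wxt h1 h2 t0 y mh1 mh2).
have [->|c1] := eqVneq (c e1) 0; first by rewrite norm10 mul0e mul0r mul0r.
have [xX tT] := cXT _ c1.
rewrite mulrAC -mulrA EFinM; apply: lee_wpmul2l; [by rewrite lee_fin norm1_ge0|exact: hA].
Qed.

(** The class in which the equation is summed: measurable functions with at most the singularity of
    the free kernel at $t_0$, locally uniformly. It forces $G$ to vanish for $t\le t_0$, where
    [isqrt0] is 0. *)
Definition locb (G : R -> R -> C) := cmeas (fun z : B * B => G z.1 z.2) /\
  forall X T, exists2 A : R, 0 <= A & forall x t, `|x| <= X -> t <= T -> norm1 (G x t) <= A * isqrt0 (t - t0).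

Lemma cmeas_env2 (G : R -> R -> C) (xn tn : name) : cmeas (fun z : B * B => G z.1 z.2) ->
  cmeas (fun e : env => G (e xn) (e tn)).
Proof.
move=> mG; apply: (cmeas_comp _ _ _ _ (fun z : B * B => G z.1 z.2) (fun e : env => (e xn, e tn))) => //.
by apply/measurable_fun_pairP; split; exact: measurable_coord.
Qed.

Lemma adm_Cfin pre xn tn c G e : adm pre xn tn c -> locb G ->
  Cfin mu pre (fun e => c e * G (e xn) (e tn)) e.
Proof.
move=> ad [mG hG]; have [X [T [b [upre mc cXT hb cb]]]] := ad; have [A A0 hA] := hG X T.
have mF : cmeas (fun e : env => c e * G (e xn) (e tn)) by apply: cmeasM => //; exact: cmeas_env2.
split => //; apply: le_lt_trans (adm_prod _ _ _ _ A e ad A0).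
apply: le_Nints; [exact: nnmeas_enorm1|exact: nnmeas_adm ad A0|move=> e1 _].
rewrite lee_fin; have [->|c1] := eqVneq (c e1) 0; first by rewrite mul0r norm10 !mul0r.
have [xX tT] := cXT _ c1.
apply: le_trans (norm1M _ _) _; rewrite mulrAC -mulrA.
by apply: ler_wpM2l; [exact: norm1_ge0|exact: hA].
Qed.

Lemma locbZ (c : C) G : locb G -> locb (fun x t => c * G x t).
Proof.
move=> [mG hG]; split; first by apply: cmeasM => //; exact: cmeas_cst.
move=> X T; have [A A0 hA] := hG X T; exists (norm1 c * A); first by rewrite mulr_ge0 ?norm1_ge0.
move=> x t xX tT; apply: le_trans (norm1M _ _) _; rewrite -mulrA.
by apply: ler_wpM2l; [exact: norm1_ge0|exact: hA].
Qed.

Lemma locb_sum (I : Type) (s : seq I) (G : I -> R -> R -> C) : (forall i, locb (G i)) ->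
  locb (fun x t => \sum_(i <- s) G i x t).
Proof.
move=> hG; split; first by apply: cmeas_sum => i; case: (hG i).
move=> X T; elim: s => [|i s [A A0 hA]].
  by exists 0 => // x t _ _; rewrite big_nil norm10 mul0r.
have [_ /(_ X T)[A' A'0 hA']] := hG i; exists (A' + A); first by rewrite addr_ge0.
move=> x t xX tT; rewrite big_cons; apply: le_trans (norm1D _ _) _.
by rewrite mulrDl; apply: lerD; [exact: hA'|exact: hA].
Qed.

Lemma locb_J L k : uniq L -> locb (fun x t => J L k x t e0).
Proof.
move=> uL; split.
  (* The fresh names of class 9 turn the parameters $x$ and $t$ into coordinates, so joint
     measurability follows from that of an integral over assignments. *)
  pose F : env -> C := Cints mu (vnames L k) (fun e => Wx L k (e (9%N, 0%N)) (e (9%N, 1%N)) e).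
  have mF : cmeas F by apply: cmeas_Cints; apply: (cmeas_Wvar m1 M2 mu1 mu2 h1 h2 w1 w2 t0 y r1 r2) => //; exact: measurable_coord.
  pose f (z : B * B) : env := upd (upd e0 (9%N, 0%N) z.1) (9%N, 1%N) z.2.
  have mf : measurable_fun setT f.
    apply: measurable_upd_comp; last exact: measurable_snd.
    by apply: measurable_upd_comp; [exact: measurable_cst|exact: measurable_fst].
  suff -> : (fun z : B * B => J L k z.1 z.2 e0) = (fun z => F (f z)) by exact: cmeas_comp.
  apply/funext => z.
  have n9 j : (9%N, j) \notin vnames L k.
    rewrite mem_cat negb_or mem_tnames /= !mem_cat !negb_or.
    by apply/and3P; split; apply/mapP => -[].
  rewrite /F /f (eq_Cints mu _ _ (Wx L k z.1 z.2)); last first.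
    by move=> e' h; rewrite !h// upd_diff// upd_same upd_same.
  by rewrite -[LHS](Jxt_closed mu1 mu2 h1 h2 t0 y L k z.1 z.2 (f z)).
move=> X T; have [A A0 hA] := Wxt_box m1 M2 mu1 mu2 h1 h2 w1 w2 D2 t0 y r1 r2 w1y w2y w2D L k X T uL.
exists A => // x t xX tT; rewrite -lee_fin; apply: le_trans (hA x t e0 xX tT).
apply: (le_Cints mu (vnames L k) (Wx L k x t)); exact: (cmeas_Wxt h1 h2 t0 y mh1 mh2).
Qed.

Lemma isqrt0_le (b s : R) : b <= s -> 0 < b -> (Num.sqrt s)^-1 <= isqrt0 b.
Proof.
move=> bs b0; rewrite /isqrt0 b0 lef_pV2 ?posrE ?sqrtr_gt0//; last exact: lt_le_trans bs.
by rewrite ler_wsqrtr.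
Qed.

(** Read off from [one_step] on $[t_0,T+1]$ with parameter 1: up to $T$ the additional factors
    there, multiplied by $\sqrt{T+1-t_0}$, are at least 1. *)
Lemma integral_isqrt0 (T : R) : (\int[leb]_a (if (a : R) <= T then isqrt0 (a - t0) else 0)%:E < +oo)%E.
Proof.
pose Q := Num.sqrt (T + 1 - t0).
have mt : measurable_fun setT (fun a : B => isqrt0 (a - t0)).
  by apply: measurable_isqrt0; exact: measurable_funB.
have ms : measurable_fun setT (fun a : B => isqrt0 (T + 1 - a)).
  by apply: measurable_isqrt0; exact: measurable_funB.
have me : measurable_fun setT (fun a : B => expR (1 ^+ 2 * (a - t0))).
  by apply: (measurableT_comp (@measurable_expR R)); apply: measurable_funM => //; exact: measurable_funB.
apply: (@le_lt_trans _ _ (\int[leb]_a (Q%:E * (isqrt0 (T + 1 - a) * isqrt0 (a - t0) * expR (1 ^+ 2 * (a - t0)))%:E))%E).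
  apply: ge0_le_integral => //.
  - by move=> a _; rewrite lee_fin; case: ifP => // _; exact: isqrt0_ge0.
  - apply/measurable_EFinP; apply: measurable_fun_ifT => //; exact: measurable_fun_ler.
  - apply: emeasurable_funM => //; apply/measurable_EFinP.
    by apply: measurable_funM => //; exact: measurable_funM.
  move=> a _; rewrite -EFinM lee_fin; case: ifPn => [aT|_]; last first.
    by rewrite !mulr_ge0 ?sqrtr_ge0 ?isqrt0_ge0 ?expR_ge0.
  have [a0|a0] := ltP 0 (a - t0); last first.
    by rewrite /isqrt0 [0 < a - t0]ltNge a0 /= mulr0 mul0r mulr0.
  rewrite -[leLHS]mulr1 [leRHS](_ : _ = isqrt0 (a - t0) * (Q * isqrt0 (T + 1 - a) * expR (1 ^+ 2 * (a - t0)))); last first.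
    by rewrite [isqrt0 (T + 1 - a) * _]mulrC -!mulrA mulrCA.
  apply: ler_wpM2l; first exact: isqrt0_ge0.
  have Q0 : 0 < Q by rewrite sqrtr_gt0; lra.
  have h : 1 <= Q * isqrt0 (T + 1 - a).
    rewrite -[leLHS](divff (lt0r_neq0 Q0)) ler_wpM2l ?(ltW Q0)//.
    by apply: isqrt0_le; lra.
  apply: mulr_ege1 => //.
  by rewrite -[leLHS]expR0 ler_expR expr1n mul1r ltW.
rewrite ge0_integralZl//; last 3 first.
- by apply/measurable_EFinP; apply: measurable_funM => //; exact: measurable_funM.
- by move=> a _; rewrite lee_fin !mulr_ge0 ?isqrt0_ge0 ?expR_ge0.
- by rewrite lee_fin sqrtr_ge0.
apply: lte_mul_pinfty; rewrite ?lee_fin ?sqrtr_ge0//.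
by apply: le_lt_trans (one_step 1 t0 (T + 1) ltr01) _; exact: ltry.
Qed.

Lemma cmeas_phi (psi : R * R -> C) (xn tn : name) : cmeas (psi : B * B -> C) -> cmeas (fun e : env => psi (e xn, e tn)).
Proof.
move=> mp; apply: (cmeas_comp _ _ _ _ psi (fun e : env => (e xn, e tn))) => //.
by apply/measurable_fun_pairP; split; exact: measurable_coord.
Qed.

Section Weights.
Variables (psi : R * R -> C) (X T N : R).
Hypothesis mpsi : cmeas (psi : B * B -> C).
Hypothesis spsi : forall x t, psi (x, t) != 0 -> `|x| <= X /\ t <= T.
Hypothesis bpsi : forall p, norm1 (psi p) <= N.
Let N0 : 0 <= N. Proof. exact: le_trans (norm1_ge0 _) (bpsi (0, 0)). Qed.
Let indX (a : R) : R := N * \1_(`[- X, X]%classic) a.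
Let indT (a : R) : R := if a <= T then isqrt0 (a - t0) else 0.
Let indX0 a : 0 <= indX a. Proof. by rewrite /indX mulr_ge0. Qed.
Let indT0 a : 0 <= indT a. Proof. by rewrite /indT; case: ifP => // _; exact: isqrt0_ge0. Qed.
Let mindX : measurable_fun setT (indX : B -> B). Proof. exact: measurable_dom. Qed.
Let mindT : measurable_fun setT (indT : B -> B).
Proof.
apply: measurable_fun_ifT => //; first exact: measurable_fun_ler.
by apply: measurable_isqrt0; exact: measurable_funB.
Qed.
Let le_ind x t : norm1 (psi (x, t)) * isqrt0 (t - t0) <= indX x * indT t.
Proof.
have [->|p0] := eqVneq (psi (x, t)) 0; first by rewrite norm10 mul0r mulr_ge0.
have [xX tT] := spsi _ _ p0; rewrite /indT tT; apply: ler_wpM2r; first exact: isqrt0_ge0.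
rewrite /indX indicE mem_set ?mulr1 ?bpsi//.
by rewrite /= in_itv /= -ler_norml.
Qed.

Let y1 : (\int[leb]_a (indX a)%:E < +oo)%E. Proof. exact: integral_dom. Qed.
Let y2 : (\int[leb]_a (indT a)%:E < +oo)%E. Proof. exact: integral_isqrt0. Qed.

Lemma adm_XT (tn : name) : mu tn = leb -> tn != (4%N, 0%N) ->
  adm [:: (4%N, 0%N); tn] (4%N, 0%N) tn (fun e => psi (e (4%N, 0%N), e tn)).
Proof.
move=> mtn ne; exists X, T, (fun i => if i == tn then indT else indX).
split; first by rewrite /= inE eq_sym ne.
- exact: cmeas_phi.
- by move=> e; exact: spsi.
- move=> i; have [->|ni] := eqVneq i tn; split => // ; first by rewrite mtn.
  by rewrite !inE (negbTE ni) orbF => /eqP ->.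
- by move=> e; rewrite big_cons big_seq1 eqxx eq_sym (negbTE ne); exact: le_ind.
Qed.

(** The weight left when the insertion [l] comes last: its time has become the time of the test
    function. The growth of $e^{x\alpha_l}$ is uniform over the bounded $x$-support and is paid for
    by the exponential moments of the first density. *)
Lemma adm_XSA (l : nat) :
  adm [:: (4%N, 0%N); (1%N, l); (3%N, l)] (4%N, 0%N) (1%N, l)
    (fun e => psi (e (4%N, 0%N), e (1%N, l)) *
      (cexp ((e (4%N, 0%N) * e (3%N, l))%:C) * h1 (e (3%N, l)))).
Proof.
pose indA (a : R) := 2 * (expR (X * `|a|) * w1 a).
have indA0 a : 0 <= indA a by rewrite mulr_ge0// mulr_ge0 ?expR_ge0// (le_trans (norm1_ge0 _) (hw1 a)).
have mindA : measurable_fun setT (indA : B -> B).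
  apply: measurable_funM => //; apply: measurable_funM => //.
  by apply: (measurableT_comp (@measurable_expR R)); apply: measurable_funM.
have y3 : (\int[mu1]_a (indA a)%:E < +oo)%E.
  under eq_integral do rewrite EFinM; rewrite ge0_integralZl//.
  - by apply: lte_mul_pinfty => //; exact: w1y.
  - apply/measurable_EFinP; apply: measurable_funM => //.
    by apply: (measurableT_comp (@measurable_expR R)); apply: measurable_funM.
  - by move=> a _; rewrite lee_fin mulr_ge0 ?expR_ge0// (le_trans (norm1_ge0 _) (hw1 a)).
exists X, T, (fun i => if i.1 == 1%N then indT else if i.1 == 3%N then indA else indX).
split => //.
- apply: cmeasM; first exact: cmeas_phi.
  apply: cmeasM; last by apply: (cmeas_comp _ _ _ _ h1 (fun e : env => e (3%N, l))) => //; exact: measurable_coord.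
  by apply: cmeas_cexp; apply: cmeasR; apply: measurable_funM; exact: measurable_coord.
- by move=> e; rewrite mulf_eq0 negb_or => /andP[/spsi].
- move=> [c j] /=; case: eqP => [->|c1]; split => //.
  + by case: ifP.
  + by case: ifP.
  + case: eqP => [->|c3]; first by rewrite !inE => /eqP[->].
    by rewrite !inE => /or3P[]/eqP[] // ->.
- move=> e; rewrite !big_cons big_nil /= mulr1 [leRHS]mulrA.
  have [p0|p0] := eqVneq (psi (e (4%N, 0%N), e (1%N, l))) 0.
    by rewrite p0 mul0r norm10 mul0r mulr_ge0// mulr_ge0.
  have [xX _] := spsi _ _ p0.
  apply: (@le_trans _ _ ((norm1 (psi (e (4%N, 0%N), e (1%N, l))) * isqrt0 (e (1%N, l) - t0)) * indA (e (3%N, l)))).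
    rewrite [leRHS]mulrAC; apply: ler_wpM2r; first exact: isqrt0_ge0.
    apply: le_trans (norm1M _ _) _; apply: ler_wpM2l; first exact: norm1_ge0.
    apply: le_trans (norm1M _ _) _; rewrite /indA mulrA; apply: ler_pM; rewrite ?norm1_ge0//.
    apply: le_trans (norm1_cexp _) _; apply: ler_wpM2l => //=.
    by rewrite ler_expR (le_trans (ler_norm _))// normrM ler_wpM2r.
  by apply: ler_wpM2r => //; exact: le_ind.
Qed.

(** The weight left when a node comes last: the test point has become the node, and its position is
    integrated against the second density instead of Lebesgue measure. *)
Lemma adm_QT (j : nat) (tn : name) : mu tn = leb -> tn != (2%N, j) ->
  adm [:: (2%N, j); tn] (2%N, j) tn (fun e => psi (e (2%N, j), e tn) * h2 (e (2%N, j))).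
Proof.
move=> mtn ne.
pose indQ (a : R) := N * w2 a.
have indQ0 a : 0 <= indQ a by rewrite mulr_ge0// (le_trans (norm1_ge0 _) (hw2 a)).
have mindQ : measurable_fun setT (indQ : B -> B) by apply: measurable_funM.
have y3 : (\int[mu2]_a (indQ a)%:E < +oo)%E.
  under eq_integral do rewrite EFinM; rewrite ge0_integralZl//.
  - by apply: lte_mul_pinfty => //; exact: w1y.
  - exact/measurable_EFinP.
  - by move=> a _; rewrite lee_fin (le_trans (norm1_ge0 _) (hw2 a)).
exists X, T, (fun i => if i == tn then indT else indQ); split.
- by rewrite /= inE eq_sym ne.
- apply: cmeasM; first exact: cmeas_phi.
  by apply: (cmeas_comp _ _ _ _ h2 (fun e : env => e (2%N, j))) => //; exact: measurable_coord.
- by move=> e; rewrite mulf_eq0 negb_or => /andP[/spsi].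
- move=> i; have [->|ni] := eqVneq i tn; split => //; first by rewrite mtn.
  by rewrite !inE (negbTE ni) orbF => /eqP ->.
- move=> e; rewrite big_cons big_seq1 eqxx eq_sym (negbTE ne).
  have [p0|p0] := eqVneq (psi (e (2%N, j), e tn)) 0; first by rewrite p0 mul0r norm10 mul0r mulr_ge0.
  have [_ tT] := spsi _ _ p0; rewrite /indT tT; apply: ler_wpM2r; first exact: isqrt0_ge0.
  by apply: le_trans (norm1M _ _) _; apply: ler_pM; rewrite ?norm1_ge0.
Qed.
End Weights.
End Admissible.

(** * The boundary term at the latest insertion *)

Section Recursion.
Context {R : realType}.
Local Notation C := R[i].
Local Notation B := (measurableTypeR R).
Local Notation leb := (@lebesgue_measure R).
Local Notation env := (@env R).
Local Notation name := (nat * nat)%type.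
Variables (m1 M2 : complex_measure R).
Variables (mu1 mu2 : {sigma_finite_measure set B -> \bar R}) (h1 h2 : R -> C) (w1 w2 : R -> R).
Variables (D2 t0 y : R).
Hypothesis r1 : represents m1 mu1 h1 w1.
Hypothesis r2 : represents M2 mu2 h2 w2.
Hypothesis w1y : forall c, (\int[mu1]_x (expR (c * `|x|) * w1 x)%:E < +oo)%E.
Hypothesis w2y : (\int[mu2]_x (w2 x)%:E < +oo)%E.
Hypothesis w2D : forall x, D2 < `|x| -> w2 x = 0.

Let mh1 : cmeas (h1 : B -> C). Proof. by case: r1. Qed.
Let mh2 : cmeas (h2 : B -> C). Proof. by case: r2. Qed.
Let mw1 : measurable_fun setT (w1 : B -> B). Proof. by case: r1. Qed.
Let mw2 : measurable_fun setT (w2 : B -> B). Proof. by case: r2. Qed.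
Let hw1 x : norm1 (h1 x) <= w1 x. Proof. by case: r1. Qed.
Let hw2 x : norm1 (h2 x) <= w2 x. Proof. by case: r2. Qed.
Local Notation mu := (fmu mu1 mu2).
Local Notation Wx := (Wxt h1 h2 t0 y).
Local Notation J := (Jxt mu1 mu2 h1 h2 t0 y).
Let e0 : env := fun=> 0.
(* the point (x, t) at which the test function is evaluated *)
Local Notation Xn := (4%N, 0%N).
Local Notation Tn := (4%N, 1%N).


Lemma measurable_all (I : Type) (s : seq I) (P : I -> env -> bool) :
  (forall i, measurable_fun setT (P i)) -> measurable_fun setT (fun e => all (P^~ e) s).
Proof.
move=> mP; elim: s => [|i s ih] /=; first exact: measurable_cst.
exact: measurable_and.
Qed.

Definition heights L k (e : env) : C :=
  (\prod_(j <- iota 0 k) h2 (e (2%N, j))) * \prod_(l <- L) h1 (e (3%N, l)).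

Lemma WxtE L k x t e : Wx L k x t e =
  if all (fun l => t0 <= e (1%N, l) <= t) L then Fxt t0 y L k e x t * heights L k e else 0.
Proof.
rewrite /Wxt /inames !big_cat !big_map /= {1}/fh /= -/(heights L k e).
have -> : \prod_(l <- L) (if t0 <= e (1%N, l) <= t then 1 else 0 : C) =
    if all (fun l => t0 <= e (1%N, l) <= t) L then 1 else 0.
  elim: (L) => [|l s ih]; first by rewrite big_nil.
  by rewrite big_cons ih /=; case: ifP => _; rewrite ?mul1r ?mul0r.
by case: ifP => _; rewrite ?mul1r ?mul0r ?mulr0.
Qed.

Lemma Wxt_guard0 L k x t e : ~~ all (fun l => t0 <= e (1%N, l) <= t) L -> Wx L k x t e = 0.
Proof. by rewrite WxtE => /negbTE ->. Qed.

Lemma not4_vnames L k j : (4%N, j) \notin vnames L k.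
Proof.
rewrite mem_cat negb_or mem_tnames /= !mem_cat !negb_or.
by apply/and3P; split; apply/mapP => -[].
Qed.

Lemma Wxt_updXT L k x t e a b : Wx L k x t (upd (upd e Xn a) Tn b) = Wx L k x t e.
Proof.
apply: Wxt_congr => i iv; rewrite !upd_diff//.
  by apply: contraTneq iv => ->; exact: not4_vnames.
by apply: contraTneq iv => ->; exact: not4_vnames.
Qed.

Lemma exists_max (s : seq nat) (f : nat -> R) : s != [::] ->
  exists2 l, l \in s & forall l', l' \in s -> f l' <= f l.
Proof.
elim: s => [//|i [|j s] ih] _.
  by exists i; rewrite ?inE // => l'; rewrite inE => /eqP ->.
have [l ls hl] := ih isT; have [il|li] := leP (f i) (f l).
  exists l; first by rewrite inE ls orbT.
  by move=> l'; rewrite inE => /predU1P[->//|]; exact: hl.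
exists i; first by rewrite inE eqxx.
by move=> l'; rewrite inE => /predU1P[->//|/hl h]; exact: le_trans (ltW li).
Qed.

Lemma cfin_box (f : R -> C) (A Y : R) : cmeas (f : B -> C) -> 0 <= A ->
  (forall x, f x != 0 -> `|x| <= Y /\ norm1 (f x) <= A) -> cfin leb f.
Proof.
move=> mf A0 hf; split => //; apply: le_lt_trans (integral_dom (- Y) Y A A0).
apply: ge0_le_integral => //.
- by move=> x _; rewrite lee_fin norm1_ge0.
- exact: emeasurable_norm1.
- by apply/measurable_EFinP; exact: measurable_dom.
move=> x _; rewrite lee_fin; have [->|f0] := eqVneq (f x) 0; first by rewrite norm10 mulr_ge0.
by have [xY fA] := hf x f0; rewrite indicE mem_set ?mulr1//= in_itv /= -ler_norml.
Qed.

Lemma Cfin_cat l1 l2 F e : Cfin mu (l1 ++ l2) F e -> Cfin mu l1 (Cints mu l2 F) e.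
Proof.
move=> [mF yF]; split; first exact: cmeas_Cints.
move: yF; rewrite Nints_cat; apply: le_lt_trans; apply: le_Nints.
- by apply: nnmeas_enorm1; exact: cmeas_Cints.
- by apply: nnmeas_Nints; exact: nnmeas_enorm1.
- by move=> e' _; exact: le_Cints.
Qed.

Let adm_cmeas pre xn tn c : adm mu1 mu2 t0 pre xn tn c -> cmeas c.
Proof. by move=> [? [? [? []]]]. Qed.

Section Test.
Variables (phi phix phixx phit : R * R -> R) (X s0 T M : R).
Hypothesis td : tdata t0 phi phix phixx phit X s0 T M.
Let w (p : R * R) : C := - 'i%C * (phit p)%:C + (2^-1 * phixx p)%:C.
Let f (p : R * R) : C := (phi p)%:C.

Lemma cmeas_weak : cmeas (w : B * B -> C).
Proof.
apply: cmeasD.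
  apply: cmeasM; first exact: cmeas_cst.
  by apply: cmeasR; apply: continuous_measurable2; exact: td_ct _ _ _ _ _ _ _ _ _ td.
apply: cmeasR; apply: measurable_funM => //.
by apply: continuous_measurable2; exact: td_cxx _ _ _ _ _ _ _ _ _ td.
Qed.

Lemma cmeas_test : cmeas (f : B * B -> C).
Proof. by apply: cmeasR; apply: continuous_measurable2; exact: td_c _ _ _ _ _ _ _ _ _ td. Qed.

Lemma weak_supp x t : w (x, t) != 0 -> [/\ `|x| <= X, t0 < t & t <= T].
Proof.
have s := td_s0 _ _ _ _ _ _ _ _ _ td.
have [/and3P[h1' h2' h3']|h] := boolP ((`|x| < X) && (s0 < t < T)).
  by move=> _; split; [exact: ltW|exact: lt_trans h2'|exact: ltW].
have [_ _ e1 e2] := td_supp _ _ _ _ _ _ _ _ _ td (x, t) h.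
by rewrite /w e1 e2 !mulr0 add0r eqxx.
Qed.

Lemma test_supp x t : f (x, t) != 0 -> [/\ `|x| <= X, t0 < t & t <= T].
Proof.
have s := td_s0 _ _ _ _ _ _ _ _ _ td.
have [/and3P[h1' h2' h3']|h] := boolP ((`|x| < X) && (s0 < t < T)).
  by move=> _; split; [exact: ltW|exact: lt_trans h2'|exact: ltW].
by have [e1 _ _ _] := td_supp _ _ _ _ _ _ _ _ _ td (x, t) h; rewrite /f e1 eqxx.
Qed.

Lemma weak_bound p : norm1 (w p) <= 2 * M.
Proof.
have [_ _ b1 b2] := td_bnd _ _ _ _ _ _ _ _ _ td p.
apply: le_trans (norm1D _ _) _; rewrite norm1R normrM.
have h := norm1M (- 'i%C) (phit p)%:C; rewrite norm1N norm1i mul1r norm1R in h.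
by rewrite ger0_norm//; have := normr_ge0 (phixx p); lra.
Qed.

Lemma test_bound p : norm1 (f p) <= M.
Proof. by rewrite norm1R; have [] := td_bnd _ _ _ _ _ _ _ _ _ td p. Qed.

(** For [sg > tau] the exponential in the kernel is bounded on the box. At [sg = tau] this needs
    real displacement, [g = 0], and then only the integrable singularity in time is left. *)
Lemma Cfin_kernel g tau z sg e : (tau < sg) || (tau == sg) && (g == 0) ->
  Cfin mu [:: Xn; Tn] (fun e => w (e Xn, e Tn) *
    (if sg < e Tn then kernel g (e Tn - tau) (e Xn - z) else 0)) e.
Proof.
move=> hts; have ts : tau <= sg by case/orP: hts => [/ltW|/andP[/eqP ->]].
(* Here [tau] takes the place of the initial time, because the singularity sits at the last node. *)
apply: (adm_Cfin mu1 mu2 tau _ Xn Tn (fun e => w (e Xn, e Tn)) (fun x t => if sg < t then kernel g (t - tau) (x - z) else 0)).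
  apply: (adm_XT mu1 mu2 tau w X T (2 * M)) => //; first exact: cmeas_weak.
    by move=> x t /weak_supp[].
  exact: weak_bound.
split.
  have mD : measurable_fun setT (fun p : B * B => p.2 - tau : B).
    by apply: measurable_funB => //; exact: measurable_snd.
  have mb : measurable_fun setT (fun p : B * B => p.1 - z : B).
    by apply: measurable_funB => //; exact: measurable_fst.
  have := cmeas_kernel _ _ (fun=> g) _ _ (measurable_cst _) mD mb => mk.
  apply: (cmeas_eq _ _ _ (cmeas_if (fun p : B * B => sg < p.2) _ _ _ mk (cmeas_cst 0))).
    by move=> p; case: ifP => // sp; rewrite subr_gt0 (le_lt_trans ts sp).
  by apply: measurable_fun_ltr => //; exact: measurable_snd.
move=> X' T'; pose E := expR ((`|X'| + `|z|) * `|g| / (sg - tau)).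
exists (2 * E); first by rewrite mulr_ge0 ?expR_ge0.
move=> x t xX tT; case: ifPn => [st|_]; last by rewrite norm10 !mulr_ge0 ?expR_ge0 ?isqrt0_ge0.
have tt : 0 < t - tau by rewrite subr_gt0 (le_lt_trans ts).
apply: le_trans (norm1_kernel _ _ _ tt) _; rewrite /isqrt0 tt -[leRHS]mulrA; apply: ler_wpM2l => //.
rewrite [leLHS]mulrC.
apply: ler_wpM2r; first by rewrite invr_ge0 sqrtr_ge0.
rewrite ler_expR; case/orP: hts => [ts'|/andP[_ /eqP ->]]; last first.
  by rewrite normr0 !mulr0 !mul0r.
apply: le_trans (ler_norm _) _; rewrite !normrM normfV (gtr0_norm tt).
apply: ler_pM; rewrite ?mulr_ge0 ?invr_ge0 ?(ltW tt)//.
  apply: ler_wpM2r => //; apply: le_trans (ler_normB _ _) _; rewrite lerD2r.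
  exact: le_trans xX (ler_norm _).
have st' : sg - tau <= t - tau by rewrite lerD2r ltW.
by rewrite lef_pV2 ?posrE// subr_gt0.
Qed.

(* almost every e is distinct, and then a unique s_l is maximal *)
Definition distinct L (e : env) : bool :=
  all (fun l => all (fun l' => (l == l') || (e (1%N, l) != e (1%N, l'))) L) L.

Lemma measurable_distinct L : measurable_fun setT (distinct L).
Proof.
apply: (measurable_all nat L (fun l e => all (fun l' => (l == l') || (e (1%N, l) != e (1%N, l'))) L)) => l.
apply: (measurable_all nat L (fun l' e => (l == l') || (e (1%N, l) != e (1%N, l')))) => l'.
case: (l == l') => /=; first exact: measurable_cst.
by apply: measurable_neg; apply: measurable_fun_eqr; exact: measurable_coord.
Qed.

Definition top_term L k l (e : env) : C :=
  f (e Xn, e (1%N, l)) * (cexp ((e Xn * e (3%N, l))%:C) * h1 (e (3%N, l))) *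
  Wx (rem l L) k (e Xn) (e (1%N, l)) e.

(** For [k = 0] the only node is the starting point, at whose time the test function vanishes. *)
Definition node_term L k (e : env) : C := if k is k'.+1 then
  f (e (2%N, k'), e (0%N, k')) * h2 (e (2%N, k')) * Wx L k' (e (2%N, k')) (e (0%N, k')) e else 0.

(** The tested integrand with strict inequalities between insertion times and test time, the form in
    which the kernel identities apply. It differs from the actual one only on ties. *)
Definition weak_term L k (e : env) : C :=
  if all (fun l => e (1%N, l) < e Tn) L then w (e Xn, e Tn) * Wx L k (e Xn) (e Tn) e else 0.

Lemma top_termE L k (l : nat) (e : env) x : uniq L -> l \in L -> (forall l', l' \in L -> t0 <= e (1%N, l') <= e (1%N, l)) ->
  top_term L k l (upd e Xn x) = f (x, e (1%N, l)) * (Fxt t0 y L k e x (e (1%N, l)) * heights L k e).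
Proof.
move=> uL lL hL.
have -> : top_term L k l (upd e Xn x) = f (x, e (1%N, l)) * (cexp ((x * e (3%N, l))%:C) * h1 (e (3%N, l))) *
    Wx (rem l L) k x (e (1%N, l)) e.
  rewrite /top_term upd_same; congr (_ * _).
  apply: Wxt_congr => i iv; rewrite upd_diff//.
  by apply: contraTneq iv => ->; exact: not4_vnames.
rewrite WxtE ifT; last by apply/allP => l' /mem_rem; exact: hL.
rewrite (Fxt_top t0 y L k e x (e (1%N, l)) l)//; last by move=> l' /hL/andP[].
have -> : heights L k e = h1 (e (3%N, l)) * heights (rem l L) k e.
  by rewrite /heights (big_rem l lL) /= mulrCA.
by set a := f _; set b := cexp _; set c := h1 _; set d := Fxt _ _ _ _ _ _ _; set g := heights _ _ _; ring.
Qed.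

(** A label that is not latest contributes nothing: the remaining integrand ends at time $s_l$ and
    contains the indicators of all other $s_{l'}\le s_l$ and a last kernel that vanishes unless the
    last node is earlier. The bound $t_0\le s_l$ comes from the support of the test function. *)
Lemma top_term0 L k (l : nat) (e : env) x : ~~ all (fun l' => t0 <= e (1%N, l') <= e (1%N, l)) L || (e (1%N, l) <= nodeT t0 e k) ->
  top_term L k l (upd e Xn x) = 0.
Proof.
move=> h.
have -> : top_term L k l (upd e Xn x) = f (x, e (1%N, l)) * (cexp ((x * e (3%N, l))%:C) * h1 (e (3%N, l))) *
    Wx (rem l L) k x (e (1%N, l)) e.
  rewrite /top_term upd_same; congr (_ * _).
  apply: Wxt_congr => i iv; rewrite upd_diff//.
  by apply: contraTneq iv => ->; exact: not4_vnames.
have [->|fx] := eqVneq (f (x, e (1%N, l))) 0; first by rewrite !mul0r.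
have [_ tl _] := test_supp _ _ fx.
rewrite WxtE; case: ifPn => hr; last by rewrite mulr0.
case/orP: h => [/allPn[l' l'L]|le]; last first.
  by rewrite /Fxt /kern0 subr_gt0 ltNge le /= mulr0 mul0r mulr0.
have [->|ne] := eqVneq l' l; first by rewrite (ltW tl) lexx.
have l'r : l' \in rem l L.
  have [lL|nl] := boolP (l \in L); last by rewrite rem_id.
  by move: l'L; rewrite (perm_mem (perm_to_rem lL)) inE (negbTE ne).
by rewrite (allP hr _ l'r).
Qed.

Lemma cfin_slice (g D z s : R) : 0 < D -> cfin leb (fun x => kernel g D (x - z) * f (x, s)).
Proof.
move=> D0.
have A0 : 0 <= 2 * ((Num.sqrt D)^-1 * expR ((X + `|z|) * `|g| / D)).
  have n2 : 0 <= (2 : R) by [].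
  apply: (mulr_ge0 n2); have n3 : 0 <= (Num.sqrt D)^-1 by rewrite invr_ge0 sqrtr_ge0.
  by apply: (mulr_ge0 n3); exact: expR_ge0.
have M0 := ltW (td_M _ _ _ _ _ _ _ _ _ td).
apply: (cfin_box _ (2 * ((Num.sqrt D)^-1 * expR ((X + `|z|) * `|g| / D)) * M) X).
- apply: cmeasM; last first.
    apply: (cmeas_comp _ _ _ _ f (fun x : B => (x, s) : B * B)); last exact: cmeas_test.
    by apply/measurable_fun_pairP; split; [exact: measurable_id|exact: measurable_cst].
  have mb : measurable_fun setT (fun x : B => x - z : B) by exact: measurable_funB.
  apply: (cmeas_eq _ _ _ (cmeas_kernel _ _ (fun=> g) (fun=> D) _ (measurable_cst _) (measurable_cst _) mb)).
  by move=> x; rewrite D0.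
- exact: mulr_ge0.
- move=> x; rewrite mulf_eq0 negb_or => /andP[_ /test_supp[xX _ _]]; split => //.
  apply: le_trans (norm1M _ _) _; apply: ler_pM; rewrite ?norm1_ge0//; last exact: test_bound.
  apply: le_trans (norm1_kernel _ _ _ D0) _; apply: ler_wpM2l => //.
  apply: ler_wpM2l; first by rewrite invr_ge0 sqrtr_ge0.
  rewrite ler_expR; apply: le_trans (ler_norm _) _; rewrite !normrM normfV (gtr0_norm D0).
  apply: ler_wpM2r; first by rewrite invr_ge0 ltW.
  by apply: ler_wpM2r => //; apply: le_trans (ler_normB _ _) _; rewrite lerD2r.
Qed.

(* The integral over (X, T) leaves the boundary term at the latest insertion
   time: a label l with s_l maximal, or else the last node. *)
Lemma weak_inner L k e : uniq L -> distinct L e ->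
  Cints mu [:: Xn; Tn] (weak_term L k) e =
  'i%C * (\sum_(l <- L) Cints mu [:: Xn] (top_term L k l) e + node_term L k e).
Proof.
move=> uL dL; set tau := nodeT t0 e k; set z := nodeX y e k.
have WE x t : weak_term L k (upd (upd e Xn x) Tn t) =
    if all (fun l => e (1%N, l) < t) L then w (x, t) * Wx L k x t e else 0.
  by rewrite /weak_term upd_same upd_diff// upd_same Wxt_updXT.
have LE : Cints mu [:: Xn; Tn] (weak_term L k) e = cint leb (fun x => cint leb (fun t =>
    if all (fun l => e (1%N, l) < t) L then w (x, t) * Wx L k x t e else 0)).
  by apply: eq_cint => x; apply: eq_cint => t; exact: WE.
rewrite LE.
have topE l : Cints mu [:: Xn] (top_term L k l) e = cint leb (fun x => top_term L k l (upd e Xn x)) by [].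
(* If an insertion time precedes $t_0$, its indicator annihilates both sides. *)
have [ok|bad] := boolP (all (fun l => t0 <= e (1%N, l)) L); last first.
  have W0 j x t : Wx L j x t e = 0.
    apply: Wxt_guard0; apply/negP => /allP h; move/negP: bad; apply.
    by apply/allP => l /h/andP[].
  rewrite [LHS](_ : _ = 0); last first.
    rewrite -[RHS](cint0 leb); apply: eq_cint => x; rewrite -[RHS](cint0 leb); apply: eq_cint => t.
    by case: ifP => [_|//]; rewrite W0 mulr0.
  rewrite big1 => [|l _]; last first.
    apply: (etrans (topE _)); rewrite -[RHS](cint0 leb); apply: eq_cint => x; apply: top_term0; apply/orP; left.
    by apply/negP => /allP h; move/negP: bad; apply; apply/allP => l' /h/andP[].
  rewrite add0r /node_term; case: (k) => [|k']; first by rewrite mulr0.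
  by rewrite W0 mulr0 mulr0.
have ok' l (lL : l \in L) : t0 <= e (1%N, l) := allP ok l lL.
have WE2 x t : all (fun l => e (1%N, l) < t) L -> Wx L k x t e =
    (if tau < t then Fcst t0 y L k e * kernel (shift_g L e tau) (t - tau) (x - z) else 0) * heights L k e.
  move=> ht; have ht' l (lL : l \in L) : e (1%N, l) <= t := ltW (allP ht l lL).
  rewrite WxtE ifT; last by apply/allP => l lL; apply/andP; split; [exact: ok'|exact: ht'].
  case: ifPn => tt; first by rewrite Fxt_kernel.
  by rewrite /Fxt /kern0 subr_gt0 (negbTE tt) mulr0.
pose c := Fcst t0 y L k e * heights L k e.
(* Common to both cases: [sg] is the latest of all insertion times and the last node, and after it
   the integrand is a constant times a single kernel. *)
have KE sg g : (tau < sg) || (tau == sg) && (g == 0) ->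
    (forall t, sg < t <-> (all (fun l => e (1%N, l) < t) L /\ tau < t)) -> g = shift_g L e tau ->
    cint leb (fun x => cint leb (fun t =>
      if all (fun l => e (1%N, l) < t) L then w (x, t) * Wx L k x t e else 0)) =
    c * cint leb (fun x => cint leb (fun t => if sg < t then kernel g (t - tau) (x - z) * w (x, t) else 0)).
  move=> hsg hall gE.
  have := CintsZ mu [:: Xn; Tn] (fun=> c) _ e (cmeas_cst c) (fun _ _ _ => erefl) (Cfin_kernel g tau z sg e hsg).
  rewrite /= /Cint /= => h; rewrite [in RHS](_ : cint leb _ = cint leb (fun x => cint leb (fun t =>
    w (x, t) * (if sg < t then kernel g (t - tau) (x - z) else 0)))); last first.
    by apply: eq_cint => x; apply: eq_cint => t; case: ifP => _; [exact: mulrC|rewrite mulr0].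
  rewrite -[RHS]h; apply: eq_cint => x; apply: eq_cint => t.
  have [st|st] := boolP (sg < t).
    have [al tt] := (hall t).1 st; rewrite al (WE2 _ _ al) tt -gE /c.
    rewrite [RHS]mulrCA [Fcst _ _ _ _ _ * _ * _]mulrAC; exact: erefl.
  rewrite !mulr0; case: ifP => [al|//]; rewrite (WE2 _ _ al).
  have [tt|_] := boolP (tau < t); last by rewrite mul0r mulr0.
  exact: (False_ind _ (negP st ((hall t).2 (conj al tt)))).
(* If the last node is latest, the displacement is real and the boundary term is the delta of
   [kernel_delta]. *)
have [low|high] := boolP (all (fun l => e (1%N, l) <= tau) L).
  have low' l (lL : l \in L) : e (1%N, l) <= tau := allP low l lL.
  have g0 : shift_g L e tau = 0 by apply: shift_g0; exact: low'.
  have k1 : (tau < tau) || (tau == tau) && ((0 : R) == 0) by rewrite !eqxx orbT.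
  have k2 t : tau < t <-> all (fun l => e (1%N, l) < t) L /\ tau < t.
    split => [tt|[_]]; last exact.
    by split; [apply/allP => l lL; apply: le_lt_trans tt; exact: low'|exact: tt].
  rewrite (KE tau 0 k1 k2 (esym g0)).
  rewrite (kernel_delta t0 phi phix phixx phit X s0 T M td tau z) mulrCA; congr (_ * _).
  rewrite big1_seq ?add0r => [|l /= lL]; last first.
    apply: (etrans (topE _)); rewrite -[RHS](cint0 leb); apply: eq_cint => x; apply: top_term0.
    by apply/orP; right; exact: low'.
  rewrite /c /node_term /tau /z; move: low'; rewrite /tau; case: (k) => [|k'] low' /=.
    (* Without nodes the delta would sit at the starting point, where the test function is 0. *)
    rewrite -/(f (y, t0)); have [->|fx] := eqVneq (f (y, t0)) 0; first by rewrite mulr0.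
    by have [_] := test_supp _ _ fx; rewrite ltxx.
  rewrite Fcst_delta; last exact: low'.
  rewrite WxtE ifT; last by apply/allP => l lL; apply/andP; split; [exact: ok'|exact: low'].
  have -> : heights L k'.+1 e = h2 (e (2%N, k')) * heights L k' e.
    by rewrite /heights -addn1 iotaD big_cat big_seq1 /= add0n [RHS]mulrA; congr (_ * _); exact: mulrC.
  rewrite -/(f _) /=; set F := Fxt _ _ _ _ _ _ _.
  by rewrite mulrC -mulrA; congr (_ * _); rewrite mulrCA.
have [l lL lmax] : exists2 l, l \in L & forall l', l' \in L -> e (1%N, l') <= e (1%N, l).
  by apply: exists_max; move: high; case: (L).
have tl : tau < e (1%N, l).
  by move: high => /allPn[l' l'L]; rewrite -ltNge => h; exact: lt_le_trans (lmax _ l'L).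
have k1 : (tau < e (1%N, l)) || (tau == e (1%N, l)) && (shift_g L e tau == 0) by rewrite tl.
have k2 t : e (1%N, l) < t <-> all (fun l => e (1%N, l) < t) L /\ tau < t.
  split => [lt|[/allP/(_ l lL) + _]]; last exact.
  split; last exact: lt_trans lt.
  by apply/allP => l' l'L; apply: le_lt_trans lt; exact: lmax.
rewrite (KE (e (1%N, l)) (shift_g L e tau) k1 k2 erefl).
rewrite (kernel_weak t0 phi phix phixx phit X s0 T M td _ _ _ _ tl).
have -> : node_term L k e = 0.
  rewrite /node_term; move: tl; rewrite /tau; case: (k) => [//|k'] /= tl.
  suff -> : Wx L k' (e (2%N, k')) (e (0%N, k')) e = 0 by exact: mulr0.
  apply: Wxt_guard0; apply/allPn; exists l; first exact: lL.
  by rewrite negb_and -!ltNge tl orbT.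
have sum1 (G : nat -> C) : (forall l', l' \in rem l L -> G l' = 0) -> \sum_(l' <- L) G l' = G l.
  by move=> G0; rewrite (big_rem l lL) big1_seq; [exact: addr0|move=> l' /andP[_]; exact: G0].
(* Here distinctness enters: no other label has the same latest time, so just one summand
   survives. *)
rewrite addr0 sum1; last first.
  move=> l' l'r.
  apply: (etrans (topE _)); rewrite -[RHS](cint0 leb); apply: eq_cint => x; apply: top_term0; apply/orP; left.
  have l'L := mem_rem l'r; apply/allPn; exists l; first exact: lL.
  rewrite negb_and; apply/orP; right.
  have ll' : l != l' by apply: contraTneq l'r => ->; rewrite mem_rem_uniqF.
  have := allP (allP dL _ lL) _ l'L; rewrite (negbTE ll') /= => ne.
  by rewrite -ltNge lt_neqAle eq_sym ne lmax.
have lok l' : l' \in L -> t0 <= e (1%N, l') <= e (1%N, l) by move=> l'L; apply/andP; split; [exact: ok'|exact: lmax].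
have FE x : top_term L k l (upd e Xn x) = c * (kernel (shift_g L e tau) (e (1%N, l) - tau) (x - z) * f (x, e (1%N, l))).
  rewrite (top_termE L k l e x uL lL lok) (Fxt_kernel t0 y L k e x (e (1%N, l)) lmax tl) -/tau -/z /c.
  by move: (Fcst _ _ _ _ _) (kernel _ _ _) (heights _ _ _) (f _) => a b d u; ring.
have cfk : cfin leb (fun x => kernel (shift_g L e tau) (e (1%N, l) - tau) (x - z) * f (x, e (1%N, l))).
  by apply: cfin_slice; rewrite subr_gt0.
rewrite /= /Cint; under [in RHS]eq_cint do rewrite FE.
apply: (etrans (congr1 (fun u => c * u) (cintZ leb 'i%C _ cfk))); apply: (etrans (mulrCA _ _ _)).
exact: (congr1 (fun u => 'i%C * u) (esym (cintZ leb c _ cfk))).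
Qed.

Definition potential (x : R) : C := cint mu1 (fun a => cexp ((x * a)%:C) * h1 a).
Local Notation V := potential.

Lemma cfin_potential x : cfin mu1 (fun a => cexp ((x * a)%:C) * h1 a).
Proof.
have mc : cmeas (fun a : B => cexp ((x * a)%:C) * h1 a).
  by apply: cmeasM => //; apply: cmeas_cexp; apply: cmeasR; exact: measurable_funM.
have mx : measurable_fun setT (fun a : B => expR (`|x| * `|a|) * w1 a : B).
  apply: measurable_funM => //.
  by apply: (measurableT_comp (@measurable_expR R)); apply: measurable_funM.
split => //; apply: (@le_lt_trans _ _ (\int[mu1]_a (2%:E * (expR (`|x| * `|a|) * w1 a)%:E))%E).
  apply: ge0_le_integral => //.
  - by move=> a _; rewrite lee_fin norm1_ge0.
  - exact: emeasurable_norm1.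
  - by apply: emeasurable_funM => //; apply/measurable_EFinP.
  move=> a _; rewrite -EFinM lee_fin mulrA; apply: le_trans (norm1M _ _) _.
  apply: ler_pM; rewrite ?norm1_ge0//; apply: le_trans (norm1_cexp _) _; apply: ler_wpM2l => //=.
  by rewrite ler_expR -normrM ler_norm.
rewrite ge0_integralZl//; last 2 first.
- exact/measurable_EFinP.
- by move=> a _; rewrite lee_fin mulr_ge0 ?expR_ge0// (le_trans (norm1_ge0 _) (hw1 a)).
by apply: lte_mul_pinfty => //; exact: w1y.
Qed.

Let tie_pairs L : seq (name * name) :=
  [seq ((1%N, l), (1%N, l')) | l <- L, l' <- [seq l' <- L | l != l']].

Lemma tie_pairsP L (v : seq name) : (forall l, l \in L -> (1%N, l) \in v) ->
  forall p, p \in tie_pairs L -> [/\ p.1 \in v, p.1 != p.2 & mu p.1 = leb].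
Proof.
move=> hv p /allpairsPdep[l [l' [lL]]]; rewrite mem_filter => /andP[ll' _] ->; split => //=.
exact: hv.
Qed.

Lemma tie_distinct L (e : env) : (forall p, p \in tie_pairs L -> e p.1 != e p.2) -> distinct L e.
Proof.
move=> h; apply/allP => l lL; apply/allP => l' l'L; case: eqVneq => //= ne.
apply: (h ((1%N, l), (1%N, l'))); apply/allpairsPdep; exists l, l'; split => //.
by rewrite mem_filter ne.
Qed.

Lemma vnames_1 L k l : l \in L -> (1%N, l) \in vnames L k.
Proof. by move=> lL; rewrite !mem_cat (map_f (fun l => (1%N, l)))// orbT. Qed.

Lemma Cfin_distinct v L F e : Cfin mu v F e -> Cfin mu v (fun e => if distinct L e then F e else 0) e.
Proof.
move=> cF; have [mF _] := cF; apply: (Cfin_le _ _ _ _ _ _ cF).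
  by apply: cmeas_if; [exact: measurable_distinct|exact: mF|exact: cmeas_cst].
by move=> e' _; case: ifP => // _; rewrite norm10 norm1_ge0.
Qed.

Lemma Cints_distinct (v : seq name) L F e : uniq v -> (forall l, l \in L -> (1%N, l) \in v) -> cmeas F ->
  Cints mu v (fun e => if distinct L e then F e else 0) e = Cints mu v F e.
Proof.
move=> uv hv mF; apply: (Cints_ties mu v (tie_pairs L)) => //.
- by apply: cmeas_if; [exact: measurable_distinct|exact: mF|exact: cmeas_cst].
- exact: tie_pairsP.
- by move=> e' /tie_distinct ->.
Qed.

Lemma perm_top L k l : l \in L ->
  perm_eq (vnames L k ++ [:: Xn]) ([:: Xn; (1%N, l); (3%N, l)] ++ vnames (rem l L) k).
Proof.
move=> lL; apply/permP => a; rewrite /vnames /inames !count_cat /= !count_map.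
by rewrite !(permP (perm_to_rem lL)) /=; lia.
Qed.

Lemma perm_node L k : perm_eq (vnames L k.+1) ([:: (2%N, k); (0%N, k)] ++ vnames L k).
Proof.
apply/permP => a; rewrite /vnames /inames /tnames -addn1 iotaD !map_cat !count_cat /= !count_map /= add0n; lia.
Qed.

Lemma vnames_out L k (c j : nat) : (if c == 1%N then j \notin L else if c == 2%N then (k <= j)%N else
  if c == 3%N then j \notin L else if c == 0%N then (k <= j)%N else true) -> (c, j) \notin vnames L k.
Proof.
move=> h; apply/negP; rewrite mem_cat mem_tnames !mem_cat /= => /orP[/andP[/eqP c0 jk]|].
  by move: h; rewrite c0 /= leqNgt jk.
case/or3P => /mapP[i hi [ec ej]]; move: h; rewrite ec ej /= ?hi//.
by move: hi; rewrite mem_iota add0n /= ltnNge => /negP.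
Qed.

(** After reordering, $\alpha_l$ is integrated under fixed $x$ and $s_l$ and occurs only in
    $e^{x\alpha_l}$, which gives [V]. The time $s_l$ then plays the part of the time of the test
    point. *)
Lemma Cints_top L k l : uniq L -> l \in L ->
  Cfin mu (vnames L k ++ [:: Xn]) (top_term L k l) e0 /\
  Cints mu (vnames L k ++ [:: Xn]) (top_term L k l) e0 =
  Cints mu [:: Xn; Tn] (fun e => V (e Xn) * f (e Xn, e Tn) * J (rem l L) k (e Xn) (e Tn) e0) e0.
Proof.
move=> uL lL; have pe := perm_top L k l lL.
have uv : uniq (vnames L k ++ [:: Xn]).
  by rewrite cat_uniq uniq_vnames//= orbF andbT not4_vnames.
have ur := rem_uniq l uL.
have nl : l \notin rem l L by rewrite mem_rem_uniqF.
pose c (e : env) := f (e Xn, e (1%N, l)) * (cexp ((e Xn * e (3%N, l))%:C) * h1 (e (3%N, l))).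
have ad : adm mu1 mu2 t0 [:: Xn; (1%N, l); (3%N, l)] Xn (1%N, l) c.
  apply: (adm_XSA m1 mu1 mu2 h1 w1 t0 r1 w1y f X T M cmeas_test _ test_bound).
  by move=> x t /test_supp[].
have ind : indep (vnames (rem l L) k) c.
  move=> e e' ee'; rewrite /c !ee'//; first exact: vnames_out.
    exact: vnames_out.
  exact: not4_vnames.
have c1 : Cfin mu ([:: Xn; (1%N, l); (3%N, l)] ++ vnames (rem l L) k) (top_term L k l) e0.
  apply: (adm_pull m1 M2 mu1 mu2 h1 h2 w1 w2 D2 t0 y r1 r2 w1y w2y w2D _ _ _ _ _ _ _ ad) => //.
    exact: not4_vnames.
  exact: vnames_out.
have c2 : Cfin mu (vnames L k ++ [:: Xn]) (top_term L k l) e0.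
  by apply: Cfin_perm c1; [rewrite -(perm_uniq pe)|rewrite perm_sym].
split => //; rewrite (Cints_perm mu _ _ _ _ uv pe c2).
have nX : Xn \notin vnames (rem l L) k by exact: not4_vnames.
have n1 : (1%N, l) \notin vnames (rem l L) k by exact: vnames_out.
apply: (etrans (Cints_pull m1 M2 mu1 mu2 h1 h2 w1 w2 D2 t0 y r1 r2 w1y w2y w2D _ _ _ _ _ c e0 ur (adm_cmeas _ _ _ _ ad) nX n1 ind)).
apply: eq_cint => x; apply: eq_cint => s.
transitivity (cint mu1 (fun a => (f (x, s) * J (rem l L) k x s e0) * (cexp ((x * a)%:C) * h1 a))).
  apply: eq_cint => a; set u := upd _ (3%N, l) a.
  have u1 : u (1%N, l) = s by rewrite /u upd_diff// upd_same.
  have u3 : u (3%N, l) = a by rewrite /u upd_same.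
  have uX : u Xn = x by [].
  by rewrite /c u1 u3 uX mulrAC.
rewrite cintZ; last exact: cfin_potential.
by rewrite mulrC mulrA.
Qed.

(** After reordering, the last node is outermost and serves as the end point of the remaining
    path. *)
Lemma Cints_node L k : uniq L ->
  Cfin mu (vnames L k.+1) (node_term L k.+1) e0 /\
  Cints mu (vnames L k.+1) (node_term L k.+1) e0 =
  Cints mu [:: (2%N, 0%N); Tn] (fun e => f (e (2%N, 0%N), e Tn) * h2 (e (2%N, 0%N)) *
    J L k (e (2%N, 0%N)) (e Tn) e0) e0.
Proof.
move=> uL; have pe := perm_node L k.
have uv : uniq (vnames L k.+1) by exact: uniq_vnames.
pose c e := f (e (2%N, k), e (0%N, k)) * h2 (e (2%N, k)).
have ad : adm mu1 mu2 t0 [:: (2%N, k); (0%N, k)] (2%N, k) (0%N, k) c.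
  apply: (adm_QT M2 mu1 mu2 h2 w2 t0 r2 w2y f X T M cmeas_test _ test_bound) => //.
  by move=> x t /test_supp[].
have n2 : (2%N, k) \notin vnames L k by apply: vnames_out => /=.
have n0 : (0%N, k) \notin vnames L k by apply: vnames_out => /=.
have ind : indep (vnames L k) c by move=> e e' ee'; rewrite /c !ee'.
have c1 : Cfin mu ([:: (2%N, k); (0%N, k)] ++ vnames L k) (node_term L k.+1) e0.
  exact: (adm_pull m1 M2 mu1 mu2 h1 h2 w1 w2 D2 t0 y r1 r2 w1y w2y w2D).
have c2 : Cfin mu (vnames L k.+1) (node_term L k.+1) e0.
  by apply: Cfin_perm c1; [rewrite -(perm_uniq pe)|rewrite perm_sym].
split => //; rewrite (Cints_perm mu _ _ _ _ uv pe c2).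
apply: (etrans (Cints_pull m1 M2 mu1 mu2 h1 h2 w1 w2 D2 t0 y r1 r2 w1y w2y w2D _ _ _ _ _ c e0 uL (adm_cmeas _ _ _ _ ad) n2 n0 ind)).
apply: eq_cint => x; apply: eq_cint => t; set u := upd _ (0%N, k) t.
have u0 : u (0%N, k) = t by rewrite /u upd_same.
have u2 : u (2%N, k) = x by rewrite /u upd_diff// upd_same.
by rewrite /c u0 u2.
Qed.

(** The pointwise identity [weak_inner] holds off the ties. Fubini is used twice around it: to bring
    the test point innermost, and to bring the variables of the latest insertion outermost again. *)
Lemma weak_recursion L k : uniq L ->
  Cints mu [:: Xn; Tn] (fun e => w (e Xn, e Tn) * J L k (e Xn) (e Tn) e0) e0 =
  'i%C * (\sum_(l <- L) Cints mu [:: Xn; Tn] (fun e => V (e Xn) * f (e Xn, e Tn) * J (rem l L) k (e Xn) (e Tn) e0) e0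
   + if k is k'.+1 then Cints mu [:: (2%N, 0%N); Tn] (fun e => f (e (2%N, 0%N), e Tn) * h2 (e (2%N, 0%N)) *
       J L k' (e (2%N, 0%N)) (e Tn) e0) e0 else 0).
Proof.
move=> uL; set v := vnames L k.
pose c (e : env) := w (e Xn, e Tn).
have ad : adm mu1 mu2 t0 [:: Xn; Tn] Xn Tn c.
  apply: (adm_XT mu1 mu2 t0 w X T (2 * M) cmeas_weak _ weak_bound) => //.
  by move=> x t /weak_supp[].
have nX : Xn \notin v by exact: not4_vnames.
have nT : Tn \notin v by exact: not4_vnames.
have ind : indep v c by move=> e e' ee'; rewrite /c !ee'.
have mc := adm_cmeas _ _ _ _ ad.
rewrite -(Cints_pull m1 M2 mu1 mu2 h1 h2 w1 w2 D2 t0 y r1 r2 w1y w2y w2D [:: Xn; Tn] Xn Tn L k c)//.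
have cF := adm_pull m1 M2 mu1 mu2 h1 h2 w1 w2 D2 t0 y r1 r2 w1y w2y w2D _ _ _ _ L k e0 ad uL nX nT ind.
have [mF _] := cF.
pose F' (e : env) := if distinct L e then weak_term L k e else 0.
have mst : measurable_fun setT (fun e : env => all (fun l => e (1%N, l) < e Tn) L).
  by apply: (measurable_all nat L (fun l e => e (1%N, l) < e Tn)) => l; apply: measurable_fun_ltr; exact: measurable_coord.
have mF' : cmeas F'.
  apply: cmeas_if; [exact: measurable_distinct| |exact: cmeas_cst].
  by apply: cmeas_if => //; exact: cmeas_cst.
have uv : uniq ([:: Xn; Tn] ++ v).
  by rewrite /= inE negb_or /= nX nT uniq_vnames.
(* Two kinds of ties are discarded: between insertion times, for a unique latest one, and between
   these and the test time, to make the inequalities strict. *)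
rewrite (Cints_ties mu _ (tie_pairs L ++ [seq (Tn, (1%N, l)) | l <- L]) _ F')//; last first.
- move=> e hp.
  have dL : distinct L e by apply: tie_distinct => p pL; apply: hp; rewrite mem_cat pL.
  rewrite /F' dL /weak_term; case: ifPn => // /allPn[l lL]; rewrite -leNgt => tl.
  rewrite Wxt_guard0 ?mulr0//; apply/allPn; exists l; first exact: lL.
  have lt : e Tn < e (1%N, l).
    rewrite lt_neqAle tl andbT.
    by apply: (hp (Tn, (1%N, l))); rewrite mem_cat (map_f (fun l => (Tn, (1%N, l))) lL) orbT.
  by rewrite negb_and -!ltNge lt orbT.
- move=> p; rewrite mem_cat => /orP[|/mapP[l lL ->]].
    by apply: tie_pairsP => l lL; rewrite mem_cat vnames_1 ?orbT.
  by split.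
have cF' : Cfin mu ([:: Xn; Tn] ++ v) F' e0.
  apply: (Cfin_le _ _ _ _ _ mF' cF) => e _; rewrite /F' /weak_term.
  by case: ifP => _; [case: ifP => _|]; rewrite ?norm10 ?norm1_ge0.
have pc : perm_eq ([:: Xn; Tn] ++ v) (v ++ [:: Xn; Tn]) by rewrite perm_catC.
rewrite (Cints_perm mu _ _ _ _ uv pc cF') Cints_cat.
(* The test [l \in L] makes every [Q l] integrable, as [Cints_sum] asks for all indices. *)
pose Q l e := if l \in L then Cints mu [:: Xn] (fun e => if distinct L e then top_term L k l e else 0) e else 0.
pose N e := if distinct L e then node_term L k e else 0.
rewrite (eq_Cints mu _ _ (fun e => 'i%C * (\sum_(l <- L) Q l e + N e))); last first.
  move=> e _; have dE x t : distinct L (upd (upd e Xn x) Tn t) = distinct L e by [].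
  have [dL|dL] := boolP (distinct L e).
    transitivity (Cints mu [:: Xn; Tn] (weak_term L k) e).
      by apply: eq_cint => x; apply: eq_cint => t; rewrite /F' dE dL.
    rewrite weak_inner//; congr (_ * (_ + _)); last by rewrite /N dL.
    apply: eq_big_seq => l lL; rewrite /Q lL; apply: eq_cint => x.
    by have -> : distinct L (upd e Xn x) = true by exact: dL.
  transitivity (0 : C).
    rewrite -[RHS](cint0 leb); apply: eq_cint => x; rewrite -[RHS](cint0 leb); apply: eq_cint => t.
    by rewrite /F' dE (negbTE dL).
  rewrite /N (negbTE dL) addr0 big1 ?mulr0// => l _; rewrite /Q; case: ifP => // _.
  rewrite -[RHS](cint0 leb); apply: eq_cint => x.
  by have -> : distinct L (upd e Xn x) = false by exact: negbTE.
have uvX : uniq (v ++ [:: Xn]) by rewrite cat_uniq uniq_vnames//= orbF andbT nX.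
have QE l : l \in L -> Cfin mu v (Q l) e0 /\ Cints mu v (Q l) e0 =
    Cints mu [:: Xn; Tn] (fun e => V (e Xn) * f (e Xn, e Tn) * J (rem l L) k (e Xn) (e Tn) e0) e0.
  move=> lL; have [ct <-] := Cints_top L k l uL lL; have [mt _] := ct.
  have -> : Q l = Cints mu [:: Xn] (fun e => if distinct L e then top_term L k l e else 0).
    by apply/funext => e; rewrite /Q lL.
  split; first by apply: Cfin_cat; exact: Cfin_distinct.
  rewrite -(Cints_cat mu v [:: Xn]) Cints_distinct// => l' l'L.
  by rewrite mem_cat vnames_1.
have cQ l : Cfin mu v (Q l) e0.
  have [lL|nl] := boolP (l \in L); first by have [] := QE l lL.
  have -> : Q l = (fun=> 0) by apply/funext => e; rewrite /Q (negbTE nl).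
  exact: Cfin_agree_zero.
have NE : Cfin mu v N e0 /\ Cints mu v N e0 = if k is k'.+1 then Cints mu [:: (2%N, 0%N); Tn]
    (fun e => f (e (2%N, 0%N), e Tn) * h2 (e (2%N, 0%N)) * J L k' (e (2%N, 0%N)) (e Tn) e0) e0 else 0.
  rewrite /N /v; case: (k) => [|k'].
    have -> : (fun e => if distinct L e then node_term L 0 e else 0) = (fun=> 0).
      by apply/funext => e; case: ifP.
    by split; [exact: Cfin_agree_zero|exact: Cints0].
  have [cn <-] := Cints_node L k' uL; have [mn _] := cn.
  split; first exact: Cfin_distinct.
  apply: Cints_distinct => //; first exact: uniq_vnames.
  by move=> l lL; exact: vnames_1.
have [cN eN] := NE; have [sE sc] := Cints_sum mu v nat L Q e0 cQ.
rewrite (CintsZ mu v (fun=> 'i%C) _ e0 (cmeas_cst _) (fun _ _ _ => erefl)); last exact: CfinD.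
rewrite CintsD// sE eN; congr (_ * (_ + _)); apply: eq_big_seq => l lL.
by have [] := QE l lL.
Qed.
End Test.
End Recursion.

(** * Summation of the recursion *)

Section Summation.
Context {R : realType}.
Local Notation C := R[i].
Local Notation B := (measurableTypeR R).
Local Notation leb := (@lebesgue_measure R).
Local Notation env := (@env R).
Local Notation name := (nat * nat)%type.
Variables (m1 M2 : complex_measure R).
Variables (mu1 mu2 : {sigma_finite_measure set B -> \bar R}) (h1 h2 : R -> C) (w1 w2 : R -> R).
Variables (D2 t0 y : R).
Hypothesis r1 : represents m1 mu1 h1 w1.
Hypothesis r2 : represents M2 mu2 h2 w2.
Hypothesis w1y : forall c, (\int[mu1]_x (expR (c * `|x|) * w1 x)%:E < +oo)%E.
Hypothesis w2y : (\int[mu2]_x (w2 x)%:E < +oo)%E.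
Hypothesis w2D : forall x, D2 < `|x| -> w2 x = 0.

Let mh1 : cmeas (h1 : B -> C). Proof. by case: r1. Qed.
Let mh2 : cmeas (h2 : B -> C). Proof. by case: r2. Qed.
Let mw1 : measurable_fun setT (w1 : B -> B). Proof. by case: r1. Qed.
Let mw2 : measurable_fun setT (w2 : B -> B). Proof. by case: r2. Qed.
Let hw1 x : norm1 (h1 x) <= w1 x. Proof. by case: r1. Qed.
Let hw2 x : norm1 (h2 x) <= w2 x. Proof. by case: r2. Qed.
Local Notation mu := (fmu mu1 mu2).
Local Notation Wx := (Wxt h1 h2 t0 y).
Local Notation J := (Jxt mu1 mu2 h1 h2 t0 y).
Let e0 : env := fun=> 0.
Local Notation Xn := (4%N, 0%N).
Local Notation Tn := (4%N, 1%N).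
Local Notation Yn := (2%N, 0%N).
Local Notation adm := (adm mu1 mu2 t0).
Local Notation locb := (locb t0).
Local Notation cterm := (cterm mu1 mu2 h1 h2 t0 y).
Local Notation K := (propagator m1 M2 t0 y).
Local Notation V := (potential mu1 h1).


Definition pair_int pre (xn tn : name) (c : env -> C) (G : R -> R -> C) : C :=
  Cints mu pre (fun e => c e * G (e xn) (e tn)) e0.

Section Weight.
Variables (pre : seq name) (xn tn : name) (c : env -> C).
Hypothesis ad : adm pre xn tn c.
Local Notation I := (pair_int pre xn tn c).

Lemma pair_int_cfin G : locb G -> Cfin mu pre (fun e => c e * G (e xn) (e tn)) e0.
Proof. exact: adm_Cfin. Qed.

Lemma pair_intZ a G : locb G -> I (fun x t => a * G x t) = a * I G.
Proof.
move=> lG; rewrite /pair_int -(CintsZ mu pre (fun=> a) _ e0 (cmeas_cst _) (fun _ _ _ => erefl) (pair_int_cfin _ lG)).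
by apply: eq_Cints => e _; rewrite mulrCA.
Qed.

Lemma pair_int_sum (J : Type) (s : seq J) (G : J -> R -> R -> C) : (forall i, locb (G i)) ->
  I (fun x t => \sum_(i <- s) G i x t) = \sum_(i <- s) I (G i).
Proof.
move=> lG; have [<- _] := Cints_sum mu pre J s (fun i e => c e * G i (e xn) (e tn)) e0 (fun i => pair_int_cfin _ (lG i)).
by apply: eq_Cints => e _; rewrite mulr_sumr.
Qed.

Lemma pair_intB G H : locb G -> locb H -> I (fun x t => G x t - H x t) = I G - I H.
Proof.
move=> lG lH.
have -> : (fun x t => G x t - H x t) = fun x t => \sum_(i <- [:: true; false]) (if i then G x t else -1 * H x t).
  by apply/funext => x; apply/funext => t; rewrite !big_cons big_nil addr0 mulN1r.
rewrite (pair_int_sum bool [:: true; false] (fun i x t => if i then G x t else -1 * H x t)).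
  by rewrite !big_cons big_nil addr0 /= (pair_intZ (-1))// mulN1r.
by case => //; exact: locbZ.
Qed.

(** The local bound is needed only on the support of the weight, and there the admissible majorant
    integrates the singularity; the rate $2^{-N}$ is a constant factor throughout. *)
Lemma pair_int_le (G : nat -> R -> R -> C) : (forall N, locb (G N)) ->
  (forall X T, exists2 A : R, 0 <= A & forall x t, `|x| <= X -> t <= T ->
     forall N, norm1 (G N x t) <= A * isqrt0 (t - t0) / 2 ^+ N) ->
  exists2 A : R, 0 <= A & forall N, norm1 (I (G N)) <= A / 2 ^+ N.
Proof.
move=> lG hG; have [X [T [b [upre mc cXT _ _]]]] := ad.
have [A A0 hA] := hG X T.
have fin := adm_prod mu1 mu2 t0 pre xn tn c A e0 ad A0.
set Z := Nints _ _ _ _ in fin.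
have Z0 : (0 <= Z)%E by have [_ h] := nnmeas_Nints mu pre _ (nnmeas_adm mu1 mu2 t0 pre xn tn c A ad A0); exact: h.
exists (fine Z); first exact: fine_ge0.
move=> N; rewrite -lee_fin EFinM fineK ?ge0_fin_numE//.
apply: le_trans (le_Cints mu pre _ e0 _) _; first by case: (pair_int_cfin _ (lG N)).
have n2 : 0 <= (2 ^+ N)^-1 :> R by rewrite invr_ge0 exprn_ge0.
have nA := nnmeas_adm mu1 mu2 t0 pre xn tn c A ad A0.
rewrite muleC -[X in (_ <= X)%E](NintsZ mu pre (fun=> (2 ^+ N)^-1) _ e0 (fun=> n2) (fun _ _ _ => erefl) nA).
apply: le_Nints.
- by apply: nnmeas_enorm1; case: (pair_int_cfin _ (lG N)).
- have [m0 p0] := nA; split; [exact: emeasurable_funM|move=> e; apply: mule_ge0; [rewrite lee_fin; exact: n2|exact: p0]].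
move=> e _; rewrite -EFinM lee_fin; have [->|c0] := eqVneq (c e) 0.
  by rewrite mul0r norm10 !mul0r mulr0.
have [xX tT] := cXT _ c0; apply: le_trans (norm1M _ _) _.
apply: le_trans (ler_wpM2l (norm1_ge0 _) (hA _ _ xX tT N)) _.
by move: (norm1 (c e)) (isqrt0 _) (2 ^+ N)^-1 => a u v; rewrite le_eqVlt; apply/orP; left; apply/eqP; ring.
Qed.
End Weight.

Lemma locb_cterm n : locb (cterm n).
Proof.
apply: locbZ.
have -> : (fun x t => \sum_(k < n.+1) ((n - k)`!%:R)^-1 * J (iota 0 (n - k)) k x t e0) =
    (fun x t => \sum_(k <- index_enum 'I_n.+1) (((n - k)`!%:R)^-1 : C) * J (iota 0 (n - k)) k x t e0) by [].
apply: locb_sum => k; apply: locbZ.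
by apply: (locb_J m1 M2 mu1 mu2 h1 h2 w1 w2 D2 t0 y r1 r2 w1y w2y w2D); exact: iota_uniq.
Qed.

Definition psum (g : C) N x t : C := \sum_(0 <= n < N) g ^+ n * cterm n x t.

Lemma locb_psum g N : locb (psum g N).
Proof. by apply: locb_sum => n; apply: locbZ; exact: locb_cterm. Qed.

Lemma K_box g X T : exists2 A : R, 0 <= A & forall x t, `|x| <= X -> t <= T ->
  forall N, norm1 (psum g N x t - K g x t) <= A * isqrt0 (t - t0) / 2 ^+ N.
Proof.
have [kap k0 hk] := propagator_tail m1 M2 mu1 mu2 h1 h2 w1 w2 D2 t0 y r1 r2 w1y w2y w2D g X.
exists (4 * (4 * expR (kap * `|T - t0|))); first by rewrite !mulr_ge0 ?expR_ge0.
move=> x t xX tT N; have [_ h] := hk x t xX N; apply: le_trans h _.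
apply: ler_wpM2r; first by rewrite invr_ge0 exprn_ge0.
rewrite -!mulrA; apply: ler_wpM2l => //; apply: ler_wpM2l => //.
rewrite mulrC; apply: ler_wpM2r; first exact: isqrt0_ge0.
by rewrite ler_expR; apply: ler_wpM2l => //; rewrite (le_trans _ (ler_norm _))// lerD2r.
Qed.

Lemma locb_K g : locb (K g).
Proof.
(* The propagator is a pointwise limit of measurable partial sums, and this is passed on to the real
   and the imaginary part. *)
have cvg_part (p : C -> R) : (forall c, `|p c| <= norm1 c) -> (forall a b, p (a - b) = p a - p b) -> forall x t,
    (fun N => p (psum g N x t)) @ \oo --> p (K g x t).
  move=> p1 pB x t; have [A A0 hA] := K_box g `|x| t; apply/cvgrPdist_lt => e e0'.
  have [N hN] := half_pow_small (A * isqrt0 (t - t0)) e e0'.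
  near=> n; rewrite distrC -pB; apply: le_lt_trans (p1 _) _.
  apply: le_lt_trans (hA x t (lexx _) (lexx _) n) _; apply: hN.
  by near: n; exact: nbhs_infty_ge.
have mS N : cmeas (fun z : B * B => psum g N z.1 z.2) by case: (locb_psum g N).
split.
  split.
    apply: (@measurable_fun_cvg _ (B * B)%type R setT (fun N (z : B * B) => complex.Re (psum g N z.1 z.2)) (fun z : B * B => complex.Re (K g z.1 z.2))).
      by move=> N; case: (mS N).
    by move=> z _; apply: (cvg_part (@complex.Re R)); [exact: Re_le_norm1|move=> a b; rewrite ReD ReN].
  apply: (@measurable_fun_cvg _ (B * B)%type R setT (fun N (z : B * B) => complex.Im (psum g N z.1 z.2)) (fun z : B * B => complex.Im (K g z.1 z.2))).
    by move=> N; case: (mS N).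
  by move=> z _; apply: (cvg_part (@complex.Im R)); [exact: Im_le_norm1|move=> a b; rewrite ImD ImN].
move=> X T; have [A A0 hA] := K_box g X T; exists A => // x t xX tT.
have := hA x t xX tT 0%N; rewrite /psum big_geq// sub0r norm1N expr0 divr1; exact.
Unshelve. all: by end_near.
Qed.

Lemma pair_int_K pre xn tn c g : adm pre xn tn c -> exists2 A : R, 0 <= A &
  forall N, norm1 (pair_int pre xn tn c (psum g N) - pair_int pre xn tn c (K g)) <= A / 2 ^+ N.
Proof.
move=> ad; have [||A A0 hA] := pair_int_le pre xn tn c ad (fun N x t => psum g N x t - K g x t).
- move=> N.
  have -> : (fun x t => psum g N x t - K g x t) = fun x t => \sum_(i <- [:: true; false]) (if i then psum g N x t else -1 * K g x t).
    by apply/funext => x; apply/funext => t; rewrite !big_cons big_nil addr0 mulN1r.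
  apply: (locb_sum t0 bool [:: true; false] (fun i x t => if i then psum g N x t else -1 * K g x t)).
  by case; [exact: locb_psum|apply: locbZ; exact: locb_K].
- exact: K_box.
exists A => // N; rewrite -pair_intB//; [exact: locb_psum|exact: locb_K].
Qed.

Lemma cmeas_potential : cmeas (V : B -> C).
Proof.
apply: (cmeas_cint mu1 (fun z : B * B => cexp ((z.1 * z.2)%:C) * h1 z.2)).
apply: cmeasM; last by apply: (cmeas_comp _ _ _ _ h1 snd) => //; exact: measurable_snd.
by apply: cmeas_cexp; apply: cmeasR; apply: measurable_funM; [exact: measurable_fst|exact: measurable_snd].
Qed.

Lemma potential_bound X : exists2 N : R, 0 <= N & forall x, `|x| <= X -> norm1 (V x) <= N.
Proof.
have mx : measurable_fun setT (fun a : B => 2 * (expR (X * `|a|) * w1 a) : B).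
  apply: measurable_funM => //; apply: measurable_funM => //.
  by apply: (measurableT_comp (@measurable_expR R)); apply: measurable_funM.
have p0 a : 0 <= 2 * (expR (X * `|a|) * w1 a).
  by rewrite !mulr_ge0 ?expR_ge0// (le_trans (norm1_ge0 _) (hw1 a)).
pose Z := (\int[mu1]_a (2 * (expR (X * `|a|) * w1 a))%:E)%E.
have Z0 : (0 <= Z)%E by apply: integral_ge0 => a _; rewrite lee_fin.
have Zy : (Z < +oo)%E.
  rewrite /Z; under eq_integral do rewrite EFinM; rewrite ge0_integralZl//.
  - by apply: lte_mul_pinfty => //; exact: w1y.
  - apply/measurable_EFinP; apply: measurable_funM => //.
    by apply: (measurableT_comp (@measurable_expR R)); apply: measurable_funM.
  - by move=> a _; rewrite lee_fin mulr_ge0 ?expR_ge0// (le_trans (norm1_ge0 _) (hw1 a)).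
exists (fine Z); first exact: fine_ge0.
move=> x xX; rewrite -lee_fin fineK ?ge0_fin_numE//.
have [mc _] := cfin_potential m1 mu1 h1 w1 r1 w1y x.
apply: le_trans (le_cint mu1 _ mc) _; apply: ge0_le_integral => //.
- by move=> a _; rewrite lee_fin norm1_ge0.
- exact: emeasurable_norm1.
- exact/measurable_EFinP.
move=> a _; rewrite lee_fin mulrA; apply: le_trans (norm1M _ _) _.
apply: ler_pM; rewrite ?norm1_ge0//; apply: le_trans (norm1_cexp _) _; apply: ler_wpM2l => //=.
by rewrite ler_expR (le_trans (ler_norm _))// normrM ler_wpM2r.
Qed.

Section Test.
Variables (phi phix phixx phit : R * R -> R) (X s0 T M : R).
Hypothesis td : tdata t0 phi phix phixx phit X s0 T M.
Let w (p : R * R) : C := - 'i%C * (phit p)%:C + (2^-1 * phixx p)%:C.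
Let f (p : R * R) : C := (phi p)%:C.
Let cw (e : env) := w (e Xn, e Tn).
Let cv (e : env) := V (e Xn) * f (e Xn, e Tn).
Let ch (e : env) := f (e Yn, e Tn) * h2 (e Yn).
Let Iw := pair_int [:: Xn; Tn] Xn Tn cw.
Let Iv := pair_int [:: Xn; Tn] Xn Tn cv.
Let Ih := pair_int [:: Yn; Tn] Yn Tn ch.

Lemma adm_cw : adm [:: Xn; Tn] Xn Tn cw.
Proof.
apply: (adm_XT mu1 mu2 t0 w X T (2 * M)) => //; first exact: cmeas_weak td.
  by move=> x t /(weak_supp _ _ _ _ _ _ _ _ _ td)[].
exact: weak_bound td.
Qed.

Lemma adm_ch : adm [:: Yn; Tn] Yn Tn ch.
Proof.
apply: (adm_QT M2 mu1 mu2 h2 w2 t0 r2 w2y f X T M) => //; first exact: cmeas_test td.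
  by move=> x t /(test_supp _ _ _ _ _ _ _ _ _ td)[].
exact: test_bound td.
Qed.

Lemma adm_cv : adm [:: Xn; Tn] Xn Tn cv.
Proof.
have [N N0 hN] := potential_bound X.
have f0 x t : V x * f (x, t) != 0 -> [/\ `|x| <= X, t0 < t & t <= T].
  by rewrite mulf_eq0 negb_or => /andP[_ /(test_supp _ _ _ _ _ _ _ _ _ td)].
apply: (adm_XT mu1 mu2 t0 (fun p => V p.1 * f p) X T (N * M)) => //.
- apply: cmeasM; last exact: cmeas_test td.
  by apply: (cmeas_comp _ _ _ _ V fst); [exact: measurable_fst|exact: cmeas_potential].
- by move=> x t /f0[].
- case=> x t; have [/= ->|n0] := eqVneq (V x * f (x, t)) 0.
    by rewrite norm10 mulr_ge0// ltW// (td_M _ _ _ _ _ _ _ _ _ td).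
  have [xX _ _] := f0 _ _ n0; apply: le_trans (norm1M _ _) _.
  by apply: ler_pM; rewrite ?norm1_ge0 ?hN//; exact: test_bound td (x, t).
Qed.

Local Notation Jm m k := (fun x t => J (iota 0 m) k x t e0).

(** By [Jxt_bump] all $m$ labels contribute equally. The resulting factor $m$ will turn $1/m!$ into
    $1/(m-1)!$. *)
Lemma weak_J m k : Iw (Jm m k) = 'i%C * ((if m is m'.+1 then m'.+1%:R * Iv (Jm m' k) else 0) +
  (if k is k'.+1 then Ih (Jm m k') else 0)).
Proof.
have := weak_recursion m1 M2 mu1 mu2 h1 h2 w1 w2 D2 t0 y r1 r2 w1y w2y w2D phi phix phixx phit X s0 T M td
  (iota 0 m) k (iota_uniq 0 m).
move=> h; apply: (etrans h); congr (_ * (_ + _)).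
case: (m) => [|m']; first by rewrite big_nil.
transitivity (\sum_(l <- iota 0 m'.+1) Iv (Jm m' k)).
  apply: eq_big_seq => l; rewrite mem_iota add0n => /= lm.
  apply: (eq_Cints mu [:: Xn; Tn] (fun e => cv e * J (rem l (iota 0 m'.+1)) k (e Xn) (e Tn) e0)
    (fun e => cv e * Jm m' k (e Xn) (e Tn)) e0) => e _.
  by congr (_ * _); exact: Jxt_bump.
by rewrite big_const_seq count_predT size_iota iter_addr_0 mulr_natl.
Qed.

Let lJ m k : locb (Jm m k).
Proof. by apply: (locb_J m1 M2 mu1 mu2 h1 h2 w1 w2 D2 t0 y r1 r2 w1y w2y w2D); exact: iota_uniq. Qed.

Lemma pair_cterm pre xn tn c n : adm pre xn tn c -> pair_int pre xn tn c (cterm n) =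
  (- 'i%C) ^+ n * \sum_(k < n.+1) ((n - k)`!%:R)^-1 * pair_int pre xn tn c (Jm (n - k) k).
Proof.
move=> ad; rewrite /cterm (pair_intZ _ _ _ _ ad); last first.
  by apply: (locb_sum t0 'I_n.+1 (index_enum _) (fun k x t => ((n - k)`!%:R)^-1 * J (iota 0 (n - k)) k x t e0)) => k; exact: locbZ.
congr (_ * _).
rewrite (pair_int_sum _ _ _ _ ad 'I_n.+1 (index_enum _) (fun k x t => ((n - k)`!%:R)^-1 * J (iota 0 (n - k)) k x t e0)).
  by apply: eq_bigr => k _; rewrite (pair_intZ _ _ _ _ ad).
by move=> k; exact: locbZ.
Qed.

(** The phase works out by $(-i)^{n+1}i=(-i)^n$. In the $V_1$ part the number of insertions drops by
    one and the factorial with it, and the summand without insertions is absent; in the $V_2$ part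
    $k$ is shifted by one and the factorial is unchanged. *)
Lemma weak_cterm n : Iw (cterm n) = if n is n'.+1 then Iv (cterm n') + Ih (cterm n') else 0.
Proof.
rewrite /Iw pair_cterm; last exact: adm_cw.
case: n => [|n].
  by rewrite big_ord_recl big_ord0 /= -/Iw (weak_J 0 0) !addr0 !mulr0.
rewrite /Iv /Ih (pair_cterm _ _ _ _ _ adm_cv) (pair_cterm _ _ _ _ _ adm_ch) -mulrDr.
rewrite exprSr -mulrA; congr (_ * _).
have ii : - 'i%C * 'i%C = 1 :> C by rewrite mulNr -expr2 sqr_i opprK.
under eq_bigr => k _ do rewrite -/Iw weak_J mulrCA.
rewrite -mulr_sumr mulrA ii mul1r.
under eq_bigr => k _ do rewrite mulrDr.
rewrite big_split /=; congr (_ + _).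
  rewrite big_ord_recr /= subnn mulr0 addr0; apply: eq_bigr => k _ /=.
  have kn : (k <= n)%N by rewrite -ltnS ltn_ord.
  rewrite subSn// mulrA; congr (_ * _); rewrite factS natrM invfM mulrAC mulVf ?mul1r//.
by rewrite big_ord_recl /= mulr0 add0r; apply: eq_bigr => k _; rewrite /= /bump /= add1n subSS.
Qed.

Lemma weak_psum g N : Iw (psum g N.+1) = g * (Iv (psum g N) + Ih (psum g N)).
Proof.
have lG n : locb (fun x t => g ^+ n * cterm n x t) by apply: locbZ; exact: locb_cterm.
have E pre xn tn c (ad : adm pre xn tn c) M' : pair_int pre xn tn c (psum g M') =
    \sum_(0 <= n < M') g ^+ n * pair_int pre xn tn c (cterm n).
  rewrite /psum (pair_int_sum _ _ _ _ ad _ _ (fun n x t => g ^+ n * cterm n x t))//.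
  by apply: eq_bigr => n _; rewrite (pair_intZ _ _ _ _ ad)//; exact: locb_cterm.
rewrite /Iw (E _ _ _ _ adm_cw) /Iv (E _ _ _ _ adm_cv) /Ih (E _ _ _ _ adm_ch).
rewrite big_nat_recl// -/Iw weak_cterm mulr0 add0r -big_split /= mulr_sumr; apply: eq_bigr => n _.
by rewrite weak_cterm exprS -mulrA -mulrDr.
Qed.

(** The partial sum with one more term on the left corresponds to the partial sum on the right. All
    three pairings converge at the rate $2^{-N}$, so the difference of the two sides is below
    $Z/2^N$ for every $N$. *)
Lemma weak_K g : Iw (K g) = g * (Iv (K g) + Ih (K g)).
Proof.
have [A A0 hA] := pair_int_K _ _ _ _ g adm_cw.
have [A' A'0 hA'] := pair_int_K _ _ _ _ g adm_cv.
have [A'' A''0 hA''] := pair_int_K _ _ _ _ g adm_ch.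
pose Z := A + norm1 g * (A' + A'').
have hZ N : norm1 (Iw (K g) - g * (Iv (K g) + Ih (K g))) <= Z / 2 ^+ N.
  have -> : Iw (K g) - g * (Iv (K g) + Ih (K g)) =
     - (Iw (psum g N.+1) - Iw (K g)) + g * ((Iv (psum g N) - Iv (K g)) + (Ih (psum g N) - Ih (K g))).
    rewrite weak_psum; move: (Iw (K g)) (Iv (K g)) (Ih (K g)) (Iv (psum g N)) (Ih (psum g N)) => a b u v z; ring.
  apply: le_trans (norm1D _ _) _; rewrite norm1N /Z mulrDl; apply: lerD.
    apply: le_trans (hA N.+1) _; apply: ler_wpM2l => //.
    by rewrite lef_pV2 ?posrE ?exprn_gt0// ler_eXn2l// ltr1n.
  apply: le_trans (norm1M _ _) _; rewrite -mulrA; apply: ler_wpM2l; first exact: norm1_ge0.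
  by apply: le_trans (norm1D _ _) _; rewrite mulrDl; apply: lerD; [exact: hA'|exact: hA''].
apply/eqP; rewrite -subr_eq0; apply/eqP; apply: norm1_eq0.
apply/eqP; rewrite eq_le norm1_ge0 andbT leNgt; apply/negP => p.
have [N hN] := half_pow_small Z _ p.
by have := lt_le_trans (hN N (leqnn N)) (hZ N); rewrite ltxx.
Qed.
End Test.
End Summation.

(** * The propagator equation *)

Section Propagator.
Context {R : realType}.
Local Notation C := R[i].
Local Notation B := (measurableTypeR R).
Local Notation leb := (@lebesgue_measure R).
Local Notation env := (@env R).
Local Notation name := (nat * nat)%type.
Variables (m1 : complex_measure R) (m2 : {charge set B -> \bar R}).
Local Notation M2 := (cm_of_charge m2).
Variables (mu1 mu2 : {sigma_finite_measure set B -> \bar R}) (h1 h2 : R -> C) (w1 w2 : R -> R).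
Variables (D2 t0 y : R).
Hypothesis r1 : represents m1 mu1 h1 w1.
Hypothesis r2 : represents M2 mu2 h2 w2.
Hypothesis w1y : forall c, (\int[mu1]_x (expR (c * `|x|) * w1 x)%:E < +oo)%E.
Hypothesis w2y : (\int[mu2]_x (w2 x)%:E < +oo)%E.
Hypothesis w2D : forall x, D2 < `|x| -> w2 x = 0.

Let mh1 : cmeas (h1 : B -> C). Proof. by case: r1. Qed.
Let mh2 : cmeas (h2 : B -> C). Proof. by case: r2. Qed.
Let mw1 : measurable_fun setT (w1 : B -> B). Proof. by case: r1. Qed.
Let mw2 : measurable_fun setT (w2 : B -> B). Proof. by case: r2. Qed.
Let hw1 x : norm1 (h1 x) <= w1 x. Proof. by case: r1. Qed.
Let hw2 x : norm1 (h2 x) <= w2 x. Proof. by case: r2. Qed.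
Local Notation mu := (fmu mu1 mu2).
Local Notation Wx := (Wxt h1 h2 t0 y).
Local Notation J := (Jxt mu1 mu2 h1 h2 t0 y).
Let e0 : env := fun=> 0.
Local Notation Xn := (4%N, 0%N).
Local Notation Tn := (4%N, 1%N).
Local Notation Yn := (2%N, 0%N).
Local Notation adm := (adm mu1 mu2 t0).
Local Notation locb := (locb t0).
Local Notation K := (propagator m1 M2 t0 y).
Local Notation V := (potential mu1 h1).


Variable V1 : R -> C.
Hypothesis V1E : forall x, V1 x = cm_integral m1 (fun a => (expR (a * x))%:C).

Lemma potentialE x : V1 x = V x.
Proof.
have mx : measurable_fun setT (fun a : B => expR (a * x) : B).
  by apply: (measurableT_comp (@measurable_expR R)); exact: measurable_funM.
rewrite V1E; have [_ _ _ r] := r1; have [|_ ->] := r 1 (fun a => (expR (a * x))%:C) (cmeasR _ mx).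
  apply: le_lt_trans (w1y `|x|); apply: ge0_le_integral => //.
  - by move=> a _; rewrite lee_fin mulr_ge0 ?norm1_ge0// (le_trans (norm1_ge0 _) (hw1 a)).
  - apply/measurable_EFinP; apply: measurable_funM => //.
    by apply: measurable_norm1; exact: cmeasR.
  - apply/measurable_EFinP; apply: measurable_funM => //.
    by apply: (measurableT_comp (@measurable_expR R)); apply: measurable_funM.
  move=> a _; rewrite lee_fin norm1R ger0_norm ?expR_ge0//; apply: ler_wpM2r.
    exact: le_trans (norm1_ge0 _) (hw1 a).
  by rewrite ler_expR mulrC -normrM ler_norm.
by apply: eq_cint => a; congr (_ * _); apply: eqC; rewrite /cexp /= cos0 sin0 (mulrC x); ring.
Qed.

Section Test.
Variables (phi phix phixx phit : R * R -> R) (X s0 T M : R).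
Hypothesis td : tdata t0 phi phix phixx phit X s0 T M.
Local Notation pairing F psi := (cintegral (leb \x leb)%E (setT `*` `]t0, +oo[%classic)
  (fun p : B * B => F p * (psi p)%:C)).

Lemma cint_support d (U : measurableType d) (mm : {measure set U -> \bar R}) (D : set U) (F : U -> C) :
  measurable D -> (forall x, ~ D x -> F x = 0) -> cintegral mm D F = cint mm F.
Proof.
move=> mD hD; rewrite /cint /cintegral.
rewrite -(Rintegral_support _ _ mm D (fun x => complex.Re (F x)))//; last by move=> x /hD ->.
by rewrite -(Rintegral_support _ _ mm D (fun x => complex.Im (F x)))//; move=> x /hD ->.
Qed.

(** The restriction to $t>t_0$ costs nothing because the test function vanishes earlier, and Fubini
    turns the integral over the plane into an iterated one. *)
Lemma pairing_cint (F : R * R -> C) (psi : R * R -> R) :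
  (forall x t, t <= t0 -> psi (x, t) = 0) ->
  Cfin mu [:: Xn; Tn] (fun e => F (e Xn, e Tn) * (psi (e Xn, e Tn))%:C) e0 ->
  cmeas (fun p : B * B => F p * (psi p)%:C) ->
  pairing F psi = Cints mu [:: Xn; Tn] (fun e => F (e Xn, e Tn) * (psi (e Xn, e Tn))%:C) e0.
Proof.
move=> h0 [_ fin] mF; rewrite cint_support; last 2 first.
- by apply: measurableX => //; exact: measurable_itv.
- move=> [x t] /= hp; rewrite h0 ?mulr0// leNgt; apply/negP => tt; apply: hp.
  by split => //=; rewrite in_itv /= tt.
by have [_ -> _] := cint_prod leb leb (fun p : B * B => F p * (psi p)%:C) mF fin.
Qed.

Lemma test_before x t : t <= t0 -> [/\ phi (x, t) = 0, phixx (x, t) = 0 & phit (x, t) = 0].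
Proof.
move=> tt; have [|-> _ -> ->//] := td_supp _ _ _ _ _ _ _ _ _ td (x, t).
rewrite negb_and /= negb_and -!leNgt (le_trans tt) ?orbT//.
exact: ltW (td_s0 _ _ _ _ _ _ _ _ _ td).
Qed.

Variable g : C.
Let lK : locb (K g).
Proof. exact: (locb_K m1 M2 mu1 mu2 h1 h2 w1 w2 D2 t0 y r1 r2 w1y w2y w2D). Qed.

Let mK : cmeas (fun p : B * B => K g p.1 p.2). Proof. by case: lK. Qed.

Lemma adm_continuous (psi : R * R -> R) : continuous psi ->
  (forall p, ~~ ((`|p.1| < X) && (s0 < p.2 < T)) -> psi p = 0) -> (forall p, `|psi p| <= M) ->
  adm [:: Xn; Tn] Xn Tn (fun e => (psi (e Xn, e Tn))%:C).
Proof.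
move=> cpsi spsi bpsi; apply: (adm_XT mu1 mu2 t0 (fun p => (psi p)%:C) X T M) => //.
- by apply: cmeasR; exact: continuous_measurable2.
- move=> x t; have [/and3P[a1 _ a3] _|n] := boolP ((`|x| < X) && (s0 < t < T)); last by rewrite spsi// eqxx.
  by split; exact: ltW.
- by move=> p; rewrite norm1R.
Qed.

Let supp p := td_supp _ _ _ _ _ _ _ _ _ td p.
Let bnd p := td_bnd _ _ _ _ _ _ _ _ _ td p.

Let ad0 : adm [:: Xn; Tn] Xn Tn (fun e => (phi (e Xn, e Tn))%:C).
Proof.
apply: adm_continuous; [exact: td_c td|by move=> p /supp[]|by move=> p; have [] := bnd p].
Qed.
Let adxx : adm [:: Xn; Tn] Xn Tn (fun e => (phixx (e Xn, e Tn))%:C).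
Proof.
apply: adm_continuous; [exact: td_cxx td|by move=> p /supp[]|by move=> p; have [] := bnd p].
Qed.
Let adt : adm [:: Xn; Tn] Xn Tn (fun e => (phit (e Xn, e Tn))%:C).
Proof.
apply: adm_continuous; [exact: td_ct td|by move=> p /supp[]|by move=> p; have [] := bnd p].
Qed.

Lemma pairing_K (psi : R * R -> R) : continuous psi -> (forall x t, t <= t0 -> psi (x, t) = 0) ->
  adm [:: Xn; Tn] Xn Tn (fun e => (psi (e Xn, e Tn))%:C) ->
  pairing (fun p : R * R => K g p.1 p.2) psi = pair_int mu1 mu2 [:: Xn; Tn] Xn Tn (fun e => (psi (e Xn, e Tn))%:C) (K g).
Proof.
move=> cpsi h0 ad.
have E : (fun e : env => (psi (e Xn, e Tn))%:C * K g (e Xn) (e Tn)) = (fun e => K g (e Xn) (e Tn) * (psi (e Xn, e Tn))%:C).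
  by apply/funext => e; rewrite mulrC.
have c := adm_Cfin mu1 mu2 t0 _ _ _ _ _ e0 ad lK; rewrite E in c.
rewrite /pair_int E; apply: (pairing_cint (fun p => K g p.1 p.2) psi h0 c).
by apply: cmeasM => //; apply: cmeasR; exact: continuous_measurable2.
Qed.

Lemma pairing_V1K : pairing (fun p : R * R => V1 p.1 * K g p.1 p.2) phi =
  pair_int mu1 mu2 [:: Xn; Tn] Xn Tn (fun e => V (e Xn) * (phi (e Xn, e Tn))%:C) (K g).
Proof.
have E : (fun e : env => V (e Xn) * (phi (e Xn, e Tn))%:C * K g (e Xn) (e Tn)) =
    (fun e => (V1 (e Xn) * K g (e Xn) (e Tn)) * (phi (e Xn, e Tn))%:C).
  by apply/funext => e; rewrite potentialE mulrAC.
have c := adm_Cfin mu1 mu2 t0 _ _ _ _ _ e0 (adm_cv m1 mu1 mu2 h1 w1 t0 r1 w1y phi phix phixx phit X s0 T M td) lK.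
rewrite E in c.
rewrite /pair_int E; apply: (pairing_cint (fun p => V1 p.1 * K g p.1 p.2) phi _ c).
  by move=> x t /(test_before x)[].
apply: cmeasM; last by apply: cmeasR; apply: continuous_measurable2; exact: td_c td.
apply: cmeasM => //.
have -> : (fun p : B * B => V1 p.1) = fun p => V p.1 by apply/funext => p; rewrite potentialE.
apply: (cmeas_comp _ _ _ _ V fst); first exact: measurable_fst.
exact: cmeas_potential m1 mu1 h1 w1 r1.
Qed.

(** To integrate the time integral of $K\phi$ against $m_2$, [represents] demands integrability in
    $x$ against the weight. Boundedness in $x$ suffices for this, and it holds for all $x$ because
    $\phi$ vanishes off a bounded set. *)
Lemma slice_bound : exists2 N : R, 0 <= N & forall x,
  cfin leb (fun t => K g x t * (phi (x, t))%:C) /\ (nint leb (fun t => (K g x t * (phi (x, t))%:C)%R) <= N%:E)%E.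
Proof.
have M0 := ltW (td_M _ _ _ _ _ _ _ _ _ td).
have [_ /(_ X T)[A A0 hA]] := lK.
pose u (t : R) : R := (A * M) * (if t <= T then isqrt0 (t - t0) else 0).
have i0 t : 0 <= (if t <= T then isqrt0 (t - t0) else 0) by case: ifP => // _; exact: isqrt0_ge0.
have u0 t : 0 <= u t by rewrite mulr_ge0// mulr_ge0.
have mi : measurable_fun setT (fun t : B => (if t <= T then isqrt0 (t - t0) else 0) : B).
  apply: measurable_fun_ifT => //; first exact: measurable_fun_ler.
  by apply: measurable_isqrt0; exact: measurable_funB.
have mu_ : measurable_fun setT (u : B -> B) by exact: measurable_funM.
have Zy : (\int[leb]_t (u t)%:E < +oo)%E.
  rewrite /u; under eq_integral do rewrite EFinM; rewrite ge0_integralZl//.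
  - apply: lte_mul_pinfty => //; first by rewrite lee_fin mulr_ge0.
    exact: integral_isqrt0.
  - exact/measurable_EFinP.
  - by move=> t _; rewrite lee_fin.
  - by rewrite lee_fin mulr_ge0.
have Z0 : (0 <= \int[leb]_t (u t)%:E)%E by apply: integral_ge0 => t _; rewrite lee_fin.
exists (fine (\int[leb]_t (u t)%:E)%E); first exact: fine_ge0.
move=> x; rewrite fineK ?ge0_fin_numE//.
have mF : cmeas (fun t : B => K g x t * (phi (x, t))%:C).
  apply: (cmeas_comp _ _ _ _ (fun p : B * B => K g p.1 p.2 * (phi p)%:C) (fun t : B => (x, t) : B * B)).
    by apply/measurable_fun_pairP; split; [exact: measurable_cst|exact: measurable_id].
  by apply: cmeasM => //; apply: cmeasR; apply: continuous_measurable2; exact: td_c td.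
have le : (nint leb (fun t => (K g x t * (phi (x, t))%:C)%R) <= \int[leb]_t (u t)%:E)%E.
  apply: ge0_le_integral => //.
  - by move=> t _; rewrite lee_fin norm1_ge0.
  - exact: emeasurable_norm1.
  - exact/measurable_EFinP.
  move=> t _; rewrite lee_fin.
  have [/and3P[xX _ tT]|n] := boolP ((`|x| < X) && (s0 < t < T)); last first.
    by have [-> _ _ _] := supp (x, t) n; rewrite mulr0 norm10.
  rewrite /u (ltW tT); apply: le_trans (norm1M _ _) _; rewrite mulrAC; apply: ler_pM; rewrite ?norm1_ge0//.
    by apply: hA; exact: ltW.
  by rewrite norm1R; have [] := bnd (x, t).
by split => //; split => //; exact: le_lt_trans le Zy.
Qed.

(** The density is constant in $t$ and moves under the time integral, so the distributional product
    with $V_2$ becomes one of the pairings of the summed recursion. *)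
Lemma pairing_V2K : cm_integral M2 (fun x => cintegral leb `]t0, +oo[ (fun t => K g x t * (phi (x, t))%:C)) =
  pair_int mu1 mu2 [:: Yn; Tn] Yn Tn (fun e => (phi (e Yn, e Tn))%:C * h2 (e Yn)) (K g).
Proof.
have [N N0 hN] := slice_bound.
have HE x : cintegral leb `]t0, +oo[ (fun t => K g x t * (phi (x, t))%:C) = cint leb (fun t => K g x t * (phi (x, t))%:C).
  apply: cint_support; first exact: measurable_itv.
  move=> t /= ht; have [|-> _ _] := test_before x t; last by rewrite mulr0.
  by rewrite leNgt; apply/negP => tt; apply: ht; rewrite in_itv /= tt.
have -> : (fun x => cintegral leb `]t0, +oo[ (fun t => K g x t * (phi (x, t))%:C)) =
    (fun x => cint leb (fun t => K g x t * (phi (x, t))%:C)) by apply/funext.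
have mH : cmeas (fun x : B => cint leb (fun t : B => K g x t * (phi (x, t))%:C)).
  apply: (cmeas_cint leb (fun p : B * B => K g p.1 p.2 * (phi p)%:C)).
  by apply: cmeasM => //; apply: cmeasR; apply: continuous_measurable2; exact: td_c td.
have bH x : norm1 (cint leb (fun t : B => K g x t * (phi (x, t))%:C)) <= N.
  have [[mF _] le] := hN x; rewrite -lee_fin; apply: le_trans le; exact: le_cint.
have [_ _ _ r] := r2; have [|_ ->] := r 1 _ mH.
  apply: (@le_lt_trans _ _ (\int[mu2]_x (N%:E * (w2 x)%:E))%E).
    apply: ge0_le_integral => //.
    - by move=> a _; rewrite lee_fin mulr_ge0 ?norm1_ge0// (le_trans (norm1_ge0 _) (hw2 a)).
    - by apply/measurable_EFinP; apply: measurable_funM => //; exact: measurable_norm1.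
    - by apply: emeasurable_funM => //; exact/measurable_EFinP.
    by move=> a _; rewrite -EFinM lee_fin; apply: ler_wpM2r => //; exact: le_trans (norm1_ge0 _) (hw2 a).
  rewrite ge0_integralZl//.
  - exact: lte_mul_pinfty.
  - exact/measurable_EFinP.
  - by move=> x _; rewrite lee_fin (le_trans (norm1_ge0 _) (hw2 x)).
apply: eq_cint => x; rewrite mulrC.
have [cf _] := hN x; apply: (etrans (esym (cintZ leb (h2 x) _ cf))).
apply: eq_cint => t; transitivity ((phi (x, t))%:C * h2 x * K g x t); last by [].
by rewrite mulrA mulrC mulrA.
Qed.

Lemma propagator_weak :
  'i%C * - pairing (fun p : R * R => K g p.1 p.2) phit =
  - 2%:R^-1 * pairing (fun p : R * R => K g p.1 p.2) phixx +
  g * (pairing (fun p : R * R => V1 p.1 * K g p.1 p.2) phi +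
    cm_integral M2 (fun x => cintegral leb `]t0, +oo[ (fun t => K g x t * (phi (x, t))%:C))).
Proof.
have E := weak_K m1 M2 mu1 mu2 h1 h2 w1 w2 D2 t0 y r1 r2 w1y w2y w2D phi phix phixx phit X s0 T M td g.
rewrite pairing_V1K pairing_V2K.
rewrite (pairing_K phit (td_ct _ _ _ _ _ _ _ _ _ td))//; last by move=> x t /(test_before x)[].
rewrite (pairing_K phixx (td_cxx _ _ _ _ _ _ _ _ _ td))//; last by move=> x t /(test_before x)[].
have ct := adm_Cfin mu1 mu2 t0 _ _ _ _ _ e0 adt lK.
have cx := adm_Cfin mu1 mu2 t0 _ _ _ _ _ e0 adxx lK.
have z0 (a : C) F : Cfin mu [:: Xn; Tn] F e0 -> Cfin mu [:: Xn; Tn] (fun e => a * F e) e0 /\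
    Cints mu [:: Xn; Tn] (fun e => a * F e) e0 = a * Cints mu [:: Xn; Tn] F e0.
  move=> cF; split; last exact: (CintsZ mu _ (fun=> a) _ e0 (cmeas_cst _) (fun _ _ _ => erefl) cF).
  have [mF yF] := cF; split; first by apply: cmeasM => //; exact: cmeas_cst.
  apply: (@le_lt_trans _ _ (Nints mu [:: Xn; Tn] (fun e => (norm1 a)%:E * enorm1 F e)%E e0)).
    apply: le_Nints.
    - by apply: nnmeas_enorm1; apply: cmeasM => //; exact: cmeas_cst.
    - have [m0 p0] := nnmeas_enorm1 _ mF; split; first exact: emeasurable_funM.
      by move=> e; apply: mule_ge0; [rewrite lee_fin norm1_ge0|exact: p0].
    by move=> e _; rewrite /enorm1 -EFinM lee_fin norm1M.
  rewrite (NintsZ mu _ (fun=> norm1 a) _ e0 (fun=> norm1_ge0 _) (fun _ _ _ => erefl) (nnmeas_enorm1 _ mF)).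
  by apply: lte_mul_pinfty; rewrite ?lee_fin ?norm1_ge0.
have [c1 e1] := z0 (- 'i%C) _ ct; have [c2 e2] := z0 ((2^-1 : R)%:C) _ cx.
have W : - 'i%C * pair_int mu1 mu2 [:: Xn; Tn] Xn Tn (fun e => (phit (e Xn, e Tn))%:C) (K g) +
    (2^-1 : R)%:C * pair_int mu1 mu2 [:: Xn; Tn] Xn Tn (fun e => (phixx (e Xn, e Tn))%:C) (K g) =
    pair_int mu1 mu2 [:: Xn; Tn] Xn Tn
      (fun e => - 'i%C * (phit (e Xn, e Tn))%:C + (2^-1 * phixx (e Xn, e Tn))%:C) (K g).
  apply: (etrans (congr2 +%R (esym e1) (esym e2))); apply: (etrans (esym (CintsD mu _ _ _ e0 c1 c2))).
  apply: eq_Cints => e _.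
  by rewrite mulrDl -!mulrA; congr (_ + _); rewrite rmorphM mulrA.
have := etrans W E.
have <- : (2^-1 : R)%:C = 2%:R^-1 :> C by have := half_real (1 : R); rewrite !mulr1.
move: (pair_int _ _ _ _ _ _ _) (pair_int _ _ _ _ _ _ _) (g * _) => a b u <-.
ring.
Qed.
End Test.
End Propagator.

Theorem proposition9 (R : realType)
  (V1 : R -> R[i]) (m1 : complex_measure R) (hV1 : in_K1 m1 V1)
  (m2 : {charge set (measurableTypeR R) -> \bar R}) (hV2 : in_K2 m2)
  (t0 y : R) :
  let gm1 g := cm_scale g m1 in
  let gm2 g := cm_scale g (cm_of_charge m2) in
  let K (g : R[i]) (x t : R) := feynman_integral t0 y t x (gm1 g) (gm2 g) in
  (forall (g : R[i]) (x t : R), t0 < t ->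
     cvgn (series (feynman_term t0 y t x (gm1 g) (gm2 g) : nat -> R[i]^o))) /\
  (forall g : R[i], propagator_equation V1 m2 g t0 (K g)) /\
  (forall x t : R, t0 < t -> analytic (fun g : R[i] => K g x t)).
Proof.
move=> gm1 gm2 K.
have [mu1 [h1 [w1 [r1 w1y]]]] := represents_K1 m1 V1 hV1.
have [mu2 [h2 [w2 [D2 [r2 _ w2D w2y]]]]] := represents_K2 m2 hV2.
split=> [g x t _|].
  exact: (feynman_cvgn m1 _ mu1 mu2 h1 h2 w1 w2 D2 t0 y r1 r2 w1y w2y w2D).
split=> [g phi tphi|x t _].
  have [X [s0 [T [M td]]]] := test_function_data t0 phi tphi.
  exact: (propagator_weak m1 m2 mu1 mu2 h1 h2 w1 w2 D2 t0 y r1 r2 w1y w2y w2D V1 hV1.2 _ _ _ _ _ _ _ _ td g).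
exact: (propagator_analytic m1 _ mu1 mu2 h1 h2 w1 w2 D2 t0 y r1 r2 w1y w2y w2D).
Qed.
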